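(* Let $d=3$, $\beta>0$, $\rho=\rho_{\mathrm c}=(4\pi\beta)^{-3/2}\zeta(3/2)$, and assume $a_1<0$. Then: (1) As $L\to\infty$, $$Z_{L,\beta,\rho_{\mathrm c}}=\mathbb P_{L,\beta,\rho_{\mathrm c}L^3}\big(\mathcal N_L=\rho_{\mathrm c}L^3\big)=L^{-2+2\lambda_1a_1-\mathbf 1\{\lambda_1=0\}+o(1)} .$$ (2) With $\alpha=\alpha_L=\log\log(L)/\log\log\log(L)$, for every $\varepsilon>0$, $$\lim_{L\to\infty}\mathbb P^{(\mathrm{can})}_{L,\beta,\rho_{\mathrm c}}\Big(\mathcal N^{(\ge \alpha L^2)}\in -2a_1\beta^{-1}L^{2}\log(L)\,(1-\varepsilon,1+\varepsilon)\Big)=1 .$$ (3) If there exists $\varepsilon>0$ (independent of $L$) such that $x=x_L,y=y_L\in\Lambda_L$ satisfy $\mathrm{dist}(x,y)>\varepsilon L$ and both points have distance at least $\varepsilon L$ from $\partial\Lambda_L$, then as $L\to\infty$ $$\gamma_{L,\beta,\rho_{\mathrm c}}(x,y)\sim -2a_1\beta^{-1}\,\phi^{(1)}(x/L)\,\phi^{(1)}(y/L)\,L^{-1}\log(L).$$ (4) Let $\mathcal L_i$ be the number of particles contained in the $i$-th largest loop of the sample, let $n$ be the number of loops in the sample, and let $m_L=-2a_1\beta^{-1}L^2\log(L)$. Under $\mathbb P^{(\mathrm{can})}_{L,\beta,\rho_{\mathrm c}}$, the vector $$\Big(\frac{\mathcal L_1}{m_L},\frac{\mathcal L_2}{m_L},\ldots,\frac{\mathcal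 L_n}{m_L}\Big)$$ (extended by zeros) converges weakly, in the product topology of $\ell^\infty$, to the Poisson--Dirichlet distribution with parameter $1$.
   Context: Setting ($d=3$). $\Lambda$ is either the torus $\mathbb T^3$ or a compact region in $\mathbb R^3$, with unit volume $|\Lambda|=1$. $\Delta$ is the Laplacian on $\Lambda$ (with Dirichlet, Neumann, Robin or mixed Dirichlet--Robin boundary conditions if $\Lambda$ has a boundary). The operator $-\Delta\ge 0$ has eigenvalues $0\le\lambda_1<\lambda_2\le\lambda_3\le\dots$ with $L^2$-normalized eigenfunctions $\phi^{(k)}$, $\phi^{(1)}>0$. Put $\Lambda_L=L\Lambda$; the heat kernel (generator $\Delta$, scaled boundary conditions) on $\Lambda_L$ is $$p^{(L)}_t(x,y)=L^{-3}\sum_{k\ge1}e^{-\lambda_k tL^{-2}}\phi^{(k)}(x/L)\phi^{(k)}(y/L).$$ Let $Z(t)=\sum_{k\ge 1}e^{-\lambda_kt}$ and $t_j=\int_{\Lambda_L}p^{(L)}_{\beta j}(x,x)\,dx=Z(\beta jL^{-2})$. As $t\to0$, $Z(t)=a_0t^{-3/2}+a_1t^{-1}+a_2t^{-1/2}+O(1)$ with $a_0=(4\pi)^{-3/2}$; the coefficient $a_1$ is called the first boundary heat coefficient. Explicitly $a_1=-|\partial\Lambda|/(16\pi)$ for Dirichlet boundary conditions, $a_1=+|\partial\Lambda|/(16\pi)$ for Neumann/Robin boundary conditions, and $a_1=0$ for $\Lambda=\mathbb T^3$. Loop soup. For $N\in\mathbb N$, $\mathbb P_{L,\beta,N}$ is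 the Poisson point process of loops with intensity measure $\sum_{j=1}^{N}\frac1j\int_{\Lambda_L}dx\,\mathbb P^{(L)}_{x,x,\beta j}$, where $\mathbb P^{(L)}_{x,y,t}$ is the unnormalized Brownian bridge measure from $x$ to $y$ in time $t$ on $\Lambda_L$, of total mass $p_t^{(L)}(x,y)$. A loop $\omega$ coming from the $j$-th term has length $\ell(\omega)=j$ (it contains $j$ particles). Thus the numbers of loops of length $j$, $1\le j\le N$, are independent Poisson variables with means $t_j/j$. For a sample $\{\omega_1,\dots,\omega_n\}$ put $\mathcal N_L=\sum_i\ell(\omega_i)$ and $\mathcal N^{(\ge R)}=\sum_i\ell(\omega_i)\mathbf 1\{\ell(\omega_i)\ge R\}$. Canonical ensemble. For $\rho>0$ with $\rho L^3\in\mathbb N$ (all limits are along such $L$), $\mathbb P^{(\mathrm{can})}_{L,\beta,\rho}(\cdot)=\mathbb P_{L,\beta,\rho L^3}(\,\cdot\mid\mathcal N_L=\rho L^3)$, $Z_{L,\beta,\rho}=\mathbb P_{L,\beta,\rho L^3}(\mathcal N_L=\rho L^3)$, and the one-particle reduced density matrix is $$\gamma_{L,\beta,\rho}(x,y)=\sum_{r=1}^{\rho L^3}\frac{p^{(L)}_{\beta r}(x,y)\,\mathbb P_{L,\beta,\rho L^3}(\mathcal N_L=\rho L^3-r)}{\mathbb P_{L,\beta,\rho L^3}(\mathcal N_L=\rho L^3)} .$$ $A\sim B$ means $A=B(1+o(1))$. *)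

(* Defs.v *)
From HB Require Import structures.
From mathcomp Require Import all_boot all_order all_algebra.
From mathcomp Require Import all_classical all_reals all_analysis.

Set Implicit Arguments.
Unset Strict Implicit.
Unset Printing Implicit Defensive.

Import Order.TTheory GRing.Theory Num.Theory numFieldNormedType.Exports.

Local Open Scope classical_set_scope.
Local Open Scope ring_scope.

Notation R3 R :=
  (measurableTypeR R * measurableTypeR R * measurableTypeR R)%type.

Section Euclidean_space.
Variable R : realType.

Definition vol : {measure set (R3 R) -> \bar R} :=
  ((@lebesgue_measure R \x @lebesgue_measure R) \x @lebesgue_measure R)%E.

(* The library norm of a product is the max norm. *)
Definition euclid (x : R3 R) : R :=
  Num.sqrt (x.1.1 ^+ 2 + x.1.2 ^+ 2 + x.2 ^+ 2).

Definition unit_vector (i : 'I_3) : R3 R :=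
  (((i == 0 :> nat)%:R, (i == 1%N :> nat)%:R), (i == 2%N :> nat)%:R).

Definition partial (i : 'I_3) (f : R3 R -> R) : R3 R -> R :=
  fun x => 'D_(unit_vector i) f x.

Definition gradient (f : R3 R -> R) (x : R3 R) : R3 R :=
  ((partial (inord 0) f x, partial (inord 1) f x), partial (inord 2) f x).

Definition laplacian (f : R3 R -> R) (x : R3 R) : R :=
  \sum_(i < 3) partial i (partial i f) x.

Fixpoint Cn (n : nat) (U : set (R3 R)) (f : R3 R -> R) : Prop :=
  (forall x, U x -> {for x, continuous f}) /\
  if n is m.+1 then
    forall i, (forall x, U x -> derivable f x (unit_vector i)) /\
              Cn m U (partial i f)
  else True.

Definition boundary (K : set (R3 R)) : set (R3 R) := closure K `\` interior K.

(* K is {g <= 0} near z, for a C^2 function g with non-zero gradient at z. *)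
Definition outer_normal (K : set (R3 R)) (z nu : R3 R) : Prop :=
  exists (U : set (R3 R)) (g : R3 R -> R),
    [/\ open U /\ U z, Cn 2 U g, gradient g z != 0,
        K `&` U = [set x | g x <= 0] `&` U
      & nu = (euclid (gradient g z))^-1 *: gradient g z].

Definition normal_derivative_is (f : R3 R -> R) (z nu : R3 R) (a : R) : Prop :=
  h^-1 * (f z - f (z - h *: nu)) @[h --> (0:R)^'+] --> a.

End Euclidean_space.

Section Domain.
Variable R : realType.

Inductive boundary_condition :=
| Dirichlet
| Neumann
| Robin of (R3 R -> R)
| DirichletRobin of set (R3 R) & (R3 R -> R).

Inductive domain :=
| Torus
| Region of set (R3 R) & boundary_condition.

(* The Robin condition d_nu f + kappa f = 0 is imposed at the points of G that
   have an outer normal. *)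
Definition robin_on (K G : set (R3 R)) (kappa f : R3 R -> R) : Prop :=
  forall z nu, G z -> outer_normal K z nu ->
    normal_derivative_is f z nu (- (kappa z * f z)).

Definition satisfies_bc (K : set (R3 R)) (bc : boundary_condition)
    (f : R3 R -> R) : Prop :=
  match bc with
  | Dirichlet => forall z, boundary K z -> f z = 0
  | Neumann => robin_on K (boundary K) (fun=> 0) f
  | Robin kappa => robin_on K (boundary K) kappa f
  | DirichletRobin D kappa =>
      (forall z, D z -> f z = 0) /\ robin_on K (boundary K `\` D) kappa f
  end.

(* T^3 is represented by the fundamental cell [0, 1)^3; functions on it are
   Z^3-periodic functions on R^3. *)
Definition carrier (Lam : domain) : set (R3 R) :=
  match Lam with
  | Torus => [set x | [/\ 0 <= x.1.1 < 1, 0 <= x.1.2 < 1 & 0 <= x.2 < 1]]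
  | Region K _ => K
  end.

Definition domain_boundary (Lam : domain) : set (R3 R) :=
  match Lam with
  | Torus => set0
  | Region K _ => boundary K
  end.

Definition lattice_vector (k : int * int * int) : R3 R :=
  ((k.1.1%:~R, k.1.2%:~R), k.2%:~R).

(* the distance of the dilated domain L Lam *)
Definition domain_dist (Lam : domain) (L : R) (x y : R3 R) : R :=
  match Lam with
  | Torus => inf [set r | exists k, r = euclid (x - y + L *: lattice_vector k)]
  | Region _ _ => euclid (x - y)
  end.

Definition dilate (L : R) (S : set (R3 R)) : set (R3 R) :=
  [set x | S (L^-1 *: x)].

(* For a region: compact, the closure of a connected open set, with a boundary
   that has normals on a dense set (automatic for a C^2 boundary; allows
   edges and corners), and unit volume. *)
Definition admissible_domain (Lam : domain) : Prop :=
  match Lam with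
  | Torus => True
  | Region K bc =>
      [/\ compact K /\ K = closure (interior K),
          connected (interior K),
          boundary K `<=` closure
            [set z | boundary K z /\ exists nu, outer_normal K z nu],
          vol R K = 1%E
        & if bc is DirichletRobin D _ then closed D /\ D `<=` boundary K
          else True]
  end.

Definition eigenfunction (Lam : domain) (l : R) (f : R3 R -> R) : Prop :=
  match Lam with
  | Torus =>
      [/\ Cn 2 setT f, (forall k x, f (x + lattice_vector k) = f x)
        & forall x, - laplacian f x = l * f x]
  | Region K bc =>
      [/\ {within K, continuous f}, Cn 2 (interior K) f,
          (forall x, interior K x -> - laplacian f x = l * f x)
        & satisfies_bc K bc f]
  end.

(* The spectral decomposition of -Delta; lam k and phi k stand for
   lambda_(k+1) and phi^(k+1). *)
Definition laplace_spectrum (Lam : domain) (lam : nat -> R)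
    (phi : nat -> R3 R -> R) : Prop :=
  [/\ forall k, eigenfunction Lam (lam k) (phi k),
      forall k l, (\int[vol R]_(x in carrier Lam) (phi k x * phi l x)%:E
                   = (k == l)%:R%:E)%E,
      forall f : R3 R -> R, measurable_fun (carrier Lam) f ->
        (\int[vol R]_(x in carrier Lam) (f x ^+ 2)%:E < +oo)%E ->
        (forall k, (\int[vol R]_(x in carrier Lam) (f x * phi k x)%:E = 0)%E) ->
        {ae vol R, forall x, carrier Lam x -> f x = 0},
      [/\ 0 <= lam 0%N, lam 0%N < lam 1%N
        & forall k, (0 < k)%N -> lam k <= lam k.+1]
    & forall x, (carrier Lam `\` domain_boundary Lam) x -> 0 < phi 0%N x].

End Domain.
Arguments Torus {R}.
Arguments Dirichlet {R}.
Arguments Neumann {R}.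

Section Heat.
Variables (R : realType) (lam : nat -> R) (phi : nat -> R3 R -> R).

Definition heat_kernel (L t : R) (x y : R3 R) : R :=
  L ^- 3 * limn (series (fun k =>
    expR (- (lam k * t * L ^- 2)) * phi k (L^-1 *: x) * phi k (L^-1 *: y))).

Definition heat_trace (t : R) : R :=
  limn (series (fun k => expR (- (lam k * t)))).

(* Z(t) = a0 t^(-3/2) + a1 t^(-1) + a2 t^(-1/2) + O(1) as t -> 0+; this
   determines the first boundary heat coefficient a1. *)
Definition heat_expansion (a1 a2 : R) : Prop :=
  exists C : R, \forall t \near (0:R)^'+,
    `|heat_trace t -
      ((4 * pi) `^ (- (3 / 2)) * t `^ (- (3 / 2)) + a1 * t^-1
       + a2 * t `^ (- (1 / 2)))| <= C.

End Heat.

Section Loop.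
Variable R : realType.

Definition path_cylinders : set (set (R -> R3 R)) :=
  [set C | exists s A, measurable A /\ C = [set w | A (w s)]].

(* A path of duration t is a function on R that is stopped outside [0, t]. *)
Definition trajectory : Type := g_sigma_algebraType path_cylinders.
HB.instance Definition _ := Measurable.on trajectory.

(* A loop of length j has duration beta * j. *)
Definition loop : Type := (nat * trajectory)%type.
HB.instance Definition _ := Measurable.on loop.

Definition loop_list : Type := seq loop.
HB.instance Definition _ := Choice.on loop_list.
HB.instance Definition _ := isPointed.Build loop_list nil.

Definition count_in (A : set loop) (w : loop_list) : nat :=
  count (fun l => `[< A l >]) w.

Definition count_events : set (set loop_list) :=
  [set E | exists A n, measurable A /\ E = [set w | count_in A w = n]].

(* Finite configurations of loops; the sigma-algebra generated by the counts
   does not see the order of the list. *)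
Definition sample : Type := g_sigma_algebraType count_events.
HB.instance Definition _ := Measurable.on sample.

End Loop.

Section Bridge.
Variables (R : realType) (Lam : domain R).
Variables (lam : nat -> R) (phi : nat -> R3 R -> R).

(* l = [:: (s_1, A_1); (s_2, A_2); ...] lists time increments and targets: the
   path is in A_1 at time s0 + s_1, in A_2 at time s0 + s_1 + s_2, etc. *)
Fixpoint visits (s0 : R) (l : seq (R * set (R3 R))) (w : R -> R3 R) : Prop :=
  if l is (s, A) :: l' then A (w (s0 + s)) /\ visits (s0 + s) l' w else True.

(* F t z is the total mass of the rest of the path, started from z *)
Definition bridge_step (L : R) (a : R * set (R3 R)) (F : R -> R3 R -> \bar R)
    (t : R) (x : R3 R) : \bar R :=
  (\int[vol R]_(z in a.2 `&` dilate L (carrier Lam))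
     ((heat_kernel lam phi L a.1 x z)%:E * F (t - a.1)%R z))%E.

Definition bridge_fdd (L t : R) (x y : R3 R) (l : seq (R * set (R3 R))) :
    \bar R :=
  foldr (bridge_step L) (fun t x => (heat_kernel lam phi L t x y)%:E) l t x.

Definition bridge_paths (L t : R) (x y : R3 R) : set (R -> R3 R) :=
  [set w | [/\ w 0 = x, w t = y,
     (forall s, w s = w (Num.max 0 (Num.min s t))),
     (forall s, dilate L (carrier Lam) (w s))
   & (forall s, domain_dist Lam L (w r) (w s) @[r --> s] --> (0 : R))]].

(* The unnormalized Brownian bridge measure from x to y in time t.  The set of
   continuous paths is not in the product sigma-algebra; the second clause says
   that it has full outer measure. *)
Definition brownian_bridge (L t : R) (x y : R3 R)
    (B : {measure set (trajectory R) -> \bar R}) : Prop :=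
  (forall l : seq (R * set (R3 R)),
     (forall a, a \in l -> 0 < a.1 /\ measurable a.2) ->
     \sum_(a <- l) a.1 < t ->
     B [set w | visits 0 l w] = bridge_fdd L t x y l) /\
  (forall A : set (trajectory R), measurable A -> bridge_paths L t x y `<=` A ->
     B (~` A) = 0%E).

Definition loop_intensity (beta L : R) (N : nat)
    (bridge : R -> R -> R3 R -> R3 R -> {measure set (trajectory R) -> \bar R})
    (A : set (loop R)) : \bar R :=
  (\sum_(1 <= j < N.+1) (j%:R^-1)%:E *
     \int[vol R]_(x in dilate L (carrier Lam))
        bridge L (beta * j%:R)%R x x [set w | A (j, w)])%E.

End Bridge.

Section Loop_soup.
Variable R : realType.

(* The library's poisson_pmf is not a probability mass function at rate 0. *)
Definition poisson_mass (r : R) (k : nat) : R :=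
  expR (- r) * r ^+ k / k`!%:R.

Definition poisson_point_process (I : set (loop R) -> \bar R)
    (P : probability (sample R) R) : Prop :=
  forall (m : nat) (A : 'I_m -> set (loop R)) (r : 'I_m -> R) (n : 'I_m -> nat),
    (forall i, measurable (A i)) -> trivIset setT A ->
    (forall i, I (A i) = (r i)%:E) ->
    P [set w | forall i, count_in (A i) w = n i]
      = (\prod_(i < m) poisson_mass (r i) (n i))%:E.

Definition particles (w : sample R) : nat := (\sum_(l <- w) l.1)%N.

Definition particles_ge (a : R) (w : sample R) : nat :=
  (\sum_(l <- w | (a <= l.1%:R)%R) l.1)%N.

(* zero-based: the (i+1)-th largest loop; 0 if there is none *)
Definition loop_size (i : nat) (w : sample R) : nat :=
  nth 0%N (sort geq [seq l.1 | l <- w]) i.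

Definition canonical_event (N : nat) : set (sample R) :=
  [set w | particles w = N].

Definition canonical_prob (P : probability (sample R) R) (N : nat)
    (E : set (sample R)) : R :=
  fine (P (E `&` canonical_event N)) / fine (P (canonical_event N)).

Definition canonical_expectation (P : probability (sample R) R) (N : nat)
    (X : sample R -> R) : R :=
  (\int[P]_(w in canonical_event N) X w) / fine (P (canonical_event N)).

Definition reduced_density_matrix (lam : nat -> R) (phi : nat -> R3 R -> R)
    (beta L : R) (P : probability (sample R) R) (N : nat) (x y : R3 R) : R :=
  \sum_(1 <= r < N.+1) heat_kernel lam phi L (beta * r%:R) x y *
    fine (P [set w | particles w = (N - r)%N]) / fine (P (canonical_event N)).

Definition zeta (s : R) : R := limn (series (fun n => n.+1%:R `^ (- s))).

Definition rho_c (beta : R) : R := (4 * pi * beta) `^ (- (3 / 2)) * zeta (3 / 2).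

Definition particle_number (rho L : R) : nat := Num.truncn (rho * L ^+ 3).

Definition admissible_length (rho : R) : set R :=
  [set L | 0 < L /\ rho * L ^+ 3 = (particle_number rho L)%:R].

(* L -> +oo along the L for which rho * L^3 is a natural number *)
Definition thermodynamic (rho : R) : set_system R :=
  within (admissible_length rho) (pinfty_nbhs R).

End Loop_soup.

Section Poisson_Dirichlet.
Variable R : realType.

Definition linfty : set (nat -> R) :=
  [set u | exists M, forall i, `|u i| <= M].

Definition iid_uniform d (T : measurableType d) (Q : probability T R)
    (U : nat -> T -> R) : Prop :=
  (forall i, measurable_fun setT (U i)) /\
  forall (m : nat) (B : 'I_m -> set (measurableTypeR R)),
    (forall i, measurable (B i)) ->
    Q [set w | forall i, B i (U i w)]
      = (\prod_(i < m) lebesgue_measure (B i `&` `[0%R, 1%R]))%E.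

Definition stick_breaking (u : nat -> R) (k : nat) : R :=
  u k * \prod_(i < k) (1 - u i).

Definition ranking (v u : nat -> R) : Prop :=
  (forall i, u i.+1 <= u i) /\
  exists s : nat -> nat, bijective s /\ forall i, u i = v (s i).

(* W is a random element of l^oo with the Poisson--Dirichlet law of
   parameter 1: the ranked uniform stick-breaking sequence. *)
Definition poisson_dirichlet1 d (T : measurableType d) (Q : probability T R)
    (W : nat -> T -> R) : Prop :=
  [/\ forall i, measurable_fun setT (W i), forall w, linfty (W ^~ w)
    & exists U : nat -> T -> R, iid_uniform Q U /\
        {ae Q, forall w, ranking (stick_breaking (U ^~ w)) (W ^~ w)}].

Definition bounded_continuous (f : {ptws nat -> R} -> R) : Prop :=
  {within (linfty : set {ptws nat -> R}), continuous f} /\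
  exists M, forall u, linfty u -> `|f u| <= M.

End Poisson_Dirichlet.

(* Main.v *)
Require Import Defs.
From HB Require Import structures.
From mathcomp Require Import all_boot all_order all_algebra.
From mathcomp Require Import all_classical all_reals all_analysis.
From mathcomp Require Import measurable_realfun.
From mathcomp Require Import ring lra zify.
Set Implicit Arguments.
Unset Strict Implicit.
Unset Printing Implicit Defensive.
Import Order.TTheory GRing.Theory Num.Theory numFieldNormedType.Exports.
Local Open Scope classical_set_scope.
Local Open Scope ring_scope.

(** With x = L^2 / beta, the loop soup conditioned on the particle number is a
    soup of weights t_j multiplied by e^(l0 j / x), which does not change the
    conditional law.  Since Z(t) e^(l0 t) >= 1, the new weights are 1 + p_j with
    p_j >= 0: an independent union of a soup of weights 1, whose loop lengths
    given their total k are those of the cycles of a uniform permutation of k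
    elements, and of a soup of weights p.  By the heat expansion, the p-loops
    hold rho_c L^3 + 2 a_1 x log L + O(x) particles, with a standard deviation
    of O(x), and those of length at least x hold O(x) of them; the remaining
    -2 a_1 x log L particles form the uniform permutation, whose long cycles
    are macroscopic.  The total mass of the soup of weights 1 at every k is 1,
    so the partition function is a cumulative sum of masses of the p-soup, and
    equals exp (sum_j p_j / j) up to a bounded factor.  The Poisson--Dirichlet
    limit comes from stick breaking for uniform permutations.  The density
    matrix needs bounds on the kernel off the diagonal: at short times, by
    Duhamel's formula against a cut-off Gaussian; at long times, by the spectral
    gap. *)

(** * Sums over multisets of loop lengths *)

(** At the critical density the leading term of the mean number of particles in the p-loops is
    exactly N, so the condensate comes from the term a1 x ln x alone; the fluctuations, of order x,
    are smaller only by a logarithm. The same cancellation fixes the exponent in (1): the tilt costs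
    exp (- l0 N / x), which removes the term of order sqrt x from the sum of the (p j - t j) / j and
    leaves (l0 a1 - 1) ln x; for l0 = 0 that sum is harmonic up to N, of order x^(3/2), whence the
    extra - 1. The obstacle in (3) is the boundary, which may have edges and corners, while the
    eigenfunctions are only known to be C^2 inside: no Gaussian bound is at hand. The estimates are
    therefore local, in a box around one point, and start from the spectral series. Duhamel's
    formula leaves an initial term, the mass that the kernel with pole y puts into the box around x
    at a very small time; it is compared with a closed Brownian bridge at y and vanishes by the
    continuity of the paths. The sign of the kernel comes from the bridges as well. *)

Section Triangular_sums.
Variable R : nmodType.
Implicit Type f : nat -> nat -> R.

Lemma triangle_cond f n (l : 'I_n.+1) :
  \sum_(m < (n - l).+1) f l m = \sum_(m < n.+1 | (l + m <= n)%N) f l m.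
Proof.
have le_ln : (l <= n)%N by rewrite -ltnS.
rewrite (big_ord_widen n.+1 (fun m => f l m)); last by rewrite ltnS leq_subr.
by apply: eq_bigl => m; lia.
Qed.

Lemma triangle_exchange f n :
  \sum_(l < n.+1) \sum_(m < (n - l).+1) f l m =
  \sum_(m < n.+1) \sum_(l < (n - m).+1) f l m.
Proof.
rewrite (eq_bigr _ (fun l _ => triangle_cond f l)).
rewrite [RHS](eq_bigr _ (fun m _ => triangle_cond (fun m l => f l m) m)).
rewrite (exchange_big_dep xpredT) //=; apply: eq_bigr => m _.
by apply: eq_bigl => l; rewrite addnC.
Qed.

Lemma triangle_diagonal f n :
  \sum_(m < n.+1) \sum_(l < m.+1) f l (m - l)%N =
  \sum_(l < n.+1) \sum_(m < (n - l).+1) f l m.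
Proof.
elim: n f => [|n IHn] f; first by rewrite !big_ord1.
rewrite big_ord_recr /= IHn [RHS]big_ord_recr /= subnn big_ord1.
rewrite [X in _ + X]big_ord_recr /= subnn addrA; congr (_ + _).
rewrite -big_split /=; apply: eq_bigr => l _.
have le_ln : (l <= n)%N by rewrite -ltnS.
by rewrite subSn // [RHS]big_ord_recr.
Qed.

End Triangular_sums.

Section Loop_sum.
Variable R : realFieldType.
Implicit Types (t u : nat -> R) (F G : seq nat -> R).

(** The recursive call has total [n' - l], which is not a structural subterm, hence the fuel; the
    value 0 for exhausted fuel is not reached when [n <= fuel]. *)
Fixpoint loop_sum_rec (fuel : nat) t (n : nat) F : R :=
  if n is n'.+1 then
    if fuel is k.+1 then
      n%:R^-1 * \sum_(l < n) t l.+1 *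
        loop_sum_rec k t (n' - l)%N (fun s => F (l.+1 :: s))
    else 0
  else F [::].

(* The sum over multisets s of loop lengths, of total length n, of
   F s * \prod_j (t j / j) ^ c_j / c_j!, where c_j is the multiplicity of j in s.
   The defining recursion marks one of the n particles and removes its loop. *)
Definition loop_sum t n F := loop_sum_rec n t n F.

Lemma loop_sum_recE t k n F : (n <= k)%N -> loop_sum_rec k t n F = loop_sum t n F.
Proof.
rewrite /loop_sum.
suff H : forall k1 k2 m G, (m <= k1)%N -> (m <= k2)%N ->
    loop_sum_rec k1 t m G = loop_sum_rec k2 t m G by move=> le_nk; apply: H.
elim=> [|k1 IH] [|k2] [|m] G // lek1 lek2.
rewrite /=; congr (_ * _); apply: eq_bigr => l _; congr (_ * _).
by apply: IH; lia.
Qed.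

Lemma loop_sum0 t F : loop_sum t 0 F = F [::].
Proof. by []. Qed.

Lemma loop_sumS t n F :
  loop_sum t n.+1 F =
  n.+1%:R^-1 * \sum_(l < n.+1) t l.+1 *
     loop_sum t (n - l) (fun s => F (l.+1 :: s)).
Proof.
rewrite {1}/loop_sum /=; congr (_ * _); apply: eq_bigr => l _; congr (_ * _).
by rewrite loop_sum_recE // leq_subr.
Qed.

#[global] Opaque loop_sum.

Lemma loop_sumSn t n F :
  n.+1%:R * loop_sum t n.+1 F =
  \sum_(l < n.+1) t l.+1 * loop_sum t (n - l) (fun s => F (l.+1 :: s)).
Proof. by rewrite loop_sumS mulrA divff ?mul1r // pnatr_eq0. Qed.

Lemma eq_loop_sum t u n F G :
  (forall l, (0 < l <= n)%N -> t l = u l) ->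
  (forall s, sumn s = n -> all (leq 1) s -> F s = G s) ->
  loop_sum t n F = loop_sum u n G.
Proof.
have [k le_nk] := ubnP n; elim: k n F G le_nk => // k IH [|n] F G le_nk tu FG.
  by rewrite !loop_sum0 FG.
rewrite !loop_sumS; congr (_ * _); apply: eq_bigr => l _.
have ln := ltn_ord l.
rewrite tu; last by lia.
congr (_ * _); apply: IH; first by lia.
  by move=> m /andP[? ?]; apply: tu; lia.
by move=> s sn s_gt0; apply: FG => //=; lia.
Qed.

Lemma loop_sumD t n F G :
  loop_sum t n (fun s => F s + G s) = loop_sum t n F + loop_sum t n G.
Proof.
have [k le_nk] := ubnP n; elim: k n F G le_nk => // k IH [|n] F G le_nk.
  by rewrite !loop_sum0.
rewrite !loop_sumS -mulrDr -big_split /=; congr (_ * _); apply: eq_bigr => l _.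
by rewrite IH ?mulrDr //; lia.
Qed.

Lemma loop_sumZ t n a F : loop_sum t n (fun s => a * F s) = a * loop_sum t n F.
Proof.
have [k le_nk] := ubnP n; elim: k n F le_nk => // k IH [|n] F le_nk.
  by rewrite !loop_sum0.
rewrite !loop_sumS [RHS]mulrCA [X in _ = _ * X]mulr_sumr; congr (_ * _); apply: eq_bigr => l _.
by rewrite IH //; [rewrite mulrCA | lia].
Qed.

Lemma loop_sumN t n F : loop_sum t n (fun s => - F s) = - loop_sum t n F.
Proof.
rewrite -[RHS]mulN1r -loop_sumZ; apply: eq_loop_sum => // s _ _.
by rewrite mulN1r.
Qed.

Lemma loop_sum_cst t n a : loop_sum t n (fun=> a) = a * loop_sum t n (fun=> 1).
Proof. by rewrite -loop_sumZ; apply: eq_loop_sum => // s _ _; rewrite mulr1. Qed.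

Lemma loop_sum_sum t n m (F : nat -> seq nat -> R) :
  loop_sum t n (fun s => \sum_(i < m) F i s) = \sum_(i < m) loop_sum t n (F i).
Proof.
elim: m => [|m IH].
  rewrite big_ord0 -[RHS](mul0r (loop_sum t n (fun=> 1))) -loop_sum_cst.
  by apply: eq_loop_sum => // s _ _; rewrite big_ord0.
rewrite big_ord_recr /= -IH -loop_sumD; apply: eq_loop_sum => // s _ _.
by rewrite big_ord_recr.
Qed.

Lemma ler_loop_sum t n F G :
  (forall l, (0 < l <= n)%N -> 0 <= t l) ->
  (forall s, sumn s = n -> all (leq 1) s -> F s <= G s) ->
  loop_sum t n F <= loop_sum t n G.
Proof.
have [k le_nk] := ubnP n; elim: k n F G le_nk => // k IH [|n] F G le_nk t0 FG.
  by rewrite !loop_sum0 FG.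
rewrite !loop_sumS ler_pM2l ?invr_gt0 ?ltr0n //; apply: ler_sum => l _.
have ln := ltn_ord l.
apply: ler_wpM2l; first by apply: t0; lia.
apply: IH; first by lia.
  by move=> m /andP[? ?]; apply: t0; lia.
by move=> s sn s_gt0; apply: FG => //=; lia.
Qed.

Lemma loop_sum_ge0 t n F :
  (forall l, (0 < l <= n)%N -> 0 <= t l) ->
  (forall s, sumn s = n -> all (leq 1) s -> 0 <= F s) -> 0 <= loop_sum t n F.
Proof.
move=> t0 F0; rewrite -(mul0r (loop_sum t n (fun=> 1))) -loop_sum_cst.
exact: ler_loop_sum.
Qed.

Lemma ler_norm_loop_sum t n F :
  (forall l, (0 < l <= n)%N -> 0 <= t l) ->
  `|loop_sum t n F| <= loop_sum t n (fun s => `|F s|).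
Proof.
move=> t0; rewrite ler_norml -loop_sumN; apply/andP; split.
  apply: ler_loop_sum => // s _ _; have := ler_norm (- F s).
  by rewrite normrN lerNl.
by apply: ler_loop_sum => // s _ _; exact: ler_norm.
Qed.

(** The factors q^l of the loops multiply to q^n, which is the same for every multiset of total n.
    This is what allows the ground state to be divided out of the weights. *)
Lemma loop_sum_exp q t n F :
  loop_sum (fun l => q ^+ l * t l) n F = q ^+ n * loop_sum t n F.
Proof.
have [k le_nk] := ubnP n; elim: k n F le_nk => // k IH [|n] F le_nk.
  by rewrite !loop_sum0 mul1r.
rewrite !loop_sumS [RHS]mulrCA [X in _ = _ * X]mulr_sumr; congr (_ * _); apply: eq_bigr => l _.
have ln := ltn_ord l.
rewrite IH; last by lia.
have E : q ^+ n.+1 = q ^+ l.+1 * q ^+ (n - l).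
  by rewrite -exprD; congr (_ ^+ _); lia.
by rewrite [in RHS]E; ring.
Qed.

(** With unit weights the terms are the probabilities of the cycle types of a uniform permutation of
    n elements. *)
Lemma loop_sum_1 n : loop_sum (fun=> 1) n (fun=> 1) = 1.
Proof.
have [k le_nk] := ubnP n; elim: k n le_nk => // k IH [|n] le_nk //.
rewrite loop_sumS (eq_bigr (fun=> 1)); last first.
  by move=> l _; rewrite IH ?mulr1 //; lia.
by rewrite sumr_const card_ord mulVf ?pnatr_eq0.
Qed.

(** Superposition: a soup of weights t + u splits into two independent soups. The symmetry of [F]
    enters because the recursion always puts the removed loop in front. *)
Lemma loop_sum_thin t u n F :
  (forall s s', perm_eq s s' -> F s = F s') ->
  loop_sum (fun l => t l + u l) n F =
  \sum_(m < n.+1) loop_sum t m (fun a =>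
     loop_sum u (n - m) (fun b => F (a ++ b))).
Proof.
have [k le_nk] := ubnP n; elim: k n F le_nk => // k IH [|n] F le_nk Fsym.
  by rewrite big_ord1.
apply: (@mulfI _ n.+1%:R); first by rewrite pnatr_eq0.
rewrite loop_sumSn mulr_sumr.
pose A m := loop_sum t m (fun a => loop_sum u (n.+1 - m) (fun b => F (a ++ b))).
(* Of the n + 1 particles, m lie in loops of the first soup and n + 1 - m in those of the second;
   the marked particle is removed with its loop from the soup that contains it. *)
have -> : \sum_(m < n.+2) n.+1%:R * A m =
    \sum_(m < n.+1) m.+1%:R * A m.+1 + \sum_(m < n.+1) (n - m).+1%:R * A m.
  transitivity (\sum_(m < n.+2) m%:R * A m + \sum_(m < n.+2) (n.+1 - m)%:R * A m).
    rewrite -big_split; apply: eq_bigr => m _ /=.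
    by rewrite -mulrDl -natrD subnKC // -ltnS.
  rewrite big_ord_recl mul0r add0r; congr (_ + _).
  rewrite big_ord_recr /= subnn mul0r addr0; apply: eq_bigr => m _.
  by rewrite subSn // -ltnS.
pose B l := \sum_(m < (n - l).+1) loop_sum t m (fun a =>
     loop_sum u (n - l - m) (fun b => F (l.+1 :: (a ++ b)))).
have -> : \sum_(m < n.+1) m.+1%:R * A m.+1 = \sum_(l < n.+1) t l.+1 * B l.
  pose f l m := t l.+1 * loop_sum t m (fun a =>
     loop_sum u (n - l - m) (fun b => F (l.+1 :: (a ++ b)))).
  transitivity (\sum_(m < n.+1) \sum_(l < m.+1) f l (m - l)%N).
    apply: eq_bigr => m _; rewrite loop_sumSn; apply: eq_bigr => l _.
    rewrite /f; congr (_ * _); apply: eq_loop_sum => // a _ _.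
    have lm := ltn_ord l; have mn := ltn_ord m.
    by have -> : (n - l - (m - l) = n.+1 - m.+1)%N by lia.
  by rewrite triangle_diagonal; apply: eq_bigr => l _; rewrite mulr_sumr.
have -> : \sum_(m < n.+1) (n - m).+1%:R * A m = \sum_(l < n.+1) u l.+1 * B l.
  pose f l m := u l.+1 * loop_sum t m (fun a =>
     loop_sum u (n - l - m) (fun b => F (l.+1 :: (a ++ b)))).
  transitivity (\sum_(m < n.+1) \sum_(l < (n - m).+1) f l m); last first.
    by rewrite -triangle_exchange; apply: eq_bigr => l _; rewrite mulr_sumr.
  apply: eq_bigr => m _; have mn := ltn_ord m.
  rewrite -loop_sumZ /f -[RHS](eq_bigr _ (fun l _ => loop_sumZ _ _ _ _)).
  rewrite -(@loop_sum_sum t m (n - m).+1 (fun l a => u l.+1 * loop_sum u (n - l - m) (fun b => F (l.+1 :: (a ++ b))))).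
  apply: eq_loop_sum => // a _ _.
  rewrite subSn // loop_sumSn; apply: eq_bigr => l _; congr (_ * _).
  rewrite subnAC; apply: eq_loop_sum => // b _ _; apply: Fsym.
  by rewrite perm_catC /= perm_cons perm_catC.
rewrite -big_split; apply: eq_bigr => l _ /=; rewrite -mulrDl; congr (_ * _).
rewrite IH //; first by have := ltn_ord l; lia.
by move=> s s' ss'; apply: Fsym; rewrite perm_cons.
Qed.

(** Campbell's formula: a loop of length l has weight t l / l and l particles, so the factor l
    cancels, and removing the loop leaves a soup of total n - l. *)
Lemma loop_sum_campbell t n (P : pred nat) :
  loop_sum t n (fun s => \sum_(l <- s | P l) l%:R) =
  \sum_(l < n.+1 | P l && (0 < l)%N) t l * loop_sum t (n - l) (fun=> 1).
Proof.
have [k le_nk] := ubnP n; elim: k n le_nk => // k IH [|n] le_nk.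
  by rewrite loop_sum0 big_nil big_mkcond big_ord1 /= andbF.
rewrite big_mkcond big_ord_recl /= andbF add0r.
under eq_bigr do rewrite /bump /= add1n subSS andbT.
apply: (@mulfI _ n.+1%:R); first by rewrite pnatr_eq0.
rewrite loop_sumSn.
pose h m := loop_sum t m (fun=> 1).
pose w l := if P l.+1 then t l.+1 else 0 : R.
(* The first sum counts the loop of the marked particle itself, the second one the loops that
   remain; they recombine through l.+1 + (n - l) = n.+1. *)
transitivity (\sum_(l < n.+1) w l * l.+1%:R * h (n - l)%N +
  \sum_(l < n.+1) \sum_(m < (n - l).+1) t l.+1 * ((0 < m)%:R * w m.-1 * h (n - l - m)%N)).
  rewrite -big_split; apply: eq_bigr => l _ /=.
  rewrite (@eq_loop_sum t t _ _ (fun s => (if P l.+1 then l.+1%:R else 0) +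
     \sum_(l <- s | P l) l%:R)) //; last first.
    by move=> s _ _; rewrite big_cons; case: ifP; rewrite ?add0r.
  rewrite loop_sumD loop_sum_cst mulrDr; congr (_ + _).
    by rewrite /w /h; case: ifP => _; ring.
  have ln := ltn_ord l.
  rewrite IH; last by lia.
  rewrite mulr_sumr big_mkcond /=; apply: eq_bigr => -[[|m] mn] _ /=.
    by rewrite andbF !mul0r mulr0.
  by rewrite andbT /w; case: ifP => _; rewrite ?mulr0 ?mul0r ?mulr0 // mul1r.
have -> : \sum_(l < n.+1)
   \sum_(m < (n - l).+1) t l.+1 * ((0 < m)%:R * w m.-1 * h (n - l - m)%N) =
   \sum_(m < n.+1) w m * ((n - m)%:R * h (n - m)%N).
  rewrite (triangle_exchange (fun l m =>
    t l.+1 * ((0 < m)%:R * w m.-1 * h (n - l - m)%N))).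
  rewrite big_ord_recl /= big1 ?add0r; last first.
    by move=> l _; rewrite !mul0r mulr0.
  rewrite [RHS]big_ord_recr /= subnn mul0r mulr0 addr0.
  apply: eq_bigr => m _; rewrite /bump /= add1n.
  have mn := ltn_ord m.
  have -> : (n - m = (n - m.+1).+1)%N by lia.
  rewrite loop_sumSn mulr_sumr; apply: eq_bigr => l _.
  have ln := ltn_ord l.
  by rewrite /h subnAC; ring.
rewrite -big_split mulr_sumr; apply: eq_bigr => l _ /=.
have ln := ltn_ord l.
rewrite /w /h; case: ifP => _; last by rewrite !mul0r mulr0 addr0.
have E : n.+1%:R = l.+1%:R + (n - l)%:R :> R.
  by rewrite -natrD; congr _%:R; lia.
by rewrite [in RHS]E; ring.
Qed.

End Loop_sum.

(** * Sums over vectors of multiplicities *)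

Section Loop_configurations.
Variable R : realFieldType.
Implicit Types (t u : nat -> R) (F G : seq nat -> R).

Lemma loop_sum_eq0 t n F :
  (forall l, (0 < l <= n)%N -> t l = 0) -> (0 < n)%N -> loop_sum t n F = 0.
Proof.
case: n => // n t0 _; rewrite loop_sumS big1 ?mulr0 // => l _.
by rewrite t0 ?mul0r //= ltn_ord.
Qed.

(** Only c loops of length k with n = c k contribute; removing them one at a time builds up the
    Poisson weight with its 1 / c!. *)
Lemma loop_sum_single t k n F :
  (0 < k)%N -> (forall l, (0 < l)%N -> l != k -> t l = 0) ->
  loop_sum t n F =
  if (k %| n)%N then (t k / k%:R) ^+ (n %/ k) / (n %/ k)`!%:R * F (nseq (n %/ k) k)
  else 0.
Proof.
case: k => // k _ tk.
have [K le_nk] := ubnP n; elim: K n F le_nk => // K IH [|n] F le_nk.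
  by rewrite dvdn0 div0n expr0 fact0 divr1 mul1r.
have [lt_nk|le_kn] := ltnP n k.
  rewrite loop_sum_eq0 //; last first.
    by move=> l /andP[l0 ln]; apply: tk => //; apply/eqP; lia.
  by rewrite gtnNdvd.
rewrite loop_sumS (bigD1 (inord k)) //= inordK ?ltnS // big1 ?addr0; last first.
  move=> l lk; rewrite tk ?mul0r //; apply: contra_neq lk => -[lk].
  by apply: val_inj; rewrite /= inordK ?ltnS.
rewrite IH; last by lia.
have -> : (k.+1 %| n.+1)%N = (k.+1 %| n - k)%N.
  by have -> : n.+1 = (k.+1 + (n - k))%N; [lia | rewrite dvdn_addr].
case: ifP => [/dvdnP[c nkE]|]; last by rewrite !mulr0.
have -> : n.+1 = (c.+1 * k.+1)%N by lia.
rewrite nkE !mulnK // factS !natrM exprS /=.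
have c0 : c`!%:R != 0 :> R by rewrite pnatr_eq0 -lt0n fact_gt0.
by field; rewrite c0 !nat1r !pnatr_eq0.
Qed.

(** Multiplicities are listed downwards: the head of [c] belongs to the length [size c], so that the
    tail describes the shorter loops. *)
Fixpoint config_lengths (c : seq nat) : seq nat :=
  if c is n :: c' then nseq n (size c').+1 ++ config_lengths c' else [::].

Fixpoint config_weight t (c : seq nat) : R :=
  if c is n :: c' then
    (t (size c').+1 / (size c').+1%:R) ^+ n / n`!%:R * config_weight t c'
  else 1.

Lemma eq_config_weight t u c :
  (forall l, (0 < l <= size c)%N -> t l = u l) ->
  config_weight t c = config_weight u c.
Proof.
elim: c => //= n c IH tu; rewrite tu ?leqnn // IH // => l /andP[l0 lc].
by apply: tu; rewrite l0 ltnW.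
Qed.

Lemma big_tuple_cons K (T : finType) (V : nmodType) (P : pred (K.+1.-tuple T))
    (G : K.+1.-tuple T -> V) :
  \sum_(c | P c) G c =
  \sum_(x : T) \sum_(c : K.-tuple T | P [tuple of x :: c]) G [tuple of x :: c].
Proof.
rewrite pair_big_dep /= (reindex (fun p : T * K.-tuple T => [tuple of p.1 :: p.2])) //.
exists (fun c => (thead c, [tuple of behead c])) => [[x c] _|c _].
  by congr (_, _); apply: val_inj.
by rewrite [RHS]tuple_eta.
Qed.

(** Links the recursion to the independent Poisson numbers of loops. The largest length is split off
    as a soup of its own; the bound B, larger than n and hence than any multiplicity, makes the
    index type finite. *)
Lemma loop_sum_config K B t n F :
  (n < B)%N -> (forall s s', perm_eq s s' -> F s = F s') ->
  (forall l, (K < l <= n)%N -> t l = 0) ->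
  loop_sum t n F =
  \sum_(c : K.-tuple 'I_B | sumn (config_lengths (map val c)) == n)
    config_weight t (map val c) * F (config_lengths (map val c)).
Proof.
elim: K t n F => [|K IH] t n F nB Fsym tK.
  case: n nB tK => [|n] nB tK.
    rewrite loop_sum0 (big_pred1 [tuple]) ?mul1r // => c.
    by rewrite (tuple0 c) /=; symmetry; exact: eqxx.
  by rewrite loop_sum_eq0 // big_pred0 // => c; rewrite (tuple0 c).
pose t1 l := if l == K.+1 then t l else 0.
pose t2 l := if l == K.+1 then 0 else t l.
have -> : loop_sum t n F = loop_sum (fun l => t1 l + t2 l) n F.
  by apply: eq_loop_sum => // l _; rewrite /t1 /t2; case: eqP; rewrite ?addr0 ?add0r.
rewrite loop_sum_thin //.
pose G c := (t K.+1 / K.+1%:R) ^+ c / c`!%:R *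
  loop_sum t2 (n - c * K.+1) (fun b => F (nseq c K.+1 ++ b)).
transitivity (\sum_(m < n.+1 | (K.+1 %| m)%N) G (m %/ K.+1)%N).
  rewrite [RHS]big_mkcond; apply: eq_bigr => m _.
  rewrite (@loop_sum_single t1 K.+1) //; last by rewrite /t1 => l _ /negbTE ->.
  by case: ifP => // Km; rewrite /t1 eqxx /G divnK.
transitivity (\sum_(c < B | (c * K.+1 <= n)%N) G c).
  have B0 : (0 < B)%N by case: (B) nB.
  have valB k : (k < B)%N -> insubd (Ordinal B0) k = k :> nat.
    by move=> kB; rewrite val_insubd kB.
  rewrite (reindex_onto (fun c : 'I_B => (inord (c * K.+1) : 'I_n.+1))
            (fun m => insubd (Ordinal B0) (m %/ K.+1)%N)) /=; last first.
    move=> m Km; have mn := ltn_ord m; apply: val_inj => /=.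
    rewrite valB; last by apply: leq_ltn_trans (leq_div _ _) _; apply: leq_trans nB.
    by rewrite divnK // inordK.
  apply: eq_big => [c|c /andP[_ /eqP cE]]; last first.
    rewrite -[in RHS]cE valB //; apply: leq_ltn_trans (leq_div _ _) _.
    by apply: leq_trans nB; exact: ltn_ord.
  have [cn|cn] := leqP (c * K.+1) n.
    rewrite inordK ?ltnS // dvdn_mull //=; apply/eqP; apply: val_inj => /=.
    by rewrite valB mulnK.
  apply/negP => /andP[_ /eqP cE]; move: cn; rewrite ltnNge -cE valB.
    by rewrite (leq_trans (leq_trunc_div _ _)) // -ltnS.
  by apply: leq_ltn_trans (leq_div _ _) _; apply: leq_trans nB; exact: ltn_ord.
rewrite big_tuple_cons [LHS]big_mkcond; apply: eq_bigr => c _ /=.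
have szc (c' : K.-tuple 'I_B) : size (map val c') = K by rewrite size_map size_tuple.
case: ifP => [cn|/negbT cn]; last first.
  rewrite big_pred0 // => c'; rewrite szc sumn_cat sumn_nseq.
  by apply/negP => /eqP nE; rewrite mulnC -[X in (_ <= X)%N]nE leq_addr in cn.
rewrite /G (IH t2); first last.
- move=> l /andP[Kl ln]; rewrite /t2; case: eqP => // /eqP lK; apply: tK.
  by rewrite ltn_neqAle eq_sym lK Kl /=; apply: leq_trans ln _; rewrite leq_subr.
- by move=> s s' ss'; apply: Fsym; rewrite perm_cat2l.
- by apply: leq_ltn_trans nB; rewrite leq_subr.
rewrite mulr_sumr; apply: eq_big => [c'|c' _].
  by rewrite szc sumn_cat sumn_nseq -(eqn_add2l (c * K.+1)) subnKC // [(K.+1 * c)%N]mulnC.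
rewrite szc mulrA (@eq_config_weight t2 t) // => l; rewrite szc => /andP[_ lK].
by rewrite /t2 ltn_eqF.
Qed.

End Loop_configurations.

(** * Generating series and moments of the number of particles *)

Section Series_of_loop_sums.
Variable R : realType.
Implicit Types (a b p : nat -> R).

Lemma cvg_subn (T : topologicalType) (u : nat -> T) k (l : T) :
  u @ \oo --> l -> (fun n => u (n - k)%N) @ \oo --> l.
Proof.
by move=> ul; apply: (cvg_comp (fun n => n - k)%N u) ul; exact: cvg_subnr.
Qed.

Lemma big_ord_cut (V : nmodType) (f : nat -> V) m n :
  (forall l, (n <= l)%N -> f l = 0) ->
  \sum_(l < m) f l = \sum_(l < n | (l < m)%N) f l.
Proof.
move=> f0; have [mn|nm] := leqP m n; first by rewrite (big_ord_widen n f mn).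
rewrite -[RHS](big_mkord (fun l => (l < m)%N) f) -(big_mkord xpredT f).
rewrite (big_cat_nat (n := n)) ?leq0n 1?ltnW //= [X in _ + X]big_nat_cond [X in _ + X]big1 ?addr0.
  by rewrite !big_mkord; apply: eq_bigl => l; rewrite (ltn_trans (ltn_ord l) nm).
by move=> l /andP[/andP[nl _] _]; rewrite f0.
Qed.

Lemma nondecreasing_series_ge0 a : (forall n, 0 <= a n) -> nondecreasing_seq (series a).
Proof. by move=> a0; apply: (@nondecreasing_series _ a xpredT 0%N). Qed.

Lemma cvg_sumr (I : Type) (s : seq I) (P : pred I) (T : Type) (F : set_system T)
    {FF : Filter F} (f : I -> T -> R) (l : I -> R) :
  (forall i, P i -> f i @ F --> l i) ->
  (fun x => \sum_(i <- s | P i) f i x) @ F --> \sum_(i <- s | P i) l i.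
Proof.
move=> fl; elim: s => [|i s IH].
  by rewrite big_nil; under eq_fun do rewrite big_nil; exact: cvg_cst.
rewrite big_cons; under eq_fun do rewrite big_cons.
by case: ifP => // Pi; apply: cvgD => //; exact: fl.
Qed.

Lemma cvg_cauchy_product a b (A B : R) :
  (forall n, 0 <= a n) -> (forall n, 0 <= b n) ->
  series a @ \oo --> A -> series b @ \oo --> B ->
  series (fun n => \sum_(m < n.+1) a m * b (n - m)%N) @ \oo --> A * B.
Proof.
move=> a0 b0 aA bB.
set c := (X in series X).
have c0 n : 0 <= c n by apply: sumr_ge0 => m _; rewrite mulr_ge0.
have a_ge0 n : 0 <= series a n by apply: sumr_ge0.
have b_ge0 n : 0 <= series b n by apply: sumr_ge0.
have nda := nondecreasing_series_ge0 a0.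
have ndb := nondecreasing_series_ge0 b0.
have ndc := nondecreasing_series_ge0 c0.
have cE n : series c n.+1 = \sum_(m < n.+1) a m * series b (n - m).+1.
  rewrite /series /= big_mkord /c.
  rewrite (triangle_diagonal (fun m l => a m * b l)).
  by apply: eq_bigr => m _; rewrite big_mkord mulr_sumr.
have leA n : series a n <= A by rewrite -(cvg_lim _ aA) //; apply: nondecreasing_cvgn_le => //; apply/cvg_ex; exists A.
have leB n : series b n <= B by rewrite -(cvg_lim _ bB) //; apply: nondecreasing_cvgn_le => //; apply/cvg_ex; exists B.
have leAB n : series c n <= A * B.
  apply: (le_trans (ndc _ _ (leqnSn n))); rewrite cE.
  apply: (@le_trans _ _ (series a n.+1 * B)); last first.
    by apply: ler_wpM2r; [exact: le_trans (b_ge0 0%N) (leB _) | exact: leA].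
  rewrite /series /= big_mkord mulr_suml; apply: ler_sum => m _.
  by apply: ler_wpM2l => //; exact: leB.
have cvc : cvgn (series c).
  by apply: nondecreasing_is_cvgn => //; exists (A * B) => _ [n _ <-].
have -> : A * B = limn (series c).
  apply/eqP; rewrite eq_le; apply/andP; split; last first.
    by apply: limr_le => //; apply: nearW.
  (* The square of side n lies in the triangle of side n + n. *)
  apply: (cvgr_to_le (cvgM aA bB)); apply: nearW => n /=; apply: le_trans (nondecreasing_cvgn_le ndc cvc (n + n).+1).
  rewrite cE {1}/series /= big_mkord mulr_suml.
  apply: (@le_trans _ _ (\sum_(m < n) a m * series b (n + n - m).+1)).
    apply: ler_sum => m _; apply: ler_wpM2l => //; apply: ndb.
    by have := ltn_ord m; lia.
  rewrite (big_ord_widen (n + n).+1 (fun m => a m * series b (n + n - m).+1)); last by lia.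
  rewrite [leRHS](bigID (fun m : 'I_(n + n).+1 => (m < n)%N)) /= lerDl.
  by apply: sumr_ge0 => m _; rewrite mulr_ge0.
exact: cvc.
Qed.

Lemma cvg_series_exp_coeff (x : R) : series (exp_coeff x) @ \oo --> expR x.
Proof. exact: is_cvg_series_exp_coeff. Qed.

(** The coefficient of z^n in exp (\sum_j p j z^j / j). *)
Definition loop_mass p n : R := loop_sum p n (fun=> 1).

Lemma loop_mass_ge0 p n : (forall l, 0 <= p l) -> 0 <= loop_mass p n.
Proof. by move=> p0; apply: loop_sum_ge0 => // l _; exact: p0. Qed.

Lemma cvg_series_loop_mass_single p k :
  (0 < k)%N -> (forall l, (0 < l)%N -> l != k -> p l = 0) ->
  series (loop_mass p) @ \oo --> expR (p k / k%:R).
Proof.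
case: k => // k _ pk; set r := p _ / _.
(* Only the multiples of [k.+1] contribute, so the first n masses contain the first ceil (n / k.+1)
   terms of the exponential series. *)
have -> : series (loop_mass p) = (fun n => series (exp_coeff r) ((n + k) %/ k.+1)%N).
  apply/funext; elim=> [|n IH]; first by rewrite add0n divn_small // /series /= !big_geq.
  rewrite seriesSr IH addSn divnS // /loop_mass (loop_sum_single _ _ _ pk) // mulr1.
  rewrite -addnS dvdn_addl //; case: ifP => [/dvdnP[c ->]|_]; last by rewrite add0n addr0.
  rewrite divnMDl // divn_small // addn0 add1n seriesSr mulnK //.
have H : (fun n => ((n + k) %/ k.+1)%N) @ \oo --> \oo; last first.
  exact: (cvg_comp _ _ H (@cvg_series_exp_coeff r)).
apply/cvgnyPge => A; near=> n.
rewrite leq_divRL //; apply: leq_trans (leq_addr _ _).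
by near: n; exact: nbhs_infty_ge.
Unshelve. all: by end_near. Qed.

Lemma loop_mass_thin p q n :
  loop_mass (fun l => p l + q l) n =
  \sum_(m < n.+1) loop_mass p m * loop_mass q (n - m)%N.
Proof.
rewrite /loop_mass loop_sum_thin //; apply: eq_bigr => m _.
by rewrite loop_sum_cst mulrC.
Qed.

(** The generating function at z = 1; splitting off the largest length turns it into a Cauchy
    product of exponentials. *)
Lemma cvg_series_loop_mass p K :
  (forall l, 0 <= p l) -> (forall l, (K < l)%N -> p l = 0) ->
  series (loop_mass p) @ \oo --> expR (\sum_(l < K) p l.+1 / l.+1%:R).
Proof.
elim: K p => [|K IH] p p0 pK.
  rewrite big_ord0 expR0 -(cvg_shiftS (series _)) /=.
  rewrite [X in X @ _](_ : _ = fun=> 1); first exact: cvg_cst.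
  apply/funext => n /=; rewrite /series /= big_mkord big_ord_recl big1 ?addr0 //.
  by move=> m _; rewrite /loop_mass loop_sum_eq0 // => l /andP[l0 _]; exact: pK.
pose q l := if l == K.+1 then p l else 0.
pose r l := if l == K.+1 then 0 else p l.
have -> : loop_mass p = fun n => \sum_(m < n.+1) loop_mass q m * loop_mass r (n - m)%N.
  apply/funext => n; rewrite -loop_mass_thin; apply: eq_loop_sum => // l _.
  by rewrite /q /r; case: eqP; rewrite ?addr0 ?add0r.
rewrite big_ord_recr /= addrC expRD.
have q0 l : 0 <= q l by rewrite /q; case: ifP.
have r0 l : 0 <= r l by rewrite /r; case: ifP.
apply: cvg_cauchy_product; try by move=> n; exact: loop_mass_ge0.
  have -> : p K.+1 = q K.+1 by rewrite /q eqxx.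
  by apply: cvg_series_loop_mass_single => // l _ /negbTE lK; rewrite /q lK.
have -> : \sum_(l < K) p l.+1 / l.+1%:R = \sum_(l < K) r l.+1 / l.+1%:R.
  by apply: eq_bigr => l _; rewrite /r eqSS ltn_eqF.
apply: IH => // l Kl; rewrite /r; case: eqP => // /eqP lK; apply: pK.
by rewrite ltn_neqAle eq_sym lK.
Qed.

(** The recursion n h(n) = \sum_l p l h(n - l) for h = [loop_mass p], summed against [g]; the
    choices g(m) = 1 and g(m) = m yield the first two moments. *)
Lemma series_weighted_loop_mass p K (g : nat -> R) n :
  (forall l, (K < l)%N -> p l = 0) ->
  series (fun m => m%:R * (g m * loop_mass p m)) n =
  \sum_(l < K) p l.+1 * series (fun m => g (m + l.+1)%N * loop_mass p m) (n - l.+1)%N.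
Proof.
move=> pK; elim: n => [|n IH].
  by rewrite /series /= big_geq // big1 // => l _; rewrite big_geq ?mulr0.
rewrite seriesSr IH; case: n {IH} => [|n].
  by rewrite mul0r addr0; apply: eq_bigr => l _; rewrite subSS !sub0n.
rewrite mulrCA /loop_mass loop_sumSn.
rewrite (@big_ord_cut _ (fun l => p l.+1 * loop_mass p (n - l)%N) n.+1 K); last first.
  by move=> l Kl; rewrite pK // mul0r.
rewrite mulr_sumr [X in _ + X]big_mkcond -big_split; apply: eq_bigr => l _ /=.
case: ifP => ln; last first.
  rewrite addr0; congr (_ * series _ _); lia.
have -> : (n.+2 - l.+1 = (n.+1 - l.+1).+1)%N by lia.
rewrite seriesSr mulrDr; congr (_ + _).
by rewrite subnK // subSS mulrCA.
Qed.

Section Moments.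
Variables (p : nat -> R) (K : nat).
Hypotheses (p0 : forall l, 0 <= p l) (pK : forall l, (K < l)%N -> p l = 0).

(** Under the masses [loop_mass p n], divided by their sum H, the number of particles is a compound
    Poisson variable of mean M and variance V. *)
Let H := expR (\sum_(l < K) p l.+1 / l.+1%:R).
Let M := \sum_(l < K) p l.+1.
Let V := \sum_(l < K) l.+1%:R * p l.+1.

Let h0 n : 0 <= loop_mass p n. Proof. exact: loop_mass_ge0. Qed.

Lemma cvg_loop_mass_mean :
  series (fun n => n%:R * loop_mass p n) @ \oo --> M * H.
Proof.
have -> : series (fun n => n%:R * loop_mass p n) =
    fun n => \sum_(l < K) p l.+1 * series (loop_mass p) (n - l.+1)%N.
  apply/funext => n.
  have -> : (fun n => n%:R * loop_mass p n) = (fun m => m%:R * ((fun=> 1) m * loop_mass p m)).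
    by apply/funext => m; rewrite mul1r.
  rewrite (@series_weighted_loop_mass p K (fun=> 1) n pK); apply: eq_bigr => l _; congr (_ * series _ _).
  by apply/funext => m; rewrite mul1r.
rewrite mulr_suml; apply: cvg_sumr => l _.
apply: cvgM; first exact: cvg_cst.
by apply: cvg_subn; exact: cvg_series_loop_mass.
Qed.

Lemma cvg_loop_mass_square :
  series (fun n => n%:R ^+ 2 * loop_mass p n) @ \oo --> (M ^+ 2 + V) * H.
Proof.
have -> : series (fun n => n%:R ^+ 2 * loop_mass p n) =
    fun n => \sum_(l < K) p l.+1 *
     (series (fun m => m%:R * loop_mass p m) (n - l.+1)%N + l.+1%:R * series (loop_mass p) (n - l.+1)%N).
  apply/funext => n.
  have -> : (fun n => n%:R ^+ 2 * loop_mass p n) = (fun m => m%:R * (m%:R * loop_mass p m)).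
    by apply/funext => m; rewrite mulrA.
  rewrite (@series_weighted_loop_mass p K (fun m => m%:R) n pK); apply: eq_bigr => l _; congr (_ * _).
  rewrite /series /= mulr_sumr -big_split; apply: eq_bigr => m _ /=.
  by rewrite natrD mulrDl.
have -> : (M ^+ 2 + V) * H = \sum_(l < K) p l.+1 * (M * H + l.+1%:R * H).
  transitivity (\sum_(l < K) p l.+1 * (M * H) + \sum_(l < K) l.+1%:R * p l.+1 * H).
    by rewrite -!mulr_suml -/M -/V; ring.
  by rewrite -big_split; apply: eq_bigr => l _ /=; ring.
apply: cvg_sumr => l _; apply: cvgM; first exact: cvg_cst.
apply: cvgD; first by apply: cvg_subn; exact: cvg_loop_mass_mean.
apply: cvgM; first exact: cvg_cst.
by apply: cvg_subn; exact: cvg_series_loop_mass.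
Qed.

Lemma loop_mass_variance n :
  \sum_(m < n) (m%:R - M) ^+ 2 * loop_mass p m <= V * H.
Proof.
have cv2 := cvg_loop_mass_square; have cv1 := cvg_loop_mass_mean.
have cv0 : series (loop_mass p) @ \oo --> H by exact: cvg_series_loop_mass.
clearbody M V H.
pose f m := (m%:R - M) ^+ 2 * loop_mass p m.
have f0 m : 0 <= f m by rewrite mulr_ge0 ?sqr_ge0 //; exact: h0.
have cvf : series f @ \oo --> V * H.
  have -> : series f = fun n => series (fun n => n%:R ^+ 2 * loop_mass p n) n -
      2 * M * series (fun n => n%:R * loop_mass p n) n + M ^+ 2 * series (loop_mass p) n.
    apply/funext => k; rewrite /series /= !mulr_sumr -sumrB -big_split.
    by apply: eq_bigr => m _ /=; rewrite /f; ring.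
  have -> : V * H = (M ^+ 2 + V) * H - 2 * M * (M * H) + M ^+ 2 * H by ring.
  apply: cvgD; [apply: cvgB; first exact: cv2|].
    by apply: cvgM; [exact: cvg_cst | exact: cv1].
  by apply: cvgM; [exact: cvg_cst | exact: cv0].
rewrite -(big_mkord xpredT f) -[leRHS](cvg_lim _ cvf) //.
apply: (nondecreasing_cvgn_le (nondecreasing_series_ge0 f0)).
by apply/cvg_ex; exists (V * H).
Qed.

Lemma sum_loop_mass_le n : \sum_(m < n) loop_mass p m <= H.
Proof.
have cvh : series (loop_mass p) @ \oo --> H by exact: cvg_series_loop_mass.
rewrite -(big_mkord xpredT (loop_mass p)) -[leRHS](cvg_lim _ cvh) //.
apply: (nondecreasing_cvgn_le (nondecreasing_series_ge0 h0)).
by apply/cvg_ex; exists H.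
Qed.

(* Chebyshev's inequality *)
Lemma sum_loop_mass_ge n : M < n%:R ->
  H * (1 - V / (n%:R - M) ^+ 2) <= \sum_(m < n) loop_mass p m.
Proof.
have var := loop_mass_variance.
have cvh : series (loop_mass p) @ \oo --> H by exact: cvg_series_loop_mass.
clearbody M V H => Mn; have nM : 0 < (n%:R - M) ^+ 2 by rewrite exprn_gt0 // subr_gt0.
rewrite mulrBr mulr1 lerBlDr.
apply: (cvgr_to_le cvh).
near=> k.
have nk : (n <= k)%N by near: k; exact: nbhs_infty_ge.
rewrite /series /= (big_cat_nat (n := n)) //= big_mkord lerD2l.
rewrite mulrA ler_pdivlMr // mulrC [leRHS]mulrC.
apply: le_trans (var k).
rewrite -(big_mkord xpredT (fun m => (m%:R - M) ^+ 2 * loop_mass p m)).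
rewrite [leRHS](big_cat_nat (n := n)) //=.
apply: (@le_trans _ _ (\sum_(n <= i < k) (i%:R - M) ^+ 2 * loop_mass p i)); last first.
  by rewrite lerDr; apply: sumr_ge0 => m _; rewrite mulr_ge0 ?sqr_ge0 //; exact: h0.
rewrite mulr_sumr big_nat_cond [leRHS]big_nat_cond.
apply: ler_sum => m /andP[/andP[nm _] _].
apply: ler_wpM2r; first exact: h0.
have nmR : n%:R <= m%:R :> R by rewrite ler_nat.
by rewrite ler_sqr ?nnegrE; lra.
Unshelve. all: by end_near. Qed.

End Moments.
End Series_of_loop_sums.

(** * The heat kernel away from the diagonal *)

Section Derivative_rules.
Variable R : realType.
Implicit Types (f g : R -> R) (x a b : R).

Lemma is_derive_mul f g x a b : is_derive x 1 f a -> is_derive x 1 g b ->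
  is_derive x (1 : R) (fun y => f y * g y) (a * g x + f x * b).
Proof.
move=> fa gb; apply: (is_derive_eq (is_deriveM fa gb)).
by rewrite /GRing.scale /= addrC mulrC.
Qed.

Lemma is_derive_add f g x a b : is_derive x 1 f a -> is_derive x 1 g b ->
  is_derive x (1 : R) (fun y => f y + g y) (a + b).
Proof. by move=> fa gb; exact: (is_deriveD fa gb). Qed.

Lemma is_derive_sub f g x a b : is_derive x 1 f a -> is_derive x 1 g b ->
  is_derive x (1 : R) (fun y => f y - g y) (a - b).
Proof. by move=> fa gb; exact: (is_deriveB fa gb). Qed.

Lemma is_derive_scale c f x a : is_derive x 1 f a ->
  is_derive x (1 : R) (fun y => c * f y) (c * a).
Proof. by move=> fa; exact: (is_deriveZ c fa). Qed.

Lemma is_derive_comp f g x a b : is_derive (g x) 1 f a -> is_derive x 1 g b ->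
  is_derive x (1 : R) (fun y => f (g y)) (a * b).
Proof. by move=> fa gb; exact: (is_derive1_comp fa gb). Qed.

Lemma is_derive_pow n x : is_derive x (1 : R) (fun y => y ^+ n.+1) (n.+1%:R * x ^+ n).
Proof.
elim: n => [|n IH].
  rewrite mul1r expr0; have -> : (fun y : R => y ^+ 1) = id by apply/funext => y; rewrite expr1.
  exact: is_derive_id.
have -> : (fun y : R => y ^+ n.+2) = (fun y => id y * y ^+ n.+1).
  by apply/funext => y; rewrite exprS.
apply: (is_derive_eq (is_derive_mul (is_derive_id x (1 : R)) IH)).
by rewrite mul1r mulrCA -exprS -[in RHS]nat1r mulrDl mul1r.
Qed.

Lemma is_derive_continuous f x a : is_derive x (1 : R) f a -> {for x, continuous f}.
Proof. by move=> [dfx _]; apply: differentiable_continuous; exact/derivable1_diffP. Qed.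

Lemma is_derive_recenter f x c a : is_derive (x - c) (1 : R) f a ->
  is_derive x (1 : R) (fun y => f (y - c)) a.
Proof.
move=> fa; rewrite -[a]mulr1; apply: is_derive_comp => //.
apply: (is_derive_eq (is_derive_sub (is_derive_id x (1 : R)) (is_derive_cst c x (1 : R)))).
by rewrite subr0.
Qed.

End Derivative_rules.

Section Continuity_rules.
Variables (R : realType) (T : topologicalType).
Implicit Types f g : T -> R.

Lemma continuous_mul f g : continuous f -> continuous g -> continuous (fun x => f x * g x).
Proof. by move=> cf cg x; apply: cvgM; [exact: cf | exact: cg]. Qed.

Lemma continuous_add f g : continuous f -> continuous g -> continuous (fun x => f x + g x).
Proof. by move=> cf cg x; apply: cvgD; [exact: cf | exact: cg]. Qed.

Lemma continuous_opp f : continuous f -> continuous (fun x => - f x).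
Proof. by move=> cf x; apply: cvgN; exact: cf. Qed.

Lemma continuous_pow f n : continuous f -> continuous (fun x => f x ^+ n).
Proof.
move=> cf; elim: n => [|n IH]; first by move=> x; exact: cvg_cst.
by under eq_fun do rewrite exprS; exact: continuous_mul.
Qed.

Lemma continuous_cst (c : R) : continuous (fun _ : T => c).
Proof. by move=> x; exact: cvg_cst. Qed.

Lemma continuous_compose (U : topologicalType) (h : T -> U) (f : U -> R) :
  continuous h -> continuous f -> continuous (fun x => f (h x)).
Proof. by move=> ch cf x; apply: (continuous_comp (ch x) (cf (h x))). Qed.

End Continuity_rules.

(** * A polynomial cut-off function *)

Section Cutoff.
Variable R : realType.

Definition pos (v : R) : R := Num.max v 0.

Lemma pos_ge0 v : 0 <= pos v. Proof. by rewrite /pos le_max lexx orbT. Qed.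
Lemma pos_id v : 0 <= v -> pos v = v. Proof. by move=> v0; apply/max_idPl. Qed.
Lemma pos_eq0 v : v <= 0 -> pos v = 0. Proof. by move=> v0; apply/max_idPr. Qed.

(** Powers of the positive part are smooth enough at 0 to build a C^2 cut-off from polynomials
    only. *)
Lemma is_derive_posX n (v : R) :
  is_derive v 1 (fun v => pos v ^+ n.+2) (n.+2%:R * pos v ^+ n.+1).
Proof.
have [v0|v0|v0] := ltgtP v 0.
- rewrite pos_eq0 ?ltW // expr0n mulr0.
  apply: (@near_eq_is_derive R R R (fun=> 0)).
    near=> u; rewrite pos_eq0 ?expr0n //.
    by apply/ltW; near: u; exact: lt_nbhsl.
- rewrite pos_id ?ltW //.
  apply: (@near_eq_is_derive R R R (fun u => u ^+ n.+2)).
    near=> u; rewrite pos_id //.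
    by apply/ltW; near: u; exact: lt_nbhsr.
  exact: is_derive_pow.
rewrite v0 pos_id // expr0n mulr0.
suff H : h^-1 *: (pos (h *: 1 + 0) ^+ n.+2 - pos 0 ^+ n.+2) @[h --> (0 : R)^'] --> (0 : R).
  by apply: DeriveDef; [apply/cvg_ex; exists 0 | exact: cvg_lim H].
apply/cvgr0Pnorm_le => e e0; near=> h.
rewrite (@pos_id 0) // expr0n subr0 addr0 /GRing.scale /= mulr1 exprS mulrA.
have h0 : h != 0 by near: h; exact: nbhs_dnbhs_neq.
have hpos : `|pos h| <= `|h|.
  have [h_ge0|h_le0] := leP 0 h; first by rewrite pos_id.
  by rewrite pos_eq0 ?normr0 // ltW.
have he : `|h| <= Num.min e 1.
  near: h; apply: dnbhs0_le.
  by rewrite lt_min e0 ltr01.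
move: he; rewrite le_min => /andP[he h1].
rewrite !normrM normfV normrX exprS.
have hh : `|h|^-1 * `|pos h| <= 1 by rewrite ler_pdivrMl ?normr_gt0 // mulr1.
have pe : `|pos h| <= e by apply: le_trans hpos he.
have p1 : `|pos h| ^+ n <= 1 by rewrite exprn_ile1 // (le_trans hpos).
apply: (@le_trans _ _ (1 * (e * 1))); last by rewrite mul1r mulr1.
by apply: ler_pM => //; rewrite ?mulr_ge0 ?invr_ge0 ?exprn_ge0 //; apply: ler_pM.
Unshelve. all: by end_near. Qed.

Lemma continuous_pos : continuous pos.
Proof. by move=> v; apply: continuous_max; [exact: cvg_id | exact: cvg_cst]. Qed.

Variable a : R.
Hypothesis a0 : 0 < a.

(** For |r| <= a / 2 one has a^2 - r^2 >= 3 / 4 a^2, so this c makes w >= 1 there; the cubes of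
    positive parts are of class C^2. *)
Let c : R := ((3 / 4 * a ^+ 2) ^+ 3)^-1.
Let w (r : R) : R := c * pos (a ^+ 2 - r ^+ 2) ^+ 3.
Let w1 (r : R) : R := c * (3 * pos (a ^+ 2 - r ^+ 2) ^+ 2 * (- (2 * r))).
Let w2 (r : R) : R := c * (3 * (2 * pos (a ^+ 2 - r ^+ 2) ^+ 1 * (- (2 * r))) * (- (2 * r)) +
                 3 * pos (a ^+ 2 - r ^+ 2) ^+ 2 * (- 2)).

(* a C^2 cutoff function, equal to 1 on [-a/2, a/2] and to 0 outside [-a, a] *)
Definition cutoff (r : R) : R := 1 - pos (1 - w r) ^+ 3.
Definition cutoff1 (r : R) : R := 3 * pos (1 - w r) ^+ 2 * w1 r.
Definition cutoff2 (r : R) : R := 3 * (2 * pos (1 - w r) ^+ 1 * (- w1 r)) * w1 r +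
                        3 * pos (1 - w r) ^+ 2 * w2 r.

Let is_derive_arg (r : R) : is_derive r (1 : R) (fun r : R => a ^+ 2 - r ^+ 2) (- (2 * r)).
Proof.
rewrite -[- _]sub0r; apply: is_derive_sub.
exact: (@is_derive_pow _ 1 r).
Qed.

Let is_derive_w (r : R) : is_derive r (1 : R) w (w1 r).
Proof.
apply: is_derive_scale; apply: (is_derive_comp (f := fun v => pos v ^+ 3)) (is_derive_arg r).
exact: (is_derive_posX 1).
Qed.

Let is_derive_lin (r : R) : is_derive r (1 : R) (fun r : R => - (2 * r)) (- 2).
Proof.
have -> : (fun r : R => - (2 * r)) = (fun r : R => (- 2) * id r) by apply/funext => x; rewrite mulNr.
by rewrite -[X in is_derive _ _ _ X]mulr1; apply: is_derive_scale.
Qed.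

Let is_derive_w1 (r : R) : is_derive r (1 : R) w1 (w2 r).
Proof.
apply: is_derive_scale; apply: is_derive_mul; last exact: is_derive_lin.
apply: is_derive_scale; apply: (is_derive_comp (f := fun v => pos v ^+ 2)) (is_derive_arg r).
exact: (is_derive_posX 0).
Qed.

Let is_derive_1w (r : R) : is_derive r (1 : R) (fun r : R => 1 - w r) (- w1 r).
Proof. by rewrite -sub0r; apply: is_derive_sub. Qed.

Lemma is_derive_cutoff (r : R) : is_derive r (1 : R) cutoff (cutoff1 r).
Proof.
have -> : cutoff1 r = 0 - 3 * pos (1 - w r) ^+ 2 * (- w1 r) by rewrite /cutoff1; ring.
apply: is_derive_sub.
apply: (is_derive_comp (f := fun v => pos v ^+ 3)) (is_derive_1w r).
exact: (is_derive_posX 1).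
Qed.

Lemma is_derive_cutoff1 (r : R) : is_derive r (1 : R) cutoff1 (cutoff2 r).
Proof.
apply: is_derive_mul; last exact: is_derive_w1.
apply: is_derive_scale; apply: (is_derive_comp (f := fun v => pos v ^+ 2)) (is_derive_1w r).
exact: (is_derive_posX 0).
Qed.

Lemma continuous_cutoff2 : continuous cutoff2.
Proof.
have cw : continuous w by move=> r; exact: is_derive_continuous (is_derive_w r).
have cw1 : continuous w1 by move=> r; exact: is_derive_continuous (is_derive_w1 r).
have cl : continuous (fun r : R => - (2 * r)).
  by move=> r; exact: is_derive_continuous (is_derive_lin r).
have cq : continuous (fun r : R => pos (a ^+ 2 - r ^+ 2)).
  apply: (continuous_compose _ continuous_pos) => r.
  exact: is_derive_continuous (is_derive_arg r).
have cp : continuous (fun r : R => pos (1 - w r)).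
  apply: (continuous_compose _ continuous_pos) => r.
  exact: is_derive_continuous (is_derive_1w r).
have cw2 : continuous w2.
  apply: continuous_mul; first exact: continuous_cst.
  apply: continuous_add.
    apply: continuous_mul (cl).
    apply: continuous_mul; first exact: continuous_cst.
    apply: continuous_mul (cl).
    by apply: continuous_mul; [exact: continuous_cst | exact: continuous_pow].
  apply: continuous_mul; last exact: continuous_cst.
  by apply: continuous_mul; [exact: continuous_cst | exact: continuous_pow].
apply: continuous_add.
  apply: continuous_mul (cw1).
  apply: continuous_mul; first exact: continuous_cst.
  apply: continuous_mul; last exact: continuous_opp.
  by apply: continuous_mul; [exact: continuous_cst | exact: continuous_pow].
apply: continuous_mul (cw2).
by apply: continuous_mul; [exact: continuous_cst | exact: continuous_pow].
Qed.

Let c0 : 0 < c. Proof. by rewrite invr_gt0 exprn_gt0 // mulr_gt0 // exprn_gt0. Qed.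

Let w_ge0 (r : R) : 0 <= w r. Proof. by apply: mulr_ge0; [exact: ltW | rewrite exprn_ge0 // pos_ge0]. Qed.

Lemma cutoff_ge0 (r : R) : 0 <= cutoff r.
Proof.
rewrite subr_ge0 exprn_ile1 ?pos_ge0 // /pos ge_max ler01 andbT gerBl.
exact: w_ge0.
Qed.

Lemma cutoff_le1 (r : R) : cutoff r <= 1.
Proof. by rewrite gerBl exprn_ge0 // pos_ge0. Qed.

Let pos_center (r : R) : `|r| <= a / 2 -> pos (1 - w r) = 0.
Proof.
move=> ra; apply: pos_eq0; rewrite subr_le0 /w mulrC -ler_pdivrMr // mul1r invrK.
have h : 3 / 4 * a ^+ 2 <= a ^+ 2 - r ^+ 2.
  have : `|r| ^+ 2 <= (a / 2) ^+ 2 by rewrite ler_sqr ?nnegrE // divr_ge0 // ltW.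
  rewrite real_normK ?num_real // => r2; nra.
have h0 : 0 <= 3 / 4 * a ^+ 2 by rewrite mulr_ge0 // sqr_ge0.
by apply: lerXn2r; rewrite ?nnegrE ?pos_ge0 // pos_id //; apply: le_trans h.
Qed.

Lemma cutoff_center (r : R) : `|r| <= a / 2 -> [/\ cutoff r = 1, cutoff1 r = 0 & cutoff2 r = 0].
Proof.
by move=> /pos_center wr; rewrite /cutoff /cutoff1 /cutoff2 wr; split; ring.
Qed.

Lemma cutoff_outside (r : R) : a <= `|r| -> cutoff r = 0 /\ cutoff1 r = 0.
Proof.
move=> ra; have q0 : pos (a ^+ 2 - r ^+ 2) = 0.
  apply: pos_eq0; rewrite subr_le0 -[leRHS]real_normK ?num_real //.
  by rewrite ler_sqr ?nnegrE // ltW.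
have w0 : w r = 0 by rewrite /w q0; ring.
by rewrite /cutoff /cutoff1 w0 /w1 q0 subr0 pos_id //; split; ring.
Qed.

Lemma cutoff_bounded : exists C, 0 <= C /\
  forall r, `|r| <= a -> `|cutoff1 r| <= C /\ `|cutoff2 r| <= C.
Proof.
have bnd (f : R -> R) : continuous f -> exists C, forall r, `|r| <= a -> `|f r| <= C.
  move=> cf; have cnf : {within `[-a, a], continuous (fun r : R => `|f r|)}.
    by apply: continuous_subspaceT => r; apply: cvg_norm; exact: cf.
  have aa : - a <= a by rewrite ge0_cp // ltW.
  have [m _ fm] := EVT_max aa cnf.
  by exists (`|f m|) => r ra; apply: fm; rewrite in_itv /= -ler_norml.
have c1 : continuous cutoff1 by move=> r; exact: is_derive_continuous (is_derive_cutoff1 r).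
have [C1 H1] := bnd _ c1; have [C2 H2] := bnd _ continuous_cutoff2.
exists (Num.max 0 (Num.max C1 C2)); split; first by rewrite le_max lexx.
by move=> r ra; rewrite !le_max H1 // H2 // !orbT.
Qed.

End Cutoff.

(** * The cut-off Gaussian on the line *)

Section Heat_kernel_line.
Variable R : realType.
Local Notation mu := (@lebesgue_measure R).

(** The fourth power of exp (y / 4) >= y / 4. Four powers suffice for all later uses of Gaussian and
    of spectral decay. *)
Lemma expRN_le (y : R) : 0 < y -> expR (- y) <= (4 / y) ^+ 4.
Proof.
move=> y0; rewrite expRN -[leRHS]invrK -exprVn invf_div lef_pV2 ?posrE ?expR_gt0 //; last first.
  by rewrite exprn_gt0 // divr_gt0.
have {2}-> : y = 4%:R * (y / 4) by field.
rewrite expRM_natl; apply: lerXn2r; rewrite ?nnegrE ?expR_ge0 ?divr_ge0 // ?ltW //.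
by apply: le_lt_trans (expR_gt1Dx _); rewrite ?lerDr // gt_eqF // divr_gt0.
Qed.

Lemma expR_half_ln (s : R) : 0 < s -> expR (2^-1 * ln s) = Num.sqrt s.
Proof.
move=> s0; have E : expR (2^-1 * ln s) ^+ 2 = s.
  by rewrite -expRM_natl mulrA mulfV // mul1r lnK ?posrE.
by rewrite -[in RHS]E sqrtr_sqr gtr0_norm // expR_gt0.
Qed.

(* (4 pi)^(1/2) times the heat kernel of the real line *)
Definition gk (s r : R) : R := expR (- (r ^+ 2 / 4 * s^-1) - 2^-1 * ln s).
Definition gk1 (s r : R) : R := - (r / 2 * s^-1) * gk s r.
(** This is also the derivative of [gk] in s: the heat equation on the line. *)
Definition gk2 (s r : R) : R := (r ^+ 2 / 4 * s ^- 2 - 2^-1 * s^-1) * gk s r.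

Lemma gk_gt0 s r : 0 < gk s r. Proof. exact: expR_gt0. Qed.

Lemma is_derive_gk (s r : R) : is_derive r (1 : R) (gk s) (gk1 s r).
Proof.
rewrite /gk1 mulrC; apply: (is_derive_comp (f := expR)).
have E : - (r / 2 * s^-1) = - (s^-1 / 4) * (2%:R * r ^+ 1) - 0.
  by move: (s^-1) => u; field.
rewrite E; apply: is_derive_sub.
have -> : (fun y : R => - (y ^+ 2 / 4 * s^-1)) = (fun y => - (s^-1 / 4) * y ^+ 2).
  by apply/funext => y; ring.
by apply: is_derive_scale; exact: is_derive_pow.
Qed.

Lemma is_derive_gk1 (s r : R) : s != 0 -> is_derive r (1 : R) (gk1 s) (gk2 s r).
Proof.
move=> s0.
have -> : gk2 s r = - (2^-1 * s^-1) * 1 * gk s r + - (r / 2 * s^-1) * gk1 s r.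
  by rewrite /gk2 /gk1; field.
apply: is_derive_mul; last exact: is_derive_gk.
have -> : (fun y : R => - (y / 2 * s^-1)) = (fun y => - (2^-1 * s^-1) * id y).
  by apply/funext => y; rewrite /=; ring.
by apply: is_derive_scale.
Qed.

Lemma is_derive_gk_time (s r : R) : 0 < s -> is_derive s (1 : R) (gk ^~ r) (gk2 s r).
Proof.
move=> s0; rewrite /gk2 mulrC; apply: (is_derive_comp (f := expR)).
have -> : (fun y => - (r ^+ 2 / 4 * y^-1) - 2^-1 * ln y) =
    (fun y : R => - (r ^+ 2 / 4) * y^-1 - 2^-1 * ln y).
  by apply/funext => y; rewrite mulNr.
have -> : r ^+ 2 / 4 * s ^- 2 - 2^-1 * s^-1 =
  - (r ^+ 2 / 4) * (- s ^- 2 *: 1) - 2^-1 * s^-1 by rewrite /GRing.scale /=; field; rewrite gt_eqF.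
apply: is_derive_sub; apply: is_derive_scale; last exact: is_derive1_ln.
by apply: (@is_deriveV _ id); rewrite /= gt_eqF.
Qed.

(** Having s^-1 in place of s^(-1/2) is crude but avoids square roots; the decay away from 0 makes
    up for it. *)
Lemma gk_le s r : 0 < s <= 1 -> gk s r <= s^-1.
Proof.
move=> /andP[s0 s1]; rewrite -[s in s^-1](@lnK _ s) ?posrE // -expRN ler_expR.
have l0 : ln s <= 0 by apply: ln_le0.
have : 0 <= r ^+ 2 / 4 * s^-1 by apply: mulr_ge0; [rewrite divr_ge0 ?sqr_ge0 | rewrite invr_ge0 ltW].
lra.
Qed.

Lemma gk_far_exp s r d : 0 < s <= 1 -> 0 <= d <= `|r| ->
  gk s r <= s^-1 * expR (- (d ^+ 2 / 4 * s^-1)).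
Proof.
move=> /andP[s0 s1] /andP[d0 dr]; rewrite -[s in s^-1 * _](@lnK _ s) ?posrE // -expRN -expRD ler_expR.
have l0 : ln s <= 0 by apply: ln_le0.
have : d ^+ 2 / 4 * s^-1 <= r ^+ 2 / 4 * s^-1.
  apply: ler_wpM2r; first by rewrite invr_ge0 ltW.
  apply: ler_wpM2r; first by [].
  by rewrite -[leRHS]real_normK ?num_real // ler_sqr ?nnegrE.
lra.
Qed.

(** The power 3 pays for the factor s^-1 of the derivative [gk1] and, in three dimensions, for the
    bounds s^-1 of the two other coordinates. *)
Lemma gk_far s r d : 0 < s <= 1 -> 0 < d <= `|r| ->
  gk s r <= (16 / d ^+ 2) ^+ 4 * s ^+ 3.
Proof.
move=> /[dup] s01 /andP[s0 s1] /andP[d0 dr].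
have dd : 0 <= d <= `|r| by rewrite dr ltW.
apply: le_trans (gk_far_exp s01 dd) _.
have y0 : 0 < d ^+ 2 / 4 * s^-1 by apply: mulr_gt0; [rewrite divr_gt0 ?exprn_gt0 | rewrite invr_gt0].
apply: (@le_trans _ _ (s^-1 * (4 / (d ^+ 2 / 4 * s^-1)) ^+ 4)).
  by apply: ler_wpM2l; [rewrite invr_ge0 ltW | exact: expRN_le].
rewrite le_eqVlt; apply/orP; left; apply/eqP; field.
by rewrite !gt_eqF.
Qed.

Variable a : R.
Hypothesis a0 : 0 < a.

Definition ck (s r : R) := gk s r * cutoff a r.
Definition ck1 (s r : R) := gk1 s r * cutoff a r + gk s r * cutoff1 a r.
Definition ckt (s r : R) := gk2 s r * cutoff a r.
(** The commutator of the second derivative with the cut-off: the second derivative of [ck] is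
    [ckt + ckerr], where [ckt] is the time derivative and [ckerr] vanishes for |r| <= a / 2. *)
Definition ckerr (s r : R) := 2 * (gk1 s r * cutoff1 a r) + gk s r * cutoff2 a r.

Lemma is_derive_ck (s r : R) : is_derive r (1 : R) (ck s) (ck1 s r).
Proof. by apply: is_derive_mul; [exact: is_derive_gk | exact: is_derive_cutoff]. Qed.

Lemma is_derive_ck1 (s r : R) : s != 0 ->
  is_derive r (1 : R) (ck1 s) (ckt s r + ckerr s r).
Proof.
move=> s0.
have -> : ckt s r + ckerr s r = (gk2 s r * cutoff a r + gk1 s r * cutoff1 a r) +
   (gk1 s r * cutoff1 a r + gk s r * cutoff2 a r) by rewrite /ckt /ckerr; ring.
apply: is_derive_add.
  exact: is_derive_mul (is_derive_gk1 r s0) (is_derive_cutoff a r).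
exact: is_derive_mul (is_derive_gk s r) (is_derive_cutoff1 a r).
Qed.

Lemma is_derive_ck_time (s r : R) : 0 < s -> is_derive s (1 : R) (ck ^~ r) (ckt s r).
Proof.
move=> s0; have -> : ckt s r = gk2 s r * cutoff a r + gk s r * 0 by rewrite /ckt mulr0 addr0.
apply: (is_derive_mul (g := fun=> cutoff a r)); exact: is_derive_gk_time.
Qed.

Lemma continuous_gk s : continuous (gk s).
Proof. by move=> r; exact: is_derive_continuous (is_derive_gk s r). Qed.
Lemma continuous_gk1 s : s != 0 -> continuous (gk1 s).
Proof. by move=> s0 r; exact: is_derive_continuous (is_derive_gk1 r s0). Qed.
Lemma continuous_gk2 s : continuous (gk2 s).
Proof.
apply: continuous_mul (@continuous_gk s).
apply: continuous_add; last exact: continuous_cst.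
apply: continuous_mul; last exact: continuous_cst.
apply: continuous_mul; last exact: continuous_cst.
by apply: continuous_pow => x; exact: cvg_id.
Qed.
Lemma continuous_cutoff : continuous (cutoff a).
Proof. by move=> r; exact: is_derive_continuous (is_derive_cutoff a r). Qed.
Lemma continuous_cutoff1 : continuous (cutoff1 a).
Proof. by move=> r; exact: is_derive_continuous (is_derive_cutoff1 a r). Qed.
Lemma continuous_ck s : continuous (ck s).
Proof. by apply: continuous_mul; [exact: continuous_gk | exact: continuous_cutoff]. Qed.
Lemma continuous_ck1 s : s != 0 -> continuous (ck1 s).
Proof.
move=> s0; apply: continuous_add.
  by apply: continuous_mul; [exact: continuous_gk1 | exact: continuous_cutoff].
by apply: continuous_mul; [exact: continuous_gk | exact: continuous_cutoff1].
Qed.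
Lemma continuous_ckt s : continuous (ckt s).
Proof. by apply: continuous_mul; [exact: continuous_gk2 | exact: continuous_cutoff]. Qed.
Lemma continuous_ckerr s : s != 0 -> continuous (ckerr s).
Proof.
move=> s0; apply: continuous_add.
  apply: continuous_mul; first exact: continuous_cst.
  by apply: continuous_mul; [exact: continuous_gk1 | exact: continuous_cutoff1].
by apply: continuous_mul; [exact: continuous_gk | exact: continuous_cutoff2].
Qed.

Lemma ck_ge0 s r : 0 <= ck s r.
Proof. by apply: mulr_ge0; [exact/ltW/gk_gt0 | exact: cutoff_ge0]. Qed.

Lemma ck_le_gk s r : ck s r <= gk s r.
Proof. by apply: ler_piMr; [exact/ltW/gk_gt0 | exact: cutoff_le1]. Qed.

Lemma ck_le s r : 0 < s <= 1 -> ck s r <= s^-1.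
Proof. by move=> s01; apply: le_trans (ck_le_gk s r) (gk_le r s01). Qed.

Lemma ckt_le s r : 0 < s <= 1 -> `|r| <= a ->
  `|ckt s r| <= (a ^+ 2 / 4 * s ^- 2 + 2^-1 * s^-1) * s^-1.
Proof.
move=> /[dup] s01 /andP[s0 s1] ra.
rewrite /ckt /gk2 -mulrA normrM; apply: ler_pM => //.
  apply: (le_trans (ler_normB _ _)); apply: lerD.
    rewrite ger0_norm; last first.
      by apply: mulr_ge0; [rewrite divr_ge0 ?sqr_ge0 | rewrite invr_ge0 exprn_ge0 // ltW].
    apply: ler_wpM2r; first by rewrite invr_ge0 exprn_ge0 // ltW.
    apply: ler_wpM2r; first by [].
    by rewrite -real_normK ?num_real // ler_sqr ?nnegrE // ltW.
  by rewrite ger0_norm //; apply: mulr_ge0; rewrite // invr_ge0 ltW.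
by rewrite ger0_norm; [exact: ck_le | exact: ck_ge0].
Qed.

Lemma ckerr_bound : exists C, 0 <= C /\
  forall s r, 0 < s <= 1 -> `|r| <= a -> `|ckerr s r| <= C * s ^+ 2.
Proof.
have [C [C0 CP]] := cutoff_bounded a0.
pose B := (16 / (a / 2) ^+ 2) ^+ 4.
have B0 : 0 <= B by rewrite exprn_ge0 // divr_ge0 // sqr_ge0.
have a1 : 0 <= a + 1 by rewrite addr_ge0 // ltW.
have aCB : 0 <= (a + 1) * C * B by apply: mulr_ge0 => //; exact: mulr_ge0.
exists ((a + 1) * C * B); split; first by [].
move=> s r /[dup] s01 /andP[s0 s1] ra.
have [C1 C2] := CP r ra.
have [r2|r2] := leP `|r| (a / 2).
  have [_ c1 c2] := cutoff_center a0 r2.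
  by rewrite /ckerr c1 c2 !mulr0 addr0 normr0 mulr_ge0 ?sqr_ge0.
have gB : gk s r <= B * s ^+ 3.
  by apply: gk_far => //; rewrite ltW // andbT divr_gt0.
have g0 := ltW (gk_gt0 s r).
have g1B : `|gk1 s r| <= a / 2 * B * s ^+ 2.
  rewrite /gk1 normrM normrN !normrM (ger0_norm g0) !normfV (gtr0_norm s0) (@gtr0_norm _ 2) //.
  have -> : a / 2 * B * s ^+ 2 = a / 2 * s^-1 * (B * s ^+ 3) by field; rewrite gt_eqF.
  apply: ler_pM => //; first by apply: mulr_ge0; [rewrite divr_ge0 | rewrite invr_ge0 ltW].
  apply: ler_wpM2r; first by rewrite invr_ge0 ltW.
  exact: ler_wpM2r.
have gB2 : gk s r <= B * s ^+ 2.
  by apply: (le_trans gB); rewrite ler_wpM2l // exprSr ler_piMr // sqr_ge0.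
have T (x y z t : R) : `|2 * (x * y) + z * t| <= 2 * (`|x| * `|y|) + `|z| * `|t|.
  by apply: (le_trans (ler_normD _ _)); rewrite !normrM (@ger0_norm _ 2).
apply: (le_trans (T _ _ _ _)); rewrite (ger0_norm g0).
have P1 : `|gk1 s r| * `|cutoff1 a r| <= a / 2 * B * s ^+ 2 * C by apply: ler_pM.
have P2 : gk s r * `|cutoff2 a r| <= B * s ^+ 2 * C by apply: ler_pM.
apply: (@le_trans _ _ (2 * (a / 2 * B * s ^+ 2 * C) + B * s ^+ 2 * C)); first by apply: lerD => //; exact: ler_wpM2l.
by rewrite le_eqVlt; apply/orP; left; apply/eqP; field.
Qed.

(** The constant is (4 pi)^(1/2), the mass of [gk s] on the whole line, which is a multiple of a
    normal density of variance 2 s. *)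
Lemma integral_ck_le (c s : R) : 0 < s ->
  (\int[mu]_(r in `[(c - a)%R, (c + a)%R]) (ck s (r - c))%:E <= (2 * Num.sqrt pi)%:E)%E.
Proof.
move=> s0; pose sg := Num.sqrt (2 * s).
have sg0 : sg != 0 by rewrite gt_eqF // sqrtr_gt0 mulr_gt0.
have sg2 : sg ^+ 2 = 2 * s by rewrite sqr_sqrtr // mulr_ge0 // ltW.
have mck : measurable_fun setT (fun r : R => ck s (r - c)).
  apply: continuous_measurable_fun; apply: continuous_compose (@continuous_ck s).
  by apply: continuous_add; [move=> x; exact: cvg_id | exact: continuous_cst].
apply: (@le_trans _ _ (\int[mu]_r ((2 * Num.sqrt pi)%:E * (normal_pdf c sg r)%:E))%E); last first.
  rewrite integralZl //; last exact: integrable_normal_pdf.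
  by rewrite integral_normal_pdf mule1.
apply: (@le_trans _ _ (\int[mu]_r (ck s (r - c))%:E)%E).
  apply: ge0_subset_integral => //; first exact/measurable_EFinP.
  by move=> r _; rewrite lee_fin ck_ge0.
apply: ge0_le_integral => //.
- by move=> r _; rewrite lee_fin ck_ge0.
- exact/measurable_EFinP.
- by apply/measurable_EFinP; apply: measurable_funM => //; exact: measurable_normal_pdf.
move=> r _; rewrite -EFinM lee_fin; apply: (le_trans (ck_le_gk _ _)).
rewrite normal_pdfE //= /normal_peak /normal_fun sg2 /gk expRD mulrC.
rewrite mulrA le_eqVlt; apply/orP; left; apply/eqP.
congr (_ * expR _); last by field; rewrite gt_eqF.
have -> : 2 * s * pi *+ 2 = (2 ^+ 2 * pi) * s by ring.
rewrite sqrtrM ?mulr_ge0 ?pi_ge0 // sqrtrM // sqrtr_sqr ger0_norm // invfM mulrA.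
rewrite divff ?mul1r; last by rewrite mulf_neq0 // gt_eqF // sqrtr_gt0 pi_gt0.
by rewrite expRN expR_half_ln.
Qed.

(** Only |r - c| <= sqrt s is kept, where the cut-off is 1 and [gk] is at least exp (- 1 / 4)
    s^(-1/2). *)
Lemma integral_ck_ge (c s : R) : 0 < s <= (a / 2) ^+ 2 ->
  ((2 * expR (- 4^-1))%:E <= \int[mu]_(r in `[(c - a)%R, (c + a)%R]) (ck s (r - c))%:E)%E.
Proof.
move=> /andP[s0 sa]; pose q := Num.sqrt s.
have q0 : 0 < q by rewrite sqrtr_gt0.
have q2 : q ^+ 2 = s by rewrite sqr_sqrtr // ltW.
have qa : q <= a / 2 by rewrite -ler_sqr ?nnegrE ?q2 // ?ltW // divr_gt0.
have mck : measurable_fun setT (fun r : R => ck s (r - c)).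
  apply: continuous_measurable_fun; apply: continuous_compose (@continuous_ck s).
  by apply: continuous_add; [move=> x; exact: cvg_id | exact: continuous_cst].
apply: (@le_trans _ _ (\int[mu]_(r in `[(c - q)%R, (c + q)%R]) (ck s (r - c))%:E)%E); last first.
  apply: ge0_subset_integral => //.
  - by apply/measurable_EFinP; exact: measurable_funTS.
  - by move=> r _; rewrite lee_fin ck_ge0.
  by move=> r /=; rewrite !in_itv /= => /andP[? ?]; apply/andP; split; lra.
apply: (@le_trans _ _ (\int[mu]_(r in `[(c - q)%R, (c + q)%R]) (expR (- 4^-1) * q^-1)%:E)%E).
  rewrite integral_cst //= lebesgue_measure_itv /= lte_fin.
  have -> : c - q < c + q by lra.
  rewrite -EFinD -EFinM lee_fin le_eqVlt; apply/orP; left; apply/eqP; field.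
  by rewrite gt_eqF.
apply: ge0_le_integral => //.
- by move=> r _; rewrite lee_fin mulr_ge0 ?expR_ge0 // invr_ge0 ltW.
- by apply/measurable_EFinP; exact: measurable_funTS.
move=> r /=; rewrite in_itv /= lee_fin => /andP[r1 r2].
have rq : `|r - c| <= q by rewrite ler_norml; apply/andP; split; lra.
rewrite /ck; have [-> _ _] := cutoff_center a0 (le_trans rq qa).
rewrite mulr1 /gk expRD; apply: ler_pM; rewrite ?expR_ge0 ?invr_ge0 ?(ltW q0) //.
  rewrite ler_expR lerN2 mulrAC -[leRHS]mul1r; apply: ler_wpM2r => //.
  rewrite ler_pdivrMr // mul1r -q2 -[leLHS]real_normK ?num_real //.
  by rewrite ler_sqr ?nnegrE // ltW.
by rewrite expRN expR_half_ln.
Qed.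

End Heat_kernel_line.

(** * Measurability in space *)

Section Space_measurability.
Variable R : realType.
Implicit Types (x y z c : R3 R).

Definition open_box c (e : R) : set (R3 R) :=
  [set z | [/\ `|z.1.1 - c.1.1| < e, `|z.1.2 - c.1.2| < e & `|z.2 - c.2| < e]].

Definition box c (a : R) : set (R3 R) :=
  [set z | [/\ `|z.1.1 - c.1.1| <= a, `|z.1.2 - c.1.2| <= a & `|z.2 - c.2| <= a]].

Lemma ball_open_box c e : 0 < e -> ball c e = open_box c e.
Proof.
move=> e0; apply/seteqP; split => z; rewrite /ball /= /prod_ball /ball /= /prod_ball /open_box /=.
  by move=> -[[h1 h2] h3]; split; rewrite distrC.
by move=> -[h1 h2 h3]; split; [split|]; rewrite /ball /= distrC.
Qed.

Lemma boxE c a : box c a =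
  (`[(c.1.1 - a)%R, (c.1.1 + a)%R] `*` `[(c.1.2 - a)%R, (c.1.2 + a)%R]) `*`
  `[(c.2 - a)%R, (c.2 + a)%R].
Proof.
apply/seteqP; split => -[[z1 z2] z3]; rewrite /box /= !in_itv /= -!ler_distl;
  by [move=> [? ? ?]; split | move=> [[? ?] ?]; split].
Qed.

Lemma measurable_box c a : measurable (box c a).
Proof. by rewrite boxE; apply: measurableX => //; exact: measurableX. Qed.

Lemma open_boxE c a : open_box c a =
  (`](c.1.1 - a)%R, (c.1.1 + a)%R[ `*` `](c.1.2 - a)%R, (c.1.2 + a)%R[) `*`
  `](c.2 - a)%R, (c.2 + a)%R[.
Proof.
apply/seteqP; split => -[[z1 z2] z3]; rewrite /open_box /= !in_itv /= -!ltr_distl;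
  by [move=> [? ? ?]; split | move=> [[? ?] ?]; split].
Qed.

Lemma measurable_open_box c a : measurable (open_box c a).
Proof. by rewrite open_boxE; apply: measurableX => //; exact: measurableX. Qed.

(** The sigma-algebra of [R3 R] is the product one; an open set belongs to it as a countable union
    of boxes with rational centres and radii 1 / (n + 1). *)
Lemma open_measurable_space (U : set (R3 R)) : open U -> measurable U.
Proof.
move=> oU.
pose B (p : rat * rat * rat * nat) :=
  open_box ((ratr p.1.1.1, ratr p.1.1.2), ratr p.1.2) (p.2.+1%:R^-1 : R).
have [g gK] : exists g : nat -> option (rat * rat * rat * nat), forall p, exists i, g i = Some p.
  by exists unpickle => p; exists (pickle p); rewrite pickleK.
pose F i := if g i is Some p then if `[< B p `<=` U >] then B p else set0 else set0.
have -> : U = \bigcup_i F i.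
  apply/seteqP; split => x.
    move=> Ux; have /nbhs_ballP[e /= e0 eU] := open_nbhs_nbhs (conj oU Ux).
    have e20 : 0 < e / 2 by rewrite divr_gt0.
    have [n ne] : exists n : nat, n.+1%:R^-1 < e / 2.
      have [n _ /(_ n (leqnn n)) /= ] := near_infty_natSinv_lt (PosNum e20).
      by exists n.
    have n0 : 0 < n.+1%:R^-1 :> R by rewrite invr_gt0.
    have rq (t : R) : exists q : rat, `|t - ratr q| < n.+1%:R^-1.
      have [|q] := @rat_in_itvoo R (t - n.+1%:R^-1) (t + n.+1%:R^-1).
        by rewrite ltrBlDr -addrA ltrDl addr_gt0.
      rewrite in_itv /= => qt; exists q; by rewrite distrC ltr_distl.
    have [q1 h1] := rq x.1.1; have [q2 h2] := rq x.1.2; have [q3 h3] := rq x.2.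
    have [i gi] := gK (q1, q2, q3, n); exists i; first exact: I.
    rewrite /F gi.
    have BU : B (q1, q2, q3, n) `<=` U.
      move=> z [/= z1 z2 z3]; apply: eU; rewrite ball_open_box //.
      have tri (p q r : R) : `|p - q| < n.+1%:R^-1 -> `|r - q| < n.+1%:R^-1 -> `|p - r| < e.
        move=> pq rq'; apply: (le_lt_trans (ler_distD q _ _)); rewrite [`|q - r|]distrC.
        by rewrite [e]splitr; apply: ltrD; apply: lt_trans ne.
      by split; [exact: tri z1 h1 | exact: tri z2 h2 | exact: tri z3 h3].
    by rewrite (asboolT BU) /B /open_box /=; split.
  move=> [i _]; rewrite /F; case: (g i) => // p.
  by case: asboolP => // BU /BU.
apply: bigcup_measurable => i _; rewrite /F; case: (g i) => // p.
by case: ifP => // _; exact: measurable_open_box.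
Qed.

Lemma closed_measurable_space (A : set (R3 R)) : closed A -> measurable A.
Proof. by move/closed_openC/open_measurable_space/measurableC; rewrite setCK. Qed.

Lemma within_continuous_measurable (D : set (R3 R)) (f : R3 R -> R) :
  measurable D -> {within D, continuous f} -> measurable_fun D f.
Proof.
move=> mD /continuousP cf; apply: (measurability _ (RGenOpens.measurableE R)).
move=> _ [_ [u [v ->] <-]].
have /open_subspaceP[V oV VD] : open ((f : subspace D -> R) @^-1` `]u, v[) by apply: cf; exact: interval_open.
rewrite setIC -VD; apply: measurableI => //; exact: open_measurable_space.
Qed.

Lemma continuous_measurable_space (D : set (R3 R)) (f : R3 R -> R) :
  measurable D -> (forall x, D x -> {for x, continuous f}) -> measurable_fun D f.
Proof.
move=> mD cf; apply: within_continuous_measurable => //.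
by apply: continuous_in_subspaceT => x; rewrite inE; exact: cf.
Qed.

End Space_measurability.

(* packed by hand because the library instance is not inferred for a nested product *)
Section Product_sigma_finite.
Context d1 d2 (T1 : measurableType d1) (T2 : measurableType d2) (R : realType).
Variable m1 : {sigma_finite_measure set T1 -> \bar R}.
Variable m2 : {sigma_finite_measure set T2 -> \bar R}.

Lemma product_measure_sigma_finite : sigma_finite setT (m1 \x m2)%E.
Proof.
have /sigma_finiteP[F [TF ndF Foo]] := sigma_finiteT m1.
have /sigma_finiteP[G [TG ndG Goo]] := sigma_finiteT m2.
exists (fun n => F n `*` G n).
  rewrite -setXTT TF TG predeqE => -[x y]; split.
    move=> [/= [n _ Fnx] [k _ Gky]]; exists (maxn n k) => //; split.
      by move: x Fnx; exact/subsetPset/ndF/leq_maxl.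
    by move: y Gky; exact/subsetPset/ndG/leq_maxr.
  by move=> [n _ []/= ? ?]; split; exists n.
move=> k; have [? ?] := Foo k; have [? ?] := Goo k.
split; first exact: measurableX.
by rewrite product_measure1E// lte_mul_pinfty// ge0_fin_numE.
Qed.

Definition product_sigma_finite : {sigma_finite_measure set (T1 * T2)%type -> \bar R} :=
  HB.pack (m1 \x m2)%E (Measure_isSigmaFinite.Build _ _ _ (m1 \x m2)%E product_measure_sigma_finite).
End Product_sigma_finite.

(** * Fubini's theorem on boxes *)

Section Box_integrals.
Variable R : realType.
Local Notation leb := (@lebesgue_measure R).
Local Notation vol := (vol R).
Local Notation leb2 := (product_sigma_finite leb leb).
Variables (c : R3 R) (a : R).
Hypothesis a0 : 0 < a.

Let I1 : set (measurableTypeR R) := `[(c.1.1 - a)%R, (c.1.1 + a)%R]%classic.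
Let I2 : set (measurableTypeR R) := `[(c.1.2 - a)%R, (c.1.2 + a)%R]%classic.
Let I3 : set (measurableTypeR R) := `[(c.2 - a)%R, (c.2 + a)%R]%classic.

Definition bounded_measurable (D : set (R3 R)) (f : R3 R -> R) :=
  measurable_fun D f /\ exists C, forall z, D z -> `|f z| <= C.

Lemma bounded_measurable_mul D f g : bounded_measurable D f -> bounded_measurable D g ->
  bounded_measurable D (fun z => f z * g z).
Proof.
move=> [mf [C fC]] [mg [C' gC]]; split; first exact: measurable_funM.
by exists (C * C') => z Dz; rewrite normrM; apply: ler_pM; rewrite ?fC ?gC.
Qed.

Lemma bounded_measurable_add D f g : bounded_measurable D f -> bounded_measurable D g ->
  bounded_measurable D (fun z => f z + g z).
Proof.
move=> [mf [C fC]] [mg [C' gC]]; split; first exact: measurable_funD.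
by exists (C + C') => z Dz; rewrite (le_trans (ler_normD _ _)) // lerD ?fC ?gC.
Qed.

Lemma bounded_measurable_cst D r : bounded_measurable D (fun=> r).
Proof. by split; [exact: measurable_cst | exists `|r|]. Qed.

Lemma bounded_measurable_sum D n (f : 'I_n -> R3 R -> R) :
  (forall i, bounded_measurable D (f i)) ->
  bounded_measurable D (fun z => \sum_(i < n) f i z).
Proof.
move=> bf; elim: n f bf => [|n IH] f bf.
  by under eq_fun do rewrite big_ord0; exact: bounded_measurable_cst.
under eq_fun do rewrite big_ord_recr /=.
by apply: bounded_measurable_add => //; exact: IH.
Qed.

Lemma vol_box : vol (box c a) = ((2 * a) ^+ 3)%:E.
Proof.
have L (t : R) : leb `[(t - a)%R, (t + a)%R] = (2 * a)%:E.
  rewrite lebesgue_measure_itv /= lte_fin.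
  have -> : t - a < t + a by have := a0; lra.
  by rewrite -EFinD; congr EFin; ring.
rewrite boxE.
have V3 (A B C : set R) : measurable A -> measurable B -> measurable C ->
    (vol ((A `*` B) `*` C) = leb A * leb B * leb C)%E.
  move=> mA mB mC; transitivity ((leb \x leb)%E (A `*` B) * leb C)%E.
    by apply: product_measure1E => //; exact: measurableX.
  by congr (_ * _)%E; exact: product_measure1E.
rewrite V3 // !L -!EFinM; congr EFin; ring.
Qed.

Lemma bounded_measurable_integrable f :
  bounded_measurable (box c a) f -> vol.-integrable (box c a) (EFin \o f).
Proof.
move=> [mf [C fC]]; apply: measurable_bounded_integrable => //.
- exact: measurable_box.
- by rewrite vol_box ltry.
exists C; split; first exact: num_real.
by move=> x Cx z /fC fz; exact: le_trans fz (ltW Cx).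
Qed.

Lemma mem_box x y r :
  (((x, y), r) \in box c a) = [&& x \in I1, y \in I2 & r \in I3].
Proof.
rewrite boxE; apply/idP/and3P; rewrite !inE /=; first by move=> [[? ?] ?].
by move=> [? ? ?].
Qed.

Let patch_E (f : R3 R -> R) x y r : (f \_ (box c a)) ((x, y), r) =
  if [&& x \in I1, y \in I2 & r \in I3] then f ((x, y), r) else 0.
Proof. by rewrite patchE mem_box. Qed.

Let measurable_patch f : bounded_measurable (box c a) f -> measurable_fun setT (f \_ (box c a)).
Proof. by move=> [mf _]; apply: (measurable_restrictT _ (@measurable_box R c a)).1. Qed.

Let integrable_patch f : bounded_measurable (box c a) f ->
  vol.-integrable setT (EFin \o (f \_ (box c a))).
Proof.
move=> bf; rewrite -restrict_EFin; apply: (integrable_mkcond _ (@measurable_box R c a)).1.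
exact: bounded_measurable_integrable.
Qed.

Let integrable_section f r : bounded_measurable (box c a) f ->
  (leb \x leb)%E.-integrable setT (fun p => ((f \_ (box c a)) (p, r))%:E).
Proof.
move=> bf; have [_ [C fC]] := bf.
have mI : measurable (I1 `*` I2) by apply: measurableX; exact: measurable_itv.
have -> : (fun p => ((f \_ (box c a)) (p, r))%:E) =
    (EFin \o ((fun p : measurableTypeR R * measurableTypeR R => (f \_ (box c a)) (p, r)) \_ (I1 `*` I2))).
  apply/funext => -[x y] /=; congr EFin; rewrite [RHS]patchE.
  case: ifPn => //; rewrite notin_setE => xy; rewrite patch_E; case: ifPn => // /and3P[Ix Iy _].
  by exfalso; apply: xy; split; [exact: set_mem Ix | exact: set_mem Iy].
rewrite -restrict_EFin; apply: (integrable_mkcond _ mI).1.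
apply: measurable_bounded_integrable => //.
- have L (t : R) : (leb `[(t - a)%R, (t + a)%R] < +oo)%E.
    by rewrite lebesgue_measure_itv /=; case: ifP; rewrite ?ltry // -EFinB ltry.
  apply: (@le_lt_trans _ _ (leb I1 * leb I2)%E).
    rewrite le_eqVlt; apply/orP; left; apply/eqP.
    by apply: product_measure1E; exact: measurable_itv.
  apply: lte_mul_pinfty (L _); first exact: measure_ge0.
  by rewrite ge0_fin_numE ?measure_ge0 // L.
- apply: measurable_funTS; apply: (measurableT_comp (measurable_patch bf)).
  exact: measurable_pair2.
exists (Num.max C 0); split; first exact: num_real.
move=> x Cx [p1 p2] _ /=; rewrite patch_E; case: ifP => [/and3P[Ip1 Ip2 Ir]|_].
  apply: le_trans (ltW Cx); rewrite le_max fC //.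
  by have : ((p1, p2), r) \in box c a by [rewrite mem_box Ip1 Ip2 Ir]; rewrite inE.
by rewrite normr0; apply: le_trans (ltW Cx); rewrite le_max lexx orbT.
Qed.

Let integral_patch f : (\int[vol]_(z in box c a) (f z)%:E =
  \int[vol]_z ((f \_ (box c a)) z)%:E)%E.
Proof. by rewrite integral_mkcond; under eq_integral do rewrite restrict_EFin. Qed.

Let fubini_12 f : bounded_measurable (box c a) f ->
  (\int[vol]_(z in box c a) (f z)%:E =
   \int[leb2]_p \int[leb]_r ((f \_ (box c a)) (p, r))%:E)%E.
Proof.
move=> bf; rewrite integral_patch; symmetry.
exact: (@integral12_prod_meas1 _ _ _ _ R leb2 leb _ (integrable_patch bf)).
Qed.

Let fubini_21 f : bounded_measurable (box c a) f ->
  (\int[vol]_(z in box c a) (f z)%:E =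
   \int[leb]_r \int[leb2]_p ((f \_ (box c a)) (p, r))%:E)%E.
Proof.
move=> bf; rewrite integral_patch; symmetry.
exact: (@integral21_prod_meas1 _ _ _ _ R leb2 leb _ (integrable_patch bf)).
Qed.

Let fubini_section12 f r : bounded_measurable (box c a) f ->
  (\int[leb2]_p ((f \_ (box c a)) (p, r))%:E =
   \int[leb]_x \int[leb]_y ((f \_ (box c a)) ((x, y), r))%:E)%E.
Proof.
move=> bf; symmetry.
exact: (@integral12_prod_meas1 _ _ _ _ R leb leb _ (integrable_section r bf)).
Qed.

Let fubini_section21 f r : bounded_measurable (box c a) f ->
  (\int[leb2]_p ((f \_ (box c a)) (p, r))%:E =
   \int[leb]_y \int[leb]_x ((f \_ (box c a)) ((x, y), r))%:E)%E.
Proof.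
move=> bf; symmetry.
exact: (@integral21_prod_meas1 _ _ _ _ R leb leb _ (integrable_section r bf)).
Qed.

Let slice3 f x y : (\int[leb]_r ((f \_ (box c a)) ((x, y), r))%:E =
  if (x \in I1) && (y \in I2) then \int[leb]_(r in I3) (f ((x, y), r))%:E else 0)%E.
Proof.
case: ifPn => [/andP[xI yI]|xI]; last first.
  by apply: integral0_eq => r _; rewrite patch_E andbA (negbTE xI).
by rewrite [RHS]integral_mkcond; apply: eq_integral => r _; rewrite patch_E patchE xI yI /=; case: (_ \in I3).
Qed.

Let slice2 f x r : (\int[leb]_y ((f \_ (box c a)) ((x, y), r))%:E =
  if (x \in I1) && (r \in I3) then \int[leb]_(y in I2) (f ((x, y), r))%:E else 0)%E.
Proof.
case: ifPn => [/andP[xI yI]|xI]; last first.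
  by apply: integral0_eq => y _; rewrite patch_E andbCA (negbTE xI) andbF.
by rewrite [RHS]integral_mkcond; apply: eq_integral => y _; rewrite patch_E patchE xI yI andbT /=; case: (_ \in I2).
Qed.

Let slice1 f y r : (\int[leb]_x ((f \_ (box c a)) ((x, y), r))%:E =
  if (y \in I2) && (r \in I3) then \int[leb]_(x in I1) (f ((x, y), r))%:E else 0)%E.
Proof.
case: ifPn => [/andP[xI yI]|xI]; last first.
  by apply: integral0_eq => x _; rewrite patch_E (negbTE xI) andbF.
by rewrite [RHS]integral_mkcond; apply: eq_integral => x _; rewrite patch_E patchE xI yI !andbT /=; case: (_ \in I1).
Qed.

(** Integration by parts acts on one coordinate; this lemma and its two variants lift an identity
    between integrals over parallel segments to the box. *)
Lemma box_integral_slice3 f g :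
  bounded_measurable (box c a) f -> bounded_measurable (box c a) g ->
  (forall x y, I1 x -> I2 y ->
    (\int[leb]_(r in I3) (f ((x, y), r))%:E = \int[leb]_(r in I3) (g ((x, y), r))%:E)%E) ->
  (\int[vol]_(z in box c a) (f z)%:E = \int[vol]_(z in box c a) (g z)%:E)%E.
Proof.
move=> bf bg fg; rewrite (fubini_12 bf) (fubini_12 bg).
apply: eq_integral => -[x y] _; rewrite !slice3.
by case: ifP => // /andP[/set_mem Ix /set_mem Iy]; exact: fg.
Qed.

Lemma box_integral_slice2 f g :
  bounded_measurable (box c a) f -> bounded_measurable (box c a) g ->
  (forall x r, I1 x -> I3 r ->
    (\int[leb]_(y in I2) (f ((x, y), r))%:E = \int[leb]_(y in I2) (g ((x, y), r))%:E)%E) ->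
  (\int[vol]_(z in box c a) (f z)%:E = \int[vol]_(z in box c a) (g z)%:E)%E.
Proof.
move=> bf bg fg; rewrite (fubini_21 bf) (fubini_21 bg).
apply: eq_integral => r _; rewrite (fubini_section12 r bf) (fubini_section12 r bg).
apply: eq_integral => x _; rewrite !slice2.
by case: ifP => // /andP[/set_mem Ix /set_mem Iy]; exact: fg.
Qed.

Lemma box_integral_slice1 f g :
  bounded_measurable (box c a) f -> bounded_measurable (box c a) g ->
  (forall y r, I2 y -> I3 r ->
    (\int[leb]_(x in I1) (f ((x, y), r))%:E = \int[leb]_(x in I1) (g ((x, y), r))%:E)%E) ->
  (\int[vol]_(z in box c a) (f z)%:E = \int[vol]_(z in box c a) (g z)%:E)%E.
Proof.
move=> bf bg fg; rewrite (fubini_21 bf) (fubini_21 bg).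
apply: eq_integral => r _; rewrite (fubini_section21 r bf) (fubini_section21 r bg).
apply: eq_integral => y _; rewrite !slice1.
by case: ifP => // /andP[/set_mem Ix /set_mem Iy]; exact: fg.
Qed.

Lemma box_integral_product (u v w : R -> R) (A B C : R) :
  bounded_measurable (box c a) (fun z => u z.1.1 * v z.1.2 * w z.2) ->
  (\int[leb]_(r in I1) (u r)%:E = A%:E)%E ->
  (\int[leb]_(r in I2) (v r)%:E = B%:E)%E ->
  (\int[leb]_(r in I3) (w r)%:E = C%:E)%E ->
  measurable_fun setT u -> measurable_fun setT v -> measurable_fun setT w ->
  (forall r, 0 <= u r) -> (forall r, 0 <= v r) -> (forall r, 0 <= w r) ->
  (\int[vol]_(z in box c a) (u z.1.1 * v z.1.2 * w z.2)%:E = (A * B * C)%:E)%E.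
Proof.
move=> b HA HB HC mu mv mw u0 v0 w0; rewrite (fubini_21 b).
have C0 : 0 <= C by rewrite -lee_fin -HC; apply: integral_ge0 => r _; rewrite lee_fin.
transitivity (\int[leb]_r ((A * B)%:E * ((w \_ I3) r)%:E))%E; last first.
  rewrite ge0_integralZl //.
  - rewrite [RHS]EFinM; congr (_ * _)%E; rewrite -HC [RHS]integral_mkcond.
    by apply: eq_integral => r _; rewrite restrict_EFin.
  - by apply/measurable_EFinP; apply: (measurable_restrictT _ _).1; [exact: measurable_itv|exact: measurable_funTS].
  - by move=> r _; rewrite lee_fin patchE; case: ifP.
  rewrite lee_fin mulr_ge0 // -lee_fin -?HA -?HB; apply: integral_ge0 => r _; by rewrite lee_fin.
apply: eq_integral => r _; rewrite (fubini_section12 r b).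
have [rI|rI] := boolP (r \in I3); last first.
  rewrite patchE (negbTE rI) mule0; apply: integral0_eq => x _.
  by rewrite slice2 (negbTE rI) andbF.
rewrite patchE rI.
transitivity (\int[leb]_x ((B * w r)%:E * ((u \_ I1) x)%:E))%E; last first.
  rewrite ge0_integralZl //.
  - have -> : (\int[leb]_x ((u \_ I1) x)%:E = A%:E)%E.
      by rewrite -HA [RHS]integral_mkcond; apply: eq_integral => x _; rewrite restrict_EFin.
    by rewrite -!EFinM; congr EFin; ring.
  - by apply/measurable_EFinP; apply: (measurable_restrictT _ _).1; [exact: measurable_itv|exact: measurable_funTS].
  - by move=> x _; rewrite lee_fin patchE; case: ifP.
  by rewrite lee_fin mulr_ge0 // -lee_fin -HB; apply: integral_ge0 => y _; rewrite lee_fin.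
apply: eq_integral => x _; rewrite slice2 rI andbT patchE; case: ifP => _; last by rewrite mule0.
rewrite /= -EFinM; transitivity ((u x * w r)%:E * \int[leb]_(y in I2) (v y)%:E)%E; last first.
  by rewrite HB -EFinM; congr EFin; ring.
rewrite -ge0_integralZl //.
- by apply: eq_integral => y _; rewrite -EFinM; congr EFin; ring.
- exact: measurable_itv.
- by apply/measurable_EFinP; exact: measurable_funTS.
- by move=> y _; rewrite lee_fin.
by rewrite lee_fin mulr_ge0.
Qed.

End Box_integrals.

(** * Integration by parts along coordinate lines *)

Section Line_derivative.
Variable R : realType.
Implicit Types (z v : R3 R) (f : R3 R -> R).

Lemma is_derive_line f z v (r : R) : derivable f (r *: v + z) v ->
  is_derive r (1 : R) (fun r => f (r *: v + z)) ('D_v f (r *: v + z)).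
Proof.
move=> df.
have E : (fun h : R => h^-1 *: (f ((h *: 1 + r) *: v + z) - f (r *: v + z))) =
         (fun h : R => h^-1 *: (f (h *: v + (r *: v + z)) - f (r *: v + z))).
  apply/funext => h; congr (_ *: (f _ - _)).
  by rewrite scalerDl addrA /GRing.scale /= mulr1.
have H : h^-1 *: (f ((h *: 1 + r) *: v + z) - f (r *: v + z)) @[h --> (0 : R)^'] --> 'D_v f (r *: v + z).
  by rewrite E; exact: df.
apply: DeriveDef; first by apply/cvg_ex; eexists; exact: H.
exact: cvg_lim H.
Qed.

Lemma line1 (x y r : R) : x *: (((1, 0), 0) : R3 R) + ((0, y), r) = ((x, y), r).
Proof.
by congr ((_, _), _); rewrite /= /GRing.scale /= ?mulr0 ?mulr1 ?add0r ?addr0.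
Qed.
Lemma line2 (x y r : R) : y *: (((0, 1), 0) : R3 R) + ((x, 0), r) = ((x, y), r).
Proof.
by congr ((_, _), _); rewrite /= /GRing.scale /= ?mulr0 ?mulr1 ?add0r ?addr0.
Qed.
Lemma line3 (x y r : R) : r *: (((0, 0), 1) : R3 R) + ((x, y), 0) = ((x, y), r).
Proof.
by congr ((_, _), _); rewrite /= /GRing.scale /= ?mulr0 ?mulr1 ?add0r ?addr0.
Qed.

Lemma is_derive_coord1 f (i : 'I_3) (x y r : R) : i = 0%N :> nat ->
  derivable f ((x, y), r) (unit_vector R i) ->
  is_derive x (1 : R) (fun x => f ((x, y), r)) (partial i f ((x, y), r)).
Proof.
move=> i0; rewrite /partial /unit_vector i0 /= => df.
have E : (fun x => f ((x, y), r)) = (fun x => f (x *: (((1, 0), 0) : R3 R) + ((0, y), r))).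
  by apply/funext => t; rewrite line1.
by rewrite E -(line1 x y r); apply: is_derive_line; rewrite line1.
Qed.

Lemma is_derive_coord2 f (i : 'I_3) (x y r : R) : i = 1%N :> nat ->
  derivable f ((x, y), r) (unit_vector R i) ->
  is_derive y (1 : R) (fun y => f ((x, y), r)) (partial i f ((x, y), r)).
Proof.
move=> i0; rewrite /partial /unit_vector i0 /= => df.
have E : (fun y => f ((x, y), r)) = (fun y => f (y *: (((0, 1), 0) : R3 R) + ((x, 0), r))).
  by apply/funext => t; rewrite line2.
by rewrite E -(line2 x y r); apply: is_derive_line; rewrite line2.
Qed.

Lemma is_derive_coord3 f (i : 'I_3) (x y r : R) : i = 2%N :> nat ->
  derivable f ((x, y), r) (unit_vector R i) ->
  is_derive r (1 : R) (fun r => f ((x, y), r)) (partial i f ((x, y), r)).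
Proof.
move=> i0; rewrite /partial /unit_vector i0 /= => df.
have E : (fun r => f ((x, y), r)) = (fun r => f (r *: (((0, 0), 1) : R3 R) + ((x, y), 0))).
  by apply/funext => t; rewrite line3.
by rewrite E -(line3 x y r); apply: is_derive_line; rewrite line3.
Qed.

Lemma continuous_coord1 (y r : R) : continuous (fun x : R => ((x, y), r) : R3 R).
Proof. by move=> x; exact: (cvg_pair (cvg_pair cvg_id (cvg_cst y)) (cvg_cst r)). Qed.
Lemma continuous_coord2 (x r : R) : continuous (fun y : R => ((x, y), r) : R3 R).
Proof. by move=> y; exact: (cvg_pair (cvg_pair (cvg_cst x) cvg_id) (cvg_cst r)). Qed.
Lemma continuous_coord3 (x y : R) : continuous (fun r : R => ((x, y), r) : R3 R).
Proof. by move=> r; exact: (cvg_pair (cvg_cst ((x, y) : R * R)) cvg_id). Qed.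

End Line_derivative.

Section Integration_by_parts.
Variable R : realType.
Local Notation leb := (@lebesgue_measure R).

Lemma is_derive_LRcontinuous (f f1 : R -> R) (u v : R) : u <= v ->
  (forall r, r \in `[u, v] -> is_derive r (1 : R) f (f1 r)) ->
  derivable_oo_LRcontinuous f u v /\ {in `]u, v[, f^`()%classic =1 f1}.
Proof.
move=> uv df; split; first split.
- move=> r ruv; have [] // := df r _; exact: subset_itv_oo_cc ruv.
- apply: cvg_at_right_filter; apply: (is_derive_continuous (a := f1 u)); apply: df.
  by rewrite in_itv /= lexx.
- apply: cvg_at_left_filter; apply: (is_derive_continuous (a := f1 v)); apply: df.
  by rewrite in_itv /= lexx andbT.
move=> r ruv; rewrite derive1E; have [] // := df r _; exact: subset_itv_oo_cc ruv.
Qed.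

Variables (c a s : R).
Hypotheses (a0 : 0 < a) (s0 : 0 < s).

(** Two integrations by parts; all boundary terms vanish, because the cut-off and its derivative are
    0 at distance a from c. *)
Lemma ibp_ck (f f1 f2 : R -> R) :
  (forall r, r \in `[c - a, c + a] -> is_derive r (1 : R) f (f1 r)) ->
  (forall r, r \in `[c - a, c + a] -> is_derive r (1 : R) f1 (f2 r)) ->
  (forall r, r \in `[c - a, c + a] -> {for r, continuous f2}) ->
  (\int[leb]_(r in `[(c - a)%R, (c + a)%R]) (ck a s (r - c) * f2 r)%:E =
   \int[leb]_(r in `[(c - a)%R, (c + a)%R]) ((ckt a s (r - c) + ckerr a s (r - c)) * f r)%:E)%E.
Proof.
move=> df df1 cf2.
have ca : c - a < c + a by rewrite ltrD2l gtrN.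
have sn0 : s != 0 by rewrite gt_eqF.
have dck r : is_derive r (1 : R) (fun r => ck a s (r - c)) (ck1 a s (r - c)).
  by have H := is_derive_ck a s (r - c); exact: (is_derive_recenter H).
have dck1 r : is_derive r (1 : R) (fun r => ck1 a s (r - c)) (ckt a s (r - c) + ckerr a s (r - c)).
  by have H := is_derive_ck1 a (r - c) sn0; exact: (is_derive_recenter H).
have csub : continuous (fun r : R => r - c).
  by apply: continuous_add; [move=> r; exact: cvg_id | exact: continuous_cst].
have [L1 D1] := is_derive_LRcontinuous (ltW ca) (fun r _ => dck r).
have [L2 D2] := is_derive_LRcontinuous (ltW ca) (fun r _ => dck1 r).
have [L3 D3] := is_derive_LRcontinuous (ltW ca) df.
have [L4 D4] := is_derive_LRcontinuous (ltW ca) df1.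
have e1 : c - a - c = - a by ring.
have e2 : c + a - c = a by ring.
have [k1 k2] : cutoff a a = 0 /\ cutoff1 a a = 0 by apply: cutoff_outside; rewrite ?gtr0_norm.
have [k3 k4] : cutoff a (- a) = 0 /\ cutoff1 a (- a) = 0.
  by apply: cutoff_outside; rewrite ?normrN ?gtr0_norm.
rewrite (integration_by_parts ca _ L1 D1 _ L4 D4); last 2 first.
- apply: continuous_subspaceT => r; apply: (continuous_compose csub).
  exact: continuous_ck1.
- by apply: continuous_in_subspaceT => r; rewrite inE; exact: cf2.
rewrite (integration_by_parts ca _ L2 D2 _ L3 D3); last 2 first.
- apply: continuous_subspaceT => r; apply: (continuous_compose csub (f := fun r => ckt a s r + ckerr a s r)).
  by apply: continuous_add; [exact: continuous_ckt | exact: continuous_ckerr].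
- apply: continuous_in_subspaceT => r; rewrite inE => ri.
  exact: is_derive_continuous (df1 r ri).
by rewrite e1 e2 /ck /ck1 k1 k2 k3 k4 !(mulr0, mul0r, addr0) subrr !add0e oppeK.
Qed.

End Integration_by_parts.

(** * Duhamel's formula around one point *)

Section Local_heat_kernel.
Variable R : realType.
Local Notation leb := (@lebesgue_measure R).
Local Notation vol := (vol R).
Variables (c : R3 R) (a : R).
Hypothesis a0 : 0 < a.

Local Notation Q := (box c a).

(** (4 pi)^(3/2) times the heat kernel of the space at time s with pole c, cut off to the box. Its
    Laplacian is [psit s + psierr s], with [psit] its time derivative. *)
Definition psi (s : R) (z : R3 R) : R :=
  ck a s (z.1.1 - c.1.1) * ck a s (z.1.2 - c.1.2) * ck a s (z.2 - c.2).

Definition psit (s : R) (z : R3 R) : R :=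
  ckt a s (z.1.1 - c.1.1) * ck a s (z.1.2 - c.1.2) * ck a s (z.2 - c.2) +
  ck a s (z.1.1 - c.1.1) * ckt a s (z.1.2 - c.1.2) * ck a s (z.2 - c.2) +
  ck a s (z.1.1 - c.1.1) * ck a s (z.1.2 - c.1.2) * ckt a s (z.2 - c.2).

Definition psierr (s : R) (z : R3 R) : R :=
  ckerr a s (z.1.1 - c.1.1) * ck a s (z.1.2 - c.1.2) * ck a s (z.2 - c.2) +
  ck a s (z.1.1 - c.1.1) * ckerr a s (z.1.2 - c.1.2) * ck a s (z.2 - c.2) +
  ck a s (z.1.1 - c.1.1) * ck a s (z.1.2 - c.1.2) * ckerr a s (z.2 - c.2).

(** No boundary condition enters, so that the estimates below serve the torus and all types of
    boundary at once. *)
Definition local_eigenfunction (l : R) (f : R3 R -> R) :=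
  exists U, [/\ Q `<=` U, Cn 2 U f & forall z, Q z -> - laplacian f z = l * f z].

Lemma compact_box : compact Q.
Proof.
by rewrite boxE; apply: compact_setX; [apply: compact_setX|]; exact: segment_compact.
Qed.

Lemma continuous_bounded_measurable f :
  (forall z, Q z -> {for z, continuous f}) -> bounded_measurable Q f.
Proof.
move=> cf; split; first by apply: continuous_measurable_space => //; exact: measurable_box.
have wcf : {within Q, continuous f}.
  by apply: continuous_in_subspaceT => x; rewrite inE; exact: cf.
have /compact_bounded[M [_ HM]] := continuous_compact wcf compact_box.
exists (M + 1) => z Qz; apply: (HM (M + 1)); first by rewrite ltrDl.
by exists z.
Qed.

Lemma continuous_coordinate1 : continuous (fun z : R3 R => z.1.1 - c.1.1).
Proof.
apply: continuous_add; last exact: continuous_cst.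
by move=> z; apply: (cvg_comp fst fst); exact: cvg_fst.
Qed.
Lemma continuous_coordinate2 : continuous (fun z : R3 R => z.1.2 - c.1.2).
Proof.
apply: continuous_add; last exact: continuous_cst.
by move=> z; apply: (cvg_comp fst snd); [exact: cvg_fst | exact: cvg_snd].
Qed.
Lemma continuous_coordinate3 : continuous (fun z : R3 R => z.2 - c.2).
Proof.
by apply: continuous_add; [move=> z; exact: cvg_snd | exact: continuous_cst].
Qed.

Lemma continuous_product (u v w : R -> R) : continuous u -> continuous v -> continuous w ->
  continuous (fun z : R3 R => u (z.1.1 - c.1.1) * v (z.1.2 - c.1.2) * w (z.2 - c.2)).
Proof.
move=> cu cv cw; apply: continuous_mul; last exact: continuous_compose continuous_coordinate3 cw.
by apply: continuous_mul; [exact: continuous_compose continuous_coordinate1 cu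
  | exact: continuous_compose continuous_coordinate2 cv].
Qed.

Lemma continuous_psi s : continuous (psi s).
Proof. by apply: continuous_product; exact: continuous_ck. Qed.

Lemma continuous_psit s : continuous (psit s).
Proof.
apply: continuous_add; first apply: continuous_add; apply: continuous_product;
  first [exact: continuous_ck | exact: continuous_ckt].
Qed.

Lemma continuous_psierr s : s != 0 -> continuous (psierr s).
Proof.
move=> s0; apply: continuous_add; first apply: continuous_add; apply: continuous_product;
  first [exact: continuous_ck | exact: continuous_ckerr].
Qed.

Let bmc (u : R3 R -> R) : continuous u -> bounded_measurable Q u.
Proof. by move=> cu; apply: continuous_bounded_measurable => z _; exact: cu. Qed.

Let k0 s r : 0 <= ck a s r. Proof. exact: ck_ge0. Qed.
Let kle s r : 0 < s <= 1 -> ck a s r <= s^-1. Proof. exact: ck_le. Qed.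

Let prod3 (x y t X Y T : R) : 0 <= x -> 0 <= y -> 0 <= t -> x <= X -> y <= Y -> t <= T ->
  x * y * t <= X * Y * T.
Proof. by move=> *; apply: ler_pM; [exact: mulr_ge0 | by [] | exact: ler_pM | by []]. Qed.

Let norm3 (x y t : R) : `|x * y * t| = `|x| * `|y| * `|t|.
Proof. by rewrite !normrM. Qed.

Lemma psi_ge0 s z : 0 <= psi s z.
Proof. by apply: mulr_ge0 => //; exact: mulr_ge0. Qed.

Lemma psi_le s z : 0 < s <= 1 -> psi s z <= s ^- 3.
Proof.
move=> s01; have -> : s ^- 3 = s^-1 * s^-1 * s^-1 by rewrite -exprVn; ring.
by apply: prod3; rewrite ?k0 ?kle.
Qed.

(** One coordinate is at distance at least d and contributes s^3, the two others at most s^-1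
    each. *)
Lemma psi_far s z d : 0 < s <= 1 -> 0 < d -> ~ open_box c d z ->
  psi s z <= (16 / d ^+ 2) ^+ 4 * s.
Proof.
move=> /[dup] s01 /andP[s0 s1] d0 zd.
have K0 : 0 <= (16 / d ^+ 2) ^+ 4 by rewrite exprn_ge0 // divr_ge0 // sqr_ge0.
have far r : d <= `|r| -> ck a s r <= (16 / d ^+ 2) ^+ 4 * s ^+ 3.
  by move=> dr; apply: (le_trans (ck_le_gk a s r)); apply: gk_far => //; rewrite d0.
have -> : (16 / d ^+ 2) ^+ 4 * s = ((16 / d ^+ 2) ^+ 4 * s ^+ 3) * s^-1 * s^-1.
  by move: (_ ^+ 4) => K; field; rewrite gt_eqF.
have B0 : 0 <= (16 / d ^+ 2) ^+ 4 * s ^+ 3 by rewrite mulr_ge0 // exprn_ge0 // ltW.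
have pf x y t : d <= `|x| -> ck a s x * ck a s y * ck a s t <=
    (16 / d ^+ 2) ^+ 4 * s ^+ 3 * s^-1 * s^-1.
  by move=> dx; apply: prod3; rewrite ?k0 ?kle ?far.
have [d1|d1] := ltP `|z.1.1 - c.1.1| d; last exact: pf.
have [d2|d2] := ltP `|z.1.2 - c.1.2| d; last by rewrite /psi [X in X * _]mulrC; exact: pf.
have [d3|d3] := ltP `|z.2 - c.2| d; last by rewrite /psi mulrC mulrA; exact: pf.
by exfalso; apply: zd; split.
Qed.

(** Provides the dominating constant for differentiating under the integral sign. *)
Lemma psit_bounded s0 : 0 < s0 <= 1 -> exists C, forall s z, s0 <= s <= 1 -> Q z ->
  `|psit s z| <= C.
Proof.
move=> /andP[s00 s01]; pose q := s0^-1.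
pose B := (a ^+ 2 / 4 * q ^+ 2 + 2^-1 * q) * q.
exists (B * q * q + q * B * q + q * q * B) => s z /andP[ss s1] [z1 z2 z3].
have sp : 0 < s by apply: lt_le_trans ss.
have s01' : 0 < s <= 1 by rewrite sp.
have q0 : 0 <= q by rewrite invr_ge0 ltW.
have sq : s^-1 <= q by rewrite lef_pV2 ?posrE.
have kq r : `|ck a s r| <= q.
  by rewrite ger0_norm ?ck_ge0 //; apply: le_trans sq; exact: ck_le.
have tB r : `|r| <= a -> `|ckt a s r| <= B.
  move=> ra; apply: (le_trans (ckt_le a0 s01' ra)).
  have si0 : 0 <= s^-1 by rewrite invr_ge0 ltW.
  have a20 : 0 <= a ^+ 2 / 4 by rewrite divr_ge0 // sqr_ge0.
  apply: ler_pM => //; first by rewrite addr_ge0 // mulr_ge0 // invr_ge0 exprn_ge0 // ltW.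
  apply: lerD; last by rewrite ler_wpM2l.
  by rewrite -exprVn; apply: ler_wpM2l => //; rewrite ler_sqr ?nnegrE.
have B0 : 0 <= B by apply: le_trans (normr_ge0 _) (tB 0 _); rewrite normr0 ltW.
rewrite /psit; apply: (le_trans (ler_normD _ _)); apply: lerD; last first.
  by rewrite norm3; apply: prod3; rewrite ?kq ?tB.
apply: (le_trans (ler_normD _ _)); apply: lerD; rewrite norm3; apply: prod3; rewrite ?kq ?tB //.
Qed.

(** The factor s^2 of [ckerr] absorbs the s^-1 of the two other coordinates, so that the error stays
    bounded as s tends to 0. *)
Lemma psierr_bounded : exists C, 0 <= C /\
  forall s z, 0 < s <= 1 -> Q z -> `|psierr s z| <= C.
Proof.
have [C [C0 HC]] := ckerr_bound a0.
exists (3 * C); split; first by rewrite mulr_ge0.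
move=> s z /[dup] s01 /andP[s0 s1] [z1 z2 z3].
have kq r : `|ck a s r| <= s^-1 by rewrite ger0_norm ?ck_ge0 // ck_le.
have si0 : 0 <= s^-1 by rewrite invr_ge0 ltW.
have prod (x y t : R) : `|x| <= C * s ^+ 2 -> `|y| <= s^-1 -> `|t| <= s^-1 -> `|x * y * t| <= C.
  move=> hx hy ht; have -> : C = C * s ^+ 2 * s^-1 * s^-1 by field; rewrite gt_eqF.
  by rewrite !normrM; apply: prod3.
have -> : 3 * C = C + C + C by ring.
apply: (le_trans (ler_normD _ _)); apply: lerD; first apply: (le_trans (ler_normD _ _)).
- apply: lerD; first by apply: prod; rewrite ?kq ?HC.
  by rewrite [X in `|X * _|]mulrC; apply: prod; rewrite ?kq ?HC.
by rewrite mulrC mulrA; apply: prod; rewrite ?kq ?HC.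
Qed.

Lemma is_derive_psi (s : R) (z : R3 R) : 0 < s -> is_derive s (1 : R) (psi ^~ z) (psit s z).
Proof.
move=> s0; have H r : is_derive s (1 : R) (ck a ^~ r) (ckt a s r) by exact: is_derive_ck_time.
have := is_derive_mul (is_derive_mul (H (z.1.1 - c.1.1)) (H (z.1.2 - c.1.2))) (H (z.2 - c.2)).
by move=> /is_derive_eq; apply; rewrite /psit; ring.
Qed.

Section Eigenfunction.
Variables (l : R) (f : R3 R -> R).
Hypothesis lf : local_eigenfunction l f.

Lemma local_eigenfunction_bounded : bounded_measurable Q f.
Proof.
by have [U [QU [cf _] _]] := lf; apply: continuous_bounded_measurable => z /QU; exact: cf.
Qed.

Lemma bounded_measurable_mulf (u : R3 R -> R) : continuous u -> bounded_measurable Q (fun z => u z * f z).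
Proof. by move=> cu; apply: bounded_measurable_mul (bmc cu) local_eigenfunction_bounded. Qed.

(** Green's formula without boundary terms, as the cut-off vanishes to first order on the faces of
    the box; it is proved one coordinate at a time. *)
Lemma psi_laplacian s : 0 < s ->
  \int[vol]_(z in Q) (psi s z * laplacian f z) =
  \int[vol]_(z in Q) ((psit s z + psierr s z) * f z).
Proof.
move=> s0; have sn0 : s != 0 by rewrite gt_eqF.
have [U [QU [cf df] _]] := lf.
pose i0 : 'I_3 := ord0. pose i1 : 'I_3 := lift ord0 ord0. pose i2 : 'I_3 := lift ord0 (lift ord0 ord0).
have d1 z i : Q z -> derivable f z (unit_vector R i) by move=> /QU Uz; have [H _] := df i; exact: H.
have d2 z i : Q z -> derivable (partial i f) z (unit_vector R i).
  by move=> /QU Uz; have [_ [_ H]] := df i; have [H' _] := H i; exact: H'.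
have c2 z i : Q z -> {for z, continuous (partial i (partial i f))}.
  by move=> /QU Uz; have [_ [_ H]] := df i; have [_ [H' _]] := H i; exact: H'.
have b2 i : bounded_measurable Q (fun z => psi s z * partial i (partial i f) z).
  apply: bounded_measurable_mul; first exact: bmc (@continuous_psi s).
  by apply: continuous_bounded_measurable => z Qz; exact: c2.
pose g1 z := (ckt a s (z.1.1 - c.1.1) + ckerr a s (z.1.1 - c.1.1)) * ck a s (z.1.2 - c.1.2) * ck a s (z.2 - c.2).
pose g2 z := ck a s (z.1.1 - c.1.1) * (ckt a s (z.1.2 - c.1.2) + ckerr a s (z.1.2 - c.1.2)) * ck a s (z.2 - c.2).
pose g3 z := ck a s (z.1.1 - c.1.1) * ck a s (z.1.2 - c.1.2) * (ckt a s (z.2 - c.2) + ckerr a s (z.2 - c.2)).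
have ckk : continuous (fun r => ckt a s r + ckerr a s r).
  by apply: continuous_add; [exact: continuous_ckt | exact: continuous_ckerr].
have cg1 : continuous g1 by apply: (@continuous_product (fun r => ckt a s r + ckerr a s r)) => //; exact: continuous_ck.
have cg2 : continuous g2 by apply: (@continuous_product _ (fun r => ckt a s r + ckerr a s r)) => //; exact: continuous_ck.
have cg3 : continuous g3 by apply: (@continuous_product _ _ (fun r => ckt a s r + ckerr a s r)) => //; exact: continuous_ck.
have Qin x y r : x \in `[c.1.1 - a, c.1.1 + a] -> y \in `[c.1.2 - a, c.1.2 + a] ->
    r \in `[c.2 - a, c.2 + a] -> Q ((x, y), r).
  by move=> *; rewrite boxE.
have E1 : \int[vol]_(z in Q) (psi s z * partial i0 (partial i0 f) z) = \int[vol]_(z in Q) (g1 z * f z).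
  congr fine; apply: box_integral_slice1 => //; first exact: bounded_measurable_mulf.
  move=> y r Iy Ir; pose k := ck a s (y - c.1.2) * ck a s (r - c.2).
  have dfl x : x \in `[c.1.1 - a, c.1.1 + a] -> is_derive x (1 : R) (fun x => k * f ((x, y), r)) (k * partial i0 f ((x, y), r)).
    by move=> Ix; apply: is_derive_scale; apply: is_derive_coord1 => //; apply: d1; exact: Qin.
  have dfl1 x : x \in `[c.1.1 - a, c.1.1 + a] -> is_derive x (1 : R) (fun x => k * partial i0 f ((x, y), r)) (k * partial i0 (partial i0 f) ((x, y), r)).
    by move=> Ix; apply: is_derive_scale; apply: is_derive_coord1 => //; apply: d2; exact: Qin.
  have cf2 x : x \in `[c.1.1 - a, c.1.1 + a] -> {for x, continuous (fun x => k * partial i0 (partial i0 f) ((x, y), r))}.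
    move=> Ix; apply: cvgM; first exact: cvg_cst.
    apply: (continuous_comp (@continuous_coord1 R y r x) (c2 _ i0 _)); exact: Qin.
  have := ibp_ck a0 s0 dfl dfl1 cf2.
  rewrite (_ : (fun x => _) = (fun x => (psi s ((x, y), r) * partial i0 (partial i0 f) ((x, y), r))%:E)); last first.
    by apply/funext => x; rewrite /psi /k /=; congr EFin; ring.
  rewrite [in RHS](_ : (fun x => _) = (fun x => (g1 ((x, y), r) * f ((x, y), r))%:E)) //.
  by apply/funext => x; rewrite /g1 /k /=; congr EFin; ring.
have E2 : \int[vol]_(z in Q) (psi s z * partial i1 (partial i1 f) z) = \int[vol]_(z in Q) (g2 z * f z).
  congr fine; apply: box_integral_slice2 => //; first exact: bounded_measurable_mulf.
  move=> x r Ix Ir; pose k := ck a s (x - c.1.1) * ck a s (r - c.2).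
  have dfl y : y \in `[c.1.2 - a, c.1.2 + a] -> is_derive y (1 : R) (fun y => k * f ((x, y), r)) (k * partial i1 f ((x, y), r)).
    by move=> Iy; apply: is_derive_scale; apply: is_derive_coord2 => //; apply: d1; exact: Qin.
  have dfl1 y : y \in `[c.1.2 - a, c.1.2 + a] -> is_derive y (1 : R) (fun y => k * partial i1 f ((x, y), r)) (k * partial i1 (partial i1 f) ((x, y), r)).
    by move=> Iy; apply: is_derive_scale; apply: is_derive_coord2 => //; apply: d2; exact: Qin.
  have cf2 y : y \in `[c.1.2 - a, c.1.2 + a] -> {for y, continuous (fun y => k * partial i1 (partial i1 f) ((x, y), r))}.
    move=> Iy; apply: cvgM; first exact: cvg_cst.
    apply: (continuous_comp (@continuous_coord2 R x r y) (c2 _ i1 _)); exact: Qin.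
  have := ibp_ck a0 s0 dfl dfl1 cf2.
  rewrite (_ : (fun y => _) = (fun y => (psi s ((x, y), r) * partial i1 (partial i1 f) ((x, y), r))%:E)); last first.
    by apply/funext => y; rewrite /psi /k /=; congr EFin; ring.
  rewrite [in RHS](_ : (fun y => _) = (fun y => (g2 ((x, y), r) * f ((x, y), r))%:E)) //.
  by apply/funext => y; rewrite /g2 /k /=; congr EFin; ring.
have E3 : \int[vol]_(z in Q) (psi s z * partial i2 (partial i2 f) z) = \int[vol]_(z in Q) (g3 z * f z).
  congr fine; apply: box_integral_slice3 => //; first exact: bounded_measurable_mulf.
  move=> x y Ix Iy; pose k := ck a s (x - c.1.1) * ck a s (y - c.1.2).
  have dfl r : r \in `[c.2 - a, c.2 + a] -> is_derive r (1 : R) (fun r => k * f ((x, y), r)) (k * partial i2 f ((x, y), r)).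
    by move=> Ir; apply: is_derive_scale; apply: is_derive_coord3 => //; apply: d1; exact: Qin.
  have dfl1 r : r \in `[c.2 - a, c.2 + a] -> is_derive r (1 : R) (fun r => k * partial i2 f ((x, y), r)) (k * partial i2 (partial i2 f) ((x, y), r)).
    by move=> Ir; apply: is_derive_scale; apply: is_derive_coord3 => //; apply: d2; exact: Qin.
  have cf2 r : r \in `[c.2 - a, c.2 + a] -> {for r, continuous (fun r => k * partial i2 (partial i2 f) ((x, y), r))}.
    move=> Ir; apply: cvgM; first exact: cvg_cst.
    apply: (continuous_comp (@continuous_coord3 R x y r) (c2 _ i2 _)); exact: Qin.
  have := ibp_ck a0 s0 dfl dfl1 cf2.
  rewrite (_ : (fun r => _) = (fun r => (psi s ((x, y), r) * partial i2 (partial i2 f) ((x, y), r))%:E)); last first.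
    by apply/funext => r; rewrite /psi /k /=; congr EFin; ring.
  rewrite [in RHS](_ : (fun r => _) = (fun r => (g3 ((x, y), r) * f ((x, y), r))%:E)) //.
  by apply/funext => r; rewrite /g3 /k /=; congr EFin; ring.
have bg (g : R3 R -> R) : continuous g -> vol.-integrable Q (EFin \o (fun z => g z * f z)).
  by move=> cg; apply: bounded_measurable_integrable => //; exact: bounded_measurable_mulf.
have ib2 i : vol.-integrable Q (EFin \o (fun z => psi s z * partial i (partial i f) z)).
  exact: bounded_measurable_integrable.
have mQ : measurable Q by exact: measurable_box.
have addI (u v : R3 R -> R) : vol.-integrable Q (EFin \o u) -> vol.-integrable Q (EFin \o v) ->
    vol.-integrable Q (EFin \o (fun z => u z + v z)).
  by move=> iu iv; apply: (@eq_integrable _ _ _ _ _ mQ (fun z => (u z)%:E + (v z)%:E)%E); [move=> z _; rewrite /= EFinD | exact: integrableD].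
transitivity (\int[vol]_(z in Q) (psi s z * partial i0 (partial i0 f) z + psi s z * partial i1 (partial i1 f) z + psi s z * partial i2 (partial i2 f) z)).
  have L z : laplacian f z = partial i0 (partial i0 f) z + (partial i1 (partial i1 f) z + partial i2 (partial i2 f) z).
    have S (h : 'I_3 -> R) : \sum_(i < 3) h i = h i0 + (h i1 + h i2).
      by rewrite !big_ord_recl big_ord0 addr0.
    exact: (S (fun i => partial i (partial i f) z)).
  by apply: eq_Rintegral => z _; rewrite L mulrDr mulrDr addrA.
have R3sum (u v w : R3 R -> R) : vol.-integrable Q (EFin \o u) -> vol.-integrable Q (EFin \o v) ->
    vol.-integrable Q (EFin \o w) -> \int[vol]_(z in Q) (u z + v z + w z) =
    \int[vol]_(z in Q) u z + \int[vol]_(z in Q) v z + \int[vol]_(z in Q) w z.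
  by move=> iu iv iw; rewrite RintegralD //; [rewrite RintegralD | exact: addI].
transitivity (\int[vol]_(z in Q) (g1 z * f z) + \int[vol]_(z in Q) (g2 z * f z) + \int[vol]_(z in Q) (g3 z * f z)).
  apply: (etrans (R3sum _ _ _ (ib2 i0) (ib2 i1) (ib2 i2))); congr (_ + _ + _); [exact: E1 | exact: E2 | exact: E3].
rewrite -R3sum; [|exact: bg..].
by apply: eq_Rintegral => z _; rewrite /g1 /g2 /g3 /psit /psierr; ring.
Qed.

(** By [psi_laplacian], the pairing with an eigenfunction solves a linear differential equation of
    rate l, forced by the cut-off error. *)
Lemma is_derive_psi_integral (s : R) : 0 < s < 1 ->
  is_derive s (1 : R) (fun s => \int[vol]_(z in Q) (psi s z * f z))
    (- l * \int[vol]_(z in Q) (psi s z * f z) - \int[vol]_(z in Q) (psierr s z * f z)).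
Proof.
move=> /andP[s0 s1].
have mQ : measurable Q by exact: measurable_box.
have bg (g : R3 R -> R) : continuous g -> vol.-integrable Q (EFin \o (fun z => g z * f z)).
  by move=> cg; apply: bounded_measurable_integrable => //; exact: bounded_measurable_mulf.
have s20 : 0 < s / 2 by rewrite divr_gt0.
(* The interval stays away from 0, so that [psit_bounded] applies on all of it. *)
have sI : `]s / 2, 1[%classic s by rewrite /= in_itv /= s1 andbT; lra.
have [C HC] : exists C, forall s' z, s / 2 <= s' <= 1 -> Q z -> `|psit s' z| <= C.
  by apply: psit_bounded; rewrite s20 /=; lra.
have [_ [D HD]] := local_eigenfunction_bounded.
have dF (s' : R) z : 0 < s' -> is_derive s' (1 : R) (fun s => psi s z * f z) (psit s' z * f z).
  move=> s'0; have -> : psit s' z * f z = psit s' z * f z + psi s' z * 0 by ring.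
  by apply: (is_derive_mul (g := fun=> f z)); exact: is_derive_psi.
have I0 s' : `]s / 2, 1[%classic s' -> 0 < s' /\ s / 2 <= s' <= 1.
  by rewrite /= in_itv /= => /andP[h1 h2]; split; [exact: lt_trans h1 | rewrite !ltW].
pose CD := Num.max 0 (C * D).
have CD0 : 0 <= CD by rewrite /CD le_max lexx.
have h1 s' : `]s / 2, 1[%classic s' -> vol.-integrable Q (EFin \o (fun z => psi s' z * f z)).
  by move=> _; apply: bg; exact: continuous_psi.
have h2 s' z : `]s / 2, 1[%classic s' -> Q z -> derivable (fun s => psi s z * f z) s' 1.
  by move=> /I0[s'0 _] _; have [] := dF s' z s'0.
have h3 : vol.-integrable Q (EFin \o (fun _ : R3 R => CD)).
  by apply: bounded_measurable_integrable => //; exact: bounded_measurable_cst.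
have h4 s' z : `]s / 2, 1[%classic s' -> Q z -> `|partial1of2 (fun s z => psi s z * f z) s' z| <= CD.
  move=> /I0[s'0 s'1] Qz; rewrite partial1of2E; have [_ ->] := dF s' z s'0.
  by rewrite normrM /CD le_max; apply/orP; right; apply: ler_pM; rewrite ?HC ?HD.
apply: DeriveDef; first exact: (derivable_under_integral mQ sI h1 h2 (fun=> CD0) h3 h4).
rewrite -derive1E (differentiation_under_integral mQ sI h1 h2 (fun=> CD0) h3 h4).
transitivity (\int[vol]_(z in Q) (psit s z * f z)).
  by apply: eq_Rintegral => z _; rewrite partial1of2E; have [_ ->] := dF s z s0.
have bpt : vol.-integrable Q (EFin \o (fun z => psit s z * f z)) by apply: bg; exact: continuous_psit.
have bpe : vol.-integrable Q (EFin \o (fun z => psierr s z * f z)).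
  by apply: bg; apply: continuous_psierr; rewrite gt_eqF.
have P := psi_laplacian s0.
have PE : \int[vol]_(z in Q) (psi s z * laplacian f z) = - l * \int[vol]_(z in Q) (psi s z * f z).
  rewrite -RintegralZl //; last exact: h1.
  apply: eq_Rintegral => z; rewrite inE => Qz.
  by have [U [_ _ /(_ z Qz) H]] := lf; rewrite -[laplacian f z]opprK H; ring.
rewrite -PE P; apply/eqP; rewrite -subr_eq opprK; apply/eqP; rewrite -RintegralD //.
by apply: eq_Rintegral => z _; ring.
Qed.

(** The mass of [psi s] is not normalized; bounds independent of s and of the centre are enough
    below. *)
Lemma psi_integral_product (s : R) : exists w : R,
  [/\ \int[vol]_(z in Q) psi s z = w, 0 < s -> 0 <= w <= (2 * Num.sqrt pi) ^+ 3
    & 0 < s <= (a / 2) ^+ 2 -> (2 * expR (- 4^-1)) ^+ 3 <= w].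
Proof.
have fin t : exists A : R, (\int[leb]_(r in `[(t - a)%R, (t + a)%R]) (ck a s (r - t))%:E = A%:E)%E /\ 0 <= A.
  have ig : leb.-integrable `[(t - a)%R, (t + a)%R] (EFin \o (fun r => ck a s (r - t))).
    apply: continuous_compact_integrable; first exact: segment_compact.
    apply: continuous_subspaceT; apply: continuous_compose (@continuous_ck R a s).
    by apply: continuous_add; [move=> x; exact: cvg_id | exact: continuous_cst].
  exists (\int[leb]_(r in `[(t - a)%R, (t + a)%R]) ck a s (r - t)); split.
    by rewrite /Rintegral fineK //; exact: integrable_fin_num.
  by apply: Rintegral_ge0 => r _; exact: k0.
have [A [HA A0]] := fin c.1.1; have [B [HB B0]] := fin c.1.2; have [C [HC C0]] := fin c.2.
have mk t : measurable_fun setT (fun r : R => ck a s (r - t)).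
  apply: continuous_measurable_fun; apply: continuous_compose (@continuous_ck R a s).
  by apply: continuous_add; [move=> x; exact: cvg_id | exact: continuous_cst].
have PE := box_integral_product a0 (bmc (@continuous_psi s)) HA HB HC (mk _) (mk _) (mk _)
  (fun r => k0 _ _) (fun r => k0 _ _) (fun r => k0 _ _).
exists (A * B * C); split.
- by rewrite /Rintegral PE.
- move=> s0; apply/andP; split; first by rewrite !mulr_ge0.
  have up t T : (\int[leb]_(r in `[(t - a)%R, (t + a)%R]) (ck a s (r - t))%:E = T%:E)%E ->
    T <= 2 * Num.sqrt pi.
    by move=> HT; rewrite -lee_fin -HT; exact: integral_ck_le.
  by rewrite exprS exprS expr1 mulrA; apply: prod3 => //; [exact: up HA | exact: up HB | exact: up HC].
move=> s0.
have lo t T : (\int[leb]_(r in `[(t - a)%R, (t + a)%R]) (ck a s (r - t))%:E = T%:E)%E ->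
    2 * expR (- 4^-1) <= T.
  by move=> HT; rewrite -lee_fin -HT; exact: integral_ck_ge.
have e0 : 0 <= 2 * expR (- 4^-1) :> R by rewrite mulr_ge0 ?expR_ge0.
by rewrite exprS exprS expr1 mulrA; apply: prod3 => //; [exact: lo HA | exact: lo HB | exact: lo HC].
Qed.

(* psi s / (its mass) is an approximate identity at c *)
Lemma cvg_psi_integral :
  (\int[vol]_(z in Q) (psi s z * f z) - (\int[vol]_(z in Q) psi s z) * f c) @[s --> (0 : R)^'+] --> (0 : R).
Proof.
have mQ : measurable Q by exact: measurable_box.
have [mf [D HD]] := local_eigenfunction_bounded.
have Qc : Q c by split; rewrite subrr normr0 ltW.
have D0 : 0 <= D by apply: le_trans (HD c Qc).
have cfc : {for c, continuous f} by have [U [QU [cf _] _]] := lf; apply: cf; exact: QU.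
pose k1 : R := (2 * Num.sqrt pi) ^+ 3.
have k10 : 0 <= k1 by rewrite exprn_ge0 // mulr_ge0 // sqrtr_ge0.
apply/cvgr0Pnorm_le => e e0.
have e1 : 0 < e / 2 / (k1 + 1) by rewrite !divr_gt0 // ltr_wpDl.
have /cvgrPdist_le/(_ _ e1)/nbhs_ballP[d /= d0 dP] := cfc.
pose K := (16 / d ^+ 2) ^+ 4.
have K0 : 0 <= K by rewrite exprn_ge0 // divr_ge0 // sqr_ge0.
(* The contribution of the points outside the d-box is at most s T: the factors come from [psi_far],
   from the oscillation of f and from the volume of the box. *)
pose T := K * (2 * D) * (2 * a) ^+ 3.
have T0 : 0 <= T by apply: mulr_ge0; [apply: mulr_ge0 => //; exact: mulr_ge0 | rewrite exprn_ge0 // mulr_ge0 // ltW].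
near=> s.
have s0 : 0 < s by near: s; exact: nbhs_right_gt.
have s1 : s <= 1 by near: s; exact: nbhs_right_le.
have sT : s <= e / 2 / (T + 1).
  by near: s; apply: nbhs_right_le; rewrite !divr_gt0 // ltr_wpDl.
have ipsi : vol.-integrable Q (EFin \o psi s).
  by apply: bounded_measurable_integrable => //; apply: bmc; exact: continuous_psi.
have ipf : vol.-integrable Q (EFin \o (fun z => psi s z * f z)).
  by apply: bounded_measurable_integrable => //; apply: bounded_measurable_mulf; exact: continuous_psi.
have ipc : vol.-integrable Q (EFin \o (fun z => f c * psi s z)).
  apply: bounded_measurable_integrable => //; apply: bmc.
  by apply: continuous_mul; [exact: continuous_cst | exact: continuous_psi].
rewrite mulrC -RintegralZl // -RintegralB //.
have idif : vol.-integrable Q (EFin \o (fun z => psi s z * f z - f c * psi s z)).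
  by apply: (@eq_integrable _ _ _ _ _ mQ (fun z => (psi s z * f z)%:E - (f c * psi s z)%:E)%E); [move=> z _; rewrite /= EFinB | exact: integrableB].
apply: (le_trans (le_normr_Rintegral mQ idif)).
have icst r : vol.-integrable Q (EFin \o (fun _ : R3 R => r)).
  by apply: bounded_measurable_integrable => //; exact: bounded_measurable_cst.
have ieps : vol.-integrable Q (EFin \o (fun z => e / 2 / (k1 + 1) * psi s z)).
  apply: bounded_measurable_integrable => //; apply: bmc.
  by apply: continuous_mul; [exact: continuous_cst | exact: continuous_psi].
apply: (@le_trans _ _ (\int[vol]_(z in Q) (e / 2 / (k1 + 1) * psi s z + K * s * (2 * D)))).
  apply: le_Rintegral => //.
  - exact: (integrable_abse idif).
  - by apply: (@eq_integrable _ _ _ _ _ mQ (fun z => (e / 2 / (k1 + 1) * psi s z)%:E + (K * s * (2 * D))%:E)%E); [move=> z _; rewrite /= EFinD | apply: integrableD => //; exact: icst].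
  move=> z Qz.
  have -> : psi s z * f z - f c * psi s z = psi s z * (f z - f c) by ring.
  rewrite normrM ger0_norm ?psi_ge0 //.
  have [zd|zd] := pselect (open_box c d z).
    have fz : `|f z - f c| <= e / 2 / (k1 + 1).
      by rewrite distrC; apply: dP; rewrite ball_open_box.
    rewrite -[leLHS]addr0; apply: lerD; first by rewrite mulrC ler_wpM2r ?psi_ge0.
    by apply: mulr_ge0; [apply: mulr_ge0 => //; exact: ltW | exact: mulr_ge0].
  rewrite -[leLHS]add0r; apply: lerD; first by rewrite mulr_ge0 ?psi_ge0 // ltW.
  apply: ler_pM; rewrite ?psi_ge0 //; first by apply: psi_far => //; rewrite s0.
  by rewrite (le_trans (ler_normB _ _)) // mulr2n mulrDl mul1r lerD ?HD.
rewrite (RintegralD mQ ieps (icst _)).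
rewrite RintegralZl // Rintegral_cst // vol_box //=.
have [w [-> /(_ s0)/andP[w0 wk] _]] := psi_integral_product s.
have E1 : e / 2 / (k1 + 1) * w <= e / 2.
  rewrite -mulrA -[leRHS]mulr1; apply: ler_wpM2l; first by rewrite ltW // divr_gt0.
  by rewrite mulrC ler_pdivrMr ?ltr_wpDl // mul1r (le_trans wk) // lerDl.
have E2 : K * s * (2 * D) * (2 * a) ^+ 3 <= e / 2.
  have -> : K * s * (2 * D) * (2 * a) ^+ 3 = s * T by rewrite /T; ring.
  have : s * (T + 1) <= e / 2 by rewrite -ler_pdivlMr // ltr_wpDl.
  by apply: le_trans; rewrite ler_wpM2l ?lerDl // ltW.
by rewrite [leRHS]splitr; exact: lerD.
Unshelve. all: by end_near. Qed.

End Eigenfunction.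
Lemma Rintegral_lincomb n (f : 'I_n -> R3 R -> R) (b : 'I_n -> R) (u : R3 R -> R) :
  (forall k, vol.-integrable Q (EFin \o (fun z => u z * f k z))) ->
  \int[vol]_(z in Q) (u z * \sum_(k < n) b k * f k z) =
  \sum_(k < n) b k * \int[vol]_(z in Q) (u z * f k z).
Proof.
have mQ : measurable Q by exact: measurable_box.
elim: n f b => [|n IH] f b iuf.
  rewrite big_ord0; under eq_Rintegral do rewrite big_ord0 mulr0.
  by rewrite Rintegral_cst // mul0r.
have iS : forall m (g : 'I_m -> R3 R -> R) (b : 'I_m -> R),
    (forall k, vol.-integrable Q (EFin \o (fun z => u z * g k z))) ->
    vol.-integrable Q (EFin \o (fun z => u z * \sum_(k < m) b k * g k z)).
  elim=> [|m IHm] g b' ig.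
    have -> : (fun z => u z * \sum_(k < 0) b' k * g k z) = (fun=> 0).
      by apply/funext => z; rewrite big_ord0 mulr0.
    by apply: bounded_measurable_integrable => //; exact: bounded_measurable_cst.
  apply: (@eq_integrable _ _ _ _ _ mQ (fun z => (u z * \sum_(k < m) b' (widen_ord (leqnSn m) k) * g (widen_ord (leqnSn m) k) z)%:E + (b' ord_max)%:E * (u z * g ord_max z)%:E)%E).
    by move=> z _; rewrite /= big_ord_recr /= -EFinM -EFinD; congr EFin; ring.
  apply: integrableD => //; first exact: IHm.
  by apply: integrableZl => //; exact: ig.
rewrite big_ord_recr /= -IH; last by move=> k; exact: iuf.
have iZ : vol.-integrable Q (EFin \o (fun z => b ord_max * (u z * f ord_max z))).
  apply: (@eq_integrable _ _ _ _ _ mQ (fun z => (b ord_max)%:E * (u z * f ord_max z)%:E)%E); first by [].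
  by apply: integrableZl => //; exact: iuf.
have iW := iS n (fun k => f (widen_ord (leqnSn n) k)) (fun k => b (widen_ord (leqnSn n) k)) (fun k => iuf _).
rewrite -(@RintegralZl _ _ _ vol Q _ (b ord_max) mQ (iuf ord_max)).
rewrite -(RintegralD mQ iW iZ).
by apply: eq_Rintegral => z _; rewrite big_ord_recr /=; ring.
Qed.

Section Duhamel.
Variables (n : nat) (l d : 'I_n -> R) (f : 'I_n -> R3 R -> R) (t B : R).
Hypotheses (lf : forall k, local_eigenfunction (l k) (f k)) (t01 : 0 < t < 1).
Hypothesis HB : forall s, 0 < s <= t ->
  `|\int[vol]_(z in Q) (psierr s z * \sum_(k < n) d k * expR (- (l k * (t - s))) * f k z)| <= B.

Let t0 : 0 < t. Proof. by case/andP: t01. Qed.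

(* The derivative in s of the pairing of psi s with the solution of the heat
   equation at time t - s only involves psierr, as psi s solves the heat
   equation up to psierr s. *)
Lemma local_duhamel :
  (2 * expR (- 4^-1)) ^+ 3 * `|\sum_(k < n) d k * expR (- (l k * t)) * f k c| <=
  `|\int[vol]_(z in Q) (psi t z * \sum_(k < n) d k * f k z)| + B * t.
Proof.
have ipsi s k : vol.-integrable Q (EFin \o (fun z => psi s z * f k z)).
  apply: bounded_measurable_integrable => //; apply: bounded_measurable_mulf (lf k) _ _.
  exact: continuous_psi.
have ierr s k : 0 < s -> vol.-integrable Q (EFin \o (fun z => psierr s z * f k z)).
  move=> s0; apply: bounded_measurable_integrable => //; apply: bounded_measurable_mulf (lf k) _ _.
  by apply: continuous_psierr; rewrite gt_eqF.
pose ex k s := expR (- (l k * (t - s))).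
pose ck k s := \int[vol]_(z in Q) (psi s z * f k z).
pose er k s := \int[vol]_(z in Q) (psierr s z * f k z).
(* [Th] interpolates between the pairing of [psi t] with the initial data, at s = t, and, up to the
   mass of [psi s], the solution at c at time t, as s tends to 0. *)
pose Th s := \sum_(k < n) d k * (ex k s * ck k s).
have dex k (s : R) : is_derive s (1 : R) (ex k) (l k * ex k s).
  rewrite mulrC; apply: (is_derive_comp (f := expR)).
  have -> : (fun y : R => - (l k * (t - y))) = (fun y => l k * y - l k * t).
    by apply/funext => y; ring.
  have E : l k = l k * 1 - 0 by ring.
  by rewrite [X in is_derive _ _ _ X]E; apply: is_derive_sub; apply: is_derive_scale.
have dTh (s : R) : 0 < s <= t -> is_derive s (1 : R) Th
   (- \int[vol]_(z in Q) (psierr s z * \sum_(k < n) d k * expR (- (l k * (t - s))) * f k z)).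
  move=> /andP[s0 st]; have s1 : s < 1 by case/andP: t01 => _; exact: le_lt_trans.
  have H k : is_derive s (1 : R) (fun s => d k * (ex k s * ck k s)) (- (d k * ex k s * er k s)).
    have -> : - (d k * ex k s * er k s) = d k * (l k * ex k s * ck k s + ex k s * (- l k * ck k s - er k s)) by ring.
    have s01 : 0 < s < 1 by rewrite s0.
    exact: (is_derive_scale (d k) (is_derive_mul (dex k s) (is_derive_psi_integral (lf k) s01))).
  have := @is_derive_sum _ _ _ n (fun k s => d k * (ex k s * ck k s)) s 1 _ H.
  have -> : \sum_(k < n) (fun s => d k * (ex k s * ck k s)) = Th.
    by apply/funext => y; rewrite fct_sumE.
  move/is_derive_eq; apply; rewrite sumrN; congr (- _).
  rewrite (@Rintegral_lincomb _ _ (fun k => d k * ex k s)) //.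
  by move=> k; exact: ierr.
have Tht : Th t = \int[vol]_(z in Q) (psi t z * \sum_(k < n) d k * f k z).
  rewrite (Rintegral_lincomb d) //; apply: eq_bigr => k _.
  by rewrite /ex subrr mulr0 oppr0 expR0 mul1r.
have lip s : 0 < s < t -> `|Th t - Th s| <= B * t.
  move=> /andP[s0 st].
  have [||x xst ->] := @MVT R Th (fun s => - \int[vol]_(z in Q) (psierr s z * \sum_(k < n) d k * expR (- (l k * (t - s))) * f k z)) s t st.
  - move=> y; rewrite in_itv /= => /andP[sy yt]; apply: dTh.
    by rewrite (lt_trans s0 sy) ltW.
  - apply: continuous_in_subspaceT => y; rewrite inE /= in_itv /= => /andP[sy yt].
    by apply: is_derive_continuous (dTh y _); rewrite (lt_le_trans s0 sy).
  move: xst; rewrite in_itv /= => /andP[sx xt].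
  rewrite normrM normrN; apply: ler_pM => //; first by apply: HB; rewrite (lt_trans s0 sx) ltW.
  by rewrite ger0_norm ?subr_ge0 ?gerBl ltW.
(* No limit of the mass [W s] has been established, so [Th s] is compared with [W s * v s], and a
   lower bound of the mass is enough. *)
pose W s := \int[vol]_(z in Q) psi s z.
pose v s := \sum_(k < n) d k * (ex k s * f k c).
have cvd : (Th s - W s * v s) @[s --> (0 : R)^'+] --> (0 : R).
  have -> : (fun s => Th s - W s * v s) = (fun s => \sum_(k < n) (d k * ex k s) * (ck k s - W s * f k c)).
    by apply/funext => s; rewrite /Th /v mulr_sumr -sumrB; apply: eq_bigr => k _; ring.
  have E0 : \sum_(k < n) (d k * ex k 0) * 0 = 0 by rewrite big1 // => k _; rewrite mulr0.
  rewrite -[X in _ --> X]E0.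
  apply: cvg_sumr => k _; apply: cvgM; last exact: cvg_psi_integral.
  apply: cvgM; first exact: cvg_cst.
  by apply: cvg_at_right_filter; exact: is_derive_continuous (dex k 0).
have cvv : v s @[s --> (0 : R)^'+] --> v 0.
  apply: cvg_sumr => k _; apply: cvgM; first exact: cvg_cst.
  apply: cvgM; last exact: cvg_cst.
  by apply: cvg_at_right_filter; exact: is_derive_continuous (dex k 0).
have v0 : v 0 = \sum_(k < n) d k * expR (- (l k * t)) * f k c.
  by apply: eq_bigr => k _; rewrite /ex subr0 mulrA.
rewrite -v0 -Tht.
have L : (2 * expR (- 4^-1)) ^+ 3 * `|v s| @[s --> (0 : R)^'+] --> (2 * expR (- 4^-1)) ^+ 3 * `|v 0|.
  by apply: cvgM; [exact: cvg_cst | exact: cvg_norm].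
have Rr : (`|Th t| + B * t) + `|Th s - W s * v s| @[s --> (0 : R)^'+] --> (`|Th t| + B * t) + 0.
  have N0 := cvg_norm cvd; rewrite normr0 in N0.
  by apply: cvgD; [exact: cvg_cst | exact: N0].
rewrite -[leRHS]addr0; apply: (ler_cvg_to L Rr); near=> s.
have s0 : 0 < s by near: s; exact: nbhs_right_gt.
have st : s < t by near: s; exact: nbhs_right_lt.
have sa : s <= (a / 2) ^+ 2 by near: s; apply: nbhs_right_le; rewrite exprn_gt0 // divr_gt0.
have [w [Ww /(_ s0)/andP[w0 _] wk]] := psi_integral_product s.
have {}wk : (2 * expR (- 4^-1)) ^+ 3 <= W s by rewrite /W Ww wk // s0.
apply: (@le_trans _ _ (W s * `|v s|)); first by rewrite ler_wpM2r.
have -> : W s * `|v s| = `|W s * v s| by rewrite normrM ger0_norm // /W Ww.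
apply: (@le_trans _ _ `|Th t - (Th t - Th s) - (Th s - W s * v s)|).
  by rewrite !subKr.
apply: (le_trans (ler_normB _ _)); apply: lerD => //.
by apply: (le_trans (ler_normB _ _)); apply: lerD => //; apply: lip; rewrite s0.
Unshelve. all: by end_near. Qed.

End Duhamel.
End Local_heat_kernel.

(** * Affine changes of variables *)

Section Affine_maps.
Variable R : realType.
Local Notation leb := (@lebesgue_measure R).
Local Notation vol := (vol R).
Local Notation image_measure :=
  measure_function_pushforward__canonical__measure_function_Measure.

Lemma product_measure_scaling d1 d2 (T1 : measurableType d1) (T2 : measurableType d2)
    (m1 : {sigma_finite_measure set T1 -> \bar R})
    (m2 : {sigma_finite_measure set T2 -> \bar R}) (f1 : T1 -> T1) (f2 : T2 -> T2) (k1 k2 : R) :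
  measurable_fun setT f1 -> measurable_fun setT f2 -> 0 < k1 -> 0 < k2 ->
  (forall A, measurable A -> m1 (f1 @^-1` A) = (k1%:E * m1 A)%E) ->
  (forall A, measurable A -> m2 (f2 @^-1` A) = (k2%:E * m2 A)%E) ->
  forall X, measurable X ->
  (m1 \x m2)%E ((fun z => (f1 z.1, f2 z.2)) @^-1` X) = ((k1 * k2)%:E * (m1 \x m2) X)%E.
Proof.
move=> mf1 mf2 k10 k20 H1 H2 X mX.
pose f (z : T1 * T2) := (f1 z.1, f2 z.2).
have mf : measurable_fun setT f.
  apply: measurable_fun_pair; apply: measurableT_comp => //.
have k12 : 0 <= (k1 * k2)^-1 by rewrite invr_ge0 mulr_ge0 // ltW.
pose m' : {measure set (T1 * T2) -> \bar R} := mscale (NngNum k12) (image_measure (m1 \x m2)%E mf).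
have E : (m1 \x m2)%E X = m' X.
  apply: product_measure_unique => // A B mA mB.
  have -> : m' (A `*` B) = (((k1 * k2)^-1)%:E * (m1 \x m2) (f1 @^-1` A `*` f2 @^-1` B))%E by [].
  rewrite product_measure1E //; last 2 first.
  - by rewrite -[_ @^-1` _]setTI; exact: mf1.
  - by rewrite -[_ @^-1` _]setTI; exact: mf2.
  transitivity (((k1 * k2)^-1)%:E * ((k1%:E * m1 A) * (k2%:E * m2 B)))%E.
    by congr (_ * (_ * _))%E; [exact: H1 | exact: H2].
  have -> : (k1%:E * m1 A * (k2%:E * m2 B) = (k1 * k2)%:E * (m1 A * m2 B))%E.
    by rewrite EFinM; exact: muleACA.
  rewrite muleA -EFinM mulVf ?mul1e //.
  by rewrite gt_eqF // mulr_gt0.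
have -> : (m1 \x m2)%E (f @^-1` X) = ((k1 * k2)%:E * m' X)%E.
  rewrite /m' /mscale /= muleA -EFinM divff ?mul1e // gt_eqF // mulr_gt0 //.
by rewrite E.
Qed.

Lemma lebesgue_affine (L v : R) A : 0 < L -> measurable A ->
  (leb ((fun x : R => L * x + v)%R @^-1` A) = (L^-1)%:E * leb A)%E.
Proof.
move=> L0 mA.
pose f : measurableTypeR R -> measurableTypeR R := fun x => L * x + v.
have mf : measurable_fun setT f.
  apply: continuous_measurable_fun; apply: continuous_add; last exact: continuous_cst.
  by apply: continuous_mul; [exact: continuous_cst | move=> x; exact: cvg_id].
pose m' : {measure set (measurableTypeR R) -> \bar R} := mscale (NngNum (ltW L0)) (image_measure leb mf).
have -> : leb A = m' A.
  apply: lebesgue_measure_unique => // _ [[x y] _ <-].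
  have -> : m' `]x, y]%classic = (L%:E * leb (f @^-1` `]x, y]))%E by [].
  have -> : f @^-1` `]x, y]%classic = `](x - v) / L, (y - v) / L]%classic.
    apply/seteqP; split => z; rewrite /f /= !in_itv /= ltr_pdivrMr // ler_pdivlMr //;
      by rewrite ltrBlDr lerBrDr [z * L]mulrC.
  rewrite !lebesgue_measure_itv /= !lte_fin ltr_pM2r ?invr_gt0 // ltrD2r.
  case: ifP => _; last by rewrite mule0.
  by rewrite -!EFinB -EFinM; congr EFin; field; rewrite gt_eqF.
by rewrite /m' /mscale /= muleA -EFinM mulVf ?mul1e // gt_eqF.
Qed.

Lemma measurable_affine (L v : R) : measurable_fun setT (fun x : measurableTypeR R => L * x + v : measurableTypeR R).
Proof.
apply: continuous_measurable_fun; apply: continuous_add; last exact: continuous_cst.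
by apply: continuous_mul; [exact: continuous_cst | move=> x; exact: cvg_id].
Qed.

Definition affine (L : R) (v : R3 R) (z : R3 R) : R3 R := L *: z + v.

Lemma measurable_affine3 L v : measurable_fun setT (affine L v).
Proof.
have -> : affine L v = fun z => ((L * z.1.1 + v.1.1, L * z.1.2 + v.1.2), L * z.2 + v.2) by [].
have m1 w : measurable_fun setT (fun z : R3 R => L * z.1.1 + w : measurableTypeR R).
  apply: (measurableT_comp (@measurable_affine L w)); apply: measurableT_comp; exact: measurable_fst.
have m2 w : measurable_fun setT (fun z : R3 R => L * z.1.2 + w : measurableTypeR R).
  apply: (measurableT_comp (@measurable_affine L w)); apply: measurableT_comp; [exact: measurable_snd|exact: measurable_fst].
have m3 w : measurable_fun setT (fun z : R3 R => L * z.2 + w : measurableTypeR R).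
  apply: (measurableT_comp (@measurable_affine L w)); exact: measurable_snd.
by apply: measurable_fun_pair; [apply: measurable_fun_pair; [exact: m1|exact: m2] | exact: m3].
Qed.

Lemma vol_affine (L : R) v A : 0 < L -> measurable A ->
  (vol (affine L v @^-1` A) = (L ^- 3)%:E * vol A)%E.
Proof.
move=> L0 mA; have L10 : 0 < L^-1 by rewrite invr_gt0.
have H2 := @product_measure_scaling _ _ _ _ leb leb _ _ L^-1 L^-1
  (@measurable_affine L v.1.1) (@measurable_affine L v.1.2) L10 L10
  (fun A mA => lebesgue_affine v.1.1 L0 mA) (fun A mA => lebesgue_affine v.1.2 L0 mA).
have mf : measurable_fun setT (fun z : measurableTypeR R * measurableTypeR R => (L * z.1 + v.1.1 : measurableTypeR R, L * z.2 + v.1.2 : measurableTypeR R)).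
  apply: measurable_fun_pair; apply: (measurableT_comp (@measurable_affine L _)); [exact: measurable_fst|exact: measurable_snd].
have L20 : 0 < L^-1 * L^-1 by rewrite mulr_gt0.
have := @product_measure_scaling _ _ _ _ (product_sigma_finite leb leb) leb _ _ (L^-1 * L^-1) L^-1
  mf (@measurable_affine L v.2) L20 L10 H2 (fun A mA => lebesgue_affine v.2 L0 mA) A mA.
have -> : L^-1 * L^-1 * L^-1 = L ^- 3 by rewrite -exprVn; ring.
by [].
Qed.

(** Serves the dilation of the domain and, with L = 1, the lattice translations. *)
Lemma ge0_integral_affine (L : R) v D (f : R3 R -> \bar R) : 0 < L -> measurable D ->
  measurable_fun D f -> (forall z, 0 <= f z)%E ->
  (\int[vol]_(z in affine L v @^-1` D) f (affine L v z) = (L ^- 3)%:E * \int[vol]_(z in D) f z)%E.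
Proof.
move=> L0 mD mf f0.
rewrite -[LHS](ge0_integral_pushforward (measurable_affine3 L v)) //.
have L3 : 0 <= L ^- 3 by rewrite invr_ge0 exprn_ge0 // ltW.
rewrite -(ge0_integral_mscale _ mD (NngNum L3)) //.
apply: (eq_measure_integral (mscale (NngNum L3) vol)
  (m1 := image_measure vol (measurable_affine3 L v))) => A mA _; exact: vol_affine.
Qed.

End Affine_maps.

(** * Cells, boxes and distances in the domain *)

Section Domain_geometry.
Variable R : realType.
Local Notation vol := (vol R).
Implicit Types (Lam : domain R) (x y z : R3 R).

(** Treats the torus and the regions together: eigenfunctions are invariant under every
    [cell_shift], which is 0 for a region. *)
Definition cell_shift Lam (k : int * int * int) : R3 R :=
  if Lam is Torus then lattice_vector R k else 0.

Lemma euclid_scale (L : R) x : 0 <= L -> euclid (L *: x) = L * euclid x.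
Proof.
move=> L0; rewrite /euclid /=.
have -> : (L *: x.1.1) ^+ 2 + (L *: x.1.2) ^+ 2 + (L *: x.2) ^+ 2 =
  L ^+ 2 * (x.1.1 ^+ 2 + x.1.2 ^+ 2 + x.2 ^+ 2) by rewrite /GRing.scale /=; ring.
by rewrite sqrtrM ?sqr_ge0 // sqrtr_sqr ger0_norm.
Qed.

Lemma open_box_euclid x y (r : R) : euclid (x - y) < r -> open_box y r x.
Proof.
have b2 (u v : R) : 0 <= u -> `|v| <= Num.sqrt (v ^+ 2 + u).
  by move=> u0; rewrite -sqrtr_sqr ler_wsqrtr // lerDl.
move=> h; have r0 : 0 < r by apply: le_lt_trans h; exact: sqrtr_ge0.
have := h; rewrite /euclid /= => h'.
split; apply: le_lt_trans h'.
- by rewrite -addrA; apply: b2; rewrite addr_ge0 // sqr_ge0.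
- by rewrite [(x.1.1 - _) ^+ 2 + _]addrC -addrA; apply: b2; rewrite addr_ge0 // sqr_ge0.
- by rewrite [_ + (x.2 - _) ^+ 2]addrC; apply: b2; rewrite addr_ge0 // sqr_ge0.
Qed.

(** The factor 2 stands for sqrt 3. *)
Lemma euclid_open_box x y (r : R) : open_box y r x -> euclid (x - y) < 2 * r.
Proof.
move=> [h1 h2 h3]; have r0 : 0 < r by apply: le_lt_trans h1.
have sq (v : R) : `|v| < r -> v ^+ 2 < r ^+ 2.
  by move=> h; rewrite -real_normK ?num_real // ltr_pXn2r // nnegrE // ltW.
rewrite /euclid /=; have -> : 2 * r = Num.sqrt ((2 * r) ^+ 2).
  by rewrite sqrtr_sqr ger0_norm // mulr_ge0 // ltW.
rewrite ltr_sqrt ?exprn_gt0 ?mulr_gt0 //.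
have := sq _ h1; have := sq _ h2; have := sq _ h3.
have : 0 <= r ^+ 2 by rewrite sqr_ge0.
by rewrite exprMn; lra.
Qed.

Lemma domain_dist_le Lam (L : R) x y k :
  domain_dist Lam L x y <= euclid (x - y + L *: cell_shift Lam k).
Proof.
case: Lam => [|K bc] /=; last by rewrite scaler0 addr0.
apply: ge_inf; last by exists k.
by exists 0 => _ [k' ->]; exact: sqrtr_ge0.
Qed.

Lemma domain_dist_lt Lam x y (r : R) : domain_dist Lam 1 x y < r ->
  exists k, euclid (x - y + cell_shift Lam k) < r.
Proof.
case: Lam => [|K bc] /=; last by exists (0, 0, 0); rewrite addr0.
move=> h; have /inf_adherent : 0 < r - domain_dist Torus 1 x y by rewrite subr_gt0.
move=> /(_ [set s | exists k, s = euclid (x - y + 1 *: lattice_vector R k)]).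
case.
  split; first by exists (euclid (x - y + 1 *: lattice_vector R (0, 0, 0))), (0, 0, 0).
  by exists 0 => _ [k' ->]; exact: sqrtr_ge0.
by move=> _ [k ->]; rewrite /domain_dist subrKC scale1r; exists k.
Qed.

(** Distances to the boundary are taken in the max norm, to match the boxes to which the Gaussian is
    cut off. *)
Definition inner Lam (e : R) x :=
  carrier Lam x /\ forall z, domain_boundary Lam z -> ~ open_box x e z.

Definition far_apart Lam (e : R) x y := forall k, ~ open_box y e (x + cell_shift Lam k).

(** On the torus a box around a point of the cell may leave the cell; its lattice translates come
    back into it. *)
Definition per_box Lam x (a : R) := [set z | exists k, box x a (z + cell_shift Lam k)].

Lemma cell_shift0 Lam : cell_shift Lam (0, 0, 0) = 0.
Proof. by case: Lam. Qed.

Lemma cell_shiftD Lam k l :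
  cell_shift Lam (k.1.1 + l.1.1, k.1.2 + l.1.2, k.2 + l.2)%R = cell_shift Lam k + cell_shift Lam l.
Proof.
case: Lam => [|? ?] /=; last by rewrite addr0.
by rewrite /lattice_vector /= !intrD.
Qed.

Lemma cell_shiftN Lam k : cell_shift Lam (- k.1.1, - k.1.2, - k.2)%R = - cell_shift Lam k.
Proof.
case: Lam => [|? ?] /=; last by rewrite oppr0.
by rewrite /lattice_vector /= !intrN.
Qed.

Lemma sub_per_box Lam x a : box x a `<=` per_box Lam x a.
Proof. by move=> z xz; exists (0, 0, 0); rewrite cell_shift0 addr0. Qed.

Lemma measurable_per_box Lam x a : measurable (per_box Lam x a).
Proof.
have -> : per_box Lam x a = \bigcup_k (affine 1 (cell_shift Lam k) @^-1` box x a).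
  apply/seteqP; split => z.
    by move=> [k xk]; exists k => //; rewrite /= /affine scale1r.
  by move=> [k _]; rewrite /= /affine scale1r => xk; exists k.
apply: countable_bigcupT_measurable => [|k]; first exact: countableP.
by rewrite -[_ @^-1` _]setTI; apply: measurable_affine3 => //; exact: measurable_box.
Qed.

Lemma eigenfunction_shift Lam (l : R) f k z : eigenfunction Lam l f ->
  f (z + cell_shift Lam k) = f z.
Proof. by case: Lam => [[_ p _]|K bc _] /=; [exact: p | rewrite addr0]. Qed.

Lemma measurable_carrier Lam : admissible_domain Lam -> measurable (carrier Lam).
Proof.
case: Lam => [_|K bc [[cK _] _ _ _ _]].
  have -> : carrier Torus = (`[0%R, 1%R[ `*` `[0%R, 1%R[) `*` `[0%R, 1%R[ :> set (R3 R).
    by apply/seteqP; split => z; rewrite /= !in_itv /=; [move=> [? ? ?] | move=> [[? ?] ?]].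
  by apply: measurableX; [apply: measurableX|]; exact: measurable_itv.
by apply: closed_measurable_space; apply: compact_closed.
Qed.

(** The segment from x to z stays in the box, and its part in V is both open and closed in it. *)
Lemma connected_box x (a : R) (V : set (R3 R)) : 0 <= a -> open V -> V x ->
  (forall z, box x a z -> closure V z -> V z) -> box x a `<=` V.
Proof.
move=> a0 oV Vx clV z xz.
pose g (s : R) : R3 R := x + s *: (z - x).
have cg : continuous g.
  move=> s; apply: cvgD; first exact: cvg_cst.
  by apply: cvgZr_tmp; exact: cvg_id.
have gb s : 0 <= s <= 1 -> box x a (g s).
  have c1 (u v : R) : 0 <= s <= 1 -> `|u - v| <= a -> `|v + s * (u - v) - v| <= a.
    move=> /andP[s0 s1] h; rewrite addrAC subrr add0r normrM ger0_norm //.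
    by rewrite -[leRHS]mul1r ler_pM.
  by move=> s01; case: xz => h1 h2 h3; split; apply: c1.
have cI := @segment_connected R 0 1.
pose B := `[0%R, 1%R]%classic `&` g @^-1` V.
have B0 : B !=set0 by exists 0; split; rewrite /= ?in_itv /= ?lexx ?ler01 // /g scale0r addr0.
have : B = `[0%R, 1%R]%classic.
  apply: cI => //.
    by exists (g @^-1` V) => //; move/continuousP: cg; exact.
  exists (g @^-1` closure V); first by move/continuous_closedP: cg; apply; exact: closed_closure.
  apply/seteqP; split => s [s01 gs]; split => //; first exact: subset_closure.
  by apply: clV => //; apply: gb; rewrite /= in_itv in s01.
move=> /(congr1 (fun S => S 1)); rewrite /B /= in_itv /= lexx ler01 => E.
have [_ ] : (true /\ V (g 1)) by rewrite E.
by rewrite /g scale1r subrKC.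
Qed.

(** For a region, a box around x without boundary points lies in the interior, by [connected_box];
    for the torus the whole space serves as U. *)
Lemma inner_box_open Lam (e a : R) x : admissible_domain Lam -> inner Lam e x ->
  0 < a < e -> exists U, [/\ open U, per_box Lam x a `<=` U,
    carrier Lam `&` U `<=` carrier Lam `\` domain_boundary Lam,
    (if Lam is Region _ _ then U `<=` carrier Lam else True) &
    forall l f, eigenfunction Lam l f ->
      Cn 2 U f /\ forall z, U z -> - laplacian f z = l * f z].
Proof.
case: Lam => [_|K bc [[cK KE] _ _ _ _]] [xK xb] /andP[a0 ae].
  exists setT; split => //; first exact: openT.
    by move=> z [? _]; split.
  by move=> l f [? ? ?]; split.
exists (interior K); split; first exact: open_interior.
- move=> z [k]; rewrite /= addr0; move: z.
  have clK : closed K by apply: compact_closed.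
  have Kint z : box x a z -> K z -> interior K z.
    move=> [h1 h2 h3] Kz; apply: contrapT => nz.
    have : boundary K z by split => //; exact: subset_closure.
    by move/xb; apply; split; apply: le_lt_trans ae.
  apply: connected_box; [exact: ltW|exact: open_interior| |].
    by apply: Kint => //; split; rewrite subrr normr0 ltW.
  move=> z xz cz; apply: Kint => //; rewrite KE; exact: cz.
- by move=> z [/= Kz iz]; split => // -[].
- by move=> z; exact: interior_subset.
- by move=> l f [_ ? ? _]; split.
Qed.

Lemma inner_shift Lam (e a : R) x z k : inner Lam e x -> a <= e / 2 ->
  box x a z -> carrier Lam (z + cell_shift Lam k) -> inner Lam (e / 2) (z + cell_shift Lam k).
Proof.
move=> [xK xb] ae xz zK; split => // w wb zw; apply: (xb w wb).
case: Lam xK xb wb zw zK => [|K bc] //= xK xb wb; rewrite addr0 => -[h1 h2 h3] zK.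
have tri (u v t : R) : `|v - u| <= a -> `|t - v| < e / 2 -> `|t - u| < e.
  move=> h h'; have -> : t - u = (t - v) + (v - u) by rewrite addrA subrK.
  apply: (le_lt_trans (ler_normD _ _)); lra.
by case: xz => g1 g2 g3; split; apply: tri; eassumption.
Qed.

(** As a <= 1, a shift by - 1, 0 or 1 in each coordinate returns to the cell of the torus; this is
    the origin of the factor 27 below. *)
Lemma box_cover Lam (e a : R) x z : admissible_domain Lam -> inner Lam e x ->
  0 < a < e -> a <= 1 -> box x a z ->
  exists i : 'I_3 * 'I_3 * 'I_3,
    carrier Lam (z + cell_shift Lam (i.1.1%:Z - 1, i.1.2%:Z - 1, i.2%:Z - 1)%R).
Proof.
move=> hL ix ae a1 xz.
have [U [oU bU _ UD _]] := inner_box_open hL ix ae.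
case: Lam hL ix bU UD => [|K bc] hL [xK xb] bU UD /=; last first.
  exists (ord0, ord0, ord0); rewrite addr0.
  by apply: UD; apply: bU; exact: sub_per_box.
have c1 (u v : R) : 0 <= u < 1 -> `|v - u| <= a ->
    exists i : 'I_3, 0 <= v + (i%:Z - 1)%:~R < 1.
  move=> /andP[u0 u1]; rewrite ler_norml => /andP[h1 h2].
  have [v0|v0] := ltP v 0.
    by exists (inord 2); rewrite inordK // (_ : (2%:Z - 1)%R = 1%Z) // ; apply/andP; split; lra.
  have [v1|v1] := ltP v 1.
    by exists (inord 1); rewrite inordK // (_ : (1%:Z - 1)%R = 0%Z) // ; apply/andP; split; lra.
  by exists (inord 0); rewrite inordK // (_ : (0%:Z - 1)%R = (-1)%Z) // ; apply/andP; split; rewrite ?mulrN1z; lra.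
case: xK => k1 k2 k3; case: xz => h1 h2 h3.
have [i1 I1] := c1 _ _ k1 h1; have [i2 I2] := c1 _ _ k2 h2; have [i3 I3] := c1 _ _ k3 h3.
by exists (i1, i2, i3).
Qed.

End Domain_geometry.

Section Folding.
Variables (R : realType) (Lam : domain R).
Local Notation vol := (vol R).
Hypothesis hLam : admissible_domain Lam.

(* The 27 cells around the one of x cover a box of radius at most 1. *)
Lemma integral_box_le (e a : R) (x : R3 R) (u : R3 R -> R) : inner Lam e x ->
  0 < a < e -> a <= 1 -> measurable_fun (per_box Lam x a) u -> (forall z, 0 <= u z) ->
  (forall z k, u (z + cell_shift Lam k) = u z) ->
  (\int[vol]_(z in box x a) (u z)%:E <=
   27%:E * \int[vol]_(z in carrier Lam `&` per_box Lam x a) (u z)%:E)%E.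
Proof.
move=> ix ae a1 mu u0 pu.
pose J : finType := ('I_3 * 'I_3 * 'I_3)%type.
pose kk (i : J) : int * int * int := (i.1.1%:Z - 1, i.1.2%:Z - 1, i.2%:Z - 1)%R.
pose B i := box x a `&` (affine 1 (cell_shift Lam (kk i)) @^-1` carrier Lam).
have maff i A : measurable A -> measurable (affine 1 (cell_shift Lam (kk i)) @^-1` A).
  by move=> mA; rewrite -[_ @^-1` _]setTI; apply: measurable_affine3.
have mC := measurable_carrier hLam.
have mP := measurable_per_box Lam x a.
have mb := measurable_box x a.
have mB i : measurable (B i) by apply: measurableI => //; exact: maff.
have mub : measurable_fun (box x a) (EFin \o u).
  apply/measurable_EFinP; apply: measurable_funS mu => //; exact: sub_per_box.
apply: (@le_trans _ _ (\sum_(i : J) \int[vol]_(z in box x a) ((u z)%:E * (\1_(B i) z)%:E))%E).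
  rewrite -ge0_integral_sum //; last first.
    by move=> i z _; rewrite mule_ge0 // lee_fin.
    move=> i; apply: emeasurable_funM => //.
    by apply/measurable_EFinP; apply: measurable_funTS; exact: measurable_indic.
  apply: ge0_le_integral => //.
  - by move=> z _; rewrite lee_fin.
  - apply: emeasurable_sum => i; apply: emeasurable_funM => //.
    by apply/measurable_EFinP; apply: measurable_funTS; exact: measurable_indic.
  move=> z xz; have [i iz] := box_cover hLam ix ae a1 xz.
  rewrite (bigD1 i) //= indicE mem_set; last by split => //; rewrite /= /affine scale1r.
  rewrite mule1 leeDl // sume_ge0 // => j _.
  by rewrite mule_ge0 // lee_fin.
have bound i : (\int[vol]_(z in box x a) ((u z)%:E * (\1_(B i) z)%:E) <=
    \int[vol]_(z in carrier Lam `&` per_box Lam x a) (u z)%:E)%E.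
  have -> : (\int[vol]_(z in box x a) ((u z)%:E * (\1_(B i) z)%:E) =
     \int[vol]_(z in B i) (u z)%:E)%E.
    rewrite [in RHS](_ : B i = box x a `&` B i); last by rewrite setIA setIid.
    rewrite [RHS]integral_mkcondr; apply: eq_integral => z _.
    by rewrite /patch indicE; case: (z \in B i); rewrite ?mule1 ?mule0.
  pose C := carrier Lam `&` (affine 1 (- cell_shift Lam (kk i)) @^-1` box x a).
  have CP : C `<=` per_box Lam x a.
    move=> z [_]; rewrite /= /affine scale1r -cell_shiftN => xz; eexists; exact: xz.
  have mCC : measurable C.
    apply: measurableI => //; rewrite -cell_shiftN -[_ @^-1` _]setTI; apply: measurable_affine3 => //.
  have -> : B i = affine 1 (cell_shift Lam (kk i)) @^-1` C.
    apply/seteqP; split => z; rewrite /B /C /= /affine !scale1r addrK; by case.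
  have -> : (\int[vol]_(z in affine 1 (cell_shift Lam (kk i)) @^-1` C) (u z)%:E =
      (1 ^- 3)%:E * \int[vol]_(z in C) (u z)%:E)%E.
    rewrite -(@ge0_integral_affine _ _ (cell_shift Lam (kk i)) C (fun z => (u z)%:E)) //.
    + by apply: eq_integral => z _; rewrite /affine scale1r pu.
    + by apply/measurable_EFinP; apply: measurable_funS mu.
  rewrite expr1n invr1 mul1e; apply: ge0_subset_integral => //.
  - exact: measurableI.
  - by apply/measurable_EFinP; apply: measurable_funS mu => // z [].
  - by move=> z _; rewrite lee_fin.
  - by move=> z Cz; split; [case: Cz | exact: CP].
apply: (le_trans (lee_sum _ (fun i _ => bound i))).
rewrite (sumr_const (_ : pred J)) !card_prod card_ord.
by rewrite [leRHS](mule_natl _ 27).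
Qed.

End Folding.

(** * Bounds by duality from the spectral decomposition *)

Section Heat_kernel_bounds.
Variables (R : realType) (Lam : domain R) (lam : nat -> R) (phi : nat -> R3 R -> R).
Local Notation vol := (vol R).
Local Notation C := (carrier Lam).
Hypotheses (hLam : admissible_domain Lam) (hspec : laplace_spectrum Lam lam phi).

Let eig k : eigenfunction Lam (lam k) (phi k).
Proof. by case: hspec. Qed.

Lemma eigenvalue_ge0 k : 0 <= lam k.
Proof.
case: hspec => _ _ _ [l0 l01 ln] _; elim: k => [//|[|k] IH]; first exact: le_trans (ltW l01).
by apply: (le_trans IH); exact: ln.
Qed.

Lemma eigenvalue_gap k : (0 < k)%N -> lam 1%N <= lam k.
Proof.
case: hspec => _ _ _ [l0 l01 ln] _; elim: k => [//|[|k] IH _]; first exact: lexx.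
by apply: (le_trans (IH isT)); exact: ln.
Qed.

Lemma phi_shift n k z : phi n (z + cell_shift Lam k) = phi n z.
Proof. by apply: eigenfunction_shift (eig n). Qed.

Lemma measurable_phi k : measurable_fun C (phi k).
Proof.
have mC := measurable_carrier hLam.
have := eig k; case: Lam mC => [|K bc] mC [].
  by move=> [cf _] _ _; apply: continuous_measurable_space => // z _; exact: cf.
by move=> wf _ _ _; exact: within_continuous_measurable.
Qed.

Lemma measurable_phi_box (e a : R) x k : inner Lam e x -> 0 < a < e ->
  measurable_fun (per_box Lam x a) (phi k).
Proof.
move=> ix ae; have [U [oU bU _ _ HU]] := inner_box_open hLam ix ae.
have [[cf _] _] := HU _ _ (eig k).
apply: continuous_measurable_space; first exact: measurable_per_box.
by move=> z /bU; exact: cf.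
Qed.

Lemma local_eigenfunction_phi (e a : R) x k : inner Lam e x -> 0 < a < e ->
  local_eigenfunction x a (lam k) (phi k).
Proof.
move=> ix ae; have [U [oU bU _ _ HU]] := inner_box_open hLam ix ae.
have [Cf lf] := HU _ _ (eig k).
exists U; split => //; first by apply: subset_trans bU; exact: sub_per_box.
by move=> z xz; apply: lf; apply: bU; exact: sub_per_box.
Qed.

Lemma integral_square_phi n (d : 'I_n -> R) :
  (\int[vol]_(z in C) ((\sum_(k < n) d k * phi k z) ^+ 2)%:E = (\sum_(k < n) d k ^+ 2)%:E)%E.
Proof.
have mC := measurable_carrier hLam.
case: hspec => _ orth _ _ _.
have isq k : vol.-integrable C (EFin \o (fun z => phi k z * phi k z)).
  apply/integrableP; split.
    by apply/measurable_EFinP; apply: measurable_funM; exact: measurable_phi.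
  under eq_integral => z _ do rewrite /= ger0_norm ?sqr_ge0 //.
  by rewrite orth eqxx ltry.
have ipr k l : vol.-integrable C (EFin \o (fun z => phi k z * phi l z)).
  apply: (@le_integrable _ _ _ _ _ mC _ (fun z => (phi k z * phi k z)%:E + (phi l z * phi l z)%:E)%E).
  - by apply/measurable_EFinP; apply: measurable_funM; exact: measurable_phi.
  - move=> z _; rewrite /= lee_fin [leRHS]ger0_norm; last by rewrite addr_ge0 // sqr_ge0.
    rewrite normrM; set u := `|phi k z|; set v := `|phi l z|.
    have -> : phi k z * phi k z = u * u by rewrite /u -normrM ger0_norm // sqr_ge0.
    have -> : phi l z * phi l z = v * v by rewrite /v -normrM ger0_norm // sqr_ge0.
    have : 0 <= (u - v) ^+ 2 by rewrite sqr_ge0.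
    have : 0 <= u ^+ 2 by rewrite sqr_ge0.
    have : 0 <= v ^+ 2 by rewrite sqr_ge0.
    by rewrite !expr2; lra.
  - by apply: integrableD => //; [exact: (isq k) | exact: (isq l)].
have idd k l : vol.-integrable C (fun z => (d k * d l)%:E * (phi k z * phi l z)%:E)%E.
  by apply: integrableZl => //; exact: ipr.
transitivity (\int[vol]_(z in C) \sum_(k < n) \sum_(l < n) (d k * d l)%:E * (phi k z * phi l z)%:E)%E.
  apply: eq_integral => z _; rewrite expr2 mulr_suml -sumEFin; apply: eq_bigr => k _.
  rewrite mulr_sumr -sumEFin; apply: eq_bigr => l _; rewrite -EFinM; congr EFin; ring.
rewrite integral_sum //; last by move=> k; apply: integrable_sum => // l _; exact: idd.
rewrite -sumEFin; apply: eq_bigr => k _.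
rewrite integral_sum //.
transitivity (\sum_(l < n) (d k * d l)%:E * ((k == l :> nat)%:R)%:E)%E.
  apply: eq_bigr => l _; rewrite integralZl //; last exact: ipr.
  by rewrite orth.
rewrite (bigD1 k) //= eqxx mule1 big1 ?adde0 // => l /negbTE lk.
by rewrite eq_sym (inj_eq val_inj) lk mule0.
Qed.

Section Box.
Variables (e a : R) (x : R3 R).
Hypotheses (ix : inner Lam e x) (ae : 0 < a < e) (a1 : a <= 1).

Let a0 : 0 < a. Proof. by case/andP: ae. Qed.

Let bm n (d : 'I_n -> R) : bounded_measurable (box x a) (fun z => \sum_(k < n) d k * phi k z).
Proof.
apply: bounded_measurable_sum => k; apply: bounded_measurable_mul; first exact: bounded_measurable_cst.
exact: (local_eigenfunction_bounded (local_eigenfunction_phi k ix ae)).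
Qed.

Lemma integral_box_square n (d : 'I_n -> R) :
  \int[vol]_(z in box x a) ((\sum_(k < n) d k * phi k z) ^+ 2) <= 27 * \sum_(k < n) d k ^+ 2.
Proof.
rewrite -lee_fin fineK; last first.
  apply: integrable_fin_num; first exact: measurable_box.
  by apply: bounded_measurable_integrable => //; apply: bounded_measurable_mul; exact: bm.
apply: (le_trans (integral_box_le hLam ix ae a1 _ _ _)).
- apply: measurable_funX; apply: measurable_sum => k; apply: measurable_funM => //.
  exact: measurable_phi_box ae.
- by move=> z; exact: sqr_ge0.
- by move=> z k; congr (_ ^+ 2); apply: eq_bigr => i _; rewrite phi_shift.
rewrite EFinM; apply: lee_wpmul2l; first by rewrite lee_fin.
rewrite -integral_square_phi.
apply: ge0_subset_integral.
- apply: measurableI; [exact: measurable_carrier | exact: measurable_per_box].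
- exact: measurable_carrier.
- apply/measurable_EFinP; apply: measurable_funX; apply: measurable_sum => k.
  by apply: measurable_funM => //; exact: measurable_phi.
- by move=> z _; rewrite lee_fin sqr_ge0.
- by move=> z [].
Qed.

(* Cauchy--Schwarz, without the square root. *)
Lemma box_pairing_le n (d : 'I_n -> R) (u : R3 R -> R) (G : R) :
  bounded_measurable (box x a) u -> (forall z, box x a z -> `|u z| <= G) ->
  \sum_(k < n) d k ^+ 2 <= 1 ->
  `|\int[vol]_(z in box x a) (u z * \sum_(k < n) d k * phi k z)| <= 27 * G.
Proof.
move=> bu uG d1.
have mb : measurable (box x a) by exact: measurable_box.
have G0 : 0 <= G.
  by apply: le_trans (uG x _) => //; split; rewrite subrr normr0 ltW.
pose v z := \sum_(k < n) d k * phi k z.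
have bv : bounded_measurable (box x a) v by exact: bm.
have iuv : vol.-integrable (box x a) (EFin \o (fun z => u z * v z)).
  by apply: bounded_measurable_integrable => //; exact: bounded_measurable_mul.
have iv2 : vol.-integrable (box x a) (EFin \o (fun z => v z ^+ 2)).
  by apply: bounded_measurable_integrable => //; exact: bounded_measurable_mul.
have i1 (r : R) : vol.-integrable (box x a) (EFin \o (fun=> r)).
  by apply: bounded_measurable_integrable => //; exact: bounded_measurable_cst.
have iR : vol.-integrable (box x a) (EFin \o (fun z => G / 2 * (1 + v z ^+ 2))).
  apply: bounded_measurable_integrable => //; apply: bounded_measurable_mul; first exact: bounded_measurable_cst.
  by apply: bounded_measurable_add; [exact: bounded_measurable_cst | exact: bounded_measurable_mul].
apply: (le_trans (le_normr_Rintegral mb iuv)).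
apply: (@le_trans _ _ (\int[vol]_(z in box x a) (G / 2 * (1 + v z ^+ 2)))).
  apply: le_Rintegral => //; first exact: integrable_norm iuv.
  move=> z xz; rewrite normrM -[v z ^+ 2]real_normK ?num_real //.
  have := uG z xz; set p := `|u z|; set q := `|v z| => pG.
  have q0 : 0 <= q by exact: normr_ge0.
  apply: (@le_trans _ _ (G * q)); first by rewrite ler_wpM2r.
  have : 0 <= (1 - q) ^+ 2 by rewrite sqr_ge0.
  move=> h; rewrite -mulrA ler_wpM2l // -subr_ge0.
  have -> : 2^-1 * (1 + q ^+ 2) - q = (1 - q) ^+ 2 / 2 by field.
  by rewrite divr_ge0.
rewrite RintegralZl //; last first.
  apply: bounded_measurable_integrable => //.
  by apply: bounded_measurable_add; [exact: bounded_measurable_cst | exact: bounded_measurable_mul].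
rewrite RintegralD // Rintegral_cst // mul1r [fine _](_ : _ = (2 * a) ^+ 3); last by rewrite vol_box.
have h1 := integral_box_square d.
(* The volume, at most 8, is rounded up to 27 to match the bound of the integral of the square. *)
have h2 : (2 * a) ^+ 3 <= 27.
  apply: (@le_trans _ _ (2 ^+ 3)); last by lra.
  by apply: lerXn2r; rewrite ?nnegrE; have := a0; have := a1; lra.
apply: (@le_trans _ _ (G / 2 * (27 + 27))); last by lra.
rewrite ler_wpM2l ?divr_ge0 //; apply: lerD => //.
by apply: (le_trans h1); lra.
Qed.

End Box.

(** Translating the centre to 0 makes the constant independent of x. *)
Lemma psierr_bounded_uniform (a : R) : 0 < a -> exists B, 0 <= B /\
  forall x s z, 0 < s <= 1 -> box x a z -> `|psierr x a s z| <= B.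
Proof.
move=> a0; have [B [B0 HB]] := psierr_bounded 0 a0.
exists B; split => // x s z s01 [h1 h2 h3].
have -> : psierr x a s z = psierr 0 a s (z - x) by rewrite /psierr /= !subr0.
by apply: HB => //; split; rewrite /= subr0.
Qed.

(** By duality: the l^2 norm of the numbers exp (- lam k t) phi k x is the supremum of their
    pairings with unit vectors d, and each pairing is the value at x of a solution of the heat
    equation with initial data of L^2 norm at most 1, which [local_duhamel] bounds. The power t^-6
    is the square of the t^-3 of [psi_le]; it is not optimal, but no final bound depends on its
    growth as t tends to 0. *)
Lemma diagonal_bound (e : R) : 0 < e -> exists D, 0 <= D /\
  forall x t n, inner Lam e x -> 0 < t < 1 ->
  \sum_(k < n) expR (- (2 * lam k * t)) * phi k x ^+ 2 <= D * t ^- 6.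
Proof.
(* Smaller than e, so that the box stays inside the domain, and at most 1 for [box_cover]. *)
move=> e0; pose a : R := Num.min (e / 2) 1.
have a0 : 0 < a by rewrite lt_min divr_gt0 // ltr01.
have ae : 0 < a < e by rewrite a0 /a gt_min ltr_pdivrMr // ltr_pMr // ltr1n.
have a1 : a <= 1 by rewrite ge_min lexx orbT.
have [B [B0 HB]] := psierr_bounded_uniform a0.
pose c0 : R := (2 * expR (- 4^-1)) ^+ 3.
have c00 : 0 < c0 by rewrite exprn_gt0 // mulr_gt0 // expR_gt0.
pose C1 := (27 + 27 * B) / c0.
exists (C1 ^+ 2); split; first exact: sqr_ge0.
move=> x t n ix /[dup] t01 /andP[t0 t1].
have le_t3 : 1 <= t ^- 3.
  by rewrite -exprVn exprn_ege1 // invf_ge1 // ltW.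
have key (d : 'I_n -> R) : \sum_(k < n) d k ^+ 2 <= 1 ->
    `|\sum_(k < n) d k * expR (- (lam k * t)) * phi k x| <= C1 * t ^- 3.
  move=> d1.
  have := @local_duhamel R x a a0 n (fun k => lam k) d (fun k => phi k) t (27 * B)
    (fun k => local_eigenfunction_phi k ix ae) t01.
  rewrite -/c0 => /(_ _)/wrap[].
    move=> s /andP[s0 st]; have s01 : 0 < s <= 1 by rewrite s0 (le_trans st) // ltW.
    have := @box_pairing_le e a x ix ae a1 n (fun k => d k * expR (- (lam k * (t - s)))) (psierr x a s) B.
    apply.
    - by apply: continuous_bounded_measurable => // z _; apply: continuous_psierr; rewrite gt_eqF.
    - by move=> z xz; exact: HB.
    apply: le_trans d1; apply: ler_sum => k _; rewrite exprMn ler_piMr ?sqr_ge0 //.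
    rewrite exprn_ile1 ?expR_ge0 // -expR0 ler_expR oppr_le0 mulr_ge0 ?eigenvalue_ge0 // subr_ge0 //.
  have := @box_pairing_le e a x ix ae a1 n d (psi x a t) (t ^- 3).
  move=> /(_ _ _ d1)/wrap[].
  - by apply: continuous_bounded_measurable => // z _; exact: continuous_psi.
  - by move=> z _; rewrite ger0_norm ?psi_ge0 // psi_le // t0 ltW.
  move=> h1 h2; rewrite /C1 mulrAC ler_pdivlMr // mulrC; apply: (le_trans h2).
  rewrite [leRHS]mulrDl; apply: lerD => //.
  rewrite ler_wpM2l ?mulr_ge0 //; apply: le_trans le_t3; exact: ltW.
pose ek (k : 'I_n) := expR (- (lam k * t)) * phi k x.
pose S := \sum_(k < n) ek k ^+ 2.
have -> : \sum_(k < n) expR (- (2 * lam k * t)) * phi k x ^+ 2 = S.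
  by apply: eq_bigr => k _; rewrite exprMn -expRM_natl; congr (expR _ * _); rewrite mulrN; ring.
have S0 : 0 <= S by apply: sumr_ge0 => k _; exact: sqr_ge0.
have [->|Sn0] := eqVneq S 0.
  by rewrite mulr_ge0 ?sqr_ge0 // invr_ge0 exprn_ge0 // ltW.
have rS : 0 < Num.sqrt S by rewrite sqrtr_gt0 lt_neqAle eq_sym Sn0.
(* The extremal unit vector, along the coefficients themselves. *)
have := key (fun k => ek k / Num.sqrt S) => /(_ _)/wrap[].
  under eq_bigr => k _ do rewrite exprMn.
  by rewrite -mulr_suml -/S exprVn sqr_sqrtr // divff.
have -> : \sum_(k < n) ek k / Num.sqrt S * expR (- (lam k * t)) * phi k x = Num.sqrt S.
  transitivity (S / Num.sqrt S).
    rewrite mulr_suml; apply: eq_bigr => k _; rewrite -mulrA -/(ek k); ring.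
  by rewrite -{1}(sqr_sqrtr S0) expr2 mulfK // gt_eqF.
rewrite ger0_norm ?sqrtr_ge0 // => h.
rewrite -[S]sqr_sqrtr //.
have -> : C1 ^+ 2 * t ^- 6 = (C1 * t ^- 3) ^+ 2 by rewrite [RHS]exprMn; congr (_ * _); rewrite exprVn -exprM.
by rewrite lerXn2r // nnegrE // ?sqrtr_ge0 // (le_trans _ h) ?sqrtr_ge0.
Qed.

End Heat_kernel_bounds.

(** * The kernel of the domain of unit volume *)

Section Unit_heat_kernel.
Variables (R : realType) (Lam : domain R) (lam : nat -> R) (phi : nat -> R3 R -> R).
Local Notation vol := (vol R).
Local Notation C := (carrier Lam).
Hypotheses (hLam : admissible_domain Lam) (hspec : laplace_spectrum Lam lam phi).

Definition kernel_term (t : R) (x y : R3 R) (k : nat) : R :=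
  expR (- (lam k * t)) * phi k x * phi k y.

Definition unit_kernel (t : R) (x y : R3 R) : R := limn (series (kernel_term t x y)).

Lemma heat_kernelE (L t : R) x y :
  heat_kernel lam phi L t x y = L ^- 3 * unit_kernel (t * L ^- 2) (L^-1 *: x) (L^-1 *: y).
Proof.
rewrite /heat_kernel (_ : (fun k => _) = kernel_term (t * L ^- 2) (L^-1 *: x) (L^-1 *: y)) //.
by apply/funext => k; rewrite /kernel_term mulrA.
Qed.

Lemma unit_kernelE t x y : heat_kernel lam phi 1 t x y = unit_kernel t x y.
Proof. by rewrite heat_kernelE expr1n invr1 mul1r expr1n !invr1 mulr1 !scale1r. Qed.

Lemma kernel_termC t x y k : kernel_term t x y k = kernel_term t y x k.
Proof. by rewrite /kernel_term mulrAC. Qed.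

Lemma unit_kernelC t x y : unit_kernel t x y = unit_kernel t y x.
Proof. by congr (lim (series _ @ \oo)); apply/funext => k; exact: kernel_termC. Qed.

Lemma unit_kernel_shift t x y k : unit_kernel t x (y + cell_shift Lam k) = unit_kernel t x y.
Proof.
congr (lim (series _ @ \oo)); apply/funext => i.
by rewrite /kernel_term (phi_shift hspec).
Qed.

Lemma kernel_term_le (t s : R) x y k : s <= t ->
  `|kernel_term t x y k| <= expR (- (lam k * s)) * (phi k x ^+ 2 + phi k y ^+ 2).
Proof.
move=> st; rewrite /kernel_term -mulrA normrM (ger0_norm (expR_ge0 _)).
apply: ler_pM => //; first by rewrite ler_expR lerN2 ler_wpM2l // (eigenvalue_ge0 hspec).
rewrite normrM -(real_normK (num_real (phi k x))) -(real_normK (num_real (phi k y))).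
set u := `|phi k x|; set v := `|phi k y|.
have : 0 <= (u - v) ^+ 2 by rewrite sqr_ge0.
have : 0 <= (u + v) ^+ 2 by rewrite sqr_ge0.
by rewrite !expr2; lra.
Qed.

Lemma le_norm_limn (u : nat -> R) (b : R) : cvgn u -> (forall n, `|u n| <= b) -> `|limn u| <= b.
Proof.
move=> cu ub; apply: (ler_cvg_to (cvg_norm cu) (cvg_cst b)).
by near=> n; exact: ub.
Unshelve. all: by end_near. Qed.

Section Inner.
Variables (e : R) (D : R).
Hypotheses (e0 : 0 < e) (D0 : 0 <= D).
Hypothesis HD : forall x t n, inner Lam e x -> 0 < t < 1 ->
  \sum_(k < n) expR (- (2 * lam k * t)) * phi k x ^+ 2 <= D * t ^- 6.

Lemma diagonal_sum_le x (s : R) n : inner Lam e x -> 0 < s < 2 ->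
  \sum_(k < n) expR (- (lam k * s)) * phi k x ^+ 2 <= D * (s / 2) ^- 6.
Proof.
move=> ix /andP[s0 s2].
have -> : \sum_(k < n) expR (- (lam k * s)) * phi k x ^+ 2 =
    \sum_(k < n) expR (- (2 * lam k * (s / 2))) * phi k x ^+ 2.
  by apply: eq_bigr => k _; congr (expR (- _) * _); field.
by apply: HD => //; rewrite divr_gt0 //=; lra.
Qed.

Lemma kernel_sum_le x y (t s : R) n : inner Lam e x -> inner Lam e y -> 0 < s < 2 -> s <= t ->
  \sum_(k < n) `|kernel_term t x y k| <= 2 * D * (s / 2) ^- 6.
Proof.
move=> ix iy s02 st.
apply: (@le_trans _ _ (\sum_(k < n) expR (- (lam k * s)) * (phi k x ^+ 2 + phi k y ^+ 2))).
  by apply: ler_sum => k _; exact: kernel_term_le.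
under eq_bigr do rewrite mulrDr.
rewrite big_split /= -mulrA mulr2n mulrDl mul1r.
by apply: lerD; exact: diagonal_sum_le.
Qed.

Lemma cvg_unit_kernel x y (t : R) : inner Lam e x -> inner Lam e y -> 0 < t ->
  series (kernel_term t x y) @ \oo --> unit_kernel t x y.
Proof.
move=> ix iy t0; apply: normed_cvg.
pose s := Num.min t 1.
have s02 : 0 < s < 2 by rewrite lt_min t0 ltr01 /= /s gt_min ltr1n orbT.
apply: nondecreasing_is_cvgn.
  by apply: nondecreasing_series => n _ _; exact: normr_ge0.
exists (2 * D * (s / 2) ^- 6) => _ [n _ <-]; rewrite /normed_series_of /series /= big_mkord.
by apply: kernel_sum_le => //; rewrite ge_min lexx.
Qed.

Lemma unit_kernel_le x y (t s : R) : inner Lam e x -> inner Lam e y -> 0 < s < 2 -> s <= t ->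
  `|unit_kernel t x y| <= 2 * D * (s / 2) ^- 6.
Proof.
move=> ix iy s02 st; have t0 : 0 < t by case/andP: s02 => s0 _; exact: lt_le_trans st.
have := @cvg_unit_kernel x y t ix iy t0 => /cvgP cu.
apply: le_norm_limn => // n; rewrite /series /= big_mkord.
apply: (le_trans (ler_norm_sum _ _ _)); exact: kernel_sum_le.
Qed.

Lemma phi_inner_le x k : inner Lam e x -> phi k x ^+ 2 <= expR (lam k) * D * 2 ^+ 6.
Proof.
move=> ix; have := @diagonal_sum_le x 1 k.+1 ix; rewrite ltr01 ltr1n => /(_ isT).
rewrite big_ord_recr /= => h.
have : expR (- (lam k * 1)) * phi k x ^+ 2 <= D * 2 ^+ 6.
  apply: (@le_trans _ _ (D * (1 / 2) ^- 6)); last by rewrite mul1r exprVn invrK.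
  apply: le_trans h; rewrite lerDr; apply: sumr_ge0 => i _.
  by rewrite mulr_ge0 ?expR_ge0 ?sqr_ge0.
rewrite mulr1 expRN mulrC ler_pdivrMr ?expR_gt0 // => h2.
by apply: (le_trans h2); rewrite [leRHS]mulrC [expR _ * _]mulrC; lra.
Qed.

(** The ground state is subtracted. Multiplied by exp (lam 0 t), every other term at time t is
    bounded by its size at time 1 / 2 times exp (lam 1) exp (- (lam 1 - lam 0) t). *)
Lemma unit_kernel_long_time x y (t : R) : inner Lam e x -> inner Lam e y -> 1 <= t ->
  `|expR (lam 0%N * t) * unit_kernel t x y - phi 0%N x * phi 0%N y| <=
  expR (lam 1%N) * (2 * D * 4 ^+ 6) * expR (- ((lam 1%N - lam 0%N) * t)).
Proof.
move=> ix iy t1; have t0 : 0 < t by apply: lt_le_trans t1.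
have cu := @cvg_unit_kernel x y t ix iy t0.
have gap k : (0 < k)%N -> lam 1%N <= lam k by exact: (eigenvalue_gap hspec).
have cv : (fun n => expR (lam 0%N * t) * series (kernel_term t x y) n.+1 - phi 0%N x * phi 0%N y)
    @ \oo --> expR (lam 0%N * t) * unit_kernel t x y - phi 0%N x * phi 0%N y.
  apply: cvgB; last exact: cvg_cst.
  apply: cvgM; first exact: cvg_cst.
  by rewrite (cvg_shiftS (series (kernel_term t x y))).
rewrite -(cvg_lim _ cv) //; apply: le_norm_limn; first exact: cvgP cv.
move=> n; rewrite /series /= big_mkord big_ord_recl /=.
have -> : expR (lam 0%N * t) * (kernel_term t x y 0 + \sum_(i < n) kernel_term t x y (bump 0 i)) -
    phi 0%N x * phi 0%N y = \sum_(i < n) expR (lam 0%N * t) * kernel_term t x y i.+1.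
  have -> : phi 0%N x * phi 0%N y = expR (lam 0%N * t) * kernel_term t x y 0.
    by rewrite /kernel_term !mulrA -expRD subrr expR0 mul1r.
  by rewrite mulrDr addrAC subrr add0r mulr_sumr; apply: eq_bigr => i _; rewrite /bump /= add1n.
apply: (le_trans (ler_norm_sum _ _ _)).
apply: (@le_trans _ _ (expR (lam 1%N) * expR (- ((lam 1%N - lam 0%N) * t)) *
   \sum_(i < n.+1) `|kernel_term (2^-1) x y i|)).
  rewrite big_ord_recl mulrDr mulr_sumr -[leLHS]add0r; apply: lerD.
    by rewrite !mulr_ge0 ?expR_ge0.
  apply: ler_sum => i _; rewrite /kernel_term -!mulrA !normrM !(ger0_norm (expR_ge0 _)).
  rewrite !mulrA ler_wpM2r // ler_wpM2r // -!expRD ler_expR lift0.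
  have := gap i.+1 isT; have := eigenvalue_ge0 hspec i.+1; have := eigenvalue_ge0 hspec 1.
  set l := lam i.+1; set l1 := lam 1%N; set l0 := lam 0%N => h1 h2 h3.
  have : 0 <= (l - l1) * (t - 2^-1) by rewrite mulr_ge0 //; lra.
  by rewrite !mulrBr !mulrBl; lra.
rewrite mulrAC ler_wpM2r ?expR_ge0 // ler_wpM2l ?expR_ge0 //.
apply: (le_trans (@kernel_sum_le x y _ 2^-1 n.+1 ix iy _ (lexx _))).
  by apply/andP; split; lra.
by rewrite ler_wpM2l ?mulr_ge0 // -exprVn lerXn2r ?nnegrE //; lra.
Qed.

End Inner.

(** A positive continuous function on a compact set that contains all inner points. The cell of the
    torus is not closed, so the closed cube is used, with positivity on its faces by periodicity;
    for a region the inner points themselves form a closed set. *)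
Lemma phi0_inner_ge (e : R) : 0 < e -> exists c, 0 < c /\
  forall x, inner Lam e x -> c <= phi 0%N x.
Proof.
move=> e0.
have pos : forall x, inner Lam e x -> 0 < phi 0%N x.
  move=> x ix; case: hspec => _ _ _ _; apply; split; first by case: ix.
  move=> bx; case: ix => _ /(_ _ bx); apply.
  by split; rewrite subrr normr0.
suff [K [cK iK cf]] : exists K, [/\ compact K, (forall x, inner Lam e x -> K x),
    {within K, continuous (phi 0%N)} & forall x, K x -> 0 < phi 0%N x].
  move=> posK; have [K0|K0] := pselect (K !=set0); last first.
    by exists 1; split => // x /iK Kx; case: K0; exists x.
  have [c cKc cmin] := compact_EVT_min K0 cK cf.
  exists (phi 0%N c); split; first by apply: posK; rewrite inE in cKc.
  by move=> x /iK Kx; apply: cmin; rewrite inE.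
case: Lam hLam hspec pos => [|K bc] hL hs pos.
  have [/(_ 0%N)[[cf _] per _] _ _ _ _] := hs.
  exists (box ((2^-1, 2^-1), 2^-1) 2^-1); split.
  - by apply: compact_box; lra.
  - move=> x [[/andP[x0 x1] /andP[y0 y1] /andP[z0 z1]] _].
    by split; rewrite /= ler_norml; apply/andP; split; lra.
  - by apply: continuous_in_subspaceT => x _; exact: cf.
  move=> x [h1 h2 h3].
  have c1 (v : R) : `|v - 2^-1| <= 2^-1 -> exists k : int, 0 <= v + k%:~R < 1.
    rewrite ler_norml => /andP[h h']; have [v1|v1] := ltP v 1.
      by exists 0; apply/andP; split; lra.
    by exists (-1); rewrite mulrN1z; apply/andP; split; lra.
  have [k1 K1] := c1 _ h1; have [k2 K2] := c1 _ h2; have [k3 K3] := c1 _ h3.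
  by rewrite -(per (k1, k2, k3)); apply: pos; split.
have [[cK _] _ _ _ _] := hL.
have clK : closed K by apply: compact_closed.
pose I := [set x | inner (Region K bc) e x].
have cI : closed I.
  have -> : I = K `&` \bigcap_(z in boundary K) ~` ball z e.
    apply/seteqP; split => x [Kx H]; split => // z bz; have := H z bz; rewrite ball_open_box //.
      by move=> h [h1 h2 h3]; apply: h; split; rewrite distrC.
    by move=> h [h1 h2 h3]; apply: h; split; rewrite distrC.
  apply: closedI => //; apply: closed_bigI => z _; rewrite closedC.
  exact: ball_open.
exists I; split => //.
- by apply: (subclosed_compact cI cK) => x [].
- by case: hs => /(_ 0%N)[cf _ _ _] _ _ _ _; apply: continuous_subspaceW cf => x [].
Qed.

End Unit_heat_kernel.

(** * Short times off the diagonal, through Brownian bridges *)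

Section Off_diagonal.
Variables (R : realType) (Lam : domain R) (lam : nat -> R) (phi : nat -> R3 R -> R).
Local Notation vol := (vol R).
Local Notation C := (carrier Lam).
Local Notation uk := (unit_kernel lam phi).
Hypotheses (hLam : admissible_domain Lam) (hspec : laplace_spectrum Lam lam phi).

Lemma dilate1 (S : set (R3 R)) : dilate 1 S = S.
Proof. by apply/seteqP; split => z; rewrite /dilate /= invr1 scale1r. Qed.

Section Bridge.
Variables (t : R) (x y : R3 R) (B : {measure set (trajectory R) -> \bar R}).
Hypotheses (t0 : 0 < t) (hB : brownian_bridge Lam lam phi 1 t x y B).

Lemma bridge_total : B setT = (uk t x y)%:E.
Proof.
have [fdd _] := hB; have := fdd [::]; rewrite big_nil => /(_ _ t0) H.
have -> : [set: trajectory R] = [set w | visits 0 [::] w] by apply/seteqP; split.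
by rewrite H // /bridge_fdd /= unit_kernelE.
Qed.

Lemma bridge_one_time (s : R) (A : set (R3 R)) : 0 < s < t -> measurable A ->
  B [set w | A (w s)] = (\int[vol]_(z in A `&` C) (uk s x z * uk (t - s) z y)%:E)%E.
Proof.
move=> /andP[s0 st] mA; have [fdd _] := hB.
have := fdd [:: (s, A)]; rewrite big_seq1 => /(_ _ st) H.
have -> : [set w : trajectory R | A (w s)] = [set w | visits 0 [:: (s, A)] w].
  by apply/seteqP; split => w; rewrite /= add0r; [split | case].
rewrite H; last by move=> p; rewrite inE => /eqP ->.
rewrite /bridge_fdd /= /bridge_step /= dilate1.
by apply: eq_integral => z _; rewrite !unit_kernelE EFinM.
Qed.

Lemma measurable_at (s : R) (A : set (R3 R)) : measurable A ->
  measurable ([set w | A (w s)] : set (trajectory R)).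
Proof. by move=> mA; apply: sub_sigma_algebra; exists s, A. Qed.

(** A continuous path from x cannot be in A, at distance at least r from x, at arbitrarily small
    times. The limsup of these events is measurable and contains no bridge path; as the bridge paths
    have full outer measure, it has mass 0, and continuity from above concludes. *)
Lemma bridge_leaves_slowly (A : set (R3 R)) (r : R) : 0 < r -> measurable A ->
  (forall z, A z -> r <= domain_dist Lam 1 z x) ->
  B [set w | A (w n.+1%:R^-1)] @[n --> \oo] --> 0%E.
Proof.
move=> r0 mA Ar.
pose E n : set (trajectory R) := \bigcup_(m in [set m | (n <= m)%N]) [set w | A (w m.+1%:R^-1)].
have mE n : measurable (E n) by apply: bigcup_measurable => m _; exact: measurable_at.
have mI : measurable (\bigcap_n E n) by exact: bigcapT_measurable.
have E0 : B (\bigcap_n E n) = 0%E.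
  have [_ full] := hB; rewrite -[\bigcap_n E n]setCK; apply: full; first exact: measurableC.
  move=> w [w0 _ _ _ cw] /(_ _ I) wE.
  have := cw 0; rewrite w0 => /cvgrPdist_lt/(_ _ r0)/nbhs_ballP[d /= d0 Hd].
  have [N dN] : exists N : nat, N.+1%:R^-1 < d.
    have [N _ HN] := near_infty_natSinv_lt (PosNum d0).
    by exists N; exact: (HN N (leqnn N)).
  have [m /= Nm Am] := wE N.
  have /Hd : ball (0 : R) d m.+1%:R^-1.
    rewrite /ball /= sub0r normrN ger0_norm // (le_lt_trans _ dN) //.
    by rewrite lef_pV2 ?posrE ?ltr0n // ler_nat.
  rewrite /= sub0r normrN => h; have := Ar _ Am; rewrite leNgt => /negP; apply.
  exact: (le_lt_trans (ler_norm _) h).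
have cE : B \o E @ \oo --> 0%E.
  rewrite -E0; apply: nonincreasing_cvg_mu => //.
    apply: (@le_lt_trans _ _ (B setT)); last by rewrite bridge_total ltry.
    by apply: le_measure; rewrite ?inE //.
  move=> n m nm; apply/subsetPset => w [k /= mk Ak]; exists k => //=.
  exact: leq_trans mk.
apply: (squeeze_cvge _ (cvg_cst 0%E) cE).
near=> n; rewrite measure_ge0 /=; apply: le_measure; rewrite ?inE //.
  exact: measurable_at.
by move=> w Aw; exists n => /=.
Unshelve. all: by end_near. Qed.

End Bridge.

(** The spectral series does not show the sign; the kernel is the total mass of a bridge measure. *)
Lemma unit_kernel_ge0 (t : R) (x y : R3 R) (B : {measure set (trajectory R) -> \bar R}) :
  0 < t -> brownian_bridge Lam lam phi 1 t x y B -> 0 <= uk t x y.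
Proof. by move=> t0 hB; rewrite -lee_fin -(bridge_total t0 hB) measure_ge0. Qed.

Lemma far_apart_dist (e a : R) x y z : far_apart Lam e x y -> 0 < a -> 2 * a <= e ->
  per_box Lam x a z -> a / 2 <= domain_dist Lam 1 z y.
Proof.
move=> sep a0 ae [k [h1 h2 h3]]; rewrite leNgt; apply/negP.
move=> /domain_dist_lt[l]; rewrite addrAC => /open_box_euclid[g1 g2 g3].
apply: (sep (l.1.1 - k.1.1, l.1.2 - k.1.2, l.2 - k.2)).
have := cell_shiftD Lam l (- k.1.1, - k.1.2, - k.2); rewrite /= cell_shiftN => ->.
have tri (p q r u v : R) : `|r + u - p| <= a -> `|r + v - q| < a / 2 -> `|p + (v - u) - q| < e.
  move=> h g; have -> : p + (v - u) - q = (r + v - q) - (r + u - p) by ring.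
  by apply: (le_lt_trans (ler_normB _ _)); lra.
split.
- exact: (tri x.1.1 y.1.1 z.1.1 (cell_shift Lam k).1.1 (cell_shift Lam l).1.1 h1 g1).
- exact: (tri x.1.2 y.1.2 z.1.2 (cell_shift Lam k).1.2 (cell_shift Lam l).1.2 h2 g2).
- exact: (tri x.2 y.2 z.2 (cell_shift Lam k).2 (cell_shift Lam l).2 h3 g3).
Qed.

Section Uniform_bound.
Variable bridge : R -> R3 R -> R3 R -> {measure set (trajectory R) -> \bar R}.
Hypothesis hbr : forall t x y, 0 < t -> C x -> C y ->
  brownian_bridge Lam lam phi 1 t x y (bridge t x y).

(** At large times the ground state dominates, and it is bounded below at inner points. The value of
    T makes the remainder at most c^2 / 2, through exp u >= 1 + u. The window [T - 1, T] contains
    the remaining times T - s with s <= 1. *)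
Lemma unit_kernel_lower (e : R) : 0 < e -> exists T kap : R, [/\ 2 <= T, 0 < kap &
  forall x y t, inner Lam e x -> inner Lam e y -> T - 1 <= t <= T -> kap <= uk t x y].
Proof.
move=> e0; have [D [D0 HD]] := diagonal_bound hLam hspec e0.
have [c [c0 Hc]] := phi0_inner_ge hLam hspec e0.
pose A := expR (lam 1%N) * (2 * D * 4 ^+ 6).
have A0 : 0 <= A by rewrite mulr_ge0 ?expR_ge0 // !mulr_ge0.
pose g := lam 1%N - lam 0%N.
have g0 : 0 < g by rewrite subr_gt0; case: hspec => _ _ _ [].
exists (2 * A / (g * c ^+ 2) + 2), (expR (- (lam 0%N * (2 * A / (g * c ^+ 2) + 2))) * (c ^+ 2 / 2)).
set T := 2 * A / (g * c ^+ 2) + 2.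
have c20 : 0 < c ^+ 2 by rewrite exprn_gt0.
have T2 : 2 <= T by rewrite /T lerDr divr_ge0 // ?mulr_ge0 // ltW.
split => //; first by rewrite mulr_gt0 ?expR_gt0 ?divr_gt0.
move=> x y t ix iy /andP[Tt tT].
have t1 : 1 <= t by lra.
have := unit_kernel_long_time hspec D0 HD ix iy t1; rewrite -/A -/g => h.
have eg : A * expR (- (g * t)) <= c ^+ 2 / 2.
  have gt0 : 0 < g * t by rewrite mulr_gt0 //; lra.
  rewrite expRN ler_pdivrMr ?expR_gt0 //.
  apply: (@le_trans _ _ (c ^+ 2 / 2 * (g * t))); last first.
    by rewrite ler_wpM2l ?divr_ge0 // ?ltW //; have := expR_ge1Dx (g * t); lra.
  have -> : c ^+ 2 / 2 * (g * t) = (g * c ^+ 2) * t / 2 by ring.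
  rewrite ler_pdivlMr // mulrC [leRHS]mulrC -ler_pdivrMr ?mulr_gt0 //.
  by move: Tt; rewrite /T; lra.
have pp : c ^+ 2 <= phi 0%N x * phi 0%N y by rewrite expr2 ler_pM ?Hc // ltW.
have : c ^+ 2 / 2 <= expR (lam 0%N * t) * uk t x y.
  by have := le_trans h eg; rewrite ler_norml => /andP[h1 _]; lra.
move=> h2; rewrite -(ler_pM2l (expR_gt0 (lam 0%N * t))); apply: le_trans h2.
rewrite mulrA -expRD; apply: ler_piMl; first by rewrite divr_ge0 // ltW.
rewrite -[leRHS]expR0 ler_expR.
have := eigenvalue_ge0 hspec 0; set l := lam 0%N => l0.
by rewrite subr_le0 ler_wpM2l.
Qed.

(** Duhamel's formula around x is applied to the kernel with pole y, from a small time s' on. Both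
    of its terms involve the integral [I s] of this kernel over the box, which is at most a constant
    times the mass [J s] of the closed bridges at y that visit the box, up to cell shifts, at time
    s. This mass is bounded for all s, and it tends to 0 along s = 1 / (n + 1), which removes the
    initial term. *)
Lemma off_diagonal_bound (e : R) : 0 < e -> exists M, forall x y t,
  inner Lam e x -> inner Lam e y -> far_apart Lam e x y -> 0 < t < 1 -> `|uk t x y| <= M.
Proof.
have ar1 (d : R) : 0 <= d -> 0 < d + 1 /\ d / (d + 1) <= 1.
  by move=> d0; split; rewrite ?ler_pdivrMr; lra.
have ar2 (r s : R) : 0 < s -> s < r / 2 -> r < 1 -> [/\ 0 < r - s, r - s < 1 & r - s <= 1].
  by split; lra.
have ar3 (r s v : R) : 0 < s -> s <= r - v -> 0 < v -> r < 1 ->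
    [/\ v <= v + (r - v - s), v + (r - v - s) <= 1, 0 < v + (r - v - s) & s <= 1].
  by split; lra.
have ar4 (r : R) : 0 < r -> r <= 1 -> (2 * r) ^+ 3 <= 8.
  move=> r0 r1; have -> : 8 = (2 : R) ^+ 3 by rewrite -natrX.
  by apply: lerXn2r; rewrite ?nnegrE; lra.
move=> e0; have e20 : 0 < e / 2 by rewrite divr_gt0.
(* Points of the box around x, once brought back into the cell, are only known to be inner for e /
   2. *)
have [D [D0 HD]] := diagonal_bound hLam hspec e20.
have [T [kap [T2 kap0 low]]] := unit_kernel_lower e20.
(* The quarter keeps the points of the box inner for e / 2 and gives 2 a <= e, as [far_apart_dist]
   asks. *)
pose a := Num.min (e / 4) 1.
have a0 : 0 < a by rewrite lt_min divr_gt0 // ltr01.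
have ae4 : a <= e / 4 by rewrite ge_min lexx.
have a1 : a <= 1 by rewrite ge_min lexx orbT.
have ae : 0 < a < e by rewrite a0 /=; lra.
have [G [G0 HG]] := psierr_bounded_uniform a0.
pose c0 : R := (2 * expR (- 4^-1)) ^+ 3.
have c00 : 0 < c0 by rewrite exprn_gt0 // mulr_gt0 // expR_gt0.
pose M1 := 27 * (2 * D * 2 ^+ 6 / kap).
exists (G * (M1 + 8) / c0) => x y t ix iy sep /[dup] t01 /andP[t0 t1].
have T0 : 0 < T by apply: lt_le_trans T2.
have i2 z : inner Lam e z -> inner Lam (e / 2) z.
  move=> [Cz bz]; split => // w /bz h [h1 h2 h3]; apply: h.
  have ee : e / 2 < e by lra.
  by split; [exact: lt_trans h1 ee | exact: lt_trans h2 ee | exact: lt_trans h3 ee].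
have iy2 := i2 _ iy; have Cy : C y by case: iy.
have inA z : C z -> per_box Lam x a z -> inner Lam (e / 2) z.
  move=> Cz [k xk]; have -> : z = (z + cell_shift Lam k) + cell_shift Lam (- k.1.1, - k.1.2, - k.2).
    by rewrite cell_shiftN addrK.
  apply: inner_shift ix _ xk _; first by lra.
  by rewrite cell_shiftN addrK.
have inbox z : box x a z -> exists k, inner Lam (e / 2) (z + cell_shift Lam k).
  move=> xz; have [i Ci] := box_cover hLam ix ae a1 xz.
  by eexists; apply: (inner_shift ix _ xz Ci); lra.
have inper z : per_box Lam x a z -> exists k, inner Lam (e / 2) (z + cell_shift Lam k).
  move=> [k /inbox[l il]]; exists (k.1.1 + l.1.1, k.1.2 + l.1.2, k.2 + l.2).
  by rewrite cell_shiftD addrA.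
have uk_shift s z k : uk s y (z + cell_shift Lam k) = uk s y z by exact: unit_kernel_shift.
have term_shift s z k : kernel_term lam phi s y (z + cell_shift Lam k) = kernel_term lam phi s y z.
  by apply/funext => i; rewrite /kernel_term (phi_shift hspec).
have cvz s z : 0 < s -> per_box Lam x a z -> series (kernel_term lam phi s y z) @ \oo --> uk s y z.
  move=> s0 /inper[k ik]; rewrite -(uk_shift _ _ k) -(term_shift _ _ k).
  exact: (cvg_unit_kernel hspec HD).
have mA := measurable_per_box Lam x a.
have mC := measurable_carrier hLam.
have mb := measurable_box x a.
have mCA : measurable (C `&` per_box Lam x a) by exact: measurableI.
have muk s : 0 < s -> measurable_fun (per_box Lam x a) (uk s y).
  move=> s0; apply: (@measurable_fun_cvg _ _ _ _ (fun n z => series (kernel_term lam phi s y z) n)).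
    move=> n; apply: measurable_sum => k; apply: measurable_funM => //.
    exact: (measurable_phi_box hLam hspec k ix ae).
  by move=> z Az; exact: cvz.
have bmuk s : 0 < s -> bounded_measurable (box x a) (uk s y).
  move=> s0; split.
    by apply: measurable_funS (muk s s0) => //; exact: sub_per_box.
  exists (2 * D * (Num.min s 1 / 2) ^- 6) => z /inbox[k ik]; rewrite -(uk_shift _ _ k).
  apply: (unit_kernel_le hspec HD) => //; last by rewrite ge_min lexx.
  by rewrite lt_min s0 ltr01 /= gt_min ltr1n orbT.
(* A closed bridge whose duration T leaves, after any time s <= 1, a remaining time to which [low]
   applies. *)
pose B := bridge T y y.
have hB : brownian_bridge Lam lam phi 1 T y y B by exact: hbr.
pose J (s : R) : \bar R := B [set w | per_box Lam x a (w s)].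
pose I (s : R) : R := \int[vol]_(z in box x a) uk s y z.
have ukT : uk T y y <= 2 * D * 2 ^+ 6.
  have -> : 2 ^+ 6 = (1 / 2 : R) ^- 6 by rewrite mul1r -exprVn invrK.
  apply: (le_trans (ler_norm _)); apply: (unit_kernel_le hspec HD) => //; last by lra.
  by rewrite ltr01 ltr1n.
have iuk s : 0 < s -> vol.-integrable (box x a) (EFin \o uk s y).
  by move=> s0; apply: bounded_measurable_integrable => //; exact: bmuk.
(* The density of the bridge at time s is [uk s y z * uk (T - s) z y], and its second factor is at
   least [kap]. *)
have IJ s : 0 < s <= 1 -> ((I s)%:E <= 27%:E * ((kap^-1)%:E * J s))%E.
  move=> /andP[s0 s1]; rewrite /I fineK; last by apply: integrable_fin_num => //; exact: iuk.
  (* [integral_box_le] asks for a function that is nonnegative on the whole space, whereas the sign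
     of the kernel comes from bridges between points of the carrier. *)
  pose u z := Num.max 0 (uk s y z).
  apply: (@le_trans _ _ (\int[vol]_(z in box x a) (u z)%:E)%E).
    apply: le_integral => //; first exact: iuk.
      apply: bounded_measurable_integrable => //.
      have [m1 [K HK]] := bmuk s s0; split; first by apply: measurable_maxr.
      exists K => z xz; have := HK z xz; rewrite /u; case: (leP 0 (uk s y z)) => // _ h.
      by rewrite normr0; apply: le_trans h.
    by move=> z _; rewrite lee_fin le_max lexx orbT.
  apply: (le_trans (integral_box_le hLam ix ae a1 _ _ _)).
  - by apply: measurable_maxr => //; exact: muk.
  - by move=> z; rewrite le_max lexx.
  - by move=> z k; rewrite /u uk_shift.
  apply: lee_wpmul2l; first by rewrite lee_fin.
  rewrite /J (bridge_one_time hB) //; last by rewrite s0 /=; lra.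
  have Ts : 0 < T - s by lra.
  have mprod : measurable_fun (C `&` per_box Lam x a) (fun z => (uk s y z * uk (T - s) z y)%:E).
    apply/measurable_EFinP; apply: measurable_funM.
      by apply: measurable_funS (muk s s0) => // z [].
    under eq_fun do rewrite unit_kernelC.
    by apply: measurable_funS (muk (T - s) Ts) => // z [].
  have pos z s' : 0 < s' -> C z -> 0 <= uk s' y z.
    by move=> s'0 Cz; exact: (unit_kernel_ge0 s'0 (hbr s'0 Cy Cz)).
  rewrite [per_box _ _ _ `&` _]setIC -ge0_integralZl //; last 2 first.
  - move=> z [Cz _]; rewrite lee_fin mulr_ge0 //; first exact: pos.
    by rewrite unit_kernelC; exact: pos.
  - by rewrite lee_fin invr_ge0 ltW.
  apply: ge0_le_integral => //.
  - by move=> z _; rewrite lee_fin le_max lexx.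
  - apply/measurable_EFinP; apply: measurable_maxr => //.
    by apply: measurable_funS (muk s s0) => // z [].
  - by apply: measurable_funeM.
  move=> z [Cz Az]; rewrite -EFinM lee_fin /u max_r ?pos //.
  rewrite mulrCA ler_peMr ?pos // ler_pdivlMl // mulr1.
  by apply: low => //; [exact: inA | apply/andP; split; lra].
have JT s : (J s <= (2 * D * 2 ^+ 6)%:E)%E.
  apply: (@le_trans _ _ (B setT)); last by rewrite (bridge_total T0 hB) lee_fin.
  by apply: le_measure; rewrite ?inE //; exact: measurable_at.
have IM s : 0 < s <= 1 -> I s <= M1.
  move=> s01; rewrite -lee_fin; apply: (le_trans (IJ s s01)).
  rewrite /M1 EFinM; apply: lee_wpmul2l; first by rewrite lee_fin.
  rewrite [_ / kap]mulrC EFinM; apply: lee_wpmul2l; last exact: JT.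
  by rewrite lee_fin invr_ge0 ltW.
have J0 : J n.+1%:R^-1 @[n --> \oo] --> 0%E.
  apply: (bridge_leaves_slowly T0 hB (r := a / 2)) => //; first by rewrite divr_gt0.
  by move=> z; apply: (far_apart_dist sep a0); lra.
have I0 (r : R) : 0 < r -> \forall n \near \oo, I n.+1%:R^-1 <= r.
  move=> r0.
  have K0 : (27%:E * ((kap^-1)%:E * J (n.+1%:R^-1)%R))%E @[n --> \oo] --> 0%E.
    rewrite [X in _ --> X](_ : 0 = 27%:E * ((kap^-1)%:E * 0))%E; last by rewrite !mule0.
    by apply: cvgeZl => //; apply: cvgeZl.
  have /K0 KK : nbhs (0 : \bar R)%E [set z : \bar R | (z < r%:E)%E].
    by apply: open_nbhs_nbhs; split; [exact: open_ereal_lt_ereal | rewrite /= lte_fin].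
  near=> n.
  have n1 : 0 < (n.+1%:R^-1 : R) <= 1 by rewrite invr_gt0 ltr0n /= invf_le1 ?ltr0n // ler1n.
  rewrite -lee_fin; apply: (le_trans (IJ _ n1)).
  by apply: ltW; near: n.
(* Duhamel's formula is for finite sums, so the series is truncated, uniformly in z and in s >= s0.
   In the bound del p^2 + q^2 / del of a product, the tail in q = |phi i y| does not depend on z and
   can be made small; the tail in p is only bounded, which fixes [del]. *)
have tail s0 eta : 0 < s0 <= 1 -> 0 < eta -> exists N, forall n s z, (N <= n)%N -> s0 <= s ->
    box x a z -> `|\sum_(k < n) kernel_term lam phi s y z k - uk s y z| <= eta.
  move=> /andP[s00 s01] eta0; have s02 : 0 < s0 < 2 by rewrite s00 /=; lra.
  pose Dz := D * (s0 / 2) ^- 6.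
  have Dz0 : 0 <= Dz by rewrite mulr_ge0 // invr_ge0 exprn_ge0 // divr_ge0 // ltW.
  pose del := eta / (2 * (Dz + 1)).
  have del0 : 0 < del by rewrite divr_gt0 // mulr_gt0 //; lra.
  pose v k := expR (- (lam k * s0)) * phi k y ^+ 2.
  have v0 k : 0 <= v k by rewrite mulr_ge0 ?expR_ge0 ?sqr_ge0.
  have cv : cvgn (series v).
    apply: nondecreasing_is_cvgn; first by apply: nondecreasing_series => n _ _.
    exists Dz => _ [n _ <-]; rewrite /series /= big_mkord.
    exact: (diagonal_sum_le HD).
  have /cauchy_cvgP/cauchy_seriesP/(_ (del * eta / 2)) [|[P Q] [/= [N1 _ PN] [N2 _ QN]] HPQ] := cv.
    by rewrite divr_gt0 // mulr_gt0.
  exists (maxn N1 N2) => n s z Nn ss xz; have sp : 0 < s by apply: lt_le_trans ss.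
  have [k ik] := inbox z xz; set z' := z + cell_shift Lam k in ik.
  rewrite -(uk_shift _ _ k) -(term_shift _ _ k) -/z'.
  have cu := cvg_unit_kernel hspec HD iy2 ik sp.
  have {}cu : (fun m => series (kernel_term lam phi s y z') n - series (kernel_term lam phi s y z') m) @ \oo -->
    series (kernel_term lam phi s y z') n - uk s y z' by apply: cvgB => //; exact: cvg_cst.
  rewrite -[\sum_(k < n) _](big_mkord xpredT (kernel_term lam phi s y z')).
  apply: (ler_cvg_to (cvg_norm cu) (cvg_cst eta)); near=> m.
  have nm : (n <= m)%N by near: m; exists n.
  rewrite distrC sub_series_geq //.
  apply: (le_trans (ler_norm_sum _ _ _)).
  apply: (@le_trans _ _ (\sum_(n <= i < m) (del * (expR (- (lam i * s0)) * phi i z' ^+ 2) + del^-1 * v i))).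
    apply: ler_sum => i _; rewrite /kernel_term -mulrA normrM (ger0_norm (expR_ge0 _)).
    apply: (@le_trans _ _ (expR (- (lam i * s0)) * (del * phi i z' ^+ 2 + del^-1 * phi i y ^+ 2))); last first.
      by rewrite /v mulrDr; apply: lerD; rewrite [leRHS]mulrCA.
    apply: ler_pM => //; first by rewrite ler_expR lerN2 ler_wpM2l // (eigenvalue_ge0 hspec).
    rewrite normrM -(real_normK (num_real (phi i z'))) -(real_normK (num_real (phi i y))).
    set p := `|phi i z'|; set q := `|phi i y|.
    have p0 : 0 <= p by exact: normr_ge0.
    have q0 : 0 <= q by exact: normr_ge0.
    rewrite -subr_ge0.
    have -> : del * p ^+ 2 + del^-1 * q ^+ 2 - q * p = del^-1 * ((del * p - q) ^+ 2 + del * p * q).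
      by field; rewrite gt_eqF.
    apply: mulr_ge0; first by rewrite invr_ge0 ltW.
    by apply: addr_ge0; [exact: sqr_ge0 | exact: mulr_ge0 (mulr_ge0 (ltW del0) p0) q0].
  rewrite big_split /= -!mulr_sumr.
  apply: (@le_trans _ _ (del * Dz + del^-1 * (del * eta / 2))).
    apply: lerD.
      rewrite ler_wpM2l ?(ltW del0) //.
      apply: (@le_trans _ _ (\sum_(i < m) expR (- (lam i * s0)) * phi i z' ^+ 2)); last exact: (diagonal_sum_le HD).
      rewrite -(big_mkord xpredT (fun i => expR (- (lam i * s0)) * phi i z' ^+ 2)).
      rewrite (big_cat_nat (n := n) (leq0n n) nm) /= lerDr; apply: sumr_ge0 => i _.
      by rewrite mulr_ge0 ?expR_ge0 ?sqr_ge0.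
    rewrite ler_wpM2l ?invr_ge0 ?(ltW del0) //.
    have : `|\sum_(n <= i < m) v i| < del * eta / 2.
      apply: (HPQ (n, m)); split => /=; [apply: PN => /=|apply: QN => /=].
        by apply: leq_trans Nn; exact: leq_maxl.
      by apply: leq_trans nm; apply: leq_trans Nn; exact: leq_maxr.
    by move=> h; apply: ltW; apply: le_lt_trans h; exact: ler_norm.
  have -> : del^-1 * (del * eta / 2) = eta / 2 by field; rewrite gt_eqF.
  rewrite /del; have -> : eta / (2 * (Dz + 1)) * Dz = eta / 2 * (Dz / (Dz + 1)) 
    by field; rewrite gt_eqF //; case: (ar1 _ Dz0).
  have [_ ] := ar1 _ Dz0.
  move=> h; have : eta / 2 * (Dz / (Dz + 1)) <= eta / 2 * 1 by rewrite ler_wpM2l //; lra.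
  by lra.
apply/ler_addgt0Pr => eps eps0.
have t20 : 0 < t / 2 by rewrite divr_gt0.
(* Chosen such that the initial term, at most (t / 2)^-3 times 16 eta, is at most c0 eps. *)
pose eta := Num.min 1 (eps * c0 * (t / 2) ^+ 3 / 16).
have eta0 : 0 < eta by rewrite lt_min ltr01 !mulr_gt0 ?exprn_gt0 ?invr_gt0.
near \oo => m.
have : m.+1%:R^-1 < t / 2 by near: m; exact: (near_infty_natSinv_lt (PosNum t20)).
have : I m.+1%:R^-1 <= 8 * eta by near: m; apply: I0; exact: mulr_gt0.
have : 0 < (m.+1%:R^-1 : R) by rewrite invr_gt0 ltr0n.
set s' : R := m.+1%:R^-1 => s'0 Is s't.
have s'1 : 0 < s' <= 1 by rewrite s'0 /=; lra.
have [N HN] := tail s' eta s'1 eta0.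
have pairing n (u : R3 R -> R) (U s : R) : (N <= n)%N -> s' <= s <= 1 -> bounded_measurable (box x a) u ->
    (forall z, box x a z -> `|u z| <= U) ->
    `|\int[vol]_(z in box x a) (u z * \sum_(k < n) kernel_term lam phi s y z k)| <= U * (I s + 8 * eta).
  move=> Nn /andP[ss s1] bu uU; have sp : 0 < s by apply: lt_le_trans ss.
  have U0 : 0 <= U.
    by apply: le_trans (uU x _) => //; split; rewrite subrr normr0 ltW.
  pose S z := \sum_(k < n) kernel_term lam phi s y z k.
  have bS : bounded_measurable (box x a) S.
    apply: bounded_measurable_sum => k.
    apply: (bounded_measurable_mul (f := fun=> expR (- (lam k * s)) * phi k y)).
      exact: bounded_measurable_cst.
    exact: (local_eigenfunction_bounded (local_eigenfunction_phi hLam hspec k ix ae)).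
  have iuS : vol.-integrable (box x a) (EFin \o (fun z => u z * S z)).
    by apply: bounded_measurable_integrable => //; exact: bounded_measurable_mul.
  have ue : bounded_measurable (box x a) (fun z => uk s y z + eta).
    by apply: bounded_measurable_add; [exact: bmuk | exact: bounded_measurable_cst].
  have icst (r : R) : vol.-integrable (box x a) (EFin \o (fun=> r)).
    by apply: bounded_measurable_integrable => //; exact: bounded_measurable_cst.
  apply: (le_trans (le_normr_Rintegral mb iuS)).
  apply: (@le_trans _ _ (\int[vol]_(z in box x a) (U * (uk s y z + eta)))).
    apply: le_Rintegral => //; first exact: integrable_norm iuS.
      apply: bounded_measurable_integrable => //.
      by apply: bounded_measurable_mul => //; exact: bounded_measurable_cst.
    move=> z xz; rewrite normrM ler_pM ?uU //.
    have uk0 : 0 <= uk s y z.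
      have [k [Ck _]] := inbox z xz; rewrite -(uk_shift _ _ k).
      exact: (unit_kernel_ge0 sp (hbr sp Cy Ck)).
    have := HN n s z Nn ss xz; rewrite -/(S z) => h.
    rewrite -[S z](subrK (uk s y z)); apply: (le_trans (ler_normD _ _)).
    by rewrite [leRHS]addrC (ger0_norm uk0) lerD.
  rewrite RintegralZl //; last exact: bounded_measurable_integrable.
  rewrite RintegralD //; last exact: iuk.
  rewrite Rintegral_cst // [fine _](_ : _ = (2 * a) ^+ 3); last by rewrite vol_box.
  rewrite ler_wpM2l // lerD // [leRHS]mulrC ler_wpM2l ?(ltW eta0) //.
  exact: ar4.
have GM : 0 <= G * (M1 + 8).
  apply: mulr_ge0 => //; apply: addr_ge0 => //; apply: mulr_ge0 => //.
  by apply: divr_ge0 (ltW kap0); rewrite !mulr_ge0.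
have [t'0 t'1 t'1w] := ar2 _ _ s'0 s't t1.
have t'01 : 0 < t - s' < 1 by rewrite t'0.
(* Duhamel's formula between the times s' and t, with the coefficients exp (- lam k s') phi k y of
   the truncated kernel. *)
have key n : (N <= n)%N ->
    c0 * `|\sum_(k < n) kernel_term lam phi t x y k| <= (t / 2) ^- 3 * (16 * eta) + G * (M1 + 8).
  move=> Nn.
  have := @local_duhamel R x a a0 n (fun k => lam k) (fun k => expR (- (lam k * s')) * phi k y)
    (fun k => phi k) (t - s') (G * (M1 + 8)) (fun k => local_eigenfunction_phi hLam hspec k ix ae) t'01.
  move=> /(_ _)/wrap[].
    move=> s /andP[s0 st]; have [b1 b2 b3 b4] := ar3 _ _ _ s0 st s'0 t1.
    under eq_Rintegral => z _.
      under eq_bigr => k _.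
        rewrite (_ : _ * _ * _ = kernel_term lam phi (s' + (t - s' - s)) y z k); last first.
          rewrite /kernel_term.
          have -> : - (lam k * (s' + (t - s' - s))) = - (lam k * s') + - (lam k * (t - s' - s)) by ring.
          by rewrite expRD; ring.
        over.
      over.
    apply: (@le_trans _ _ (G * (I (s' + (t - s' - s)) + 8 * eta))).
      apply: pairing => //.
      - by rewrite ?b1 ?b2 ?b3 ?b4 ?s0.
      - by apply: continuous_bounded_measurable => // z _; apply: continuous_psierr; rewrite gt_eqF.
      - by move=> z xz; apply: HG => //; rewrite ?b1 ?b2 ?b3 ?b4 ?s0.
    rewrite ler_wpM2l //; apply: lerD; first by apply: IM; rewrite ?b1 ?b2 ?b3 ?b4 ?s0.
    by rewrite -[leRHS]mulr1 ler_wpM2l // ge_min lexx.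
  have -> : \sum_(k < n) expR (- (lam k * s')) * phi k y * expR (- (lam k * (t - s'))) * phi k x =
      \sum_(k < n) kernel_term lam phi t x y k.
    apply: eq_bigr => k _; rewrite /kernel_term.
    have -> : - (lam k * t) = - (lam k * s') + - (lam k * (t - s')) by ring.
    by rewrite expRD; ring.
  move=> h; apply: (le_trans h); apply: lerD; last first.
    by apply: ler_piMr.
  under eq_Rintegral => z _.
    under eq_bigr => k _.
      rewrite (_ : _ * _ * _ = kernel_term lam phi s' y z k); last by rewrite /kernel_term; ring.
      over.
    over.
  apply: (@le_trans _ _ ((t / 2) ^- 3 * (I s' + 8 * eta))).
    apply: pairing => //; first by rewrite lexx; case/andP: s'1.
    - by apply: continuous_bounded_measurable => // z _; exact: continuous_psi.
    - move=> z _; rewrite ger0_norm ?psi_ge0 //; apply: (@le_trans _ _ ((t - s') ^- 3)).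
        by apply: psi_le => //; rewrite t'0 t'1w.
      by rewrite lef_pV2 ?posrE ?exprn_gt0 // ?lerXn2r ?nnegrE //; lra.
  by rewrite ler_wpM2l ?invr_ge0 ?exprn_ge0 ?(ltW t20) //; lra.
have cu := cvg_unit_kernel hspec HD (i2 _ ix) iy2 t0.
have {}cu : (fun n => c0 * `|series (kernel_term lam phi t x y) n|) @ \oo --> c0 * `|uk t x y|.
  by apply: cvgM; [exact: cvg_cst | exact: cvg_norm].
have : c0 * `|uk t x y| <= (t / 2) ^- 3 * (16 * eta) + G * (M1 + 8).
  apply: (ler_cvg_to cu (cvg_cst _)); near=> n.
  by rewrite /series /= big_mkord; apply: key; near: n; exists N.
have : (t / 2) ^- 3 * (16 * eta) <= c0 * eps.
  rewrite mulrC ler_pdivrMr ?exprn_gt0 // -ler_pdivlMl // ge_min; apply/orP; right.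
  by rewrite le_eqVlt; apply/orP; left; apply/eqP; field.
move=> h1 h2; rewrite -(ler_pM2l c00) mulrDr.
have -> : c0 * (G * (M1 + 8) / c0) = G * (M1 + 8) by rewrite mulrC divfK // gt_eqF.
by lra.
Unshelve. all: by end_near.
Qed.

End Uniform_bound.
End Off_diagonal.

Section Kernel_remainder.
Variables (R : realType) (Lam : domain R) (lam : nat -> R) (phi : nat -> R3 R -> R).
Local Notation C := (carrier Lam).
Local Notation uk := (unit_kernel lam phi).
Hypotheses (hLam : admissible_domain Lam) (hspec : laplace_spectrum Lam lam phi).
Variable bridge : R -> R3 R -> R3 R -> {measure set (trajectory R) -> \bar R}.
Hypothesis hbr : forall t x y, 0 < t -> C x -> C y ->
  brownian_bridge Lam lam phi 1 t x y (bridge t x y).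

(** The two bounds are what [grid_sum] needs near 0 and at infinity in order to sum the remainders
    over the loop lengths. Times below 1 use [off_diagonal_bound], later ones the spectral gap. *)
Lemma kernel_remainder (e : R) : 0 < e -> exists K, forall x y t,
  inner Lam e x -> inner Lam e y -> far_apart Lam e x y -> 0 < t ->
  let r := `|expR (lam 0%N * t) * uk t x y - phi 0%N x * phi 0%N y| in
  r <= K /\ t ^+ 2 * r <= K.
Proof.
move=> e0; have [D [D0 HD]] := diagonal_bound hLam hspec e0.
have [M HM] := off_diagonal_bound hLam hspec hbr e0.
pose A := expR (lam 1%N) * (2 * D * 4 ^+ 6).
have A0 : 0 <= A by rewrite mulr_ge0 ?expR_ge0 // !mulr_ge0.
pose P := expR (lam 0%N) * D * 2 ^+ 6.
have P0 : 0 <= P by rewrite !mulr_ge0 ?expR_ge0.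
pose g := lam 1%N - lam 0%N.
have g0 : 0 < g by rewrite subr_gt0; case: hspec => _ _ _ [].
have l0 := eigenvalue_ge0 hspec 0.
pose K1 := expR (lam 0%N) * `|M| + P.
pose K2 := A * (4 / g) ^+ 4.
have K20 : 0 <= K2 by rewrite mulr_ge0 // exprn_ge0 // divr_ge0 // ltW.
have K10 : 0 <= K1 by rewrite addr_ge0 // mulr_ge0 ?expR_ge0.
exists (K1 + K2) => x y t ix iy sep t0 r.
have [t1|t1] := ltP t 1.
  have rK : r <= K1.
    apply: (le_trans (ler_normB _ _)); apply: lerD.
      rewrite normrM (ger0_norm (expR_ge0 _)); apply: ler_pM; rewrite ?expR_ge0 //.
        by rewrite ler_expR ler_piMr // ltW.
      by apply: (le_trans (HM x y t ix iy sep _)); [rewrite t0 | exact: ler_norm].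
    have := phi_inner_le HD 0 ix; have := phi_inner_le HD 0 iy; rewrite -/P normrM.
    rewrite -(real_normK (num_real (phi 0%N x))) -(real_normK (num_real (phi 0%N y))).
    set u := `|phi 0%N x|; set v := `|phi 0%N y| => hv hu.
    have : 0 <= (u - v) ^+ 2 by rewrite sqr_ge0.
    by rewrite !expr2 in hu hv *; lra.
  split; first by lra.
  apply: (@le_trans _ _ r); last by lra.
  by apply: ler_piMl; [exact: normr_ge0 | rewrite exprn_ile1 // ltW].
have := unit_kernel_long_time hspec D0 HD ix iy t1; rewrite -/A -/g -/r => h.
have gt0 : 0 < g * t by rewrite mulr_gt0.
have h2 : r <= K2 * t ^- 4.
  apply: (le_trans h); rewrite /K2 -mulrA ler_wpM2l //.
  by apply: (le_trans (expRN_le gt0)); rewrite -exprVn -exprMn invfM mulrA.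
have tn : t != 0 by rewrite gt_eqF.
have r0 : 0 <= r by exact: normr_ge0.
have t21 : 1 <= t ^+ 2 by rewrite exprn_ege1.
have h3 : t ^+ 2 * r <= K2.
  apply: (@le_trans _ _ (t ^+ 2 * (K2 * t ^- 4))); first by rewrite ler_wpM2l // sqr_ge0.
  have -> : t ^+ 2 * (K2 * t ^- 4) = K2 * t ^- 2 by field.
  by rewrite ler_piMr // invf_le1 // exprn_gt0.
split; last by lra.
apply: (@le_trans _ _ (t ^+ 2 * r)); last by lra.
exact: ler_peMl.
Qed.

End Kernel_remainder.

(** * Law of the loop lengths in the soup *)

Section Soup_law.
Variable R : realType.

Lemma count_config_lengths (c : seq nat) l :
  count_mem l (config_lengths c) =
  if (0 < l <= size c)%N then nth 0%N c (size c - l) else 0%N.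
Proof.
elim: c => [|n c IH]; first by case: l.
rewrite /= count_cat count_nseq IH /=.
have [<-|ne] := eqVneq (size c).+1 l; first by rewrite subnn ltnn ltnS leqnn mul1n /= addn0.
rewrite mul0n add0n (_ : (l <= (size c).+1)%N = (l <= size c)%N); last first.
  by rewrite leq_eqVlt eq_sym (negbTE ne).
by case: ifP => // /andP[_ lc]; rewrite subSn.
Qed.

(** Independent Poisson probabilities multiply to [config_weight]; the index [size c - i.+1] undoes
    the downward listing. *)
Lemma prod_poisson_mass (t : nat -> R) (c : seq nat) :
  \prod_(i < size c) poisson_mass (t i.+1 / i.+1%:R) (nth 0%N c (size c - i.+1)) =
  expR (- \sum_(i < size c) t i.+1 / i.+1%:R) * config_weight t c.
Proof.
elim: c => [|n c IH]; first by rewrite !big_ord0 oppr0 expR0 mulr1.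
rewrite [size _]/= big_ord_recr /= subnn /=.
have -> : \prod_(i < size c) poisson_mass (t i.+1 / i.+1%:R) (nth 0%N (n :: c) ((size c).+1 - i.+1)) =
    expR (- \sum_(i < size c) t i.+1 / i.+1%:R) * config_weight t c.
  by rewrite -IH; apply: eq_bigr => i _; rewrite subSn //=.
rewrite big_ord_recr /= opprD expRD /poisson_mass; ring.
Qed.

Variables (P : probability (sample R) R) (N : nat) (I : set (loop R) -> \bar R) (t : nat -> R).
Hypothesis I_long : I [set l | (N < l.1)%N] = 0%E.
Hypothesis I_length : forall j, (0 < j <= N)%N -> I [set l | l.1 = j] = (t j / j%:R)%:E.
Hypothesis hP : poisson_point_process I P.

(** A sample may contain loops of length 0. They hold no particles, and dropping them makes the
    identities below true for every sample, not only almost surely. *)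
Definition loop_lengths (w : sample R) : seq nat := [seq j <- map fst w | (0 < j)%N].

(** The index 0 stands for all loops longer than N, whose number must be 0 according to [cnt]; an
    index i > 0 stands for the length i. *)
Let A (i : 'I_N.+1) : set (loop R) :=
  if i == 0%N :> nat then [set l | (N < l.1)%N] else [set l | l.1 = i :> nat].

Let cnt (c : seq nat) (i : 'I_N.+1) : nat := if i == 0%N :> nat then 0%N else nth 0%N c (N - i).

Let E (c : seq nat) : set (sample R) := [set w | forall i, count_in (A i) w = cnt c i].

Let mA i : measurable (A i).
Proof.
suff m (S : set nat) : measurable ([set l | S l.1] : set (loop R)).
  by rewrite /A; case: ifP => _; [exact: (m [set k | (N < k)%N]) | exact: (m [set k | k = i :> nat])].
by have := @measurable_fst _ _ nat (trajectory R) measurableT S Logic.I; rewrite setTI.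
Qed.

Let mE c : measurable (E c).
Proof.
have -> : E c = \bigcap_(i in [set: 'I_N.+1]) [set w | count_in (A i) w = cnt c i].
  by apply/seteqP; split => w h; [move=> i _; exact: h | move=> i; exact: h].
apply: fin_bigcap_measurable; first exact: finite_finset.
by move=> i _; apply: sub_sigma_algebra; exists (A i), (cnt c i); split; [exact: mA|].
Qed.

Let PE (c : N.-tuple 'I_N.+1) : P (E (map val c)) =
  (expR (- \sum_(i < N) t i.+1 / i.+1%:R) * config_weight t (map val c))%:E.
Proof.
pose r (i : 'I_N.+1) : R := if i == 0%N :> nat then 0 else t i / i%:R.
have -> : P (E (map val c)) = (\prod_(i < N.+1) poisson_mass (r i) (cnt (map val c) i))%:E.
  apply: (@hP _ A r (cnt (map val c)) mA).
    move=> i j _ _ [l []]; rewrite /A.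
    case: eqP => i0; case: eqP => j0 /=.
    - by move=> _ _; apply: val_inj; rewrite /= i0 j0.
    - by move=> h h'; have := ltn_ord j; rewrite -h' ltnS leqNgt h.
    - by move=> h' h; have := ltn_ord i; rewrite -h' ltnS leqNgt h.
    - by move=> h h'; apply: val_inj; rewrite /= -h -h'.
  move=> i; rewrite /A /r; case: eqP => i0; first exact: I_long.
  by rewrite I_length // lt0n -ltnS ltn_ord andbT; apply/eqP.
congr EFin; have szc : size (map val c) = N by rewrite size_map size_tuple.
have := prod_poisson_mass t (map val c); rewrite szc => <-.
rewrite big_ord_recl /= {1}/poisson_mass /r /cnt /= oppr0 expR0 mul1r expr0 fact0 divr1 mul1r.
by apply: eq_bigr => i _; rewrite /bump /= add1n.
Qed.

Let count_in_length (w : sample R) j : count_in [set l | l.1 = j] w = count_mem j (map fst w).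
Proof.
rewrite /count_in count_map; apply: eq_count => l /=.
by apply/asboolP/eqP.
Qed.

Let sumn_lengths (w : sample R) : sumn (loop_lengths w) = particles w.
Proof.
rewrite /particles sumnE /loop_lengths big_filter big_map big_mkcond /=.
by apply: eq_bigr => l _; case: posnP.
Qed.

Let E_perm (c : N.-tuple 'I_N.+1) w : E (map val c) w ->
  perm_eq (loop_lengths w) (config_lengths (map val c)).
Proof.
have szc : size (map val c) = N by rewrite size_map size_tuple.
move=> Ew; apply/allP => l _; apply/eqP.
rewrite count_config_lengths szc /loop_lengths count_filter.
have [->|l0] := posnP l.
  by rewrite (eq_count (a2 := pred0)) ?count_pred0 // => j /=; case: eqP => // ->.
rewrite (eq_count (a2 := pred1 l)); last by move=> j /=; case: eqP => // ->; rewrite l0.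
have [lN|Nl] := leqP l N.
  have := Ew (inord l); rewrite /A /cnt inordK ?ltnS // gtn_eqF //= => <-.
  by rewrite count_in_length.
have := Ew ord0; rewrite /A /cnt /= /count_in => h.
apply/eqP; rewrite -leqn0 -[X in (_ <= X)%N]h count_map; apply: sub_count => -[j w'] /= /eqP ->.
by apply/asboolP.
Qed.

Let E_exists w : (particles w <= N)%N -> exists c : N.-tuple 'I_N.+1, E (map val c) w.
Proof.
move=> wN.
have cntN j : (0 < j)%N -> (count_mem j (map fst w) <= N)%N.
  move=> j0; apply: leq_trans wN; rewrite /particles.
  elim: w => [|l w IH] //=; rewrite big_cons; apply: leq_add => //.
  by case: eqP => // ->.
exists [tuple inord (count_mem (N - i)%N (map fst w)) | i < N] => i.
rewrite /A /cnt; case: eqP => i0.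
  apply/eqP; rewrite -leqn0 leqNgt -has_count; apply/hasPn => l lw /=.
  apply/asboolP => Nl; move: wN; rewrite leqNgt /particles.
  by rewrite (perm_big _ (perm_to_rem lw)) big_cons (leq_trans Nl) // leq_addr.
have iN : (N - i < N)%N by have := ltn_ord i; move/eqP: i0; rewrite -lt0n; lia.
rewrite count_in_length -map_comp (nth_map (Ordinal iN)); last by rewrite -cardE card_ord.
rewrite /= nth_enum_ord // subKn; last by rewrite -ltnS.
by rewrite inordK // ltnS; apply: cntN; rewrite lt0n; apply/eqP.
Qed.

Let E_unique (c c' : N.-tuple 'I_N.+1) w : E (map val c) w -> E (map val c') w -> c = c'.
Proof.
move=> Ew Ew'; apply: eq_from_tnth => j.
have jN := ltn_ord j.
have ij : (N - j < N.+1)%N by rewrite ltnS leq_subr.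
have nj : (N - j)%N != 0%N by rewrite subn_eq0 -ltnNge.
have := Ew' (Ordinal ij); rewrite (Ew (Ordinal ij)) /cnt /= (negbTE nj) subKn; last exact: ltnW.
rewrite !(nth_map ord0) ?size_tuple // => h.
by rewrite !(tnth_nth ord0); apply: val_inj.
Qed.

Let canE n : (n <= N)%N -> canonical_event n =
  \bigcup_(c in [set c : N.-tuple 'I_N.+1 | sumn (config_lengths (map val c)) = n]) E (map val c).
Proof.
move=> nN; apply/seteqP; split => w.
  move=> wn; have [c Ec] : exists c : N.-tuple 'I_N.+1, E (map val c) w by apply: E_exists; rewrite wn.
  exists c => //=; have /perm_sumn := E_perm Ec; rewrite sumn_lengths => <-; exact: wn.
by move=> [c /= <- Ec]; have /perm_sumn <- := E_perm Ec; rewrite sumn_lengths.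
Qed.

Lemma measurable_canonical_event n : (n <= N)%N -> measurable (canonical_event n : set (sample R)).
Proof. by move=> nN; rewrite canE //; apply: fin_bigcup_measurable => //; exact: (sub_finite_set (@subsetT _ _) (finite_finset _)). Qed.

Let W := expR (- \sum_(i < N) t i.+1 / i.+1%:R).

(** The event of n particles is a finite disjoint union of events with prescribed multiplicities, on
    each of which [F] is constant; [loop_sum_config] resums their Poisson probabilities. *)
Lemma soup_integral n (F : seq nat -> R) : (n <= N)%N ->
  (forall s s', perm_eq s s' -> F s = F s') ->
  (\int[P]_(w in canonical_event n) (F (loop_lengths w))%:E = (W * loop_sum t n F)%:E)%E.
Proof.
move=> nN Fsym; have mD := measurable_canonical_event nN.
pose f (c : N.-tuple 'I_N.+1) := F (config_lengths (map val c)).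
pose J := [pred c : N.-tuple 'I_N.+1 | sumn (config_lengths (map val c)) == n].
transitivity (\int[P]_(w in canonical_event n)
    \sum_(c : N.-tuple 'I_N.+1 | J c) (f c)%:E * (\1_(E (map val c)) w)%:E)%E.
  apply: eq_integral => w; rewrite inE canE // => -[c /= cn Ec].
  have Jc : J c by apply/eqP.
  rewrite (bigD1 c) //= big1 ?adde0; last first.
    move=> c' /andP[_ cc']; rewrite indicE memNset ?mule0 // => Ec'.
    by case/eqP: cc'; exact: E_unique Ec' Ec.
  by rewrite indicE mem_set // mule1 /f (Fsym _ _ (E_perm Ec)).
have iE (c : N.-tuple 'I_N.+1) : P.-integrable (canonical_event n) (fun w => (\1_(E (map val c)) w)%:E).
  apply: (integrableS measurableT) => //; apply: integrable_indic => //.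
have iEf (c : N.-tuple 'I_N.+1) : P.-integrable (canonical_event n) (fun w => (f c)%:E * (\1_(E (map val c)) w)%:E)%E.
  by apply: integrableZl => //; exact: iE.
transitivity (\sum_(c : N.-tuple 'I_N.+1 | J c)
    \int[P]_(w in canonical_event n) ((f c)%:E * (\1_(E (map val c)) w)%:E))%E.
  by apply: integral_sum.
transitivity (\sum_(c : N.-tuple 'I_N.+1 | J c) ((f c * (W * config_weight t (map val c)))%:E))%E.
  apply: eq_bigr => c /eqP Jc; rewrite (integralZl mD (iE c)).
  rewrite integral_indic // (_ : E _ `&` _ = E (map val c)); last first.
    by apply: setIidl => w Ew; rewrite canE //; exists c.
  by rewrite [RHS]EFinM; congr (_ * _)%E; exact: PE.
rewrite sumEFin; congr EFin.
rewrite (@loop_sum_config R N N.+1) //; last first.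
  by move=> l /andP[Nl ln]; have := leq_trans Nl (leq_trans ln nN); rewrite ltnn.
by rewrite mulr_sumr; apply: eq_bigr => c _; rewrite /f; ring.
Qed.

Lemma soup_prob n (G : seq nat -> bool) : (n <= N)%N ->
  (forall s s', perm_eq s s' -> G s = G s') ->
  P ([set w | G (loop_lengths w)] `&` canonical_event n) =
  (W * loop_sum t n (fun s => (G s)%:R))%:E.
Proof.
move=> nN Gsym; rewrite -soup_integral //; last by move=> s s' /Gsym ->.
set S := _ `&` _; have mS : measurable S.
  have -> : S = \bigcup_(c in [set c : N.-tuple 'I_N.+1 | sumn (config_lengths (map val c)) = n /\ G (config_lengths (map val c))]) E (map val c).
    rewrite /S canE //; apply/seteqP; split => w.
      by move=> [/= Gw [c cn Ec]]; exists c => //; split => //; rewrite -(Gsym _ _ (E_perm Ec)).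
    by move=> [c [cn Gc] Ec]; split; [rewrite /= (Gsym _ _ (E_perm Ec)) | exists c].
  by apply: fin_bigcup_measurable => //; exact: (sub_finite_set (@subsetT _ _) (finite_finset _)).
have -> : P S = P (S `&` canonical_event n) by rewrite /S -setIA setIid.
rewrite -integral_indic //; last exact: measurable_canonical_event.
apply: eq_integral => w; rewrite inE => wn; rewrite indicE; congr (_%:R%:E)%R.
have [Gw|Gw] := boolP (G (loop_lengths w)); first by rewrite mem_set.
by rewrite memNset // => -[/= h _]; move/negP: Gw.
Qed.

End Soup_law.

(** * Heat trace and intensity of the soup *)

Section Soup_intensity.
Variables (R : realType) (Lam : domain R) (lam : nat -> R) (phi : nat -> R3 R -> R).
Local Notation vol := (vol R).
Local Notation C := (carrier Lam).
Hypotheses (hLam : admissible_domain Lam) (hspec : laplace_spectrum Lam lam phi).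
Variables (a1 a2 : R).
Hypothesis hexp : heat_expansion lam a1 a2.

Lemma powR_neg_half (u : R) : 0 < u -> u `^ (- (1 / 2)) = (Num.sqrt u)^-1.
Proof. by move=> u0; rewrite powRN mul1r powR12_sqrt // ltW. Qed.

Lemma powR_neg_three_half (u : R) : 0 < u -> u `^ (- (3 / 2)) = (Num.sqrt u) ^- 3.
Proof.
move=> u0; rewrite powRN; congr (_^-1); rewrite [3 / 2]mulrC powRrM powR12_sqrt ?(ltW u0) //.
by rewrite -powR_mulrn ?sqrtr_ge0.
Qed.

(** The limit of a divergent sequence defaults to 0, so convergence is not built into
    [heat_expansion]. A value 0 at a small time s would contradict the leading term of order
    s^(-3/2); comparison of series then gives all larger times. *)
Lemma cvg_heat_trace (t : R) : 0 < t ->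
  series (fun k => expR (- (lam k * t))) @ \oo --> heat_trace lam t.
Proof.
move=> t0; have [K HK] := hexp.
set a0 : R := (4 * pi) `^ (- (3 / 2)) in HK.
have a00 : 0 < a0 by rewrite powR_gt0 // mulr_gt0 // pi_gt0.
(* For s <= V^-2 the leading term exceeds the two others and the error K together. *)
pose V := (`|a1| + `|a2| + `|K| + 1) / a0 + 1.
have V1 : 1 <= V by rewrite lerDr divr_ge0 // ?(ltW a00) // !addr_ge0.
have V0 : 0 < V by lra.
near (0 : R)^'+ => s.
have s0 : 0 < s by near: s; exact: nbhs_right_gt.
have st : s < t by near: s; exact: nbhs_right_lt.
have sV : s <= V ^- 2 by near: s; apply: nbhs_right_le; rewrite invr_gt0 exprn_gt0.
have Ks : `|heat_trace lam s - (a0 * s `^ (- (3 / 2)) + a1 * s^-1 + a2 * s `^ (- (1 / 2)))| <= K.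
  by near: s.
have big : K < a0 * s `^ (- (3 / 2)) + a1 * s^-1 + a2 * s `^ (- (1 / 2)).
  rewrite powR_neg_half // powR_neg_three_half //.
  set v := (Num.sqrt s)^-1.
  have rs : 0 < Num.sqrt s by rewrite sqrtr_gt0.
  have vV : V <= v.
    rewrite -[V]invrK lef_pV2 ?posrE ?invr_gt0 // -[leRHS]ger0_norm ?invr_ge0 ?(ltW V0) //.
    by rewrite -sqrtr_sqr exprVn ler_wsqrtr.
  have -> : s^-1 = v ^+ 2 by rewrite /v exprVn sqr_sqrtr // ltW.
  have -> : (Num.sqrt s) ^- 3 = v ^+ 3 by rewrite /v exprVn.
  have v1 : 1 <= v by lra.
  have v2 : 1 <= v ^+ 2 by rewrite exprn_ege1.
  have vv : v <= v ^+ 2 by rewrite expr2 ler_peMr //; lra.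
  have h1 : - (`|a1| * v ^+ 2) <= a1 * v ^+ 2.
    by rewrite -mulNr ler_wpM2r ?sqr_ge0 // lerNl; have := ler_norm (- a1); rewrite normrN; lra.
  have h2 : - (`|a2| * v ^+ 2) <= a2 * v.
    apply: (@le_trans _ _ (- (`|a2| * v))); first by rewrite lerN2 ler_wpM2l.
    rewrite -mulNr ler_wpM2r //; first by lra.
    by have := ler_norm (- a2); rewrite normrN; lra.
  have h3 : (`|a1| + `|a2| + `|K| + 1) * v ^+ 2 <= a0 * v ^+ 3.
    have -> : a0 * v ^+ 3 = a0 * v * v ^+ 2 by ring.
    rewrite ler_wpM2r ?sqr_ge0 // [leRHS]mulrC -ler_pdivrMr //.
    by move: vV; rewrite /V; lra.
  have h4 : `|K| + 1 <= (`|K| + 1) * v ^+ 2 by rewrite ler_peMr // addr_ge0.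
  have := ler_norm K; move: h3; rewrite !mulrDl; lra.
have cs : cvgn (series (fun k => expR (- (lam k * s)))).
  apply: contrapT => ncv; have : heat_trace lam s = 0 by apply: (dvgP ncv).
  by move=> z0; move: Ks; rewrite z0 sub0r normrN => h; have := ler_norm (a0 * s `^ (- (3 / 2)) + a1 * s^-1 + a2 * s `^ (- (1 / 2))); lra.
apply: series_le_cvg cs => k; rewrite ?expR_ge0 // ler_expR lerN2.
by rewrite ler_wpM2l ?(ltW st) // (eigenvalue_ge0 hspec).
Unshelve. all: by end_near. Qed.

(** If the series diverges, both sides are the default value 0. *)
Lemma limn_series_fine (u : nat -> R) : (forall k, 0 <= u k) ->
  limn (series u) = fine (\sum_(k <oo) (u k)%:E)%E.
Proof.
move=> u0; have nd : nondecreasing_seq (series u) by apply: nondecreasing_series => k _ _.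
have E : (\sum_(k <oo) (u k)%:E)%E = limn (EFin \o series u).
  by congr (limn _); apply/funext => n; rewrite /= sumEFin.
have [cu|ncu] := pselect (cvgn (series u)); first by rewrite E EFin_lim.
rewrite (dvgP ncu) E; have -> // : limn (EFin \o series u) = +oo%E.
apply/cvg_lim => //; apply/cvgeryP; exact: nondecreasing_dvgn_lt.
Qed.

Section Diagonal.
Variable t : R.
Hypothesis t0 : 0 < t.
Let G z := (\sum_(k <oo) (kernel_term lam phi t z z k)%:E)%E.

Let k0 z k : 0 <= kernel_term lam phi t z z k.
Proof. by rewrite /kernel_term -mulrA mulr_ge0 ?expR_ge0 // -expr2 sqr_ge0. Qed.

Let G0 z : (0 <= G z)%E.
Proof. by apply: nneseries_ge0 => k _ _; rewrite lee_fin. Qed.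

Let ukG z : unit_kernel lam phi t z z = fine (G z).
Proof. exact: limn_series_fine. Qed.

Lemma unit_kernel_diag_ge0 z : 0 <= unit_kernel lam phi t z z.
Proof. by rewrite ukG fine_ge0. Qed.

Let mG : measurable_fun C G.
Proof.
apply: ge0_emeasurable_sum => k; first by move=> z _ _; rewrite lee_fin.
move=> _; apply/measurable_EFinP; apply: measurable_funM; last exact: (measurable_phi hLam hspec).
by apply: measurable_funM => //; exact: (measurable_phi hLam hspec).
Qed.

Lemma measurable_unit_kernel_diag : measurable_fun C (fun z => unit_kernel lam phi t z z).
Proof.
under eq_fun do rewrite ukG.
by apply: measurableT_comp mG => //; exact: measurable_fine.
Qed.

(** Monotone convergence gives the integral of the extended-valued series [G]. The kernel is its
    real part [fine], and agrees with it almost everywhere because [G] is integrable. *)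
Lemma integral_unit_kernel :
  (\int[vol]_(z in C) (unit_kernel lam phi t z z)%:E = (heat_trace lam t)%:E)%E.
Proof.
have mC := measurable_carrier hLam.
have mp k := measurable_phi hLam hspec k.
have IG : (\int[vol]_(z in C) G z = (heat_trace lam t)%:E)%E.
  rewrite integral_nneseries //; first last.
  - by move=> k z _; rewrite lee_fin.
  - move=> k; apply/measurable_EFinP; apply: measurable_funM => //.
    by apply: measurable_funM.
  have -> : (heat_trace lam t)%:E = limn (EFin \o series (fun k => expR (- (lam k * t)))).
    by rewrite EFin_lim //; apply: cvgP; exact: cvg_heat_trace.
  congr (lim (_ @ \oo)); apply/funext => n; rewrite /= /series /= -sumEFin; apply: eq_bigr => k _.
  under eq_integral => z _ do rewrite /kernel_term -mulrA EFinM.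
  rewrite ge0_integralZl_EFin ?expR_ge0 //.
  - by case: hspec => _ orth _ _ _; rewrite orth eqxx mule1.
  - by move=> z _; rewrite lee_fin -expr2 sqr_ge0.
  - by apply/measurable_EFinP; apply: measurable_funM.
have iG : vol.-integrable C G.
  apply/integrableP; split => //.
  rewrite (_ : (\int[vol]_(z in C) `|G z|)%E = (\int[vol]_(z in C) G z)%E); last first.
    by apply: eq_integral => z _; rewrite gee0_abs.
  by rewrite IG ltry.
rewrite -IG; apply: ae_eq_integral => //.
  by apply/measurable_EFinP; exact: measurable_unit_kernel_diag.
have [S [mS S0 SP]] := integrable_ae mC iG.
exists S; split => //; apply: subset_trans SP => z /= h Cz.
by apply: h => Cz'; rewrite ukG fineK //; exact: Cz.
Qed.

End Diagonal.

Lemma integral_heat_kernel (L t : R) : 0 < L -> 0 < t ->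
  (\int[vol]_(x in dilate L C) (heat_kernel lam phi L t x x)%:E = (heat_trace lam (t * L ^- 2))%:E)%E.
Proof.
move=> L0 t0; have tL : 0 < t * L ^- 2 by rewrite mulr_gt0 // invr_gt0 exprn_gt0.
have Li0 : 0 < L^-1 by rewrite invr_gt0.
have L30 : 0 <= L ^- 3 by rewrite invr_ge0 exprn_ge0 // ltW.
pose aff := affine L^-1 (0 : R3 R).
have -> : dilate L C = aff @^-1` C.
  by apply/seteqP; split => z; rewrite /dilate /aff /affine /= addr0.
have mC := measurable_carrier hLam.
pose f z := ((L ^- 3) * unit_kernel lam phi (t * L ^- 2) z z)%:E.
transitivity (\int[vol]_(z in aff @^-1` C) f (aff z))%E.
  by apply: eq_integral => z _; rewrite /f /aff /affine addr0 heat_kernelE.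
have mu := measurable_unit_kernel_diag (t * L ^- 2).
rewrite ge0_integral_affine //; last 2 first.
- by apply/measurable_EFinP; apply: measurable_funM.
- by move=> z; rewrite lee_fin mulr_ge0 // unit_kernel_diag_ge0.
under eq_integral => z _ do rewrite /f EFinM.
rewrite ge0_integralZl_EFin //.
- have e1 : L^-1 ^- 3 * L ^- 3 = 1 :> R by field; rewrite gt_eqF.
  by rewrite integral_unit_kernel // -!EFinM mulrA e1 mul1r.
- by move=> z _; rewrite lee_fin unit_kernel_diag_ge0.
- exact/measurable_EFinP.
Qed.

Variables (beta L : R) (N : nat).
Hypotheses (beta0 : 0 < beta) (L0 : 0 < L).
Variable bridge : R -> R -> R3 R -> R3 R -> {measure set (trajectory R) -> \bar R}.
Hypothesis hbridge : forall (t : R) x y, 0 < t -> dilate L C x -> dilate L C y ->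
  brownian_bridge Lam lam phi L t x y (bridge L t x y).

Let total j x : (0 < j)%N -> dilate L C x ->
  bridge L (beta * j%:R) x x setT = (heat_kernel lam phi L (beta * j%:R) x x)%:E.
Proof.
move=> j0 Cx; have bj : 0 < beta * j%:R by rewrite mulr_gt0 // ltr0n.
have [fdd _] := hbridge bj Cx Cx; have := fdd [::]; rewrite big_nil => /(_ _ bj) H.
have -> : [set: trajectory R] = [set w | visits 0 [::] w] by apply/seteqP; split.
by rewrite H.
Qed.

Lemma loop_intensity_length j : (0 < j <= N)%N ->
  loop_intensity Lam beta L N bridge [set l | l.1 = j] =
  (heat_trace lam (beta * j%:R * L ^- 2) / j%:R)%:E.
Proof.
move=> /andP[j0 jN]; rewrite /loop_intensity (bigD1_seq j) /=; first last.
- exact: iota_uniq.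
- by rewrite mem_index_iota j0 ltnS.
rewrite big1_seq ?adde0; last first.
  move=> i /andP[ij _]; rewrite integral0_eq ?mule0 // => x Cx.
  have -> : [set w : trajectory R | [set l : loop R | l.1 = j] (i, w)] = set0.
    by apply/seteqP; split => w //= e; rewrite e eqxx in ij.
  exact: measure0.
have -> : (\int[vol]_(x in dilate L C) bridge L (beta * j%:R)%R x x
      [set w | [set l : loop R | l.1 = j] (j, w)] =
    \int[vol]_(x in dilate L C) (heat_kernel lam phi L (beta * j%:R) x x)%:E)%E.
  apply: eq_integral => x; rewrite inE => Cx; rewrite -total //.
  by congr (bridge _ _ _ _ _); apply/seteqP; split.
rewrite integral_heat_kernel //; last by rewrite mulr_gt0 // ltr0n.
by rewrite -EFinM mulrC.
Qed.

Lemma loop_intensity_long : loop_intensity Lam beta L N bridge [set l | (N < l.1)%N] = 0%E.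
Proof.
rewrite /loop_intensity big_nat_cond big1 // => j /andP[/andP[j0 jN] _].
rewrite integral0_eq ?mule0 // => x Cx.
have -> : [set w : trajectory R | [set l : loop R | (N < l.1)%N] (j, w)] = set0.
  by apply/seteqP; split => w //=; rewrite ltnNge -ltnS jN.
exact: measure0.
Qed.

End Soup_intensity.

(** * Sums over a fine grid *)

Section Sums_over_a_grid.
Variable R : realType.
Local Notation sqrt := (@Num.sqrt R).

Lemma sqrt_natS_gt0 j : 0 < sqrt j.+1%:R.
Proof. by rewrite sqrtr_gt0 ltr0n. Qed.

Lemma sum_inv_sqrt k : \sum_(j < k) (sqrt j.+1%:R)^-1 <= 2 * sqrt k%:R.
Proof.
elim: k => [|k IH]; first by rewrite big_ord0 sqrtr0 mulr0.
rewrite big_ord_recr /=; apply: (le_trans (lerD IH (lexx _))).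
have s0 := sqrt_natS_gt0 k; set s := sqrt k.+1%:R in s0 *; set v := sqrt k%:R.
have v0 : 0 <= v by exact: sqrtr_ge0.
have s2 : s ^+ 2 = v ^+ 2 + 1 by rewrite !sqr_sqrtr ?ler0n // -natr1.
rewrite -(ler_pM2r s0) mulrDl mulVf ?gt_eqF //.
have : 0 <= (s - v) ^+ 2 by exact: sqr_ge0.
by move: s2; rewrite !expr2; nra.
Qed.

(** Telescoping: (j + 1)^(-3/2) is at most twice the decrease of 1 / sqrt from j to j + 1. *)
Lemma sum_three_half_tail k m : (0 < k)%N ->
  \sum_(k <= j < k + m) (sqrt j.+1%:R) ^- 3 <= 2 * ((sqrt k%:R)^-1 - (sqrt (k + m)%:R)^-1).
Proof.
move=> k0; elim: m => [|m IH]; first by rewrite addn0 big_geq // subrr mulr0.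
rewrite addnS big_nat_recr ?leq_addr //=; apply: (le_trans (lerD IH (lexx _))).
have n0 : (0 < k + m)%N by rewrite addn_gt0 k0.
set n := (k + m)%N in n0 *.
have s0 := sqrt_natS_gt0 n; set s := sqrt n.+1%:R in s0 *.
have v0 : 0 < sqrt n%:R by rewrite sqrtr_gt0 ltr0n.
set v := sqrt n%:R in v0 *.
have s2 : s ^+ 2 = v ^+ 2 + 1 by rewrite !sqr_sqrtr ?ler0n // -natr1.
suff : s ^- 3 <= 2 * (v^-1 - s^-1) by lra.
have sv : v <= s by rewrite ler_wsqrtr // ler_nat.
have -> : v^-1 - s^-1 = (s ^+ 2 - v ^+ 2) / (s * v * (s + v)).
  by field; rewrite !gt_eqF // addr_gt0.
have -> : s ^+ 2 - v ^+ 2 = 1 by rewrite s2 addrAC subrr add0r.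
rewrite mul1r ler_pdivlMr; last by rewrite !mulr_gt0 // addr_gt0.
have sv0 : 0 <= s - v by lra.
apply: (@le_trans _ _ (s ^- 3 * (2 * s ^+ 3))); last by rewrite mulrCA mulVf ?mulr1 // gt_eqF // exprn_gt0.
rewrite ler_wpM2l ?invr_ge0 ?exprn_ge0 ?(ltW s0) //.
have : 0 <= s * (s - v) * (2 * s + v).
  by rewrite mulr_ge0 ?mulr_ge0 ?(ltW s0) //; lra.
by rewrite !exprS expr0; nra.
Qed.

Lemma sum_inv_square_tail k m : (0 < k)%N ->
  \sum_(k <= j < k + m) (j.+1%:R ^- 2 : R) <= k%:R^-1.
Proof.
move=> k0; suff : \sum_(k <= j < k + m) (j.+1%:R ^- 2 : R) <= k%:R^-1 - (k + m)%:R^-1.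
  by move=> h; apply: (le_trans h); rewrite gerBl invr_ge0 ler0n.
elim: m => [|m IH]; first by rewrite addn0 big_geq // subrr.
rewrite addnS big_nat_recr ?leq_addr //=; apply: (le_trans (lerD IH (lexx _))).
have n0 : 0 < ((k + m)%:R : R) by rewrite ltr0n addn_gt0 k0.
rewrite -natr1; set n := (k + m)%:R in n0 *.
suff : (n + 1) ^- 2 <= n^-1 - (n + 1)^-1 by lra.
have n10 : 0 < n + 1 by lra.
have -> : n^-1 - (n + 1)^-1 = (n * (n + 1))^-1 
  by field; apply/andP; split; apply/eqP; lra.
by rewrite lef_pV2 ?posrE ?exprn_gt0 ?mulr_gt0 // expr2 ler_wpM2r //; lra.
Qed.

Lemma sum_inv_ln k : (0 < k)%N ->
  ln k.+1%:R <= \sum_(j < k) (j.+1%:R^-1 : R) <= 1 + ln k%:R.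
Proof.
have up (j : nat) : ln j.+2%:R <= ln j.+1%:R + (j.+1%:R^-1 : R).
  have j0 : 0 < (j.+1%:R : R) by rewrite ltr0n.
  have -> : (j.+2%:R : R) = j.+1%:R * (1 + j.+1%:R^-1) by rewrite mulrDr mulr1 divff ?gt_eqF // -natr1.
  rewrite lnM ?posrE ?addr_gt0 ?invr_gt0 // lerD2l.
  by apply: le_ln1Dx; apply: lt_le_trans (_ : 0 <= _); rewrite ?invr_ge0 ?ltW //; lra.
have dn (j : nat) : ln j.+1%:R + (j.+2%:R^-1 : R) <= ln j.+2%:R.
  have j0 : 0 < (j.+1%:R : R) by rewrite ltr0n.
  have j1 : 0 < (j.+2%:R : R) by rewrite ltr0n.
  have -> : ln j.+1%:R = ln j.+2%:R + ln (1 - j.+2%:R^-1 : R).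
    rewrite -lnM ?posrE //; last by rewrite subr_gt0 invf_lt1 // ltr1n.
    by congr ln; rewrite mulrBr mulr1 divff ?gt_eqF // -[j.+2%:R]natr1 addrK.
  have : ln (1 - j.+2%:R^-1 : R) <= - j.+2%:R^-1.
    by apply: le_ln1Dx; rewrite ltrN2 invf_lt1 // ltr1n.
  by move=> h; rewrite -[leRHS]addr0 -addrA lerD2l -lerBrDr sub0r.
elim: k => // -[|k] IH _; first by rewrite big_ord1 invr1 ln1 addr0 lexx andbT; have := up 0%N; rewrite ln1 invr1 add0r.
have /andP[l u] := IH isT; rewrite big_ord_recr /=; apply/andP; split.
  by apply: (le_trans (up k.+1)); rewrite lerD2r.
by apply: (le_trans (lerD u (lexx _))); rewrite -addrA lerD2l dn.
Qed.

Lemma zeta_sum_bound k : (0 < k)%N ->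
  \sum_(j < k) (sqrt j.+1%:R) ^- 3 <= zeta (3 / 2 : R) <=
  \sum_(j < k) (sqrt j.+1%:R) ^- 3 + 2 * (sqrt k%:R)^-1.
Proof.
move=> k0; pose u j : R := (sqrt j.+1%:R) ^- 3.
have u0 j : 0 <= u j by rewrite invr_ge0 exprn_ge0 // sqrtr_ge0.
have E : zeta (3 / 2 : R) = limn (series u).
  rewrite /zeta; congr (lim (series _ @ \oo)); apply/funext => j.
  by rewrite powR_neg_three_half // ltr0n.
have ub n : series u n <= \sum_(j < k) u j + 2 * (sqrt k%:R)^-1.
  have h : series u (k + n) <= \sum_(j < k) u j + 2 * (sqrt k%:R)^-1.
    rewrite /series /= (big_cat_nat (n := k)) ?leq_addr //= big_mkord lerD2l.
    apply: (le_trans (sum_three_half_tail n k0)).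
    by rewrite ler_wpM2l // gerBl invr_ge0 sqrtr_ge0.
  apply: le_trans h; have := @nondecreasing_series R u xpredT 0 (fun n _ _ => u0 n).
  by apply; rewrite leq_addl.
have nd : nondecreasing_seq (series u) by apply: nondecreasing_series => n _ _.
have cu : cvgn (series u).
  by apply: nondecreasing_is_cvgn => //; exists (\sum_(j < k) u j + 2 * (sqrt k%:R)^-1) => _ [n _ <-].
rewrite E; apply/andP; split.
  by have := nondecreasing_cvgn_le nd cu k; rewrite /series /= big_mkord.
by apply: limr_le => //; apply: nearW.
Qed.

(* The grid of mesh 1 / x, up to a point n / x >= 1. *)
Lemma grid_sum (f : R -> R) (A B C x : R) n : 1 <= x -> x <= n%:R ->
  (forall u, 0 < u <= 1 -> `|f u - A * (sqrt u) ^- 3 - B * u^-1| <= C * (sqrt u)^-1) ->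
  (forall u, 1 <= u -> `|f u| <= C * u ^- 2) ->
  `|\sum_(j < n) f (j.+1%:R / x) - A * zeta (3 / 2 : R) * (sqrt x) ^+ 3 - B * x * ln x| <=
  (4 * `|A| + `|B| + 4 * C) * x.
Proof.
move=> x1 xn f1 f2; have x0 : 0 < x by lra.
have sx0 : 0 < sqrt x by rewrite sqrtr_gt0.
have sx2 : sqrt x ^+ 2 = x by rewrite sqr_sqrtr // ltW.
have C0 : 0 <= C.
  have := f2 1 (lexx _); rewrite expr1n invr1 mulr1; exact: le_trans.
(* The sum is cut at u = 1: the expansion at 0 applies below, the decay above. *)
pose k := Num.truncn x.
have /andP[kx xk] : k%:R <= x < k.+1%:R by apply: truncn_itv; exact: ltW.
have k0 : (0 < k)%N.
  by case: (k) xk => // h; have := lt_le_trans h x1; rewrite ltxx.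
have kn : (k <= n)%N by rewrite -(ler_nat R); lra.
have k1 : 1 <= (k%:R : R) by rewrite ler1n.
have xk2 : x <= 2 * k%:R by move: xk; rewrite -natr1; lra.
have ne (j : nat) : (j.+1%:R : R) != 0 by rewrite pnatr_eq0.
have su (j : nat) : sqrt (j.+1%:R / x) = sqrt j.+1%:R / sqrt x.
  by rewrite sqrtrM ?ler0n // sqrtrV // ltW.
rewrite -(big_mkord xpredT (fun j => f (j.+1%:R / x))) (big_cat_nat (n := k)) //= big_mkord.
set S1 := \sum_(i < k) _; set S2 := \sum_(k <= i < n) _.
have t2 : `|S2| <= 2 * C * x.
  apply: (le_trans (ler_norm_sum _ _ _)).
  apply: (@le_trans _ _ (C * x ^+ 2 * \sum_(k <= j < k + (n - k)) (j.+1%:R ^- 2 : R))).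
    rewrite subnKC // mulr_sumr big_nat_cond [leRHS]big_nat_cond; apply: ler_sum => j /andP[/andP[kj _] _].
    have -> : C * x ^+ 2 * j.+1%:R ^- 2 = C * (j.+1%:R / x) ^- 2.
      by field; rewrite gt_eqF //= ne.
    apply: f2; rewrite ler_pdivlMr // mul1r; apply: (le_trans (ltW xk)).
    by rewrite ler_nat ltnS.
  apply: (@le_trans _ _ (C * x ^+ 2 * k%:R^-1)).
    by apply: ler_wpM2l; [rewrite mulr_ge0 ?sqr_ge0 | exact: sum_inv_square_tail].
  rewrite ler_pdivrMr ?ltr0n // expr2.
  have : 0 <= C * x * (2 * k%:R - x) by rewrite !mulr_ge0 // ?(ltW x0) // subr_ge0.
  by rewrite !mulrBr; nra.
pose S3 := \sum_(j < k) (A * (sqrt (j.+1%:R / x)) ^- 3 + B * (j.+1%:R / x)^-1).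
have t1 : `|S1 - S3| <= 2 * C * x.
  rewrite -sumrB; apply: (le_trans (ler_norm_sum _ _ _)).
  apply: (@le_trans _ _ (C * sqrt x * \sum_(j < k) (sqrt j.+1%:R)^-1)).
    rewrite mulr_sumr; apply: ler_sum => j _; rewrite opprD addrA.
    have -> : C * sqrt x * (sqrt j.+1%:R)^-1 = C * (sqrt (j.+1%:R / x))^-1.
      by rewrite su invfM invrK mulrA mulrAC.
    apply: f1; rewrite divr_gt0 ?ltr0n //= ler_pdivrMr // mul1r.
    by apply: le_trans kx; rewrite ler_nat.
  apply: (@le_trans _ _ (C * sqrt x * (2 * sqrt k%:R))).
    by rewrite ler_wpM2l ?mulr_ge0 ?(ltW sx0) // sum_inv_sqrt.
  apply: (@le_trans _ _ (C * sqrt x * (2 * sqrt x))).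
    by rewrite ler_wpM2l ?mulr_ge0 ?(ltW sx0) // ler_wpM2l // ler_wsqrtr.
  by rewrite -{3}sx2 expr2; lra.
have E3 : S3 = A * sqrt x ^+ 3 * \sum_(j < k) (sqrt j.+1%:R) ^- 3 + B * x * \sum_(j < k) (j.+1%:R^-1 : R).
  rewrite !mulr_sumr -big_split /=; apply: eq_bigr => j _; rewrite su.
  have gen (y s r : R) : y != 0 -> s != 0 -> r != 0 ->
      A * (s / r) ^- 3 + B * (y / x)^-1 = A * r ^+ 3 * s ^- 3 + B * x * y^-1.
    by move=> y1 s1 r1; field; rewrite y1 s1 r1 gt_eqF.
  by apply: gen; rewrite ?ne ?gt_eqF // sqrt_natS_gt0.
(* Completing the partial sum to zeta costs x^(3/2) times 2 / sqrt k, which is of order x. *)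
have z3 : `|A * sqrt x ^+ 3 * \sum_(j < k) (sqrt j.+1%:R) ^- 3 - A * zeta (3 / 2 : R) * sqrt x ^+ 3| <= 4 * `|A| * x.
  set s := \sum_(j < k) _; have /andP[z1 z2] := zeta_sum_bound k0.
  have -> : A * sqrt x ^+ 3 * s - A * zeta (3 / 2 : R) * sqrt x ^+ 3 = - (A * (sqrt x ^+ 3 * (zeta (3 / 2 : R) - s))) by ring.
  have -> : 4 * `|A| * x = `|A| * (4 * x) by ring.
  rewrite normrN normrM; apply: ler_wpM2l => //.
  rewrite ger0_norm; last by rewrite mulr_ge0 ?exprn_ge0 ?(ltW sx0) // subr_ge0.
  have sk0 : 0 < sqrt k%:R by rewrite sqrtr_gt0 ltr0n.
  apply: (@le_trans _ _ (sqrt x ^+ 3 * (2 * (sqrt k%:R)^-1))).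
    by rewrite ler_wpM2l ?exprn_ge0 ?(ltW sx0) // lerBlDl.
  rewrite mulrA ler_pdivrMr // -{2}sx2.
  have : sqrt x <= 2 * sqrt k%:R.
    rewrite -(ler_pXn2r (n := 2)) ?nnegrE ?mulr_ge0 ?(ltW sx0) ?(ltW sk0) //.
    by rewrite exprMn !sqr_sqrtr ?ler0n ?(ltW x0) //; lra.
  move=> h; have : 0 <= sqrt x ^+ 2 * 2 * (2 * sqrt k%:R - sqrt x).
    by rewrite !mulr_ge0 ?sqr_ge0 // subr_ge0.
  by rewrite exprS; set a := sqrt x ^+ 2; nra.
have l3 : `|B * x * \sum_(j < k) (j.+1%:R^-1 : R) - B * x * ln x| <= `|B| * x.
  rewrite -mulrBr normrM normrM (ger0_norm (ltW x0)) -[leRHS]mulr1 ler_wpM2l ?mulr_ge0 ?(ltW x0) //.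
  have /andP[h1 h2] := sum_inv_ln k0.
  have : ln x <= ln k.+1%:R by rewrite ler_ln ?posrE ?ltr0n // ltW.
  have : ln k%:R <= ln x by rewrite ler_ln ?posrE ?ltr0n.
  by move=> h3 h4; rewrite ler_norml; apply/andP; split; lra.
have -> : S1 + S2 - A * zeta (3 / 2 : R) * sqrt x ^+ 3 - B * x * ln x = (S1 - S3) + S2 +
   (A * sqrt x ^+ 3 * \sum_(j < k) (sqrt j.+1%:R) ^- 3 - A * zeta (3 / 2 : R) * sqrt x ^+ 3) +
   (B * x * \sum_(j < k) (j.+1%:R^-1 : R) - B * x * ln x) by rewrite E3; ring.
apply: (le_trans (ler_normD _ _)); apply: (le_trans (lerD (ler_normD _ _) (lexx _))).
apply: (le_trans (lerD (lerD (ler_normD _ _) (lexx _)) (lexx _))).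
by move: t1 t2 z3 l3; lra.
Qed.

End Sums_over_a_grid.

Definition weyl_constant (R : realType) : R := (4 * pi) `^ (- (3 / 2)).

(** * The trace without its ground state *)

Section Trace_expansion.
Variables (R : realType) (Lam : domain R) (lam : nat -> R) (phi : nat -> R3 R -> R).
Local Notation sqrt := (@Num.sqrt R).
Hypothesis hspec : laplace_spectrum Lam lam phi.
Variables (a1 a2 : R).
Hypothesis hexp : heat_expansion lam a1 a2.

Local Notation Z := (heat_trace lam).
Local Notation a0 := (weyl_constant R).

(** The sum of exp (- (lam k - lam 0) u) over the excited states k >= 1; the ground state, once
    tilted, is the subtracted 1. *)
Definition excess (u : R) : R := expR (lam 0%N * u) * Z u - 1.

Let l0 : 0 <= lam 0%N. Proof. exact: eigenvalue_ge0 hspec 0. Qed.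

Let cZ (u : R) : 0 < u -> series (fun k => expR (- (lam k * u))) @ \oo --> Z u.
Proof. exact: (cvg_heat_trace hspec hexp). Qed.

Let Z_partial (u : R) n : 0 < u -> \sum_(k < n) expR (- (lam k * u)) <= Z u.
Proof.
move=> u0; have nd : nondecreasing_seq (series (fun k => expR (- (lam k * u)))).
  by apply: nondecreasing_series => k _ _; exact: expR_ge0.
have := nondecreasing_cvgn_le nd (cvgP _ (cZ u0)) n.
by rewrite (cvg_lim _ (cZ u0)) // /series /= big_mkord.
Qed.

Lemma heat_trace_ge0 (u : R) : 0 < u -> 0 <= Z u.
Proof. by move=> u0; have := Z_partial 0 u0; rewrite big_ord0. Qed.

Lemma excess_ge0 (u : R) : 0 < u -> 0 <= excess u.
Proof.
move=> u0; rewrite subr_ge0; have := Z_partial 1 u0; rewrite big_ord1 => h.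
rewrite -(ler_pM2l (expR_gt0 (- (lam 0%N * u)))) mulr1 mulrA -expRD addNr expR0 mul1r.
by rewrite mulrC in h *.
Qed.

Lemma heat_traceE (u : R) : Z u = expR (- (lam 0%N * u)) * (1 + excess u).
Proof. by rewrite /excess addrC subrK mulrA -expRD addNr expR0 mul1r. Qed.

Let Z_le (u v : R) : 0 < v -> v <= u -> Z u <= Z v.
Proof.
move=> v0 vu; have u0 : 0 < u by apply: lt_le_trans vu.
apply: (ler_cvg_to (cZ u0) (cZ v0)); apply: nearW => n; apply: ler_sum => k _.
by rewrite ler_expR lerN2 ler_wpM2l // (eigenvalue_ge0 hspec).
Qed.

(** The gap yields exponential decay; the power 3 leaves u^-2 after the multiplication by u in
    [excess_moment]. *)
Lemma excess_decay : exists K, 0 <= K /\ forall u, 1 <= u -> excess u <= K * u ^- 3.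
Proof.
pose g := lam 1%N - lam 0%N.
have g0 : 0 < g by rewrite subr_gt0; case: hspec => _ _ _ [].
have h0 : 0 < (2^-1 : R) by rewrite invr_gt0.
pose K := expR (lam 0%N / 2) * Z 2^-1 * (8 / g) ^+ 4.
have K0 : 0 <= K.
  apply: mulr_ge0; first by rewrite mulr_ge0 ?expR_ge0 ?heat_trace_ge0.
  by rewrite exprn_ge0 // divr_ge0 // ltW.
exists K; split => // u u1; have u0 : 0 < u by apply: lt_le_trans u1.
have step : excess u <= expR (- (g * (u / 2))) * (expR (lam 0%N / 2) * Z 2^-1).
  have cl : (fun n => expR (lam 0%N * u) * series (fun k => expR (- (lam k * u))) n.+1 - 1) @ \oo --> excess u.
    apply: cvgB; last exact: cvg_cst.
    apply: cvgM; first exact: cvg_cst.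
    by have := cZ u0; rewrite -(cvg_shiftS (series _)).
  apply: (ler_cvg_to cl (cvg_cst _)); apply: nearW => n.
  rewrite /series /= big_mkord big_ord_recl mulrDr -expRD subrr expR0 addrAC subrr add0r mulr_sumr.
  apply: (@le_trans _ _ (expR (- (g * (u / 2))) * (expR (lam 0%N / 2) * \sum_(k < n.+1) expR (- (lam k * 2^-1))))).
    rewrite big_ord_recl !mulrDr -[leLHS]add0r; apply: lerD; first by rewrite !mulr_ge0 ?expR_ge0.
    rewrite !mulr_sumr; apply: ler_sum => k _; rewrite lift0 -!expRD ler_expR.
    have := eigenvalue_gap hspec (isT : (0 < k.+1)%N); rewrite /g.
    set l := lam k.+1; set l1 := lam 1%N; set z := lam 0%N => h.
    have h1 : 0 <= (l - l1) * (u - 2^-1) by rewrite mulr_ge0 ?subr_ge0 //; lra.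
    have h2 : 0 <= (l1 - z) * (u - 1).
      by rewrite mulr_ge0 ?subr_ge0 // ltW // -subr_gt0.
    by move: h1 h2; rewrite !mulrBr !mulrBl; lra.
  by rewrite ler_wpM2l ?expR_ge0 // ler_wpM2l ?expR_ge0 // Z_partial.
apply: (le_trans step).
have gu : 0 < g * (u / 2) by rewrite mulr_gt0 // divr_gt0.
apply: (@le_trans _ _ ((4 / (g * (u / 2))) ^+ 4 * (expR (lam 0%N / 2) * Z 2^-1))).
  by rewrite ler_wpM2r ?mulr_ge0 ?expR_ge0 ?heat_trace_ge0 // expRN_le.
have -> : (4 / (g * (u / 2))) ^+ 4 = (8 / g) ^+ 4 * u ^- 4.
  by field; rewrite !gt_eqF.
have -> : (8 / g) ^+ 4 * u ^- 4 * (expR (lam 0%N / 2) * Z 2^-1) = K * u ^- 4 by rewrite /K; ring.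
by rewrite ler_wpM2l // lef_pV2 ?posrE ?exprn_gt0 // ler_weXn2l.
Qed.

(** Near 0 this is the hypothesis; on the rest of (0, 1] all terms are bounded, the trace being
    monotone. *)
Let Z_expansion : exists K, 0 <= K /\ forall u, 0 < u <= 1 ->
  `|Z u - a0 * (sqrt u) ^- 3 - a1 * u^-1| <= K * (sqrt u)^-1.
Proof.
have [C /nbhs_ballP[d /= d0 Hd]] := hexp.
have a00 : 0 <= a0 by exact: powR_ge0.
pose K2 := Z d + a0 * (sqrt d) ^- 3 + `|a1| * d^-1.
have sd0 : 0 < sqrt d by rewrite sqrtr_gt0.
have K20 : 0 <= K2.
  apply: addr_ge0; last by rewrite mulr_ge0 // invr_ge0 ltW.
  by rewrite addr_ge0 ?heat_trace_ge0 // mulr_ge0 // invr_ge0 exprn_ge0 // ltW.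
exists (`|C| + `|a2| + K2); split.
  by apply: addr_ge0 => //; exact: addr_ge0.
move=> u /andP[u0 u1].
have s0 : 0 < sqrt u by rewrite sqrtr_gt0.
have w1 : 1 <= (sqrt u)^-1 by rewrite invf_ge1 // -[leRHS]sqrtr1 ler_wsqrtr.
set w := (sqrt u)^-1 in w1 *.
have [ud|du] := ltP u d.
  have /Hd /(_ u0) : ball (0 : R) d u by rewrite /ball /= sub0r normrN gtr0_norm.
  rewrite /= -/(weyl_constant R) powR_neg_half // powR_neg_three_half // -/w => h.
  have -> : Z u - a0 * (sqrt u) ^- 3 - a1 * u^-1 =
    (Z u - (a0 * (sqrt u) ^- 3 + a1 * u^-1 + a2 * w)) + a2 * w by ring.
  apply: (le_trans (ler_normD _ _)); rewrite normrM (ger0_norm (x := w)); last by lra.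
  have h2 : C <= `|C| * w by apply: le_trans (ler_norm C) _; rewrite ler_peMr.
  have h3 : 0 <= K2 * w by rewrite mulr_ge0 //; lra.
  by lra.
apply: (@le_trans _ _ K2); last first.
  apply: (@le_trans _ _ (K2 * w)); first by rewrite ler_peMr.
  by rewrite ler_wpM2r ?lerDr ?addr_ge0 //; lra.
apply: (le_trans (ler_normB _ _)); apply: lerD.
  apply: (le_trans (ler_normB _ _)); apply: lerD.
    by rewrite ger0_norm ?heat_trace_ge0 // Z_le.
  rewrite ger0_norm; last by rewrite mulr_ge0 // invr_ge0 exprn_ge0 // ltW.
  by rewrite ler_wpM2l // lef_pV2 ?posrE ?exprn_gt0 // lerXn2r ?nnegrE ?(ltW s0) ?(ltW sd0) // ler_wsqrtr.
by rewrite normrM ler_wpM2l // gtr0_norm ?invr_gt0 // lef_pV2.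
Qed.

Let expR_lin (y : R) : 0 <= y -> 0 <= expR y - 1 <= y * expR y.
Proof.
move=> y0; rewrite subr_ge0 -expR0 ler_expR y0 /=.
have := expR_ge1Dx (- y); rewrite expRN => h.
have e0 := expR_gt0 y.
have : expR y * (1 - y) <= 1.
  by rewrite -[leRHS](divff (x := expR y)) ?gt_eqF // ler_wpM2l ?(ltW e0).
by rewrite expR0 mulrBr mulr1; lra.
Qed.

Let small_u (u : R) : 0 < u <= 1 -> let w := (sqrt u)^-1 in
  [/\ 1 <= w, u * w ^+ 2 = 1, (sqrt u) ^- 3 = w ^+ 3, u^-1 = w ^+ 2 & w <= w ^+ 2 /\ w ^+ 2 <= w ^+ 3].
Proof.
move=> /andP[u0 u1] w.
have s0 : 0 < sqrt u by rewrite sqrtr_gt0.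
have w1 : 1 <= w by rewrite invf_ge1 // -[leRHS]sqrtr1 ler_wsqrtr.
have u2 : u^-1 = w ^+ 2 by rewrite /w exprVn sqr_sqrtr // ltW.
split => //; first by rewrite -u2 divff // gt_eqF.
  by rewrite /w exprVn.
split; last by apply: ler_weXn2l.
by rewrite -[X in X <= _]expr1; apply: ler_weXn2l.
Qed.

Let q_bound : exists K q, [/\ 0 <= K, 0 <= q, (forall u, 0 < u <= 1 ->
   `|Z u - a0 * (sqrt u) ^- 3 - a1 * u^-1| <= K * (sqrt u)^-1) &
   forall u, 0 < u <= 1 -> Z u <= q * (sqrt u) ^- 3].
Proof.
have [K [K0 HK]] := Z_expansion.
exists K, (a0 + `|a1| + K); split => //; first by rewrite !addr_ge0 // powR_ge0.
move=> u u01; have := HK u u01; have [w1 uw -> -> [w2 w3]] := small_u u01.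
rewrite ler_norml => /andP[_]; set w := _^-1 in w1 uw w2 w3 *.
have h1 : a1 * w ^+ 2 <= `|a1| * w ^+ 3.
  apply: (@le_trans _ _ (`|a1| * w ^+ 2)); first by rewrite ler_wpM2r ?sqr_ge0 // ler_norm.
  by rewrite ler_wpM2l.
have h2 : K * w <= K * w ^+ 3 by rewrite ler_wpM2l //; lra.
by lra.
Qed.

(** The tilt changes the trace by about l0 u times u^(-3/2), which is of the order of the error;
    hence a0 and a1 are those of the trace itself. *)
Lemma excess_expansion : exists K, 0 <= K /\ forall u, 0 < u <= 1 ->
  `|excess u - a0 * (sqrt u) ^- 3 - a1 * u^-1| <= K * (sqrt u)^-1.
Proof.
have [K [q [K0 q0 HK Hq]]] := q_bound.
exists (K + lam 0%N * expR (lam 0%N) * q + 1); split.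
  by rewrite !addr_ge0 // !mulr_ge0 ?expR_ge0.
move=> u /[dup] u01 /andP[u0 u1]; have := HK u u01; have := Hq u u01.
have [w1 uw -> -> [w2 w3]] := small_u u01; set w := _^-1 in w1 uw w2 w3 *.
move=> Zq h; pose y := lam 0%N * u.
have y0 : 0 <= y by rewrite mulr_ge0 // ltW.
have /andP[e1 e2] := expR_lin y0.
have Z0 := heat_trace_ge0 u0.
have ey : expR y <= expR (lam 0%N) by rewrite ler_expR ler_piMr.
have hz : (expR y - 1) * Z u <= lam 0%N * expR (lam 0%N) * q * w.
  apply: (@le_trans _ _ (y * expR (lam 0%N) * (q * w ^+ 3))).
    apply: ler_pM => //; apply: (le_trans e2); by rewrite ler_wpM2l.
  have -> : y * expR (lam 0%N) * (q * w ^+ 3) = lam 0%N * expR (lam 0%N) * q * w * (u * w ^+ 2) by rewrite /y; ring.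
  by rewrite uw mulr1.
have hz0 : 0 <= (expR y - 1) * Z u by rewrite mulr_ge0.
have -> : excess u - a0 * w ^+ 3 - a1 * w ^+ 2 =
   (Z u - a0 * w ^+ 3 - a1 * w ^+ 2) + (expR y - 1) * Z u - 1 by rewrite /excess -/y; ring.
move: h; rewrite !ler_norml => /andP[h1 h2].
by apply/andP; split; lra.
Qed.

(** Multiplication by u turns the sum of the p j into that of the j p j, the variance, and leaves a
    singularity u^(-1/2) only. *)
Lemma excess_moment : exists K, 0 <= K /\
  (forall u, 0 < u <= 1 -> `|u * excess u| <= K * (sqrt u)^-1) /\
  forall u, 1 <= u -> `|u * excess u| <= K * u ^- 2.
Proof.
have [K [K0 HK]] := excess_expansion; have [K' [K'0 HK']] := excess_decay.
have a00 : 0 <= a0 by exact: powR_ge0.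
exists (a0 + `|a1| + K + K'); split; first by rewrite addr_ge0 // addr_ge0 // addr_ge0.
split => u => [/[dup] u01 /andP[u0 u1]|u1]; last first.
  have u0 : 0 < u by lra.
  rewrite ger0_norm; last by rewrite mulr_ge0 ?excess_ge0 // ltW.
  apply: (@le_trans _ _ (u * (K' * u ^- 3))); first by rewrite ler_wpM2l ?(ltW u0) // HK'.
  have -> : u * (K' * u ^- 3) = K' * u ^- 2 by field; rewrite gt_eqF.
  by rewrite ler_wpM2r ?invr_ge0 ?sqr_ge0 // lerDr addr_ge0 // addr_ge0.
have := HK u u01; have [w1 uw -> -> [w2 w3]] := small_u u01; set w := _^-1 in w1 uw w2 w3 *.
rewrite ler_norml => /andP[_ h]; rewrite ger0_norm; last by rewrite mulr_ge0 ?excess_ge0 // ltW.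
have h1 : a1 * w ^+ 2 <= `|a1| * w ^+ 3.
  apply: (@le_trans _ _ (`|a1| * w ^+ 2)); first by rewrite ler_wpM2r ?sqr_ge0 // ler_norm.
  by rewrite ler_wpM2l.
have h2 : K * w <= K * w ^+ 3 by rewrite ler_wpM2l //; lra.
have h3 : 0 <= K' * w ^+ 3 by rewrite mulr_ge0 // exprn_ge0 //; lra.
apply: (@le_trans _ _ (u * ((a0 + `|a1| + K + K') * w ^+ 3))).
  by rewrite ler_wpM2l ?(ltW u0) //; lra.
have -> : u * ((a0 + `|a1| + K + K') * w ^+ 3) = (a0 + `|a1| + K + K') * w * (u * w ^+ 2) by ring.
by rewrite uw mulr1.
Qed.

(** As exp (l0 u) - 1 is l0 u to first order, the quotient is about l0 Z(u) - 1 / u, which explains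
    both coefficients. For l0 = 0 it would be - 1 / u, which does not decay like u^-2; that case is
    treated apart. *)
Lemma tilted_expansion : 0 < lam 0%N -> exists K, 0 <= K /\
  (forall u, 0 < u <= 1 -> `|(excess u - Z u) / u - lam 0%N * a0 * (sqrt u) ^- 3 -
     (lam 0%N * a1 - 1) * u^-1| <= K * (sqrt u)^-1) /\
  forall u, 1 <= u -> `|(excess u - Z u) / u| <= K * u ^- 2.
Proof.
move=> lp; have [K [q [K0 q0 HK Hq]]] := q_bound; have [K' [K'0 HK']] := excess_decay.
pose Q := lam 0%N ^+ 2 * expR (lam 0%N) * q + lam 0%N * K.
have Q0 : 0 <= Q by rewrite addr_ge0 // !mulr_ge0 ?sqr_ge0 ?expR_ge0.
pose Q' := K' + (1 + K') / lam 0%N.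
have Q'0 : 0 <= Q' by rewrite addr_ge0 // divr_ge0 // addr_ge0.
exists (Q + Q'); split; first by rewrite addr_ge0.
split => u => [/[dup] u01 /andP[u0 u1]|u1]; last first.
  have u0 : 0 < u by lra.
  have p0 := excess_ge0 u0; have pK := HK' u u1; have Z0 := heat_trace_ge0 u0.
  have u31 : u ^- 3 <= u^-1 by rewrite lef_pV2 ?posrE ?exprn_gt0 // -[leLHS]expr1 ler_weXn2l.
  have pu : excess u <= K' * u^-1 by apply: (le_trans pK); rewrite ler_wpM2l.
  have iu1 : u^-1 <= 1 by rewrite invf_le1.
  have p1 : excess u <= K' by apply: (le_trans pu); rewrite ler_piMr.
  have ZK : Z u <= (1 + K') / lam 0%N * u^-1.
    have yp : 0 < lam 0%N * u by rewrite mulr_gt0.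
    have -> : (1 + K') / lam 0%N * u^-1 = (lam 0%N * u)^-1 * (1 + K').
      by field; rewrite !gt_eqF.
    rewrite heat_traceE expRN; apply: ler_pM; rewrite ?invr_ge0 ?expR_ge0 ?lerD2l //.
      by rewrite addr_ge0.
    rewrite lef_pV2 ?posrE ?expR_gt0 //.
    by have := expR_ge1Dx (lam 0%N * u); lra.
  rewrite normrM (ger0_norm (x := u^-1)) ?invr_ge0 ?(ltW u0) //.
  have -> : u ^- 2 = u^-1 * u^-1 by rewrite -invfM expr2.
  rewrite mulrA ler_wpM2r ?invr_ge0 ?(ltW u0) //.
  have hq : Q' * u^-1 = K' * u^-1 + (1 + K') / lam 0%N * u^-1 by rewrite [LHS]mulrDl.
  rewrite [leRHS]mulrDl hq.
  have h0 : 0 <= Q * u^-1 by rewrite mulr_ge0 // invr_ge0 ltW.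
  by rewrite ler_norml; apply/andP; split; lra.
have := HK u u01; have := Hq u u01.
have [w1 uw -> u2 [w2 w3]] := small_u u01; set w := _^-1 in w1 uw u2 w2 w3 *.
move=> Zq h; pose y := lam 0%N * u.
have y0 : 0 <= y by rewrite mulr_ge0 // ltW.
have /andP[e1 e2] := expR_lin y0.
have Z0 := heat_trace_ge0 u0.
have ey : expR y <= expR (lam 0%N) by rewrite ler_expR ler_piMr.
pose D := (expR y - 1 - y) / u * Z u.
have D0 : 0 <= D.
  by rewrite mulr_ge0 // divr_ge0 ?(ltW u0) // subr_ge0 lerBrDl expR_ge1Dx.
have DQ : D <= lam 0%N ^+ 2 * expR (lam 0%N) * q * w.
  apply: (@le_trans _ _ (lam 0%N ^+ 2 * u * expR (lam 0%N) * (q * w ^+ 3))); last first.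
    have -> : lam 0%N ^+ 2 * u * expR (lam 0%N) * (q * w ^+ 3) =
      lam 0%N ^+ 2 * expR (lam 0%N) * q * w * (u * w ^+ 2) by ring.
    by rewrite uw mulr1.
  apply: ler_pM => //; first by rewrite divr_ge0 ?(ltW u0) // subr_ge0 lerBrDl expR_ge1Dx.
  rewrite ler_pdivrMr //.
  have h1 : y * (expR y - 1) <= y * (y * expR (lam 0%N)).
    by rewrite ler_wpM2l //; apply: (le_trans e2); rewrite ler_wpM2l.
  have -> : lam 0%N ^+ 2 * u * expR (lam 0%N) * u = y * (y * expR (lam 0%N)) by rewrite /y; ring.
  by apply: le_trans h1; rewrite mulrBr mulr1; lra.
have -> : (excess u - Z u) / u - lam 0%N * a0 * w ^+ 3 - (lam 0%N * a1 - 1) * u^-1 =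
   D + lam 0%N * (Z u - a0 * w ^+ 3 - a1 * u^-1).
  by rewrite /D /excess -/y /y; field; rewrite gt_eqF.
apply: (le_trans (ler_normD _ _)); rewrite (ger0_norm D0) normrM (ger0_norm l0).
have h1 : lam 0%N * `|Z u - a0 * w ^+ 3 - a1 * u^-1| <= lam 0%N * (K * w) by rewrite ler_wpM2l.
have h2 : 0 <= Q' * w by rewrite mulr_ge0 //; lra.
by rewrite [leRHS]mulrDl {1}/Q; lra.
Qed.

(** With p j = [excess (j / x)], the four sums are the mean and the variance of the number of
    particles in p-loops, the mean number of those in loops of length at least x, and, up to the
    tilt, the logarithm of the partition function. *)
Lemma trace_grid : exists K, 0 <= K /\ forall x n, 1 <= x -> x <= n%:R ->
  [/\ `|\sum_(j < n) excess (j.+1%:R / x) - a0 * zeta (3 / 2 : R) * (sqrt x) ^+ 3 - a1 * x * ln x| <= K * x,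
      \sum_(j < n) j.+1%:R * excess (j.+1%:R / x) <= K * x ^+ 2,
      \sum_(j < n | x <= j.+1%:R) excess (j.+1%:R / x) <= K * x &
      0 < lam 0%N -> `|\sum_(j < n) (excess (j.+1%:R / x) - Z (j.+1%:R / x)) / j.+1%:R -
        lam 0%N * a0 * zeta (3 / 2 : R) * sqrt x - (lam 0%N * a1 - 1) * ln x| <= K].
Proof.
have [K1 [K10 H1]] := excess_expansion; have [K2 [K20 H2]] := excess_decay.
have [K3 [K30 [H3 H3']]] := excess_moment.
have [K4 [K40 H4]] : exists K, 0 <= K /\ (0 < lam 0%N ->
   (forall u, 0 < u <= 1 -> `|(excess u - Z u) / u - lam 0%N * a0 * (sqrt u) ^- 3 -
     (lam 0%N * a1 - 1) * u^-1| <= K * (sqrt u)^-1) /\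
   forall u, 1 <= u -> `|(excess u - Z u) / u| <= K * u ^- 2).
  have [lp|ln0] := ltP 0 (lam 0%N); last by exists 0; split => // lp; have := lt_le_trans lp ln0; rewrite ltxx.
  by have [K [K0 HK]] := tilted_expansion lp; exists K.
have a00 : 0 <= a0 by exact: powR_ge0.
pose k1 := 4 * `|a0| + `|a1| + 4 * (K1 + K2).
pose k2 := 4 * `|0 : R| + `|0 : R| + 4 * K3.
pose k3 := 4 * `|0 : R| + `|0 : R| + 4 * K2.
pose k4 := 4 * `|lam 0%N * a0| + `|lam 0%N * a1 - 1| + 4 * K4.
have k10 : 0 <= k1 by rewrite addr_ge0 ?mulr_ge0 // ?addr_ge0 // mulr_ge0.
have k20 : 0 <= k2 by rewrite addr_ge0 ?mulr_ge0 // ?addr_ge0 // mulr_ge0.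
have k30 : 0 <= k3 by rewrite addr_ge0 ?mulr_ge0 // ?addr_ge0 // mulr_ge0.
have k40 : 0 <= k4 by rewrite addr_ge0 ?mulr_ge0 // ?addr_ge0 // mulr_ge0.
have H2' u : 1 <= u -> `|excess u| <= K2 * u ^- 2.
  move=> u1; have u0 : 0 < u by lra.
  rewrite ger0_norm ?excess_ge0 //; apply: (le_trans (H2 u u1)); rewrite ler_wpM2l //.
  by rewrite lef_pV2 ?posrE ?exprn_gt0 // ler_weXn2l.
exists (k1 + k2 + k3 + k4); split; first by rewrite addr_ge0 // addr_ge0 // addr_ge0.
move=> x n x1 xn; have x0 : 0 < x by lra.
have jx (j : nat) : 0 < j.+1%:R / x by rewrite divr_gt0 // ltr0n.
split.
- apply: (@le_trans _ _ (k1 * x)); last by rewrite ler_wpM2r ?(ltW x0) //; lra.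
  apply: grid_sum => // u u1; last by apply: (le_trans (H2' u u1)); rewrite ler_wpM2r ?invr_ge0 ?sqr_ge0 //; lra.
  by apply: (le_trans (H1 u u1)); rewrite ler_wpM2r ?invr_ge0 ?sqrtr_ge0 //; lra.
- have := @grid_sum R (fun u => u * excess u) 0 0 K3 x n x1 xn; rewrite -/k2 => /(_ _ _)/wrap[].
  + by move=> u u1; rewrite !mul0r !subr0; exact: H3.
  + exact: H3'.
  rewrite !mul0r !subr0 => /(le_trans (ler_norm _)) h.
  have -> : \sum_(j < n) j.+1%:R * excess (j.+1%:R / x) = x * \sum_(j < n) (j.+1%:R / x * excess (j.+1%:R / x)).
    rewrite mulr_sumr; apply: eq_bigr => j _; rewrite mulrA; congr (_ * _).
    by rewrite mulrCA divff ?mulr1 // gt_eqF.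
  apply: (@le_trans _ _ (x * (k2 * x))); first by rewrite ler_wpM2l // ltW.
  rewrite expr2 mulrCA ler_wpM2r ?mulr_ge0 ?(ltW x0) //; lra.
(* Truncating at u = 1 removes the singularity at 0, so that both leading coefficients are 0. *)
- pose f u := if 1 <= u then excess u else 0.
  have := @grid_sum R f 0 0 K2 x n x1 xn; rewrite -/k3 => /(_ _ _)/wrap[].
  + move=> u /andP[u0 u1]; rewrite !mul0r !subr0 /f; case: ifP => [u1'|_].
      have -> : u = 1 by apply/eqP; rewrite eq_le u1 u1'.
      by have := H2' 1 (lexx _); rewrite sqrtr1 expr1n !invr1.
    by rewrite normr0 mulr_ge0 // invr_ge0 sqrtr_ge0.
  + by move=> u u1; rewrite /f u1; exact: H2'.
  rewrite !mul0r !subr0 => /(le_trans (ler_norm _)) h.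
  apply: (@le_trans _ _ (k3 * x)); last by rewrite ler_wpM2r ?(ltW x0) //; lra.
  apply: le_trans h; rewrite big_mkcond /=; apply: ler_sum => j _.
  by rewrite /f ler_pdivlMr // mul1r.
- move=> lp; have [H4a H4b] := H4 lp.
  have := @grid_sum R (fun u => (excess u - Z u) / u) _ _ K4 x n x1 xn H4a H4b; rewrite -/k4 => h.
  rewrite -(ler_pM2r x0).
  apply: (@le_trans _ _ (k4 * x)); last by rewrite ler_wpM2r ?(ltW x0) //; lra.
  have nx (v : R) : `|v| * x = `|v * x| by rewrite normrM (gtr0_norm x0).
  rewrite nx; apply: le_trans h; rewrite le_eqVlt; apply/orP; left; apply/eqP; congr (`|_|).
  rewrite !mulrBl mulr_suml; congr (_ - _ - _).
  + apply: eq_bigr => j _; rewrite invf_div mulrA mulrAC -!mulrA; congr (_ * _).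
  + by rewrite [_ ^+ 3]exprS sqr_sqrtr ?(ltW x0) //; ring.
  + by ring.
Qed.

End Trace_expansion.

(** * The two soups with a fixed total *)

Section Condensate.
Variables (R : realType) (p : nat -> R) (N : nat).
Hypotheses (p0 : forall l, 0 <= p l) (pN : forall l, (N < l)%N -> p l = 0).

Local Notation h := (loop_mass p).
Let H := expR (\sum_(l < N) p l.+1 / l.+1%:R).
Let M := \sum_(l < N) p l.+1.

Let h0 n : 0 <= h n. Proof. exact: loop_mass_ge0. Qed.

(** The unnormalized law of two independent soups restricted to a total of N particles: [a] lists
    the loops of weight 1, [b] those of weight p. *)
Definition mix (F : seq nat -> seq nat -> R) : R :=
  \sum_(k < N.+1) loop_sum (fun=> 1) k (fun a => loop_sum p (N - k) (fun b => F a b)).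

(** This is the mass of the soup of weights 1 + p at total n, because the soup of unit weights has
    mass 1 at every total. *)
Definition cumulative_mass n : R := \sum_(k < n.+1) h k.
Local Notation S := cumulative_mass.

Lemma cumulative_mass_ge0 n : 0 <= S n.
Proof. by apply: sumr_ge0. Qed.

Lemma ler_mix F G :
  (forall a b, (sumn a + sumn b)%N = N -> F a b <= G a b) -> mix F <= mix G.
Proof.
move=> FG; apply: ler_sum => k _; apply: ler_loop_sum => [? _|a ak _]; first exact: ler01.
apply: ler_loop_sum => [? _|b bk _]; first exact: p0.
by apply: FG; rewrite ak bk subnKC // -ltnS.
Qed.

Lemma mixD F G : mix (fun a b => F a b + G a b) = mix F + mix G.
Proof.
rewrite -big_split /=; apply: eq_bigr => k _; rewrite -loop_sumD.
by apply: eq_loop_sum => // a _ _; exact: loop_sumD.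
Qed.

Lemma mixZ c F : mix (fun a b => c * F a b) = c * mix F.
Proof.
rewrite mulr_sumr; apply: eq_bigr => k _; rewrite -loop_sumZ.
by apply: eq_loop_sum => // a _ _; exact: loop_sumZ.
Qed.

Lemma mix_right (g : nat -> R) : mix (fun _ b => g (sumn b)) = \sum_(k < N.+1) g k * h k.
Proof.
rewrite [RHS](reindex_inj rev_ord_inj) /=; apply: eq_bigr => k _; rewrite subSS.
rewrite loop_sum_cst loop_sum_1 mulr1 /loop_mass -loop_sum_cst.
by apply: eq_loop_sum => // b -> _.
Qed.

Lemma mix1 : mix (fun _ _ => 1) = S N.
Proof. by rewrite (mix_right (fun=> 1)); apply: eq_bigr => k _; rewrite mul1r. Qed.

Lemma mix_left (F : seq nat -> R) :
  mix (fun a _ => F a) = \sum_(k < N.+1) loop_sum (fun=> 1) k F * h (N - k).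
Proof.
apply: eq_bigr => k _; rewrite [RHS]mulrC -loop_sumZ; apply: eq_loop_sum => // a _ _.
by rewrite loop_sum_cst mulrC.
Qed.

(** In a uniform permutation of k elements each length from 1 to k holds one element on average, so
    the lengths below r hold at most r. *)
Lemma mix_short (r : R) : 0 <= r ->
  mix (fun a _ => \sum_(l <- a | l%:R < r) l%:R) <= r * S N.
Proof.
move=> r0; rewrite mix_left /cumulative_mass mulr_sumr [leRHS](reindex_inj rev_ord_inj) /=.
apply: ler_sum => k _; rewrite subSS ler_wpM2r //.
rewrite (loop_sum_campbell (fun=> 1) k (fun l => l%:R < r)).
rewrite (eq_bigr (fun=> 1)); last by move=> l _; rewrite mul1r loop_sum_1.
apply: (@le_trans _ _ (\sum_(l < Num.truncn r) 1)); last first.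
  rewrite sumr_const card_ord; by have /andP[] := truncn_itv r0.
rewrite -(big_mkord (fun l => (l%:R < r) && (0 < l)%N) (fun=> 1 : R)).
rewrite -(big_mkord xpredT (fun=> 1 : R)) big_ltn_cond // ltnn andbF /=.
rewrite big_add1 /= big_mkcond /=.
apply: (@le_trans _ _ (\sum_(0 <= l < k) (if (l < Num.truncn r)%N then 1 else 0))).
  apply: ler_sum => l _; case: ifP => [/andP[lr _]|_]; last by case: ifP.
  by rewrite (_ : (l < Num.truncn r)%N) // truncn_ge_nat // ltW.
rewrite -big_mkcond big_mkord [leRHS]big_mkord !sumr_const card_ord ler_nat.
rewrite -sum1_card -(big_mkord (fun l => (l < Num.truncn r)%N) (fun=> 1%N)) sum1_count.
rewrite -[leqRHS](size_iota 0) /index_iota subn0 -size_filter; apply: uniq_leq_size.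
  by rewrite filter_uniq ?iota_uniq.
by move=> l; rewrite mem_filter !mem_iota !add0n /= => /andP[].
Qed.

(** By Campbell's formula the loops of length l hold p l particles times the mass of the soup that
    is left, and these masses add up to at most H over all totals. *)
Lemma mix_long (P : pred nat) :
  mix (fun _ b => \sum_(l <- b | P l) l%:R) <= (\sum_(l < N | P l.+1) p l.+1) * H.
Proof.
rewrite /mix (reindex_inj rev_ord_inj) /=.
apply: (@le_trans _ _ (\sum_(k < N.+1) \sum_(l < N.+1)
    (if P l && (0 < l)%N then p l * (if (l <= k)%N then h (k - l) else 0) else 0))).
  apply: ler_sum => k _; rewrite subSS loop_sum_cst loop_sum_1 mulr1 subKn; last by rewrite -ltnS.
  rewrite loop_sum_campbell big_mkcond (big_ord_widen N.+1 (fun l => if P l && (0 < l)%N then p l * loop_sum p (k - l) (fun=> 1) else 0)) //.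
  rewrite big_mkcond; apply: ler_sum => l _.
  by rewrite ltnS; case: (P l && _); case: leqP => // _; rewrite mulr0.
rewrite exchange_big /= big_ord_recl /= big1 ?add0r; last by move=> k _; rewrite andbF.
rewrite [X in _ <= X * _]big_mkcond mulr_suml.
apply: ler_sum => l _; rewrite /bump /= add1n andbT.
case: ifP => _; last by rewrite big1 // mul0r.
rewrite -mulr_sumr ler_wpM2l //.
apply: le_trans (sum_loop_mass_le p0 pN (N.+1 - l.+1)).
rewrite -(big_mkord xpredT (fun k => if (l.+1 <= k)%N then h (k - l.+1) else 0)).
rewrite (big_cat_nat (n := l.+1)) //=; last by rewrite ltnS ltnW.
rewrite big_nat_cond big1 ?add0r; last by move=> i /andP[/andP[_ il] _]; rewrite leqNgt il.
rewrite -{1}[l.+1]add0n big_addn big_mkord; apply: ler_sum => i _.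
by rewrite leq_addl addnK.
Qed.

(** * Concentration of the number of condensed particles *)

Section Concentration.
Variables (x K m : R).
Hypotheses (x0 : 0 < x) (K1 : 1 <= K).
Hypothesis HV : \sum_(l < N) l.+1%:R * p l.+1 <= K * x ^+ 2.
Hypothesis HM : `|N%:R - M - m| <= K * x.
Hypothesis HT : \sum_(l < N | x <= l.+1%:R) p l.+1 <= K * x.
Hypothesis Hm : 4 * K * x <= m.

Let V := \sum_(l < N) l.+1%:R * p l.+1.

Let V0 : 0 <= V. Proof. by apply: sumr_ge0 => l _; rewrite mulr_ge0. Qed.

Let Kx0 : 0 < K * x. Proof. by rewrite mulr_gt0 //; move: K1; lra. Qed.

Let m0 : 0 < m. Proof. by move: Hm Kx0; rewrite -mulrA; lra. Qed.

Let MN : 3 * (K * x) <= N%:R - M.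
Proof. by move: HM Hm; rewrite ler_norml -mulrA => /andP[h _]; lra. Qed.

(** Chebyshev's inequality: N exceeds the mean M by at least 3 K x, while the variance is at most K
    x^2. *)
Lemma cumulative_mass_bounds : H / 2 <= S N <= H.
Proof.
apply/andP; split; last exact: sum_loop_mass_le.
have MN' : M < N.+1%:R by rewrite -natr1; move: MN Kx0; lra.
apply: le_trans (sum_loop_mass_ge p0 pN MN').
rewrite ler_wpM2l ?expR_ge0 //.
suff : V / (N.+1%:R - M) ^+ 2 <= 2^-1 by rewrite -/M -/V; lra.
have d0 : 0 < N.+1%:R - M by rewrite subr_gt0.
rewrite ler_pdivrMr ?exprn_gt0 //; apply: (le_trans HV).
apply: (@le_trans _ _ (2^-1 * (3 * (K * x)) ^+ 2)); last first.
  rewrite ler_wpM2l ?invr_ge0 // lerXn2r ?nnegrE ?(ltW d0) //; first by move: Kx0; lra.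
  by rewrite -natr1; move: MN; lra.
rewrite !exprMn; have : K * x ^+ 2 <= K ^+ 2 * x ^+ 2.
  by rewrite ler_wpM2r ?sqr_ge0 // expr2 ler_peMr //; move: K1; lra.
have : 0 <= K ^+ 2 * x ^+ 2 by rewrite mulr_ge0 ?sqr_ge0.
by lra.
Qed.

Lemma cumulative_mass_gt0 : 0 < S N.
Proof. by have /andP[h _] := cumulative_mass_bounds; apply: lt_le_trans h; rewrite divr_gt0 ?expR_gt0. Qed.

Let HS : H <= 2 * S N.
Proof. by have /andP[h _] := cumulative_mass_bounds; lra. Qed.

Lemma mass_variance : \sum_(k < N.+1) (k%:R - M) ^+ 2 * h k <= 2 * K * x ^+ 2 * S N.
Proof.
apply: (le_trans (loop_mass_variance p0 pN N.+1)).
apply: (@le_trans _ _ (K * x ^+ 2 * (2 * S N))); last by lra.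
by apply: ler_pM => //; exact: expR_ge0.
Qed.

(* Markov's inequality for |b| - M, for the short loops of a and for the long
   loops of b. *)
Lemma mix_deviation (r eps : R) : x <= r -> 0 < eps -> K * x < eps * m / 4 ->
  mix (fun a b => (~~ (m * (1 - eps) <
      \sum_(l <- a ++ b | r <= l%:R) l%:R < m * (1 + eps)))%:R) <=
  S N * (2 * K * x ^+ 2 / (eps * m / 4) ^+ 2 + r / (eps * m / 4) + 2 * K * x / (eps * m / 4)).
Proof.
move=> xr eps0 Kd; set d := eps * m / 4 in Kd *.
have d0 : 0 < d by move: Kd Kx0; lra.
(* The long loops hold N - [sumn b] particles, less those in the short loops of a, plus those in the
   long loops of b. If the three Markov quotients sum to less than 1, then [sumn b - M], the two
   loop sums and [N - M - m] are all smaller than d in size, and together smaller than 4 d = eps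
   m. *)
apply: (@le_trans _ _ (mix (fun a b => d ^- 2 * ((sumn b)%:R - M) ^+ 2 +
   (d^-1 * (\sum_(l <- a | l%:R < r) l%:R) + d^-1 * \sum_(l <- b | r <= l%:R) l%:R)))).
  apply: ler_mix => a b abN.
  have e1 : 0 <= d ^- 2 * ((sumn b)%:R - M) ^+ 2 by rewrite mulr_ge0 ?invr_ge0 ?sqr_ge0.
  have s1 : 0 <= \sum_(l <- a | l%:R < r) (l%:R : R) by apply: sumr_ge0.
  have s2 : 0 <= \sum_(l <- b | r <= l%:R) (l%:R : R) by apply: sumr_ge0.
  have e2 : 0 <= d^-1 * \sum_(l <- a | l%:R < r) (l%:R : R) by rewrite mulr_ge0 ?invr_ge0 ?(ltW d0).
  have e3 : 0 <= d^-1 * \sum_(l <- b | r <= l%:R) (l%:R : R) by rewrite mulr_ge0 ?invr_ge0 ?(ltW d0).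
  case: (boolP (m * (1 - eps) < _ < _)) => [_|bad]; first by rewrite addr_ge0 // addr_ge0.
  rewrite leNgt; apply/negP => /= small; move/negP: bad; apply.
  have f1 : `|(sumn b)%:R - M| < d.
    have : d ^- 2 * ((sumn b)%:R - M) ^+ 2 < 1 by lra.
    rewrite mulrC ltr_pdivrMr ?exprn_gt0 // mul1r -real_normK ?num_real //.
    by rewrite ltr_pXn2r // nnegrE // ltW.
  have f2 : \sum_(l <- a | l%:R < r) (l%:R : R) < d.
    have : d^-1 * \sum_(l <- a | l%:R < r) (l%:R : R) < 1 by lra.
    by rewrite mulrC ltr_pdivrMr // mul1r.
  have f3 : \sum_(l <- b | r <= l%:R) (l%:R : R) < d.
    have : d^-1 * \sum_(l <- b | r <= l%:R) (l%:R : R) < 1 by lra.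
    by rewrite mulrC ltr_pdivrMr // mul1r.
  have sa : \sum_(l <- a | r <= l%:R) (l%:R : R) = (sumn a)%:R - \sum_(l <- a | l%:R < r) (l%:R : R).
    rewrite sumnE natr_sum [X in X - _](bigID (fun l : nat => r <= l%:R)) /=.
    by rewrite [X in _ + X - _](eq_bigl (fun l : nat => l%:R < r)) ?addrK // => l; rewrite ltNge.
  have Nab : (sumn a)%:R = N%:R - (sumn b)%:R :> R by rewrite -abN natrD addrK.
  rewrite big_cat /= sa Nab.
  have dd : m * eps = 4 * d by rewrite /d; field.
  rewrite mulrBr mulrDr mulr1 dd.
  move: f1 HM; rewrite ltr_norml ler_norml => /andP[g1 g2] /andP[g3 g4].
  by apply/andP; split; lra.
rewrite !mixD !mixZ (mix_right (fun k => (k%:R - M) ^+ 2)).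
have t1 := mass_variance.
have t2 : mix (fun a _ => \sum_(l <- a | l%:R < r) l%:R) <= r * S N by apply: mix_short; move: x0; lra.
have t3 : mix (fun _ b => \sum_(l <- b | r <= l%:R) l%:R) <= K * x * (2 * S N).
  apply: (le_trans (mix_long (fun l => r <= l%:R))); apply: ler_pM => //.
  - exact: sumr_ge0.
  - exact: expR_ge0.
  apply: le_trans HT; rewrite big_mkcond [leRHS]big_mkcond; apply: ler_sum => l _.
  by case: (leP r) => // rl; rewrite ?(le_trans xr rl) //; case: ifP.
apply: (@le_trans _ _ (d ^- 2 * (2 * K * x ^+ 2 * S N) + (d^-1 * (r * S N) + d^-1 * (K * x * (2 * S N))))).
  by rewrite !lerD // ler_wpM2l ?invr_ge0 ?sqr_ge0 ?(ltW d0).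
by rewrite le_eqVlt; apply/orP; left; apply/eqP; ring.
Qed.

(** Interchanging the sums gives \sum_k (N - k) h k, which is S N times the mean number of particles
    in loops of weight 1. This is the sum over loop lengths that appears in the density matrix. *)
Lemma sum_cumulative_mass :
  `|\sum_(r < N) S (N - r.+1) - m * S N| <= (3 * K + 1) * x * S N.
Proof.
have gen n (c : R) (j : nat) : \sum_(i < n) (if (j <= i)%N then c else 0) = (n - j)%:R * c.
  elim: n => [|n IH]; first by rewrite big_ord0 sub0n mul0r.
  rewrite big_ord_recr /= IH; case: leqP => jn; first by rewrite subSn // -natr1 mulrDl mul1r.
  have -> : (n.+1 - j = 0)%N by apply/eqP; rewrite subn_eq0.
  have -> : (n - j = 0)%N by apply/eqP; rewrite subn_eq0 ltnW.
  by rewrite !mul0r addr0.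
have E : \sum_(r < N) S (N - r.+1) = \sum_(k < N.+1) (N%:R - k%:R) * h k.
  rewrite (reindex_inj rev_ord_inj) /=.
  rewrite (eq_bigr (fun r : 'I_N => \sum_(k < N.+1) (if (k <= r)%N then h k else 0))); last first.
    move=> r _; have rN := ltn_ord r; have -> : (N - (N - r.+1).+1)%N = r by lia.
    rewrite /cumulative_mass (big_ord_widen N.+1 h); last by rewrite ltnS ltnW.
    by rewrite big_mkcond; apply: eq_bigr => k _; rewrite ltnS.
  rewrite exchange_big /=; apply: eq_bigr => k _; have kN : (k <= N)%N by rewrite -ltnS.
  by rewrite -natrB // gen.
rewrite E.
have -> : \sum_(k < N.+1) (N%:R - k%:R) * h k - m * S N =
   (N%:R - M - m) * S N - \sum_(k < N.+1) (k%:R - M) * h k.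
  rewrite /cumulative_mass !mulr_sumr -!sumrB; apply: eq_bigr => k _; ring.
apply: (le_trans (ler_normB _ _)).
have S0 := cumulative_mass_ge0 N.
have b1 : `|(N%:R - M - m) * S N| <= K * x * S N by rewrite normrM (ger0_norm S0) ler_wpM2r.
have b2 : `|\sum_(k < N.+1) (k%:R - M) * h k| <= (2 * K + 1) * x * S N.
  apply: (le_trans (ler_norm_sum _ _ _)).
  (* The inequality u <= u^2 / x + x bounds the mean absolute deviation through the variance,
     without a square root. *)
  apply: (@le_trans _ _ (\sum_(k < N.+1) (x^-1 * ((k%:R - M) ^+ 2 * h k) + x * h k))).
    apply: ler_sum => k _; rewrite normrM (ger0_norm (h0 k)) mulrA -mulrDl ler_wpM2r //.
    rewrite -(real_normK (num_real (k%:R - M))); set u := `|_|.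
    have u0 : 0 <= u by exact: normr_ge0.
    rewrite -subr_ge0; have -> : x^-1 * u ^+ 2 + x - u = x^-1 * ((u - x) ^+ 2 + u * x).
      by field; rewrite gt_eqF.
    by rewrite mulr_ge0 ?invr_ge0 ?(ltW x0) // addr_ge0 ?sqr_ge0 // mulr_ge0 // ltW.
  rewrite big_split /= -!mulr_sumr -/(S N).
  apply: (@le_trans _ _ (x^-1 * (2 * K * x ^+ 2 * S N) + x * S N)).
    by rewrite lerD2r ler_wpM2l ?invr_ge0 ?(ltW x0) // mass_variance.
  have -> : x^-1 * (2 * K * x ^+ 2 * S N) = 2 * K * x * S N by field; rewrite gt_eqF.
  by lra.
by lra.
Qed.

End Concentration.
End Condensate.

(** * Uniform permutations and stick breaking *)

Section Discrete_sticks.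
Variable R : realType.
Implicit Types (u v w : nat -> R).

(** For r uniform in [0, 1] it is uniform on 1, ..., n, like the length of the cycle of a given
    element; the minimum with n takes care of r = 1. *)
Definition piece n (r : R) : nat := minn n (Num.truncn (r * n%:R)).+1.

(** For independent uniform [u i] these are the cycle lengths of a uniform permutation of n
    elements, discovered one cycle at a time. *)
Fixpoint stick u fuel n : seq nat :=
  if fuel is k.+1 then
    if n is 0%N then [::]
    else piece n (u 0%N) :: stick (fun i => u i.+1) k (n - piece n (u 0%N))%N
  else [::].

Lemma piece_bounds n r : (0 < n)%N -> (0 < piece n r <= n)%N.
Proof. by move=> n0; rewrite leq_min n0 /= geq_minl. Qed.

Lemma piece_close n r : (0 < n)%N -> 0 <= r <= 1 -> `|(piece n r)%:R - n%:R * r| <= 1.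
Proof.
move=> n0 /andP[r0 r1]; have nR : 0 < (n%:R : R) by rewrite ltr0n.
have rn0 : 0 <= r * n%:R by rewrite mulr_ge0 // ltW.
have /andP[t1 t2] := truncn_itv rn0.
rewrite /piece [n%:R * r]mulrC; have [h|h] := leqP n (Num.truncn (r * n%:R)).+1.
  rewrite ler_norml; have : r * n%:R <= n%:R by rewrite ler_piMl // ltW.
  have : (n%:R : R) <= (Num.truncn (r * n%:R)).+1%:R by rewrite ler_nat.
  by rewrite -natr1 => h1 h2; apply/andP; split; lra.
by rewrite -natr1 ler_norml in t2 *; apply/andP; split; lra.
Qed.

Lemma stick_breakingS u p : stick_breaking u p.+1 = (1 - u 0%N) * stick_breaking (fun i => u i.+1) p.
Proof. by rewrite /stick_breaking big_ord_recl /= mulrCA. Qed.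

Lemma remaining_ge0 u J : (forall i, 0 <= u i <= 1) -> 0 <= \prod_(i < J) (1 - u i) <= 1.
Proof.
move=> u01; apply/andP; split; first by apply: prodr_ge0 => i _; have /andP[] := u01 i; lra.
by apply: prodr_ile1 => i _; have /andP[] := u01 i; lra.
Qed.

Lemma stick_breaking_bounds u p : (forall i, 0 <= u i <= 1) -> 0 <= stick_breaking u p <= 1.
Proof.
move=> u01; have /andP[h1 h2] := remaining_ge0 p u01; have /andP[h3 h4] := u01 p.
by rewrite mulr_ge0 //= mulr_ile1.
Qed.

(** Each break rounds by at most 1, and earlier errors are only multiplied by factors in [0, 1]. *)
Lemma stick_close u fuel n p : (n <= fuel)%N -> (forall i, 0 <= u i <= 1) ->
  `|(nth 0%N (stick u fuel n) p)%:R - n%:R * stick_breaking u p| <= p.+1%:R.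
Proof.
elim: fuel u n p => [|k IH] u [|n] p // nk u01; rewrite ?nth_nil ?mul0r ?subr0 ?normr0 ?ler0n //=.
have n0 : (0 < n.+1)%N by [].
have pc := piece_close n0 (u01 0%N); have /andP[p0 pn] := piece_bounds (u 0%N) n0.
case: p => [|p] /=; first by rewrite /stick_breaking big_ord0 mulr1.
have us : forall i, 0 <= u i.+1 <= 1 by move=> i; exact: u01.
have := IH (fun i => u i.+1) (n.+1 - piece n.+1 (u 0%N))%N p _ us => /(_ _)/wrap[]; first by lia.
rewrite stick_breakingS natrB //; set l := (piece _ _)%:R in pc *; set s := stick_breaking _ _.
set z := (nth _ _ _)%:R => h.
have /andP[s0 s1] : 0 <= s <= 1 by exact: stick_breaking_bounds.
have -> : z - n.+1%:R * ((1 - u 0%N) * s) = (z - (n.+1%:R - l) * s) - (l - n.+1%:R * u 0%N) * s by ring.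
apply: (le_trans (ler_normB _ _)); rewrite normrM (ger0_norm s0) -[p.+2%:R]natr1; apply: lerD => //.
by rewrite mulr_ile1.
Qed.

(** Bounds all pieces from J on by what is left after J breaks; this gives the uniformity in p that
    [stick_close] lacks. *)
Lemma stick_tail u fuel n J p : (n <= fuel)%N -> (J <= p)%N -> (forall i, 0 <= u i <= 1) ->
  (nth 0%N (stick u fuel n) p)%:R <= n%:R * \prod_(i < J) (1 - u i) + J%:R.
Proof.
elim: fuel u n J p => [|k IH] u n J p nk Jp u01.
  by have /andP[h _] := remaining_ge0 J u01; rewrite nth_nil addr_ge0 // mulr_ge0.
case: n nk => [|n] nk; first by rewrite /= nth_nil mul0r add0r.
have n0 : (0 < n.+1)%N by [].
have pc := piece_close n0 (u01 0%N); have /andP[p0 pn] := piece_bounds (u 0%N) n0.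
have us : forall i, 0 <= u i.+1 <= 1 by move=> i; exact: u01.
have nk' : (n.+1 - piece n.+1 (u 0%N) <= k)%N by lia.
case: J Jp => [_|J Jp].
  rewrite big_ord0 mulr1 addr0; case: p => [|p] /=; first by rewrite ler_nat.
  apply: (le_trans (IH (fun i => u i.+1) _ 0%N p nk' (leq0n _) us)).
  by rewrite big_ord0 mulr1 addr0 ler_nat leq_subr.
case: p Jp => // p Jp /=; apply: (le_trans (IH (fun i => u i.+1) _ J p nk' Jp us)).
rewrite big_ord_recl /= natrB //; set P := \prod_(_ < _) _; set l := (piece _ _)%:R in pc *.
have /andP[P0 P1] : 0 <= P <= 1 by exact: (remaining_ge0 J us).
rewrite ler_norml in pc; case/andP: pc => h1 h2; rewrite -[J.+1%:R]natr1.
have : 0 <= (l - n.+1%:R * u 0%N + 1) * P by rewrite mulr_ge0 //; lra.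
by rewrite mulrA; lra.
Qed.

Lemma nth_sorted_count (z : seq nat) (P : pred nat) i : sorted geq z ->
  (forall x y, (x <= y)%N -> P x -> P y) -> ~~ P 0%N -> (i < count P z)%N = P (nth 0%N z i).
Proof.
move=> sz Pm P0; elim: z i sz => [|x z IH] i sz; first by rewrite nth_nil (negbTE P0).
have sz' := path_sorted sz.
have xz y : y \in z -> (y <= x)%N.
  have tr : transitive geq by move=> a b c ba cb; exact: leq_trans cb ba.
  by move: sz; rewrite /= (path_sortedE tr) => /andP[/allP h _] /h.
have [Px|Px] := boolP (P x); first by case: i => [|i]; rewrite /= Px ?add1n // ltnS IH.
have cz : count P z = 0%N.
  by apply/eqP; rewrite -leqn0 leqNgt -has_count; apply/hasPn => y /xz yx; apply: contra Px; exact: Pm.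
rewrite /= (negbTE Px) cz; case: i => [|i] /=; first by rewrite (negbTE Px).
by rewrite -(IH i sz') cz.
Qed.

(** Ranking does not increase the distance in the sup norm: the rank of an entry is a count of
    entries beyond a level, and the level moves by at most eta. Entries of [b] are at most eta and
    never exceed a level [w i + eta]. *)
Lemma sorted_close (a b : seq nat) (m eta : R) v w i : 0 < m -> 0 <= eta -> ranking v w ->
  (forall p, 0 <= v p) ->
  (forall p, `|(nth 0%N a p)%:R / m - v p| <= eta) -> (forall l, l \in b -> l%:R / m <= eta) ->
  `|(nth 0%N (sort geq (a ++ b)) i)%:R / m - w i| <= eta.
Proof.
move=> m0 eta0 [wn [s [[g sg gs] ws]]] v0 va vb.
have mono i' j : (i' <= j)%N -> w j <= w i'.
  elim: j => [|j IH]; first by rewrite leqn0 => /eqP ->.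
  rewrite leq_eqVlt => /orP[/eqP -> //|ij].
  by apply: (le_trans (wn j)); apply: IH; rewrite -ltnS.
set z := sort geq (a ++ b).
have zs : sorted geq z by apply: sort_sorted => x y; exact: leq_total.
have cz P : count P z = (count P a + count P b)%N by rewrite -count_cat; apply/permP; rewrite perm_sort.
have mono_div (x y : nat) : (x <= y)%N -> x%:R / m <= y%:R / m :> R.
  by move=> xy; rewrite ler_pM2r ?invr_gt0 // ler_nat.
have ca P : count P a = size [seq p <- iota 0 (size a) | P (nth 0%N a p)].
  by rewrite size_filter -{1}(mkseq_nth 0%N a) count_map.
rewrite ler_norml lerBrDl lerBlDl; apply/andP; split.
- rewrite leNgt; apply/negP => h.
  pose P := [pred l : nat | w i - eta <= l%:R / m].
  have w0 : 0 <= (nth 0%N z i)%:R / m by rewrite divr_ge0 // ltW.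
  have P0 : ~~ P 0%N by rewrite /= mul0r -ltNge; lra.
  have Pm x y : (x <= y)%N -> P x -> P y by move=> xy /= h'; apply: (le_trans h'); exact: mono_div.
  have : ~~ P (nth 0%N z i) by rewrite /= -ltNge; lra.
  rewrite -(nth_sorted_count i zs Pm P0) cz -leqNgt => ci.
  (* The i + 1 pieces that come first in the limiting ranking all reach the level [w i - eta]. *)
  have : (i.+1 <= count P a)%N.
    rewrite ca -(size_iota 0 i.+1) -(size_map s); apply: uniq_leq_size.
      by rewrite map_inj_uniq ?iota_uniq //; exact: can_inj sg.
    move=> p /mapP[r]; rewrite mem_iota add0n => /andP[_ ri] ->.
    have Pp : P (nth 0%N a (s r)).
      have := va (s r); rewrite -ws ler_norml => /andP[h1 _] /=.
      by have := mono r i (_ : (r <= i)%N); rewrite -ltnS => /(_ ri); lra.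
    rewrite mem_filter Pp mem_iota /= add0n; rewrite ltnNge; apply/negP => big.
    by move: Pp P0; rewrite nth_default // => ->.
  by move=> ca'; have := leq_trans ca' (leq_trans (leq_addr _ _) ci); rewrite ltnn.
- rewrite leNgt; apply/negP => h.
  pose P := [pred l : nat | w i + eta < l%:R / m].
  have wi0 : 0 <= w i by rewrite ws.
  have P0 : ~~ P 0%N by rewrite /= mul0r -leNgt; lra.
  have Pm x y : (x <= y)%N -> P x -> P y by move=> xy /= h'; apply: (lt_le_trans h'); exact: mono_div.
  have : P (nth 0%N z i) by rewrite /=; lra.
  rewrite -(nth_sorted_count i zs Pm P0) cz.
  have -> : count P b = 0%N.
    apply/eqP; rewrite -leqn0 leqNgt -has_count; apply/hasPn => l /vb lb /=.
    by rewrite -leNgt; lra.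
  rewrite addn0 ca; apply/negP; rewrite -leqNgt -(size_map g).
  apply: (@leq_trans (size (iota 0 i))); last by rewrite size_iota.
  apply: uniq_leq_size.
    by rewrite map_inj_uniq ?filter_uniq ?iota_uniq //; exact: can_inj gs.
  move=> r /mapP[p]; rewrite mem_filter => /andP[/= Pp _] ->.
  rewrite mem_iota /= add0n ltnNge; apply/negP => ig.
  have := va p; rewrite ler_norml => /andP[_ h1].
  by have := mono _ _ ig; rewrite ws gs; lra.
Qed.

(** The first J pieces are compared by [stick_close]; the later ones are small on both sides, since
    at most a fraction eta / 4 of the stick remains after J breaks. *)
Lemma stick_uniform_close u (eta : R) : (forall i, 0 <= u i <= 1) ->
  (forall e, 0 < e -> exists J, \prod_(i < J) (1 - u i) <= e) -> 0 < eta ->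
  exists n0 : nat, forall k (m : R), n0%:R <= m -> `|k%:R / m - 1| <= n0.+1%:R^-1 ->
    forall p, `|(nth 0%N (stick u k k) p)%:R / m - stick_breaking u p| <= eta.
Proof.
move=> u01 HJ eta0; have e40 : 0 < Num.min eta 1 / 4 by rewrite divr_gt0 // lt_min eta0 ltr01.
have [J JR] := HJ _ e40; set R_ := \prod_(_ < _) _ in JR.
have /andP[R0 R1] : 0 <= R_ <= 1 by exact: remaining_ge0.
have mn1 : Num.min eta 1 <= eta by rewrite ge_min lexx.
pose T := J.+1%:R * 4 / eta + 4 / eta + 1.
have T0 : 0 <= T by rewrite !addr_ge0 // divr_ge0 ?mulr_ge0 // ltW.
pose n0 := (Num.truncn T).+1.
have Tn : T < n0%:R by have /andP[] := truncn_itv T0.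
have J0 : 0 <= J.+1%:R * 4 / eta by rewrite divr_ge0 ?mulr_ge0 // ltW.
have q0 : 0 <= 4 / eta by rewrite divr_ge0 // ltW.
exists n0 => k m nm km p.
have mT : T < m by lra.
have m0 : 0 < m by move: mT; rewrite /T; lra.
have Jm : J.+1%:R / m <= eta / 4.
  rewrite ler_pdivrMr // mulrAC ler_pdivlMr // mulrC -ler_pdivrMl //.
  by rewrite mulrC mulrCA mulrC; move: mT; rewrite /T; lra.
have ke : `|k%:R / m - 1| <= eta / 4.
  apply: (le_trans km); rewrite -[leRHS]invrK lef_pV2 ?posrE ?invr_gt0 ?divr_gt0 ?ltr0n // invf_div.
  by rewrite -natr1; move: Tn; rewrite /T; lra.
have k1 : `|k%:R / m - 1| <= 1.
  by apply: (le_trans km); rewrite invf_le1 ?ltr0n // ler1n.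
have /andP[s0 s1] := stick_breaking_bounds p u01; set s := stick_breaking u p in s0 s1 *.
have [pJ|Jp] := ltnP p J.
  have := stick_close p (leqnn k) u01; rewrite -/s => h.
  have -> : (nth 0%N (stick u k k) p)%:R / m - s =
      ((nth 0%N (stick u k k) p)%:R - k%:R * s) / m + (k%:R / m - 1) * s by ring.
  apply: (le_trans (ler_normD _ _)); rewrite [X in _ + X]normrM [X in X + _]normrM (ger0_norm s0) normfV (gtr0_norm m0).
  have h1 : `|(nth 0%N (stick u k k) p)%:R - k%:R * s| / m <= eta / 4.
    apply: le_trans Jm; rewrite ler_pM2r ?invr_gt0 //; apply: (le_trans h).
    by rewrite ler_nat ltnS ltnW.
  have h2 : `|k%:R / m - 1| * s <= eta / 4 * 1 by rewrite ler_pM.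
  by lra.
have st := stick_tail (leqnn k) Jp u01; rewrite -/R_ in st.
have t1 : (nth 0%N (stick u k k) p)%:R / m <= eta.
  have : (nth 0%N (stick u k k) p)%:R / m <= k%:R / m * R_ + J%:R / m.
    by rewrite mulrAC -mulrDl ler_pM2r ?invr_gt0.
  have : J%:R / m <= J.+1%:R / m by rewrite ler_pM2r ?invr_gt0 // ler_nat.
  have : k%:R / m * R_ <= 2 * R_ by rewrite ler_wpM2r //; move: k1; rewrite ler_norml => /andP[_]; lra.
  by lra.
have t2 : s <= eta.
  apply: (@le_trans _ _ R_); last by lra.
  rewrite /s /stick_breaking -(big_mkord xpredT (fun i => 1 - u i)) (big_cat_nat (n := J)) //= big_mkord.
  rewrite -/R_ mulrCA ler_piMr //; have /andP[h1 h2] := u01 p; apply: mulr_ile1 => //.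
    by apply: prodr_ge0 => i _; have /andP[] := u01 i; lra.
  by apply: prodr_ile1 => i _; have /andP[] := u01 i; lra.
have t0 : 0 <= (nth 0%N (stick u k k) p)%:R / m by rewrite divr_ge0 // ltW.
by rewrite ler_norml; apply/andP; split; lra.
Qed.

End Discrete_sticks.

(** * Law of the discrete sticks *)

Section Stick_law.
Context d (T : measurableType d) (R : realType).
Variables (Q : probability T R) (U : nat -> T -> R).
Hypothesis hU : iid_uniform Q U.

Let mU i : measurable_fun setT (U i). Proof. by case: hU. Qed.

Let mUB i (A : set (measurableTypeR R)) : measurable A -> measurable (U i @^-1` A).
Proof. by move=> mA; rewrite -[X in measurable X]setTI; exact: (mU i measurableT mA). Qed.

Definition rectangle m (B : nat -> set (measurableTypeR R)) : set T :=
  [set w | forall i, (i < m)%N -> B i (U i w)].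

Lemma rectangleE m B : rectangle m B = \bigcap_(i in [set: 'I_m]) (U i @^-1` B i).
Proof.
apply/seteqP; split => w h; first by move=> i _; exact: h.
by move=> i im; exact: (h (Ordinal im) I).
Qed.

Lemma measurable_rectangle m B : (forall i, measurable (B i)) -> measurable (rectangle m B).
Proof.
move=> mB; rewrite rectangleE; apply: fin_bigcap_measurable; first exact: finite_finset.
by move=> i _; exact: mUB.
Qed.

Lemma prob_rectangle m B : (forall i, measurable (B i)) ->
  Q (rectangle m B) = (\prod_(i < m) lebesgue_measure (B i `&` `[0%R, 1%R]))%E.
Proof.
move=> mB; have [_ H] := hU; rewrite -(H m (fun i => B i)) //.
congr (Q _); apply/seteqP; split => w h; first by move=> i; exact: h.
by move=> i im; exact: (h (Ordinal im)).
Qed.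

Let cell n l : set (measurableTypeR R) := [set r | piece n r = l].

Let above n l : set (measurableTypeR R) := [set r | (l < piece n r)%N].

Let aboveE n l : above n l =
  if (l < n)%N then (if l == 0%N then setT else (fun r => r * n%:R) @^-1` `[l%:R, +oo[%classic) else set0.
Proof.
apply/seteqP; split => r; rewrite /above /piece /= leq_min.
  case: ifP => //= ln h; case: ifP => // l0.
  by case: l l0 h {ln} => // l _; rewrite /= in_itv /= andbT ltnS truncn_gt_nat.
case: ifP => //= ln; case: eqP => [-> //|].
by case: l ln => // l ln _; rewrite /= in_itv /= andbT ltnS truncn_gt_nat.
Qed.

Let cellE n l : cell n l.+1 = above n l `\` above n l.+1.
Proof.
apply/seteqP; split => r; rewrite /cell /above /=; first by move=> ->; rewrite ltnn.
by move=> [h1 /negP]; rewrite -leqNgt => h2; apply/eqP; rewrite eqn_leq h1 h2.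
Qed.

Lemma measurable_cell n l : measurable (cell n l.+1).
Proof.
have ma k : measurable (above n k).
  rewrite aboveE; case: ifP => // _; case: ifP => // _.
  rewrite -[_ @^-1` _]setTI; apply: measurable_funM => //; exact: measurable_itv.
by rewrite cellE; exact: measurableD.
Qed.

(** The cell is the interval from l / n to (l + 1) / n; the last one, [l.+1 = n], contains its right
    end because of the minimum in [piece]. *)
Lemma lebesgue_cell n l : (l < n)%N ->
  lebesgue_measure (cell n l.+1 `&` `[0%R, 1%R]) = (n%:R^-1)%:E.
Proof.
move=> ln; have n0 : 0 < (n%:R : R) by rewrite ltr0n (leq_ltn_trans _ ln).
have lo r : 0 <= r -> (above n l) r <-> l%:R / n%:R <= r.
  move=> r0; rewrite aboveE ln; case: eqP => [->|_] /=; first by rewrite mul0r.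
  by rewrite in_itv /= andbT ler_pdivrMr.
have l0 : 0 <= l%:R / n%:R :> R by rewrite divr_ge0 // ltW.
have l1 : l%:R / n%:R <= 1 :> R by rewrite ler_pdivrMr // mul1r ler_nat ltnW.
have [e|ln1] := eqVneq l.+1 n.
  have -> : cell n l.+1 `&` `[0%R, 1%R] = `[l%:R / n%:R, 1%R]%classic.
    rewrite cellE; apply/seteqP; split => r; rewrite /= !in_itv /=.
      by move=> [[h _] /andP[r0 r1]]; rewrite r1 andbT; apply/(lo _ r0).
    move=> /andP[h r1]; have r0 : 0 <= r by apply: le_trans h.
    split; last by rewrite r0.
    by split; [apply/(lo _ r0) | rewrite aboveE e ltnn].
  rewrite lebesgue_measure_itv /= lte_fin; case: ltP => [_|h].
    by rewrite -EFinB -e -natr1; congr EFin; field; rewrite natr1 pnatr_eq0.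
  have : l%:R / n%:R < (1 : R) by rewrite ltr_pdivrMr // mul1r ltr_nat.
  by rewrite ltNge h.
have ln2 : (l.+1 < n)%N by rewrite ltn_neqAle ln1.
have -> : cell n l.+1 `&` `[0%R, 1%R] = `[l%:R / n%:R, l.+1%:R / n%:R[%classic.
  have h1 : l.+1%:R / n%:R <= (1 : R) by rewrite ler_pdivrMr // mul1r ler_nat.
  rewrite cellE; apply/seteqP; split => r; rewrite /= !in_itv /=.
    move=> [[h] ]; rewrite aboveE ln2 /= in_itv /= andbT => /negP; rewrite -ltNge => h2 /andP[r0 r1].
    by rewrite ltr_pdivlMr // h2 andbT; apply/(lo _ r0).
  move=> /andP[h h2]; have r0 : 0 <= r by apply: le_trans h.
  split; last by rewrite r0 ltW // (lt_le_trans h2).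
  split; first by apply/(lo _ r0).
  by rewrite aboveE ln2 /= in_itv /= andbT; apply/negP; rewrite -ltNge -ltr_pdivlMr.
rewrite lebesgue_measure_itv /= lte_fin ltr_pM2r ?invr_gt0 // ltr_nat ltnSn.
by rewrite -EFinB -natr1; congr EFin; field; rewrite gt_eqF.
Qed.

Local Notation path m w := (fun i => U (m + i)%N w).

Let stickS m k n w : stick (path m w) k.+1 n.+1 =
  piece n.+1 (U m w) :: stick (path m.+1 w) k (n.+1 - piece n.+1 (U m w)).
Proof.
rewrite /= addn0; congr (_ :: stick _ _ _).
by apply/funext => i; rewrite addnS.
Qed.

Let stick_sum m k n (F : seq nat -> R) w : F (stick (path m w) k.+1 n.+1) =
  \sum_(l < n.+1) \1_(U m @^-1` cell n.+1 l.+1) w * F (l.+1 :: stick (path m.+1 w) k (n - l)).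
Proof.
have /andP[p0 pn] := piece_bounds (U m w) (ltn0Sn n).
have pl : ((piece n.+1 (U m w)).-1 < n.+1)%N by rewrite prednK.
rewrite stickS (bigD1 (Ordinal pl)) //= big1 ?addr0.
  rewrite indicE mem_set ?mul1r /cell /= ?prednK //.
  by congr (F (_ :: stick _ _ _)); case: (piece _ _) p0.
move=> l ll; rewrite indicE memNset ?mul0r // => e; case/eqP: ll; apply: val_inj => /=.
by rewrite e.
Qed.

Lemma measurable_stick k : forall m n (F : seq nat -> R), measurable_fun setT (fun w => F (stick (path m w) k n)).
Proof.
elim: k => [m n F|k IH m n F]; first exact: (@measurable_cst _ _ _ _ setT (F [::])).
case: n => [|n]; first exact: (@measurable_cst _ _ _ _ setT (F [::])).
under eq_fun => w do rewrite (stick_sum m k n F w).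
have ml (l : 'I_n.+1) : measurable_fun setT (fun w =>
    \1_(U m @^-1` cell n.+1 l.+1) w * F (l.+1 :: stick (path m.+1 w) k (n - l)) : R).
  apply: measurable_funM; last exact: (IH m.+1 (n - l)%N (fun s => F (l.+1 :: s))).
  by apply: measurable_indic; apply: mUB; exact: measurable_cell.
exact: (measurable_sum (index_enum 'I_n.+1) ml).
Qed.

(** At unit weights the recursion of [loop_sum] removes a loop of uniform length, and so does the
    first break of the stick. Constraints on the past variables take the place of conditional
    expectations. *)
Lemma integral_stick_rectangle k : forall m n B (F : seq nat -> R), (n <= k)%N ->
  (forall i, measurable (B i)) -> (forall s, 0 <= F s) ->
  (\int[Q]_(w in rectangle m B) (F (stick (path m w) k n))%:E =
   Q (rectangle m B) * (loop_sum (fun=> 1) n F)%:E)%E.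
Proof.
elim: k => [|k IH] m n B F nk mB F0; have mR := measurable_rectangle m mB.
  case: n nk => // _; rewrite loop_sum0 muleC; exact: (integral_cst Q mR (F [::])%:E).
case: n nk => [|n] nk.
  by rewrite loop_sum0 muleC; exact: (integral_cst Q mR (F [::])%:E).
under eq_integral => w _ do rewrite (stick_sum m k n F w) -sumEFin.
have mI l : measurable (U m @^-1` cell n.+1 l.+1).
  by apply: mUB; exact: measurable_cell.
rewrite ge0_integral_sum //; first last.
- by move=> l w _; rewrite lee_fin mulr_ge0 // indicE ler0n.
- move=> l; apply/measurable_EFinP; apply: measurable_funM.
    by apply: measurable_funTS; apply: measurable_indic.
  apply: measurable_funTS; exact: (measurable_stick k m.+1 (n - l) (fun s => F (l.+1 :: s))).
(* The length of the new piece becomes one more constraint, on the variable [U m]. *)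
pose Bl (l : nat) i := if i == m then cell n.+1 l.+1 else B i.
have mBl l i : measurable (Bl l i) by rewrite /Bl; case: eqP => // _; exact: measurable_cell.
have QR : (Q (rectangle m B))%E = (fine (Q (rectangle m B)))%:E by rewrite fineK // fin_num_measure.
transitivity (\sum_(l < n.+1) (fine (Q (rectangle m B)) / n.+1%:R * loop_sum (fun=> 1) (n - l) (fun s => F (l.+1 :: s)))%:E)%E.
  apply: eq_bigr => l _.
  have -> : (\int[Q]_(w in rectangle m B) (\1_(U m @^-1` cell n.+1 l.+1) w * F (l.+1 :: stick (path m.+1 w) k (n - l)))%:E =
     \int[Q]_(w in rectangle m.+1 (Bl l)) (F (l.+1 :: stick (path m.+1 w) k (n - l)))%:E)%E.
    have -> : rectangle m.+1 (Bl l) = rectangle m B `&` (U m @^-1` cell n.+1 l.+1).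
      apply/seteqP; split => w /= h.
        split; last by have := h m (ltnSn m); rewrite /Bl eqxx.
        by move=> i im; have := h i (ltnW im); rewrite /Bl ltn_eqF.
      move=> i; rewrite /Bl ltnS leq_eqVlt; case: eqP => [-> _|_ /= im]; first by case: h.
      by case: h => h _; exact: h.
    rewrite [RHS]integral_mkcondr; apply: eq_integral => w _.
    by rewrite /patch indicE; case: (w \in _); rewrite ?mul1r ?mul0r.
  rewrite (IH m.+1 (n - l)%N (Bl l) (fun s => F (l.+1 :: s)) (leq_trans (leq_subr l n) (nk : (n <= k)%N)) (mBl l) (fun s => F0 _)).
  rewrite EFinM; congr (_ * _)%E.
  rewrite EFinM -QR !prob_rectangle // big_ord_recr /=; congr (_ * _)%E.
    by apply: eq_bigr => i _; rewrite /Bl ltn_eqF.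
  by rewrite /Bl eqxx lebesgue_cell.
rewrite sumEFin QR -EFinM; congr EFin; rewrite loop_sumS -mulr_sumr mulrA; congr (_ * _).
by apply: eq_bigr => l _; rewrite mul1r.
Qed.

Lemma integral_stick n (F : seq nat -> R) : (forall s, 0 <= F s) ->
  (\int[Q]_w (F (stick (U ^~ w) n n))%:E = (loop_sum (fun=> 1) n F)%:E)%E.
Proof.
move=> F0; have := @integral_stick_rectangle n 0 n (fun=> setT) F (leqnn n) (fun=> measurableT) F0.
have -> : rectangle 0 (fun=> setT) = setT by apply/seteqP; split.
by rewrite probability_setT mul1e.
Qed.

Lemma ae_uniform_range : {ae Q, forall w, forall i, 0 <= U i w <= 1}.
Proof.
apply: ae_foralln => i.
have mI : measurable (`[0%R, 1%R]%classic : set (measurableTypeR R)) by exact: measurable_itv.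
have mS : measurable (U i @^-1` `[0%R, 1%R]) by exact: mUB.
exists (~` (U i @^-1` `[0%R, 1%R])); split; first exact: measurableC.
  transitivity (1 - Q (U i @^-1` `[0%R, 1%R]))%E; first exact: probability_setC.
  have := @prob_rectangle i.+1 (fun j => if j == i then `[0%R, 1%R]%classic else setT).
  move=> /(_ _)/wrap[]; first by move=> j; case: ifP.
  rewrite big_ord_recr /= eqxx setIid lebesgue_measure_itv /= lte_fin ltr01 oppr0 adde0 mule1.
  rewrite big1; last by move=> j _; rewrite ltn_eqF // setTI lebesgue_measure_itv /= lte_fin ltr01 oppr0 adde0.
  have -> : rectangle i.+1 (fun j => if j == i then `[0%R, 1%R]%classic else setT) = U i @^-1` `[0%R, 1%R].
    apply/seteqP; split => w h; first by have := h i (ltnSn i); rewrite eqxx.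
    by move=> j _; case: eqP => // ->.
  by move=> ->; rewrite subee.
by move=> w /= h; apply: contra_not h; rewrite /= in_itv.
Qed.

(** The probability that m successive variables are all below 1 / 2 is 2^-m. Infinitely many breaks
    by at least one half exhaust the stick. *)
Lemma ae_large_piece : {ae Q, forall w, forall j, exists r, (j <= r)%N /\ 2^-1 <= U r w}.
Proof.
apply: ae_foralln => j.
pose B (i : nat) : set (measurableTypeR R) := if (j <= i)%N then `]-oo, 2^-1[%classic else setT.
have mB i : measurable (B i) by rewrite /B; case: ifP => // _; exact: measurable_itv.
pose S := \bigcap_m rectangle (j + m) B.
have mS : measurable S by apply: bigcapT_measurable => m; exact: measurable_rectangle.
exists S; split => //; last first.
  move=> w /= h m _ i im; rewrite /B; case: ifP => // ji; rewrite /= in_itv /= ltNge.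
  by apply/negP => h'; apply: h; exists i.
apply/eqP; rewrite -measure_le0; apply/lee_addgt0Pr => e e0; rewrite add0e.
have [m em] : exists m : nat, (2^-1 : R) ^+ m < e.
  have c : (2^-1 : R) ^+ n @[n --> \oo] --> 0 by apply: cvg_expr; rewrite ger0_norm ?invr_ge0 // invf_lt1 // ltr1n.
  have /cvgrPdist_lt/(_ e e0)[m _ Hm] := c.
  by exists m; have := Hm m (leqnn m); rewrite /= sub0r normrN ger0_norm // exprn_ge0 // invr_ge0.
apply: (@le_trans _ _ (Q (rectangle (j + m) B))).
  by apply: le_measure; rewrite ?inE //; [exact: measurable_rectangle | move=> w; exact].
rewrite prob_rectangle //.
apply: (@le_trans _ _ ((2^-1 : R) ^+ m)%:E); last by rewrite lee_fin ltW.
have b0 i : (lebesgue_measure (B i `&` `[0%R, 1%R]) <= (if (j <= i)%N then 2^-1 else 1 : R)%:E)%E.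
  rewrite /B; case: ifP => _; last by rewrite setTI lebesgue_measure_itv /= lte_fin ltr01 oppr0 adde0.
  apply: (@le_trans _ _ (lebesgue_measure (`[0%R, 2^-1]%classic : set (measurableTypeR R)))).
    apply: le_measure; rewrite ?inE; [apply: measurableI; exact: measurable_itv|exact: measurable_itv|].
    by move=> r [/=]; rewrite !in_itv /= => h /andP[-> _]; exact: ltW.
  by rewrite lebesgue_measure_itv /= lte_fin invr_gt0 ltr0n oppr0 adde0.
apply: (@le_trans _ _ (\prod_(i < j + m) (if (j <= i)%N then 2^-1 else 1 : R)%:E)%E).
  elim: (j + m)%N => [|n IH]; first by rewrite !big_ord0.
  rewrite !big_ord_recr /=; apply: lee_pmul => //; first exact: prode_ge0.
rewrite prodEFin lee_fin big_split_ord /= big1 ?mul1r; last by move=> i _; rewrite leqNgt ltn_ord.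
by rewrite (eq_bigr (fun=> 2^-1)) ?prodr_const ?card_ord // => i _; rewrite leq_addr.
Qed.

Lemma ae_remaining_small : {ae Q, forall w, (forall i, 0 <= U i w <= 1) /\
  forall e, 0 < e -> exists J, \prod_(i < J) (1 - U i w) <= e}.
Proof.
have FF : Filter (almost_everywhere Q) by exact: ae_filter_ringOfSetsType.
apply: filterS2 ae_uniform_range ae_large_piece => w u01 big; split => // e e0.
have step c : exists J, \prod_(i < J) (1 - U i w) <= (2^-1 : R) ^+ c.
  elim: c => [|c [J IH]]; first by exists 0%N; rewrite big_ord0 expr0.
  have [r [Jr Ur]] := big J; exists r.+1; rewrite big_ord_recr /= exprSr.
  have /andP[ur0 ur1] := u01 r.
  apply: ler_pM; [by have /andP[] := remaining_ge0 r u01| lra | | lra].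
  apply: le_trans IH; rewrite -!(big_mkord xpredT (fun i => 1 - U i w)) (big_cat_nat (n := J)) //=.
  rewrite ler_piMr //.
    by rewrite big_mkord; have /andP[] := remaining_ge0 J u01.
  by apply: prodr_ile1 => i _; have /andP[] := u01 i; lra.
have [m em] : exists m : nat, (2^-1 : R) ^+ m < e.
  have c : (2^-1 : R) ^+ n @[n --> \oo] --> 0 by apply: cvg_expr; rewrite ger0_norm ?invr_ge0 // invf_lt1 // ltr1n.
  have /cvgrPdist_lt/(_ e e0)[m _ Hm] := c.
  by exists m; have := Hm m (leqnn m); rewrite /= sub0r normrN ger0_norm // exprn_ge0 // invr_ge0.
by have [J HJ] := step m; exists J; apply: le_trans HJ (ltW em).
Qed.

End Stick_law.

(** * Passage to the Poisson--Dirichlet law *)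

Section Limit_law.
Context d (T : measurableType d) (R : realType).
Variables (Q : probability T R) (W : nat -> T -> R) (f : {ptws nat -> R} -> R).
Hypotheses (hW : poisson_dirichlet1 Q W) (hf : bounded_continuous f).

Lemma bounded_continuous_seq (u : nat -> nat -> R) (w : nat -> R) :
  (forall n, linfty (u n)) -> linfty w -> (forall i, u n i @[n --> \oo] --> w i) ->
  f (u n) @[n --> \oo] --> f w.
Proof.
move=> lu lw uw; have [/subspace_continuousP cf _] := hf.
have pw : (u : nat -> {ptws nat -> R}) @ \oo --> (w : {ptws nat -> R}).
  by apply/(pointwise_cvgP (F := u @ \oo)) => i; exact: uw.
have H := cf w lw; move=> A /H /pw [n _ Hn].
by exists n => // k nk; apply: (Hn k nk); exact: lu.
Qed.

Let mW i : measurable_fun setT (W i). Proof. by case: hW. Qed.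
Let lW w : linfty (W ^~ w). Proof. by case: hW. Qed.

(* The coordinates are rounded to multiples of 1 / (n + 1), and only the first n
   ones are kept. *)
Lemma measurable_bounded_continuous : measurable_fun setT (fun w => f (W ^~ w)).
Proof.
pose z n w i : int := Num.floor (W i w * n.+1%:R).
pose u n w : nat -> R := fun i => if (i < n)%N then (z n w i)%:~R / n.+1%:R else 0.
apply: (@measurable_fun_cvg _ _ _ _ (fun n w => f (u n w))); last first.
  move=> w _; have zb n i : `|(z n w i)%:~R / n.+1%:R - W i w| <= n.+1%:R^-1.
    have n0 : 0 < (n.+1%:R : R) by rewrite ltr0n.
    have /andP[h1 h2] : (z n w i)%:~R <= W i w * n.+1%:R < (z n w i + 1)%:~R by exact: floor_itv.
    rewrite -(ler_pM2r n0) mulVf ?gt_eqF // -{2}(gtr0_norm n0) -normrM mulrBl divfK ?gt_eqF //.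
    by rewrite intrD in h2; rewrite ler_norml; apply/andP; split; lra.
  have [M HM] := lW w.
  apply: bounded_continuous_seq => // [n|i].
    exists (M + 1) => i; rewrite /u; case: ifP => _; last first.
      by rewrite normr0; have := HM 0%N; have := normr_ge0 (W 0%N w); lra.
    have -> : (z n w i)%:~R / n.+1%:R = W i w + ((z n w i)%:~R / n.+1%:R - W i w) by rewrite addrC subrK.
    apply: (le_trans (ler_normD _ _)); apply: lerD; first exact: HM.
    by apply: (le_trans (zb n i)); rewrite invf_le1 ?ltr0n // ler1n.
  apply/cvgrPdist_le => e e0; near=> n.
  have iN : (i < n)%N by near: n; exists i.+1.
  rewrite /u iN distrC; apply: (le_trans (zb n i)); apply: ltW; near: n.
  exact: (near_infty_natSinv_lt (PosNum e0)).
move=> n; pose g (t : n.-tuple int) : R := f (fun i => (nth 0 t i)%:~R / n.+1%:R).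
have ug w : f (u n w) = g [tuple z n w i | i < n].
  congr f; apply/funext => i; rewrite /u; case: ltnP => iN.
    by rewrite -(tnth_nth 0 [tuple z n w i | i < n] (Ordinal iN)) tnth_mktuple.
  by rewrite nth_default ?mul0r // size_tuple.
move=> _ B mB; rewrite setTI.
have -> : (fun w => f (u n w)) @^-1` B = \bigcup_(t : n.-tuple int)
    (if `[< B (g t) >] then \bigcap_(i in [set: 'I_n]) [set w | z n w i = tnth t i] else set0).
  apply/seteqP; split => w /=.
    rewrite ug => Bw; exists [tuple z n w i | i < n] => //.
    by rewrite asboolT // => i _; rewrite /= tnth_mktuple.
  move=> [t _]; case: asboolP => // Bt H.
  rewrite ug (_ : [tuple _ | _ < _] = t) //; apply: eq_from_tnth => i.
  by rewrite tnth_mktuple; exact: (H i).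
apply: countable_bigcupT_measurable => [|t]; first exact: countableP.
case: asboolP => // _; apply: fin_bigcap_measurable => [|i _]; first exact: finite_finset.
pose I : set (measurableTypeR R) := `[(tnth t i)%:~R, (tnth t i + 1)%:~R[%classic.
have -> : [set w | z n w i = tnth t i] = (fun w => W i w * n.+1%:R) @^-1` I.
  apply/seteqP; split => w /=; rewrite /I /= in_itv /=.
    by move=> <-; exact: floor_itv.
  by move=> h; exact: floor_def.
have mm : measurable_fun setT (fun w => W i w * n.+1%:R) by exact: measurable_funM.
have mI : measurable I by exact: measurable_itv.
by rewrite -[X in measurable X]setTI; exact: (mm measurableT _ mI).
Unshelve. all: by end_near. Qed.

Definition ranked_value (m : R) (s : seq nat) : R :=
  f (fun i => (nth 0%N (sort geq s) i)%:R / m).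

Lemma perm_ranked_value m s s' : perm_eq s s' -> ranked_value m s = ranked_value m s'.
Proof.
move=> ss'; rewrite /ranked_value; suff -> : sort geq s = sort geq s' by [].
apply/perm_sort_inP => // [x y _ _|x y z _ _ _ yx zy|x y _ _ /andP[xy yx]].
- exact: leq_total.
- exact: leq_trans zy yx.
- by apply/eqP; rewrite eqn_leq; apply/andP; split; [exact: yx|exact: xy].
Qed.

Lemma linfty_seq (m : R) (s : seq nat) : linfty (fun i => (nth 0%N s i)%:R / m : R).
Proof.
exists ((sumn s)%:R / `|m|) => i; rewrite normrM normfV ger0_norm // ler_wpM2r ?invr_ge0 // ler_nat.
elim: s i => [|x s IH] [|i] //=; first exact: leq_addr.
exact: leq_trans (IH i) (leq_addl _ _).
Qed.

(** The same uniform variables produce the discrete sticks for all k and the limit, which couples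
    them. Uniformity in k, b and m comes by contradiction: along a sequence of counterexamples the
    values converge almost surely, by [sorted_close], and so do their integrals, by dominated
    convergence. *)
Lemma stick_limit (e : R) : 0 < e -> exists n0 : nat, forall k (b : seq nat) (m : R), n0.+1%:R <= m ->
  `|k%:R / m - 1| <= n0.+1%:R^-1 -> (forall l, l \in b -> l%:R / m <= n0.+1%:R^-1) ->
  `|loop_sum (fun=> 1) k (fun a => ranked_value m (a ++ b)) - \int[Q]_w f (W ^~ w)| <= e.
Proof.
move=> e0; apply: contrapT => /forallNP H.
have /choice[c Hc] : forall n, exists c : nat * seq nat * R, [/\ n.+1%:R <= c.2,
    `|c.1.1%:R / c.2 - 1| <= n.+1%:R^-1, (forall l, l \in c.1.2 -> l%:R / c.2 <= n.+1%:R^-1) &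
    e < `|loop_sum (fun=> 1) c.1.1 (fun a => ranked_value c.2 (a ++ c.1.2)) - \int[Q]_w f (W ^~ w)|].
  move=> n; apply: contrapT => /forallNP Hn; apply: (H n) => k b m h1 h2 h3.
  by rewrite leNgt; apply/negP => h4; apply: (Hn ((k, b), m)); split.
have [_ [M HM]] := hf; have [_ _ [U [hU rk]]] := hW.
pose k n := (c n).1.1; pose b n := (c n).1.2; pose m n := (c n).2.
(* The constant M makes the functions nonnegative, as [integral_stick] asks. *)
pose g n w := ranked_value (m n) (stick (U ^~ w) (k n) (k n) ++ b n) + M.
pose g0 w := f (W ^~ w) + M.
have vM mm s : `|ranked_value mm s| <= M by apply: HM; exact: linfty_seq.
have pos n w : 0 <= g n w by have := vM (m n) (stick (U ^~ w) (k n) (k n) ++ b n); rewrite /g ler_norml => /andP[h _]; lra.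
have mg n : measurable_fun setT (EFin \o g n).
  apply/measurable_EFinP; apply: measurable_funD => //.
  exact: (measurable_stick hU (k n) 0 (k n) (fun a => ranked_value (m n) (a ++ b n))).
have mg0 : measurable_fun setT (EFin \o g0).
  by apply/measurable_EFinP; apply: measurable_funD => //; exact: measurable_bounded_continuous.
have FF : Filter (almost_everywhere Q) by exact: ae_filter_ringOfSetsType.
have cg : {ae Q, forall w, [set: T] w -> (EFin \o g n) w @[n --> \oo] --> (EFin \o g0) w}.
  apply: filterS2 (ae_remaining_small hU) rk => w [u01 HJ] rw _.
  apply: cvg_EFin; first by apply: nearW.
  apply: cvgD; last exact: cvg_cst.
  apply: bounded_continuous_seq => // [n|i]; first exact: linfty_seq.
  apply/cvgrPdist_le => eta eta0.
  have [n0 Hn0] := stick_uniform_close u01 HJ eta0.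
  near=> n; have [h1 h2 h3 _] := Hc n.
  have nn : (n0 <= n)%N by near: n; exists n0.
  have mn0 : 0 < m n by apply: lt_le_trans h1; rewrite ltr0n.
  have inv : n.+1%:R^-1 <= n0.+1%:R^-1 :> R by rewrite lef_pV2 ?posrE ?ltr0n // ler_nat ltnS.
  rewrite distrC; apply: (sorted_close i mn0 (ltW eta0) rw).
  - by move=> p; have /andP[] := stick_breaking_bounds p u01.
  - apply: Hn0; last exact: le_trans h2 inv.
    by apply: le_trans h1; rewrite ler_nat (leq_trans nn).
  - move=> l /h3 h; apply: (le_trans h); apply: ltW; near: n.
    exact: (near_infty_natSinv_lt (PosNum eta0)).
have iM (r : R) : Q.-integrable setT (EFin \o (fun=> r)).
  apply: measurable_bounded_integrable => //; first by rewrite ltey_eq fin_num_measure.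
  by exists `|r|; split; [exact: num_real | move=> y ry t _ /=; exact: ltW].
have gM : {ae Q, forall w n, [set: T] w -> (`|(EFin \o g n) w| <= (EFin \o (fun=> (2 * M)%R)) w)%E}.
  apply: aeW => w n _ /=; rewrite lee_fin ger0_norm //.
  by have := vM (m n) (stick (U ^~ w) (k n) (k n) ++ b n); rewrite /g ler_norml => /andP[_ h]; lra.
have [ig0 _ cI] := @dominated_convergence _ _ _ Q setT measurableT (fun n => EFin \o g n) (EFin \o g0)
  (EFin \o (fun=> 2 * M)) mg mg0 cg (iM _) gM.
have if0 : Q.-integrable setT (EFin \o (fun w => f (W ^~ w))).
  apply: measurable_bounded_integrable => //.
  - by rewrite ltey_eq fin_num_measure.
  - exact: measurable_bounded_continuous.
  exists M; split; first exact: num_real.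
  by move=> y My w _ /=; apply: le_trans (ltW My); apply: HM; exact: lW.
have I0 : (\int[Q]_w (EFin \o g0) w = (\int[Q]_w f (W ^~ w) + M)%:E)%E.
  rewrite -[LHS]fineK; last exact: integrable_fin_num.
  congr EFin; rewrite -/(Rintegral Q setT g0) (RintegralD measurableT if0 (iM M)).
  have QT : fine (Q setT) = 1 by rewrite probability_setT.
  by rewrite Rintegral_cst // QT mulr1.
have In n : (\int[Q]_w (EFin \o g n) w =
   (loop_sum (fun=> 1) (k n) (fun a => ranked_value (m n) (a ++ b n)) + M)%:E)%E.
  have := @integral_stick _ _ _ Q U hU (k n) (fun a => ranked_value (m n) (a ++ b n) + M).
  move=> -> ; last by move=> s; have := vM (m n) (s ++ b n); rewrite ler_norml => /andP[h _]; lra.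
  by rewrite loop_sumD loop_sum_cst loop_sum_1 mulr1.
have c0 : (fun n => loop_sum (fun=> 1) (k n) (fun a => ranked_value (m n) (a ++ b n)) + M) @ \oo -->
    \int[Q]_w f (W ^~ w) + M.
  have := cI; rewrite I0 => c1; have {}c1 : (fun n => (loop_sum (fun=> 1) (k n) (fun a => ranked_value (m n) (a ++ b n)) + M)%:E) @ \oo --> (\int[Q]_w f (W ^~ w) + M)%:E.
    by apply: cvg_trans c1; apply: near_eq_cvg; apply: nearW => n; rewrite /= In.
  exact: (fine_cvg c1).
move: c0 => /cvgrPdist_lt/(_ e e0)[n _ Hn].
have := Hn n (leqnn n); have [_ _ _] := Hc n.
by rewrite /= distrC opprD addrACA subrr addr0 => h1 h2; have := lt_trans h1 h2; rewrite ltxx.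
Unshelve. all: by end_near. Qed.

End Limit_law.

(** The zeros are sorted to the end, where they coincide with the default value. *)
Lemma nth_sort_positive (s : seq nat) i :
  nth 0%N (sort geq s) i = nth 0%N (sort geq [seq x <- s | (0 < x)%N]) i.
Proof.
have ss z : sorted geq (sort geq z) by apply: sort_sorted => x y; exact: leq_total.
have H z y : (y < nth 0%N (sort geq z) i)%N = (i < count [pred l | (y < l)%N] z)%N.
  transitivity (i < count [pred l | (y < l)%N] (sort geq z))%N; last first.
    by congr (_ < _)%N; apply/permP; rewrite perm_sort.
  apply/esym; apply: (nth_sorted_count (P := [pred l | (y < l)%N]) i (ss z)) => // a b /= ab ya.
  exact: leq_trans ab.
have E y : (y < nth 0%N (sort geq s) i)%N = (y < nth 0%N (sort geq [seq x <- s | (0 < x)%N]) i)%N.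
  rewrite !H count_filter; congr (_ < _)%N; apply: eq_count => l /=.
  by case: (ltnP y l) => // yl; rewrite (leq_ltn_trans (leq0n y) yl).
apply/eqP; rewrite eqn_leq; apply/andP; split; first by rewrite leqNgt E ltnn.
by rewrite leqNgt -E ltnn.
Qed.

Section Mixture_average.
Variables (R : realType) (p : nat -> R) (N : nat).
Hypothesis p0 : forall l, 0 <= p l.

(** The p-loops are placed outside, so that the loops of weight 1 can be averaged for fixed b. *)
Lemma mix_swap (F : seq nat -> R) : (forall s s', perm_eq s s' -> F s = F s') ->
  mix p N (fun a b => F (a ++ b)) =
  \sum_(j < N.+1) loop_sum p j (fun b => loop_sum (fun=> 1) (N - j) (fun a => F (a ++ b))).
Proof.
move=> Fs; transitivity (loop_sum (fun l => 1 + p l) N F).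
  by rewrite (loop_sum_thin (fun=> 1) p N Fs).
transitivity (loop_sum (fun l => p l + 1) N F).
  by apply: eq_loop_sum => // l _; rewrite addrC.
rewrite (loop_sum_thin p (fun=> 1) N Fs); apply: eq_bigr => j _.
apply: eq_loop_sum => // b _ _; apply: eq_loop_sum => // a _ _.
by apply: Fs; rewrite perm_catC.
Qed.

Lemma mix_right_fun (g : seq nat -> R) :
  mix p N (fun _ b => g b) = \sum_(j < N.+1) loop_sum p j g.
Proof.
rewrite /mix (reindex_inj rev_ord_inj) /=; apply: eq_bigr => k _.
by rewrite subSS loop_sum_cst loop_sum_1 mulr1 subKn // -ltnS.
Qed.

(* Given the loops of weight p, the rest is uniform. *)
Lemma mix_average (F g : seq nat -> R) (I : R) : (forall s s', perm_eq s s' -> F s = F s') ->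
  (forall b, (sumn b <= N)%N ->
     `|loop_sum (fun=> 1) (N - sumn b) (fun a => F (a ++ b)) - I| <= g b) ->
  `|mix p N (fun a b => F (a ++ b)) - I * cumulative_mass p N| <= mix p N (fun _ b => g b).
Proof.
move=> Fs H; rewrite mix_swap // mix_right_fun.
have -> : cumulative_mass p N = \sum_(j < N.+1) loop_sum p j (fun=> 1) by [].
rewrite mulr_sumr -sumrB.
apply: (le_trans (ler_norm_sum _ _ _)); apply: ler_sum => j _.
have jN : (j <= N)%N by rewrite -ltnS.
rewrite -(loop_sum_cst p j I) -loop_sumN -loop_sumD.
apply: le_trans; first by apply: ler_norm_loop_sum => l _; exact: p0.
apply: ler_loop_sum => [l _|b bj _]; first exact: p0.
by have := H b; rewrite bj; apply.
Qed.

End Mixture_average.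

(** * The critical canonical ensemble *)

Section Thermodynamic_limit.
Variable R : realType.
Implicit Types (rho L : R).

Lemma thermodynamicP rho (P : R -> Prop) :
  (\forall L \near thermodynamic rho, P L) <->
  exists L0, forall L, L0 < L -> admissible_length rho L -> P L.
Proof.
split=> [[L0 [_ HL]]|[L0 HL]]; first by exists L0.
by exists L0; split; [exact: num_real | move=> L L0L aL; exact: HL].
Qed.

Lemma thermodynamic_filter rho : Filter (thermodynamic rho).
Proof. exact: within_filter. Qed.

Lemma cvg_thermodynamic rho (f : R -> R) (l : R) :
  (forall e, 0 < e -> exists L0, forall L, L0 < L -> admissible_length rho L -> `|f L - l| <= e) ->
  f L @[L --> thermodynamic rho] --> l.
Proof.
move=> H; have FF := thermodynamic_filter rho.
apply/cvgrPdist_le => e /H HL; apply/thermodynamicP.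
by have [L0 HL0] := HL; exists L0 => L L0L aL; rewrite distrC; exact: HL0.
Qed.

Lemma ln_gt (c L : R) : expR c < L -> c < ln L.
Proof.
move=> h; rewrite -{1}(expRK c) ltr_ln ?posrE ?expR_gt0 //.
by apply: lt_trans h; exact: expR_gt0.
Qed.

End Thermodynamic_limit.

Section Critical_soup.
Variables (R : realType) (Lam : domain R) (lam : nat -> R) (phi : nat -> R3 R -> R).
Variables (beta a1 a2 : R).
Variable bridge : R -> R -> R3 R -> R3 R -> {measure set (trajectory R) -> \bar R}.
Variable soup : R -> probability (sample R) R.
Hypotheses (hLam : admissible_domain Lam) (hspec : laplace_spectrum Lam lam phi).
Hypotheses (hbeta : 0 < beta) (hexp : heat_expansion lam a1 a2) (ha1 : a1 < 0).
Hypothesis hbridge : forall (L t : R) (x y : R3 R), 0 < L -> 0 < t ->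
  dilate L (carrier Lam) x -> dilate L (carrier Lam) y ->
  brownian_bridge Lam lam phi L t x y (bridge L t x y).
Hypothesis hsoup : forall L : R, admissible_length (rho_c beta) L ->
  poisson_point_process
    (loop_intensity Lam beta L (particle_number (rho_c beta) L) bridge) (soup L).

Local Notation rho := (rho_c beta).
Local Notation N := (particle_number rho).
Local Notation Z := (heat_trace lam).
Local Notation l0 := (lam 0%N).
Local Notation sqrt := (@Num.sqrt R).

Definition scale (L : R) : R := L ^+ 2 / beta.
(** Cutting the weights at N does not change sums over totals up to N, and it gives them the finite
    range that the moment estimates suppose. *)
Definition excess_at (L : R) (j : nat) : R :=
  if (0 < j <= N L)%N then excess lam (j%:R / scale L) else 0.
Definition condensate (L : R) : R := - (2 * a1) * beta^-1 * L ^+ 2 * ln L.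
(** The probability of an empty soup, times the factor by which the tilt changes every sample of N
    particles. *)
Definition soup_norm (L : R) : R :=
  expR (- \sum_(i < N L) Z (beta * i.+1%:R * L ^- 2) / i.+1%:R) * expR (- (l0 / scale L)) ^+ N L.

Section Fixed_L.
Variable L : R.
Hypothesis aL : admissible_length rho L.

Let L0 : 0 < L. Proof. by case: aL. Qed.

Lemma scale_gt0 : 0 < scale L.
Proof. by rewrite divr_gt0 // exprn_gt0. Qed.

Let uE j : beta * j%:R * L ^- 2 = j%:R / scale L.
Proof. by rewrite /scale invf_div mulrA [beta * _]mulrC. Qed.

(** This is where the critical density enters: the right-hand side is the leading term of the mean
    number of particles in p-loops given by [trace_grid]. *)
Lemma particle_numberE : (N L)%:R = weyl_constant R * zeta (3 / 2 : R) * sqrt (scale L) ^+ 3.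
Proof.
have [_ <-] := aL; rewrite /rho_c powRM ?mulr_ge0 ?pi_ge0 ?(ltW hbeta) // -/(weyl_constant R).
rewrite powR_neg_three_half // /scale sqrtrM ?sqr_ge0 // sqrtrV ?(ltW hbeta) //.
rewrite sqrtr_sqr (ger0_norm (ltW L0)) exprMn -exprVn; ring.
Qed.

Lemma excess_at_ge0 j : 0 <= excess_at L j.
Proof.
rewrite /excess_at; case: ifP => // /andP[j0 _]; apply: (excess_ge0 hspec hexp).
by rewrite divr_gt0 ?ltr0n // scale_gt0.
Qed.

Lemma excess_at_eq0 j : (N L < j)%N -> excess_at L j = 0.
Proof.
move=> Nj; rewrite /excess_at; case: ifP => // /andP[_ jN].
by have := leq_trans Nj jN; rewrite ltnn.
Qed.

Let t j := Z (beta * j%:R * L ^- 2).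
Let q := expR (- (l0 / scale L)).

Let tE j : (0 < j <= N L)%N -> t j = q ^+ j * (1 + excess_at L j).
Proof.
move=> jN; rewrite /t uE heat_traceE /excess_at jN; congr (_ * _).
by rewrite /q -expRM_natl; congr expR; rewrite mulrN; congr (- _); rewrite mulrCA mulrC -mulrA mulrC.
Qed.

Let loop_sumE n F : (n <= N L)%N -> loop_sum t n F = q ^+ n * loop_sum (fun j => 1 + excess_at L j) n F.
Proof.
move=> nN; rewrite -loop_sum_exp; apply: eq_loop_sum => // l /andP[l1 ln].
by apply: tE; rewrite l1 (leq_trans ln).
Qed.

Let intensity_long : loop_intensity Lam beta L (N L) bridge [set l | (N L < l.1)%N] = 0%E.
Proof. exact: loop_intensity_long. Qed.

Let intensity_length j : (0 < j <= N L)%N ->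
  loop_intensity Lam beta L (N L) bridge [set l | l.1 = j] = (t j / j%:R)%:E.
Proof.
move=> jN; apply: (loop_intensity_length hLam hspec hexp hbeta L0 _ jN).
by move=> s x y s0 Cx Cy; exact: hbridge.
Qed.

Lemma canonical_integral (F : seq nat -> R) : (forall s s', perm_eq s s' -> F s = F s') ->
  (\int[soup L]_(w in canonical_event (N L)) (F (loop_lengths w))%:E =
   (soup_norm L * mix (excess_at L) (N L) (fun a b => F (a ++ b)))%:E)%E.
Proof.
move=> Fs; rewrite (soup_integral intensity_long intensity_length (hsoup aL)) //.
by rewrite loop_sumE // loop_sum_thin // mulrA.
Qed.

Lemma canonical_set (G : seq nat -> bool) : (forall s s', perm_eq s s' -> G s = G s') ->
  soup L ([set w | G (loop_lengths w)] `&` canonical_event (N L)) =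
  (soup_norm L * mix (excess_at L) (N L) (fun a b => (G (a ++ b))%:R))%:E.
Proof.
move=> Gs; rewrite (soup_prob intensity_long intensity_length (hsoup aL)) //.
rewrite loop_sumE // loop_sum_thin; first by rewrite mulrA.
by move=> s s' /Gs ->.
Qed.

Lemma prob_particles n : (n <= N L)%N ->
  soup L (canonical_event n) =
  (expR (- \sum_(i < N L) t i.+1 / i.+1%:R) * (q ^+ n * cumulative_mass (excess_at L) n))%:E.
Proof.
move=> nN; have := @soup_prob _ _ _ _ _ intensity_long intensity_length (hsoup aL) n (fun=> true) nN (fun _ _ _ => erefl).
have -> : [set w : sample R | (fun=> true) (loop_lengths w)] `&` canonical_event n = canonical_event n.
  by apply/seteqP; split => w; [case | split].
move=> ->; rewrite loop_sumE //; congr (_ * (_ * _))%:E.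
have := loop_mass_thin (fun=> 1) (excess_at L) n; rewrite /loop_mass => ->.
rewrite /cumulative_mass [RHS](reindex_inj rev_ord_inj) /=; apply: eq_bigr => k _.
by rewrite loop_sum_1 mul1r subSS.
Qed.

End Fixed_L.

Definition condensation_bounds (K L : R) : Prop :=
  let p := excess_at L in let x := scale L in
  [/\ 1 <= x, x <= (N L)%:R, 1 < ln L & 4 * K * x <= condensate L] /\
  [/\ \sum_(l < N L) l.+1%:R * p l.+1 <= K * x ^+ 2,
      `|(N L)%:R - \sum_(l < N L) p l.+1 - condensate L| <= K * x,
      \sum_(l < N L | x <= l.+1%:R) p l.+1 <= K * x &
      `|\sum_(l < N L) (p l.+1 - Z (beta * l.+1%:R * L ^- 2)) / l.+1%:R - l0 * (N L)%:R / x -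
        (- 2 + 2 * l0 * a1 - (l0 == 0)%:R) * ln L| <= K].

(** Rewrites [trace_grid] in terms of L, through ln x = 2 ln L - ln beta; the shifts by ln beta only
    cost O(x) particles, and O(1) in the logarithm of the partition function. *)
Lemma eventual_bounds : exists K L0, 1 <= K /\
  forall L, L0 < L -> admissible_length rho L -> condensation_bounds K L.
Proof.
have ha := ha1; have hb := hbeta; have [K0 [K00 HK]] := trace_grid hspec hexp.
pose A := weyl_constant R * zeta (3 / 2 : R).
have z1 : 1 <= zeta (3 / 2 : R).
  by have /andP[h _] := zeta_sum_bound R (isT : (0 < 1)%N); move: h; rewrite big_ord1 sqrtr1 expr1n invr1.
have A0 : 0 < A by rewrite mulr_gt0 ?powR_gt0 ?mulr_gt0 ?pi_gt0 //; lra.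
pose K := K0 + `|a1 * ln beta| + `|l0 * a1 - 1| * `|ln beta| + `|ln A| + 3 / 2 * `|ln beta| + 2.
have K1 : 1 <= K.
  have h1 := normr_ge0 (a1 * ln beta); have h2 := normr_ge0 (ln A); have h3 := normr_ge0 (ln beta).
  have h4 : 0 <= `|l0 * a1 - 1| * `|ln beta| by rewrite mulr_ge0.
  by rewrite /K; lra.
(* A lower bound for ln L that ensures x >= 1, x <= N, ln L > 1 and the lower bound of the
   condensate. *)
pose c1 := `|ln beta| + 4 * K / - (2 * a1) + 2 * `|ln A| + 1.
exists K, (expR c1); split => // L Lc aL.
have x0 := scale_gt0 aL; have L0 : 0 < L by case: aL.
have lnc := ln_gt Lc.
have q0 : 0 <= 4 * K / - (2 * a1) by rewrite divr_ge0 ?mulr_ge0 //; lra.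
have lb := ler_norm (ln beta); have lb' := ler_norm (- ln beta); rewrite normrN in lb'.
have la' := ler_norm (- ln A); rewrite normrN in la'.
have nA := normr_ge0 (ln A); have nb := normr_ge0 (ln beta).
have lnx : ln (scale L) = 2 * ln L - ln beta.
  by rewrite /scale lnM ?posrE ?invr_gt0 ?exprn_gt0 // lnV ?posrE // lnXn // mulr_natl.
have x1 : 1 <= scale L by rewrite -ler_ln ?posrE // ln1 lnx; move: lnc; rewrite /c1; lra.
have NE := particle_numberE aL; rewrite -/A in NE.
have sx0 : 0 < sqrt (scale L) by rewrite sqrtr_gt0.
have sx2 : sqrt (scale L) ^+ 2 = scale L by rewrite sqr_sqrtr // ltW.
have lsx : 2 * ln (sqrt (scale L)) = ln (scale L) by rewrite -{2}sx2 lnXn // mulr_natl.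
have xN : scale L <= (N L)%:R.
  rewrite NE exprS sx2 mulrA ler_peMl ?(ltW x0) // -ler_ln ?posrE ?(mulr_gt0 A0 sx0) //.
  by rewrite ln1 (@lnM _ A) ?posrE //; move: lnc; rewrite /c1; lra.
have pE : forall l : 'I_(N L), excess_at L l.+1 = excess lam (l.+1%:R / scale L).
  by move=> l; rewrite /excess_at /= ltn_ord.
have [b1 b2 b3 b4] := HK _ _ x1 xN.
have mE : condensate L = - a1 * scale L * (ln (scale L) + ln beta).
  by rewrite /condensate lnx /scale; field; rewrite gt_eqF.
split; split => //.
- by move: lnc; rewrite /c1; lra.
- rewrite mE lnx; have -> : - a1 * scale L * (2 * ln L - ln beta + ln beta) = (- (2 * a1) * ln L) * scale L by ring.
  rewrite ler_wpM2r ?(ltW x0) // [leRHS]mulrC -ler_pdivrMr; last by lra.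
  by move: lnc; rewrite /c1; lra.
- under eq_bigr do rewrite pE; apply: (le_trans b2); rewrite ler_wpM2r ?sqr_ge0 //.
  have h1 := normr_ge0 (a1 * ln beta).
  have h4 : 0 <= `|l0 * a1 - 1| * `|ln beta| by rewrite mulr_ge0.
  by rewrite /K; lra.
- under eq_bigr do rewrite pE.
  move: b1; set M := \sum_(_ < _) _; rewrite -/A -NE => b1.
  have -> : (N L)%:R - M - condensate L =
    - (M - (N L)%:R - a1 * scale L * ln (scale L)) + a1 * ln beta * scale L by rewrite mE; ring.
  apply: (le_trans (ler_normD _ _)); rewrite normrN normrM (ger0_norm (ltW x0)).
  apply: (@le_trans _ _ ((K0 + `|a1 * ln beta|) * scale L)); first by rewrite mulrDl lerD2r.
  rewrite ler_wpM2r ?(ltW x0) //.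
  have h4 : 0 <= `|l0 * a1 - 1| * `|ln beta| by rewrite mulr_ge0.
  by rewrite /K; lra.
- under eq_bigr do rewrite pE; apply: (le_trans b3); rewrite ler_wpM2r ?(ltW x0) //.
  have h1 := normr_ge0 (a1 * ln beta).
  have h4 : 0 <= `|l0 * a1 - 1| * `|ln beta| by rewrite mulr_ge0.
  by rewrite /K; lra.
(* For l0 > 0 the term l0 N / x equals the sqrt x term of the sum and cancels it. For l0 = 0 the
   summands are - 1 / j, and the sum up to N, of order x^(3/2), is - 3 / 2 ln x, hence - 3 ln L, up
   to a constant. *)
- have uE j : beta * j%:R * L ^- 2 = j%:R / scale L by rewrite /scale invf_div mulrA [beta * _]mulrC.
  under eq_bigr do rewrite pE uE.
  have l00 := eigenvalue_ge0 hspec 0; have [lz|ln0] := eqVneq l0 0; last first.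
    have lp : 0 < l0 by rewrite lt_neqAle eq_sym ln0.
    have := b4 lp; set E := \sum_(_ < _) _ => h.
    have -> : l0 * (N L)%:R / scale L = l0 * weyl_constant R * zeta (3 / 2 : R) * sqrt (scale L).
      by rewrite NE /A exprS sx2; field; rewrite gt_eqF.
    have -> : E - l0 * weyl_constant R * zeta (3 / 2 : R) * sqrt (scale L) - (- 2 + 2 * l0 * a1 - false%:R) * ln L =
      (E - l0 * weyl_constant R * zeta (3 / 2 : R) * sqrt (scale L) - (l0 * a1 - 1) * ln (scale L)) - (l0 * a1 - 1) * ln beta.
      by rewrite lnx /=; ring.
    apply: (le_trans (ler_normB _ _)); rewrite [X in _ + X]normrM.
    have h1 := normr_ge0 (a1 * ln beta).
    by rewrite /K; lra.
  have -> : \sum_(l < N L) (excess lam (l.+1%:R / scale L) - Z (l.+1%:R / scale L)) / l.+1%:R = - \sum_(l < N L) l.+1%:R^-1.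
    rewrite -sumrN; apply: eq_bigr => l _; rewrite /excess lz mul0r expR0 mul1r; ring.
  have N0 : (0 < N L)%N by rewrite -(ltr0n R); lra.
  have /andP[s1 s2] := sum_inv_ln R N0.
  have lnN : ln (N L)%:R = ln A + 3 / 2 * ln (scale L).
    by rewrite NE (@lnM _ A) ?posrE ?exprn_gt0 // lnXn // -lsx -mulr_natl; lra.
  have s1' : ln (N L)%:R <= ln (N L).+1%:R :> R by rewrite ler_ln ?posrE ?ltr0n // ler_nat.
  rewrite lz mul0r mul0r subr0 mulr0 mul0r addr0 /=.
  have h1 := normr_ge0 (a1 * ln beta); have hA := ler_norm (ln A).
  have h4 : 0 <= `|l0 * a1 - 1| * `|ln beta| by rewrite mulr_ge0.
  rewrite lnN lnx in s1' s2; rewrite lz in h4.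
  rewrite ler_norml /K lz; set S := \sum_(_ < _) _ in s1 s2 *.
  by apply/andP; split; lra.
Qed.

Lemma condensation_facts (K L : R) : 1 <= K -> admissible_length rho L -> condensation_bounds K L ->
  let S := cumulative_mass (excess_at L) in
  let H := expR (\sum_(l < N L) excess_at L l.+1 / l.+1%:R) in
  [/\ H / 2 <= S (N L) <= H, 0 < S (N L),
     `|\sum_(r < N L) S (N L - r.+1)%N - condensate L * S (N L)| <= (3 * K + 1) * scale L * S (N L) &
     forall r eps, scale L <= r -> 0 < eps -> K * scale L < eps * condensate L / 4 ->
     mix (excess_at L) (N L) (fun a b => (~~ (condensate L * (1 - eps) <
         \sum_(l <- a ++ b | r <= l%:R) l%:R < condensate L * (1 + eps)))%:R) <=
     S (N L) * (2 * K * scale L ^+ 2 / (eps * condensate L / 4) ^+ 2 + r / (eps * condensate L / 4) +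
       2 * K * scale L / (eps * condensate L / 4))].
Proof.
move=> K1 aL [[x1 xN lnL Hm] [HV HM HT _]] S H.
have x0 := scale_gt0 aL; have p0 := excess_at_ge0 aL; have pN := @excess_at_eq0 L.
split.
- exact: (cumulative_mass_bounds p0 pN x0 K1 HV HM Hm).
- exact: (cumulative_mass_gt0 p0 pN x0 K1 HV HM Hm).
- have := sum_cumulative_mass p0 pN x0 K1 HV HM HT Hm; exact.
- by move=> r eps; exact: (mix_deviation p0 pN x0 K1 HV HM HT Hm).
Qed.

(** The probability is exp (\sum_j (p j - t j) / j - l0 N / x) up to a factor between 1 / 2 and 1;
    the bounded error of its logarithm, divided by ln L, is the delta in the exponent. *)
Lemma partition_function_asymptotics : exists delta : R -> R,
  delta L @[L --> thermodynamic rho] --> (0 : R) /\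
  (\forall L \near thermodynamic rho, fine (soup L (canonical_event (N L))) =
     L `^ (- 2 + 2 * l0 * a1 - (l0 == 0)%:R + delta L)).
Proof.
have [K [L0 [K1 HK]]] := eventual_bounds.
set c := - 2 + 2 * l0 * a1 - (l0 == 0)%:R.
exists (fun L => ln (fine (soup L (canonical_event (N L)))) / ln L - c).
have key L : L0 < L -> admissible_length rho L ->
    [/\ 1 < ln L, 0 < fine (soup L (canonical_event (N L))) &
     `|ln (fine (soup L (canonical_event (N L)))) - c * ln L| <= K + 1].
  move=> LL aL; have bL := HK _ LL aL; have [SB S0 _ _] := condensation_facts K1 aL bL.
  have [[_ _ lnL _] [_ _ _ HE]] := bL.
  rewrite (prob_particles aL (leqnn _)) /=.
  set S := cumulative_mass _ _ in SB S0 *; set q := expR _ ^+ N L.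
  have qE : q = expR (- (l0 * (N L)%:R / scale L)).
    by rewrite /q -expRM_natl; congr expR; ring.
  have P0 : 0 < expR (- \sum_(i < N L) Z (beta * i.+1%:R * L ^- 2) / i.+1%:R) * (q * S).
    by rewrite mulr_gt0 ?expR_gt0 // mulr_gt0 // qE expR_gt0.
  split => //.
  rewrite lnM ?posrE ?expR_gt0 ?mulr_gt0 ?qE ?expR_gt0 // expRK lnM ?posrE ?expR_gt0 // expRK.
  have /andP[S1 S2] := SB.
  have l2 : ln 2 <= 1 :> R by have := @le_ln1Dx R 1; rewrite -[1 + 1]/(2 : R); apply; lra.
  have u2 : ln S <= \sum_(l < N L) excess_at L l.+1 / l.+1%:R.
    by rewrite -[leRHS]expRK ler_ln ?posrE ?expR_gt0.
  have u1 : \sum_(l < N L) excess_at L l.+1 / l.+1%:R - ln 2 <= ln S.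
    rewrite -[X in X - _]expRK -ln_div ?posrE ?expR_gt0 //.
    by rewrite ler_ln ?posrE ?divr_gt0 ?expR_gt0.
  have hs : \sum_(l < N L) (excess_at L l.+1 - Z (beta * l.+1%:R * L ^- 2)) / l.+1%:R =
      \sum_(l < N L) excess_at L l.+1 / l.+1%:R - \sum_(l < N L) Z (beta * l.+1%:R * L ^- 2) / l.+1%:R.
    by rewrite -sumrB; apply: eq_bigr => l _; rewrite mulrBl.
  rewrite hs -/c in HE; move: HE.
  move: u1 u2; set P := \sum_(l < N L) excess_at _ _ / _; set T := \sum_(_ < _) _ => u1 u2.
  rewrite !ler_norml => /andP[h1 h2].
  by apply/andP; split; lra.
split; last first.
  apply/thermodynamicP; exists L0 => L LL aL; have [lnL P0 _] := key L LL aL.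
  have L00 : 0 < L by case: aL.
  rewrite /powR gt_eqF // addrC subrK divfK ?lnK ?posrE //; rewrite gt_eqF //; lra.
apply: cvg_thermodynamic => e e0; exists (Num.max L0 (expR ((K + 1) / e))) => L.
rewrite gt_max => /andP[LL Le] aL; have [lnL P0 h] := key L LL aL.
have := ln_gt Le; rewrite ltr_pdivrMr // => le.
have ln0 : 0 < ln L by lra.
rewrite subr0; set P := ln (fine _) in h *.
have -> : P / ln L - c = (P - c * ln L) / ln L by field; rewrite gt_eqF.
rewrite normrM normfV (gtr0_norm ln0) ler_pdivrMr //; apply: (le_trans h).
by rewrite mulrC ltW.
Qed.

Let geE (r : R) (w : sample R) :
  (particles_ge r w)%:R = \sum_(l <- loop_lengths w | r <= l%:R) (l%:R : R).
Proof.
rewrite /particles_ge /loop_lengths natr_sum big_filter_cond big_map [LHS]big_mkcond [RHS]big_mkcond /=.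
by apply: eq_bigr => l _; case: (posnP l.1) => [->|]; rewrite ?andbT //; case: ifP.
Qed.

(** Of the threshold r = alpha L^2 only r >= x and r = o(x ln L) are used: on average the loops of
    weight 1 that are shorter than r hold at most r particles, and the p-loops longer than r hold
    O(x), both negligible against the condensate. *)
Lemma condensate_fraction (eps : R) : 0 < eps ->
  canonical_prob (soup L) (N L)
    [set w | condensate L * (1 - eps)
             < (particles_ge (ln (ln L) / ln (ln (ln L)) * L ^+ 2) w)%:R
             < condensate L * (1 + eps)]
  @[L --> thermodynamic rho] --> (1 : R).
Proof.
move=> eps0; have ha := ha1; have hb := hbeta.
have [K [L0 [K1 HK]]] := eventual_bounds.
apply: cvg_thermodynamic => e e0.
(* Such that eps m / 4 = c x ln L. *)
have [c [c0 cE]] : exists c, 0 < c /\ c = eps * (- (2 * a1)) / 4.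
  by eexists; split; last reflexivity; rewrite divr_gt0 // mulr_gt0 //; lra.
(* Lower bounds for ln L and ln ln L: [g1], [g2] and [g3] bring the variance, the short loops and
   the long p-loops below e / 3 each, [g4] makes K x smaller than eps m / 4, and [g5] puts the
   threshold above x. As ln ln ln L exceeds their sum, so do the other two. *)
pose g1 := 6 * K / (c ^+ 2 * e); pose g2 := (6 * beta / (c * e)) ^+ 2.
pose g3 := 6 * K / (c * e); pose g4 := K / c; pose g5 := 4 / beta ^+ 2.
have g10 : 0 <= g1 by apply: divr_ge0; [lra | rewrite mulr_ge0 ?sqr_ge0 // ltW].
have g20 : 0 <= g2 by exact: sqr_ge0.
have g30 : 0 <= g3 by apply: divr_ge0; [lra | rewrite mulr_ge0 ?(ltW c0) // ltW].
have g40 : 0 <= g4 by apply: divr_ge0; lra.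
have g50 : 0 <= g5 by rewrite divr_ge0 ?sqr_ge0.
pose T := 1 + g1 + g2 + g3 + g4 + g5.
exists (Num.max L0 (expR (expR (expR T)))) => L.
rewrite gt_max => /andP[LL LT] aL.
have y3 : T < ln (ln (ln L)) by apply: ln_gt; apply: ln_gt; exact: ln_gt.
have y2 : expR T < ln (ln L) by apply: ln_gt; exact: ln_gt.
have y1 : expR (expR T) < ln L by exact: ln_gt.
set z := ln L in y1 y2 y3 *; set y := ln z in y2 y3 *.
have eT := expR_ge1Dx T; have eeT := expR_ge1Dx (expR T).
have yT : T < y by lra.
have zT : T < z by lra.
have T1 : 1 <= T by rewrite /T; lra.
have y0 : 0 < y by lra.
have z0 : 0 < z by lra.
have lnsq (v : R) : 0 < v -> ln v <= 2 * sqrt v.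
  move=> v0; have s0 : 0 < sqrt v by rewrite sqrtr_gt0.
  have -> : ln v = 2 * ln (sqrt v) by rewrite -{1}(sqr_sqrtr (ltW v0)) lnXn // mulr_natl.
  rewrite ler_wpM2l //.
  have -> : sqrt v = 1 + (sqrt v - 1) by lra.
  by apply: (le_trans (le_ln1Dx _)); lra.
have bL := HK _ LL aL; have [_ S0 _ dev] := condensation_facts K1 aL bL.
have x0 := scale_gt0 aL; set x := scale L in dev x0 *.
have L00 : 0 < L by case: aL.
have Lx : L ^+ 2 = beta * x by rewrite /x /scale mulrC divfK // gt_eqF.
set al := y / ln y; set r := al * L ^+ 2.
have ly0 : 0 < ln y by lra.
have al0 : 0 < al by rewrite divr_gt0.
have sy0 : 0 < sqrt y by rewrite sqrtr_gt0.
have sz0 : 0 < sqrt z by rewrite sqrtr_gt0.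
have xr : x <= r.
  rewrite /r Lx mulrA ler_peMl ?(ltW x0) //.
  have h1 : sqrt y / 2 <= al.
    rewrite /al ler_pdivlMr //; have hl := lnsq y y0.
    have : 0 <= sqrt y * (2 * sqrt y - ln y) by rewrite mulr_ge0 ?(ltW sy0) // subr_ge0.
    by have := sqr_sqrtr (ltW y0); rewrite expr2; lra.
  have h2 : 2 / beta <= sqrt y.
    have b0 : 0 <= 2 / beta by rewrite divr_ge0 // ltW.
    rewrite -[leLHS]ger0_norm // -sqrtr_sqr ler_wsqrtr // exprMn exprVn.
    by apply: ltW; apply: le_lt_trans yT; rewrite -natrX -/g5 /T; lra.
  have h3 : beta^-1 <= al by apply: le_trans h1; lra.
  by rewrite -(mulVf (x := beta)) ?gt_eqF // ler_wpM2r // ltW.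
have dE : eps * condensate L / 4 = c * x * z.
  by rewrite /condensate -/z cE /x /scale; ring.
have Kd : K * x < eps * condensate L / 4.
  rewrite dE mulrAC ltr_pM2r // -ltr_pdivrMl //.
  by apply: le_lt_trans zT; rewrite mulrC -/g4 /T; lra.
have := dev r eps xr eps0 Kd; rewrite dE => mixbad.
rewrite /canonical_prob.
have -> : [set w | condensate L * (1 - eps) < (particles_ge r w)%:R < condensate L * (1 + eps)] =
   [set w : sample R | condensate L * (1 - eps) < \sum_(l <- loop_lengths w | r <= l%:R) l%:R < condensate L * (1 + eps)].
  by apply/seteqP; split => w; rewrite /= geE.
pose G (s : seq nat) := condensate L * (1 - eps) < \sum_(l <- s | r <= l%:R) l%:R < condensate L * (1 + eps).
have Gs s s' : perm_eq s s' -> G s = G s' by move=> ss'; rewrite /G (perm_big _ ss').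
have := canonical_set aL Gs; rewrite /G => ->.
have -> : soup L (canonical_event (N L)) = (soup_norm L * cumulative_mass (excess_at L) (N L))%:E.
  by rewrite (prob_particles aL (leqnn _)) mulrA.
rewrite /=; set S := cumulative_mass _ _ in S0 mixbad *.
set bad := mix _ _ _ in mixbad; set good := mix _ _ _.
have gb : good + bad = S.
  rewrite /good /bad /S -mixD -mix1; apply: eq_bigr => k _; apply: eq_loop_sum => // a _ _.
  by apply: eq_loop_sum => // b _ _; case: (_ < _ < _); rewrite ?addr0 ?add0r.
have W0 : soup_norm L != 0 by rewrite /soup_norm mulf_neq0 ?expf_neq0 // gt_eqF // expR_gt0.
rewrite -mulf_div divff // mul1r.
have -> : good / S - 1 = - (bad / S) by rewrite -gb; field; rewrite gb gt_eqF.
have bad0 : 0 <= bad.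
  apply: sumr_ge0 => k _; apply: loop_sum_ge0 => [? _|a _ _]; first exact: ler01.
  by apply: loop_sum_ge0 => [l _|b _ _]; [exact: excess_at_ge0 | exact: ler0n].
rewrite normrN ger0_norm ?divr_ge0 ?(ltW S0) // ler_pdivrMr // mulrC.
apply: (le_trans mixbad); rewrite ler_wpM2l ?(ltW S0) //.
have t1 : 2 * K * x ^+ 2 / (c * x * z) ^+ 2 <= e / 3.
  have -> : 2 * K * x ^+ 2 / (c * x * z) ^+ 2 = 2 * K / (c ^+ 2 * z ^+ 2) by field; rewrite !gt_eqF.
  rewrite ler_pdivrMr ?mulr_gt0 ?exprn_gt0 //.
  have h : g1 <= z by move: zT; rewrite /T; lra.
  have h2 : g1 <= z ^+ 2 by apply: (le_trans h); rewrite expr2 ler_peMr //; lra.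
  have : 6 * K <= z ^+ 2 * (c ^+ 2 * e) by rewrite -ler_pdivrMr // mulr_gt0 // exprn_gt0.
  by rewrite mulrA; lra.
have t3 : 2 * K * x / (c * x * z) <= e / 3.
  have -> : 2 * K * x / (c * x * z) = 2 * K / (c * z) by field; rewrite !gt_eqF.
  rewrite ler_pdivrMr ?mulr_gt0 //.
  have h : g3 <= z by move: zT; rewrite /T; lra.
  have : 6 * K <= z * (c * e) by rewrite -ler_pdivrMr // mulr_gt0.
  by rewrite mulrA; lra.
have t2 : r / (c * x * z) <= e / 3.
  have aly : al <= y by rewrite /al ler_pdivrMr // ler_peMr //; lra.
  have yz : y <= 2 * sqrt z by exact: lnsq.
  have -> : r / (c * x * z) = al * beta / (c * z) by rewrite /r Lx; field; rewrite !gt_eqF.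
  rewrite ler_pdivrMr ?mulr_gt0 //.
  have h : 6 * beta / (c * e) <= sqrt z.
    have b0 : 0 <= 6 * beta / (c * e).
      by apply: divr_ge0; [rewrite mulr_ge0 // ltW | exact: ltW (mulr_gt0 c0 e0)].
    rewrite -[leLHS]ger0_norm // -sqrtr_sqr ler_wsqrtr // -/g2.
    by move: zT; rewrite /T; lra.
  have h2 : 6 * beta <= sqrt z * (c * e) by rewrite -ler_pdivrMr // mulr_gt0.
  have h3 : 6 * beta * sqrt z <= z * (c * e).
    apply: (@le_trans _ _ (sqrt z * (c * e) * sqrt z)); first by rewrite ler_wpM2r ?(ltW sz0).
    by rewrite -{3}(sqr_sqrtr (ltW z0)) expr2 le_eqVlt; apply/orP; left; apply/eqP; ring.
  have h4 : al * beta <= 2 * sqrt z * beta by rewrite ler_wpM2r ?(ltW hb) // (le_trans aly).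
  by lra.
by lra.
Qed.

(** The tilt exp (- l0 r / x) of the kernel cancels against the ratio of the two probabilities. What
    is left is the sum of (phi0 phi0 + remainder) S(N - r) / S(N), where S is increasing: the ground
    state part gives the condensate, by [sum_cumulative_mass], and the remainders add up to O(x), by
    [grid_sum] with both coefficients 0. *)
Lemma reduced_density_matrix_asymptotics (x y : R -> R3 R) (eps : R) : 0 < eps ->
  (\forall L \near thermodynamic rho,
     [/\ dilate L (carrier Lam) (x L), dilate L (carrier Lam) (y L),
         eps * L < domain_dist Lam L (x L) (y L)
       & forall z, dilate L (domain_boundary Lam) z ->
           eps * L <= domain_dist Lam L (x L) z /\
           eps * L <= domain_dist Lam L (y L) z]) ->
  exists delta : R -> R,
    delta L @[L --> thermodynamic rho] --> (0 : R) /\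
    (\forall L \near thermodynamic rho,
       reduced_density_matrix lam phi beta L (soup L) (N L) (x L) (y L) =
       - (2 * a1) * beta^-1 * phi 0%N (L^-1 *: x L)
         * phi 0%N (L^-1 *: y L) * L^-1 * ln L * (1 + delta L)).
Proof.
move=> eps0 /thermodynamicP[L1 Hxy]; have ha := ha1; have hb := hbeta.
(* The half pays for passing from Euclidean distances to boxes, as in [euclid_open_box]. *)
have e20 : 0 < eps / 2 by rewrite divr_gt0.
have hbr t u v : 0 < t -> carrier Lam u -> carrier Lam v ->
    brownian_bridge Lam lam phi 1 t u v (bridge 1 t u v).
  by move=> t0 Cu Cv; apply: hbridge => //; rewrite dilate1.
have [K3 HK3] := kernel_remainder hLam hspec hbr e20.
have [c [c0 Hc]] := phi0_inner_ge hLam hspec e20.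
have [K [L0 [K1 HK]]] := eventual_bounds.
pose T L := - (2 * a1) * beta^-1 * phi 0%N (L^-1 *: x L) * phi 0%N (L^-1 *: y L) * L^-1 * ln L.
pose g L := reduced_density_matrix lam phi beta L (soup L) (N L) (x L) (y L).
(* Its parts are the error of [sum_cumulative_mass] and the sum of the remainders relative to the
   product of the two values of [phi 0], which is at least c^2. *)
pose B := 3 * K + 1 + 4 * `|K3| / c ^+ 2.
have key L : Num.max L0 L1 < L -> admissible_length rho L ->
    0 < T L /\ `|g L / T L - 1| <= B / (- (2 * a1) * ln L).
  rewrite gt_max => /andP[LL0 LL1] aL.
  have L00 : 0 < L by case: aL.
  have Ln0 : L != 0 by rewrite gt_eqF.
  have [Cx Cy dxy dbd] := Hxy L LL1 aL.
  set X := L^-1 *: x L; set Y := L^-1 *: y L.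
  have scale_back (u v w : R3 R) : u - v + L *: w = L *: (L^-1 *: u - L^-1 *: v + w).
    by rewrite scalerDr scalerBr !scalerA divff // !scale1r.
  have sep : far_apart Lam (eps / 2) X Y.
    move=> k /euclid_open_box; rewrite mulrC divfK ?pnatr_eq0 // => h.
    have := lt_le_trans dxy (domain_dist_le Lam L (x L) (y L) k).
    rewrite scale_back euclid_scale ?(ltW L00) // mulrC ltr_pM2l // -/X -/Y addrAC => h'.
    by have := lt_trans h h'; rewrite ltxx.
  have inn (u : R3 R) : dilate L (carrier Lam) u ->
      (forall z, dilate L (domain_boundary Lam) z -> eps * L <= domain_dist Lam L u z) ->
      inner Lam (eps / 2) (L^-1 *: u).
    move=> Cu Hu; split => // z bz [h1 h2 h3].
    have : open_box z (eps / 2) (L^-1 *: u) by split; rewrite distrC.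
    move=> /euclid_open_box; rewrite mulrC divfK ?pnatr_eq0 // => h.
    have bz' : dilate L (domain_boundary Lam) (L *: z).
      by rewrite /dilate /= scalerA mulVf // scale1r.
    have := le_trans (Hu _ bz') (domain_dist_le Lam L u (L *: z) (0, 0, 0)).
    rewrite cell_shift0 scale_back euclid_scale ?(ltW L00) // mulrC ler_pM2l //.
    rewrite scalerA mulVf // scale1r addr0 => h'.
    by have := lt_le_trans h h'; rewrite ltxx.
  have ix : inner Lam (eps / 2) X by apply: inn => // z /dbd[].
  have iy : inner Lam (eps / 2) Y by apply: inn => // z /dbd[].
  pose ff := phi 0%N X * phi 0%N Y.
  have cff : c ^+ 2 <= ff by rewrite expr2 ler_pM ?Hc // ltW.
  have ff0 : 0 < ff by apply: lt_le_trans cff; rewrite exprn_gt0.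
  have bL := HK _ LL0 aL; have [SB S0 SS _] := condensation_facts K1 aL bL.
  have [[x1 xN lnL Hm] _] := bL.
  have s0 := scale_gt0 aL; set s := scale L in s0 x1 xN SS.
  set S := cumulative_mass (excess_at L) in S0 SS SB *.
  have ln0 : 0 < ln L by lra.
  have a10 : 0 < - (2 * a1) by lra.
  have mE : condensate L = - (2 * a1) * s * ln L by rewrite /condensate /s /scale; ring.
  have TE : T L = L ^- 3 * (ff * condensate L).
    by rewrite /T -/X -/Y /condensate /ff; field; rewrite Ln0 gt_eqF.
  have m0 : 0 < condensate L by rewrite mE; exact: mulr_gt0 (mulr_gt0 a10 s0) ln0.
  have T0 : 0 < T L by rewrite TE; apply: (mulr_gt0 _ (mulr_gt0 ff0 m0)); rewrite invr_gt0 exprn_gt0.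
  split => //.
  pose rem u := expR (l0 * u) * unit_kernel lam phi u X Y - ff.
  have uE j : beta * j%:R * L ^- 2 = j%:R / s by rewrite /s /scale invf_div mulrA [beta * _]mulrC.
  have gE : g L = L ^- 3 * \sum_(r < N L) (ff + rem (r.+1%:R / s)) * (S (N L - r.+1)%N / S (N L)).
    rewrite /g /reduced_density_matrix big_add1 /= big_mkord mulr_sumr.
    apply: eq_bigr => r _; have rN := ltn_ord r.
    rewrite [fine (soup L [set w | _])](_ : _ = fine (soup L (canonical_event (N L - r.+1)))) //.
    rewrite !(prob_particles aL) ?leq_subr // heat_kernelE -/X -/Y uE /=.
    rewrite /rem [ff + _]addrC subrK.
    set W := expR (- \sum_(_ < _) _); set q := expR (- (l0 / s)).
    have qE : q ^+ N L = q ^+ (N L - r.+1) * q ^+ r.+1 by rewrite -exprD subnK.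
    have qr : q ^+ r.+1 * expR (l0 * (r.+1%:R / s)) = 1.
      by rewrite -expRM_natl -expRD (_ : _ + _ = 0) ?expR0 //; field; rewrite gt_eqF.
    have q0 k : q ^+ k != 0 by rewrite expf_neq0 // gt_eqF // expR_gt0.
    have W0 : W != 0 by rewrite gt_eqF // expR_gt0.
    have -> : expR (l0 * (r.+1%:R / s)) = (q ^+ r.+1)^-1.
      by apply: (mulfI (q0 r.+1)); rewrite qr divff.
    have gen (A u V Q1 Q2 S1 S2 : R) : V != 0 -> Q1 != 0 -> Q2 != 0 -> S2 != 0 ->
        A * u * (V * (Q1 * S1)) / (V * (Q1 * Q2 * S2)) = A * (Q2^-1 * u * (S1 / S2)).
      by move=> h1 h2 h3 h4; field; rewrite h1 h2 h3 h4.
    by rewrite qE gen ?q0 // gt_eqF.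
  have Smono k : (k <= N L)%N -> S k <= S (N L).
    move=> kN; rewrite /S /cumulative_mass -!(big_mkord xpredT (loop_mass (excess_at L))).
    rewrite [leRHS](big_cat_nat (n := k.+1)) //= lerDl; apply: sumr_ge0 => i _.
    by apply: loop_mass_ge0 => l; exact: excess_at_ge0.
  have rem_sum : \sum_(r < N L) `|rem (r.+1%:R / s)| <= 4 * `|K3| * s.
    have := @grid_sum R (fun u => `|rem u|) 0 0 `|K3| s (N L) x1 xN => /(_ _ _)/wrap[].
    - move=> u /andP[u0 u1]; rewrite !mul0r !subr0 normr_id.
      have [h _] := HK3 X Y u ix iy sep u0; rewrite -/ff -/(rem u) in h.
      apply: (le_trans h); apply: (le_trans (ler_norm _)); rewrite ler_peMr //.
      by rewrite invf_ge1 ?sqrtr_gt0 // -[leRHS]sqrtr1 ler_wsqrtr.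
    - move=> u u1; have u0 : 0 < u by lra.
      have [_ h] := HK3 X Y u ix iy sep u0; rewrite -/ff -/(rem u) in h.
      rewrite normr_id ler_pdivlMr ?exprn_gt0 // mulrC; apply: (le_trans h); exact: ler_norm.
    rewrite !mul0r !subr0 normr0 mulr0 !add0r => /(le_trans (ler_norm _)); exact.
  have dE : g L - T L = L ^- 3 * (ff * ((\sum_(r < N L) S (N L - r.+1)%N - condensate L * S (N L)) / S (N L)) +
      \sum_(r < N L) rem (r.+1%:R / s) * (S (N L - r.+1)%N / S (N L))).
    rewrite gE TE -mulrBr; congr (_ * _).
    under eq_bigr do rewrite mulrDl.
    rewrite big_split /= -mulr_sumr -mulr_suml mulrBl mulfK ?gt_eqF //; ring.
  have L30 : 0 < L ^- 3 by rewrite invr_gt0 exprn_gt0.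
  have -> : g L / T L - 1 = (g L - T L) / T L by field; rewrite gt_eqF.
  rewrite normrM normfV (gtr0_norm T0) ler_pdivrMr // dE TE normrM (gtr0_norm L30).
  rewrite [leRHS]mulrCA ler_pM2l //; apply: (le_trans (ler_normD _ _)).
  have -> : B / (- (2 * a1) * ln L) * (ff * condensate L) = ff * ((3 * K + 1) * s) + ff / c ^+ 2 * (4 * `|K3| * s).
    have gen (A mu l k3 d f : R) : mu != 0 -> l != 0 -> d != 0 ->
        (A + 4 * k3 / d ^+ 2) / (mu * l) * (f * (mu * s * l)) = f * (A * s) + f / d ^+ 2 * (4 * k3 * s).
      by move=> h1 h2 h3; field; rewrite h1 h2 h3.
    by rewrite mE /B gen // gt_eqF.
  apply: lerD.
    rewrite normrM (gtr0_norm ff0) ler_pM2l // normrM normfV (gtr0_norm S0).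
    by rewrite ler_pdivrMr.
  apply: (@le_trans _ _ (4 * `|K3| * s)); last first.
    apply: ler_peMl; first exact: (mulr_ge0 (mulr_ge0 (ler0n R 4) (normr_ge0 _)) (ltW s0)).
    by rewrite ler_pdivlMr ?exprn_gt0 // mul1r.
  apply: le_trans rem_sum; apply: (le_trans (ler_norm_sum _ _ _)); apply: ler_sum => r _.
  have Sk0 k : 0 <= S k by apply: sumr_ge0 => i _; apply: loop_mass_ge0 => l; exact: excess_at_ge0.
  rewrite normrM ler_piMr // ger0_norm ?divr_ge0 // ler_pdivrMr // mul1r.
  by apply: Smono; exact: leq_subr.
exists (fun L => g L / T L - 1); split; last first.
  apply/thermodynamicP; exists (Num.max L0 L1) => L LL aL; have [T0 _] := key L LL aL.
  by rewrite addrC subrK -/(g L) -/(T L) mulrC divfK // gt_eqF.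
apply: cvg_thermodynamic => e e0.
exists (Num.max (Num.max L0 L1) (expR (B / (e * - (2 * a1))))) => L.
rewrite gt_max => /andP[LL Le] aL; have [T0 h] := key L LL aL.
have a10 : 0 < - (2 * a1) by lra.
have := ln_gt Le; rewrite ltr_pdivrMr ?mulr_gt0 // => le.
have B0 : 0 <= B.
  by rewrite addr_ge0 ?divr_ge0 ?sqr_ge0 ?mulr_ge0 //; lra.
have ln0 : 0 < ln L.
  apply: le_lt_trans (ln_gt Le); rewrite divr_ge0 // mulr_ge0 // ltW //.
rewrite subr0; apply: (le_trans h); rewrite ler_pdivrMr ?mulr_gt0 //; apply: ltW.
by apply: (lt_le_trans le); rewrite le_eqVlt; apply/orP; left; apply/eqP; ring.
Qed.

(** If the p-loops have a typical total and none of them is longer than eta m, the loops of weight 1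
    hold about m particles and [stick_limit] applies. Otherwise [G b] is at least 1, and the error,
    never more than M, is charged to its average, which is small by the variance bound and
    [mix_long]. *)
Lemma poisson_dirichlet_limit d (T : measurableType d) (Q : probability T R) (W : nat -> T -> R)
    (f : {ptws nat -> R} -> R) : poisson_dirichlet1 Q W -> bounded_continuous f ->
  canonical_expectation (soup L) (N L) (fun w => f (fun i => (loop_size i w)%:R / condensate L))
  @[L --> thermodynamic rho] --> \int[Q]_w f (W ^~ w).
Proof.
move=> hW hf; have ha := ha1; have hb := hbeta.
have [K [L0 [K1 HK]]] := eventual_bounds.
apply: cvg_thermodynamic => e e0; have [_ [M0 HM0]] := hf.
set I := \int[Q]_w f (W ^~ w).
have M00 : 0 <= M0.
  apply: le_trans (normr_ge0 _) (HM0 (fun=> 0) _); exists 0 => i; by rewrite normr0.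
pose M := M0 + `|I|; have M_0 : 0 <= M by rewrite addr_ge0.
have e20 : 0 < e / 2 by lra.
have [n0 Hn0] := stick_limit hW hf e20; rewrite -/I in Hn0.
pose eta : R := n0.+1%:R^-1; have eta0 : 0 < eta by rewrite invr_gt0 ltr0n.
pose mu := - (2 * a1); have mu0 : 0 < mu by rewrite /mu; lra.
pose c := eta * mu / 2; have c0 : 0 < c by have := mulr_gt0 eta0 mu0; rewrite /c; lra.
(* Lower bounds for ln L: [g1] gives m >= n0 + 1, [g2] gives 2 K x <= D, and [g3] and [g4] make the
   two averages in that of [G], times M, at most e / 4 each. *)
pose g1 := n0.+1%:R / mu; pose g2 := 2 * K / c.
pose g3 := 8 * K * M / (c ^+ 2 * e); pose g4 := 8 * K * M / (c * e).
have KM0 : 0 <= 8 * K * M by have := mulr_ge0 (le_trans ler01 K1) M_0; lra.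
have g10 : 0 <= g1 by apply: divr_ge0; [exact: ler0n | exact: ltW].
have g20 : 0 <= g2 by apply: divr_ge0; lra.
have g30 : 0 <= g3 by apply: divr_ge0 => //; exact: ltW (mulr_gt0 (exprn_gt0 2 c0) e0).
have g40 : 0 <= g4 by apply: divr_ge0 => //; exact: ltW (mulr_gt0 c0 e0).
exists (Num.max L0 (expR (g1 + g2 + g3 + g4 + 1))) => L.
rewrite gt_max => /andP[LL Le] aL; have yT := ln_gt Le; set y := ln L in yT.
have bL := HK _ LL aL; have [SB S0 _ _] := condensation_facts K1 aL bL.
have [[x1 xN lnL Hm] [HV HM HT _]] := bL.
have x0 := scale_gt0 aL; have p0 := excess_at_ge0 aL; have pN := @excess_at_eq0 L.
have mE : condensate L = mu * scale L * y by rewrite /condensate /mu /scale /y; ring.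
have var := mass_variance p0 pN x0 K1 HV HM Hm.
have y0 : 0 < y by lra.
set m := condensate L in mE Hm HM var *; set x := scale L in x0 x1 xN mE HV HM HT Hm var *.
set p := excess_at L in p0 pN SB S0 HV HM HT var *; set S := cumulative_mass p (N L) in SB S0 var *.
have m0 : 0 < m by rewrite mE; exact: mulr_gt0 (mulr_gt0 mu0 x0) y0.
(* Half of eta m: the deviation of [sumn b] from its mean and that of N minus this mean from m must
   fit together into eta m. *)
pose D := c * x * y; have D0 : 0 < D by exact: mulr_gt0 (mulr_gt0 c0 x0) y0.
have DE : 2 * D = eta * m by rewrite /D mE /c; field.
have xy : y <= x * y by rewrite ler_peMl // ltW.
have n0m : n0.+1%:R <= m.
  have h : g1 <= y by lra.
  move: h; rewrite /g1 ler_pdivrMr // => h; apply: (le_trans h).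
  by rewrite mE -mulrA [leRHS]mulrC ler_pM2r.
have KxD : 2 * K * x <= D.
  have h : g2 <= y by lra.
  move: h; rewrite /g2 ler_pdivrMr // => h.
  have := ler_wpM2r (ltW x0) h; rewrite /D; have -> : c * x * y = y * c * x by ring.
  by [].
have K0 : 0 < K by lra.
have xKx : x <= K * x by rewrite ler_peMl // ltW.
pose Mean := \sum_(l < N L) p l.+1.
pose G (b : seq nat) := D ^- 2 * ((sumn b)%:R - Mean) ^+ 2 + D^-1 * \sum_(l <- b | x <= l%:R) l%:R.
have Gle b : 0 <= D ^- 2 * ((sumn b)%:R - Mean) ^+ 2 /\ 0 <= D^-1 * \sum_(l <- b | x <= l%:R) (l%:R : R).
  split; first by apply: mulr_ge0; rewrite ?invr_ge0 sqr_ge0.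
  by apply: mulr_ge0; [rewrite invr_ge0 ltW | apply: sumr_ge0 => l _; exact: ler0n].
have vM (s : seq nat) : `|ranked_value f m s| <= M0 by apply: HM0; exact: linfty_seq.
have fs s s' : perm_eq s s' -> ranked_value f m s = ranked_value f m s' by exact: perm_ranked_value.
have loc b : (sumn b <= N L)%N ->
    `|loop_sum (fun=> 1) (N L - sumn b) (fun a => ranked_value f m (a ++ b)) - I| <= e / 2 + M * G b.
  move=> bN; have [G1 G2] := Gle b; set A := loop_sum _ _ _.
  have AM : `|A - I| <= M.
    apply: (le_trans (ler_normB _ _)); rewrite lerD2r.
    apply: le_trans; first by apply: ler_norm_loop_sum => l _; exact: ler01.
    apply: (@le_trans _ _ (loop_sum (fun=> 1) (N L - sumn b) (fun=> M0))).
      by apply: ler_loop_sum => [l _|a _ _]; [exact: ler01 | exact: vM].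
    by rewrite loop_sum_cst loop_sum_1 mulr1.
  have big : 1 <= G b -> `|A - I| <= e / 2 + M * G b.
    by move=> h; have := ler_wpM2l M_0 h; rewrite mulr1; lra.
  have [far|near] := leP D `|(sumn b)%:R - Mean|.
    apply: big; suff : 1 <= D ^- 2 * ((sumn b)%:R - Mean) ^+ 2 by rewrite /G; lra.
    rewrite mulrC ler_pdivlMr ?exprn_gt0 // mul1r -[leRHS](real_normK (num_real _)).
    by rewrite lerXn2r ?nnegrE ?normr_ge0 // ltW.
  have [al|] := boolP (all (fun l => l%:R <= eta * m) b); last first.
    rewrite -has_predC => /hasP[l lb /=]; rewrite -ltNge -DE => lD.
    apply: big; suff : 1 <= D^-1 * \sum_(l <- b | x <= l%:R) (l%:R : R) by rewrite /G; lra.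
    rewrite mulrC ler_pdivlMr // mul1r (big_rem l lb) /=.
    have -> : x <= l%:R by lra.
    have : 0 <= \sum_(i <- rem l b | x <= i%:R) (i%:R : R) by apply: sumr_ge0 => i _; exact: ler0n.
    by lra.
  have h0 : 0 <= M * G b by apply: mulr_ge0 => //; exact: addr_ge0.
  suff : `|A - I| <= e / 2 by lra.
  apply: Hn0 => // [|l lb]; last by rewrite ler_pdivrMr //; exact: (allP al).
  rewrite -/eta; have -> : (N L - sumn b)%:R / m - 1 = ((N L)%:R - (sumn b)%:R - m) / m :> R.
    by rewrite natrB //; field; rewrite gt_eqF.
  rewrite normrM normfV (gtr0_norm m0) ler_pdivrMr // -DE.
  move: near HM; rewrite -/Mean ltr_norml !ler_norml => /andP[h1 h2] /andP[h3 h4].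
  by apply/andP; split; lra.
have av := mix_average p0 fs loc.
have mixg : mix p (N L) (fun _ b => e / 2 + M * G b) <= e * S.
  have -> : mix p (N L) (fun _ b => e / 2 + M * G b) = e / 2 * S +
      M * (D ^- 2 * \sum_(k < (N L).+1) (k%:R - Mean) ^+ 2 * loop_mass p k +
           D^-1 * mix p (N L) (fun _ b => \sum_(l <- b | x <= l%:R) l%:R)).
    have c1 : mix p (N L) (fun _ _ => e / 2) = e / 2 * S.
      by have := mix_right p (N L) (fun=> e / 2); rewrite -mulr_sumr; apply.
    have c2 : mix p (N L) (fun _ b => M * G b) = M * mix p (N L) (fun _ b => G b).
      exact: (mixZ p (N L) M (fun _ b => G b)).
    have c3 : mix p (N L) (fun _ b => D ^- 2 * ((sumn b)%:R - Mean) ^+ 2) =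
        D ^- 2 * mix p (N L) (fun _ b => ((sumn b)%:R - Mean) ^+ 2).
      exact: (mixZ p (N L) (D ^- 2) (fun _ b => ((sumn b)%:R - Mean) ^+ 2)).
    have c4 := mixZ p (N L) D^-1 (fun _ b => \sum_(l <- b | x <= l%:R) l%:R).
    have c5 := mix_right p (N L) (fun k => (k%:R - Mean) ^+ 2).
    rewrite (mixD p (N L) (fun _ _ => e / 2) (fun _ b => M * G b)) c1 c2.
    rewrite (mixD p (N L) (fun _ b => D ^- 2 * ((sumn b)%:R - Mean) ^+ 2)
      (fun _ b => D^-1 * \sum_(l <- b | x <= l%:R) l%:R)).
    by rewrite c3 c4 c5.
  have long : mix p (N L) (fun _ b => \sum_(l <- b | x <= l%:R) l%:R) <= 2 * K * x * S.
    apply: le_trans; first by apply: mix_long.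
    have /andP[SH _] := SB.
    apply: (@le_trans _ _ (K * x * (2 * S))); last by rewrite le_eqVlt; apply/orP; left; apply/eqP; ring.
    apply: ler_pM => //; [by apply: sumr_ge0 => l _; exact: p0 | by lra].
  have E1 : D ^- 2 * (2 * K * x ^+ 2 * S) = 2 * K / (c * y) ^+ 2 * S.
    by rewrite /D; field; rewrite !gt_eqF.
  have E2 : D^-1 * (2 * K * x * S) = 2 * K / (c * y) * S by rewrite /D; field; rewrite !gt_eqF.
  have D20 : 0 <= D ^- 2 by rewrite invr_ge0 sqr_ge0.
  have D10 : 0 <= D^-1 by rewrite invr_ge0 ltW.
  have V1 := ler_wpM2l D20 var; rewrite E1 in V1.
  have V2 := ler_wpM2l D10 long; rewrite E2 in V2.
  have cy0 : 0 < c * y by exact: mulr_gt0.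
  have s1 : M * (2 * K / (c * y) ^+ 2) <= e / 4.
    have h : g3 <= y by lra.
    have h2 : g3 <= y ^+ 2 by apply: (le_trans h); rewrite expr2 ler_peMr //; lra.
    move: h2; rewrite /g3 ler_pdivrMr ?(mulr_gt0 (exprn_gt0 2 c0) e0) // => h2.
    rewrite mulrA ler_pdivrMr ?exprn_gt0 // exprMn; move: h2.
    have -> : y ^+ 2 * (c ^+ 2 * e) = c ^+ 2 * y ^+ 2 * e by ring.
    by set u := c ^+ 2 * y ^+ 2 => h2; lra.
  have s2 : M * (2 * K / (c * y)) <= e / 4.
    have h : g4 <= y by lra.
    move: h; rewrite /g4 ler_pdivrMr ?(mulr_gt0 c0 e0) // => h2.
    rewrite mulrA ler_pdivrMr //; move: h2.
    have -> : y * (c * e) = c * y * e by ring.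
    by set u := c * y => h2; lra.
  have h1 := ler_wpM2l M_0 (lerD V1 V2).
  have h2 := ler_wpM2r (ltW S0) (lerD s1 s2).
  have h3 : M * (2 * K / (c * y) ^+ 2 * S + 2 * K / (c * y) * S) =
      (M * (2 * K / (c * y) ^+ 2) + M * (2 * K / (c * y))) * S.
    by move: (_ / _) (_ / _) => u v; ring.
  rewrite h3 in h1; move: (le_trans h1 h2); set X := M * (D ^- 2 * _ + _) => h; lra.
have -> : (fun w : sample R => f (fun i => (loop_size i w)%:R / m)) =
    (fun w => ranked_value f m (loop_lengths w)).
  by apply/funext => w; congr f; apply/funext => i; rewrite /loop_size nth_sort_positive.
rewrite /canonical_expectation /Rintegral (canonical_integral aL fs) /=.
have -> : soup L (canonical_event (N L)) = (soup_norm L * S)%:E.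
  by rewrite (prob_particles aL (leqnn _)) mulrA.
have W0 : soup_norm L != 0 by rewrite /soup_norm mulf_neq0 ?expf_neq0 // gt_eqF // expR_gt0.
rewrite /= -mulf_div divff // mul1r -/p.
move: av; set A := mix _ _ _ => av.
have -> : A / S - I = (A - I * S) / S by field; rewrite gt_eqF.
rewrite normrM normfV (gtr0_norm S0) ler_pdivrMr //; exact: le_trans av mixg.
Qed.

End Critical_soup.

Theorem theorem1 (R : realType) (Lam : domain R)
  (lam : nat -> R) (phi : nat -> R3 R -> R) (beta a1 a2 : R)
  (bridge : R -> R -> R3 R -> R3 R -> {measure set (trajectory R) -> \bar R})
  (soup : R -> probability (sample R) R)
  (hLam : admissible_domain Lam)
  (hspec : laplace_spectrum Lam lam phi)
  (hbeta : 0 < beta)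
  (hexp : heat_expansion lam a1 a2)
  (ha1 : a1 < 0)
  (hbridge : forall (L t : R) (x y : R3 R), 0 < L -> 0 < t ->
     dilate L (carrier Lam) x -> dilate L (carrier Lam) y ->
     brownian_bridge Lam lam phi L t x y (bridge L t x y))
  (hsoup : forall L : R, admissible_length (rho_c beta) L ->
     poisson_point_process
       (loop_intensity Lam beta L (particle_number (rho_c beta) L) bridge)
       (soup L)) :
  let rho := rho_c beta in
  let N := particle_number rho in
  let m : R -> R := fun L => - (2 * a1) * beta^-1 * L ^+ 2 * ln L in
  [/\ exists delta : R -> R,
        delta L @[L --> thermodynamic rho] --> (0 : R) /\
        (\forall L \near thermodynamic rho,
           fine (soup L (canonical_event (N L))) =
           L `^ (- 2 + 2 * lam 0%N * a1 - (lam 0%N == 0)%:R + delta L)),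
      forall eps : R, 0 < eps ->
        canonical_prob (soup L) (N L)
          [set w | m L * (1 - eps)
                   < (particles_ge (ln (ln L) / ln (ln (ln L)) * L ^+ 2) w)%:R
                   < m L * (1 + eps)]
        @[L --> thermodynamic rho] --> (1 : R),
      forall (x y : R -> R3 R) (eps : R), 0 < eps ->
        (\forall L \near thermodynamic rho,
           [/\ dilate L (carrier Lam) (x L), dilate L (carrier Lam) (y L),
               eps * L < domain_dist Lam L (x L) (y L)
             & forall z, dilate L (domain_boundary Lam) z ->
                 eps * L <= domain_dist Lam L (x L) z /\
                 eps * L <= domain_dist Lam L (y L) z]) ->
        exists delta : R -> R,
          delta L @[L --> thermodynamic rho] --> (0 : R) /\
          (\forall L \near thermodynamic rho,
             reduced_density_matrix lam phi beta L (soup L) (N L) (x L) (y L) =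
             - (2 * a1) * beta^-1 * phi 0%N (L^-1 *: x L)
               * phi 0%N (L^-1 *: y L) * L^-1 * ln L * (1 + delta L))
    & forall (d : measure_display) (T : measurableType d)
        (Q : probability T R) (W : nat -> T -> R),
        poisson_dirichlet1 Q W ->
        forall f : {ptws nat -> R} -> R, bounded_continuous f ->
          canonical_expectation (soup L) (N L)
            (fun w => f (fun i => (loop_size i w)%:R / m L))
          @[L --> thermodynamic rho] --> \int[Q]_w f (W ^~ w)].
Proof.
have HZ := partition_function_asymptotics hLam hspec hbeta hexp ha1 hbridge hsoup.
have HN := condensate_fraction hLam hspec hbeta hexp ha1 hbridge hsoup.
have Hg := reduced_density_matrix_asymptotics hLam hspec hbeta hexp ha1 hbridge hsoup.
have HP := poisson_dirichlet_limit hLam hspec hbeta hexp ha1 hbridge hsoup.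
move=> rho N m; split.
- exact: HZ.
- exact: HN.
- exact: Hg.
- by move=> d T Q W hW f hf; exact: (HP d T Q W f hW hf).
Qed.
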